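(* Let $[\cdot]_\beta$ be the superexpectation of the $\mathbb{H}^{2|2}$ model on $\Lambda$, and let $\mathbb{E}_{i,\boldsymbol{\ell}}$ be the expectation of the vertex-reinforced jump process (VRJP). Let $g\colon\mathbb{R}^\Lambda\to\mathbb{R}$ be a smooth compactly supported function, let $a\in\Lambda$, and let $s\in\mathbb{R}$. Then $$\Big[g(\theta_s\boldsymbol{z})\,\delta_{u_0}(u_a)\Big]_\beta=\mathbb{E}_{a,\boldsymbol{1}}\,g\big(\boldsymbol{L}_{\tau(\cosh s)}\big),$$ where $\tau(\gamma)=\inf\{t\mid L_t^a\ge\gamma\}$ and $u_0=(1,0,0,0,0)$.
   Context: $\Lambda$ is a finite set and $\beta=(\beta_{ij})_{i,j\in\Lambda}$ are edge weights with $\beta_{ij}=\beta_{ji}\ge0$ such that the graph with vertex set $\Lambda$ and edge set $\{\{i,j\}\mid\beta_{ij}>0\}$ is connected. Bold symbols denote objects indexed by $\Lambda$; $\boldsymbol{1}=(1)_{i\in\Lambda}$. Forms: $\Omega^{2\Lambda}(\mathbb{R}^{2\Lambda})$ is the algebra over $C^\infty(\mathbb{R}^{2\Lambda})$ (coordinates $(x_i,y_i)_{i\in\Lambda}$) generated by pairwise anticommuting (Grassmann) generators $(\xi_i,\eta_i)_{i\in\Lambda}$ (each squaring to $0$); its elements are called forms. $F_0$ denotes the degree-$0$ part of a form $F$, and a form is even if all its terms have even degree in the generators. For even forms $F^1,\dots,F^k$ and a smooth $g$, $g(F^1,\dots,F^k)=\sum_\alpha\frac1{\alpha!}g^{(\alpha)}(F^1_0,\dots,F^k_0)\prod_j(F^j-F^j_0)^{\alpha_j}$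 (a finite sum). $\partial_{\xi_i},\partial_{\eta_i}$ are the left derivatives (antiderivations over $C^\infty$ with $\partial_{\xi_i}\xi_j=\delta_{ij}=\partial_{\eta_i}\eta_j$, $\partial_{\xi_i}\eta_j=0=\partial_{\eta_i}\xi_j$). $\mathbb{H}^{2|2}$ model: let $z_i=\sqrt{1+x_i^2+y_i^2-2\xi_i\eta_i}$ (an even form), $u_i=(z_i,x_i,y_i,\xi_i,\eta_i)$, $u_i\cdot u_j=-z_iz_j+x_ix_j+y_iy_j-\xi_i\eta_j+\eta_i\xi_j$ (so $u_i\cdot u_i=-1$). For $A\subseteq\Lambda$, $\int_{(\mathbb{H}^{2|2})^A}F=(2\pi)^{-|A|}\int_{\mathbb{R}^{2A}}\prod_{i\in A}dx_i\,dy_i\ \big(\prod_{i\in A}\partial_{\eta_i}\partial_{\xi_i}\big)\frac{1}{\prod_{i\in A}z_i}F$. Let $H_\beta(\boldsymbol{u})=\frac12\sum_{i,j\in\Lambda}\beta_{ij}(-1-u_i\cdot u_j)$ and $[F]_\beta=\int_{(\mathbb{H}^{2|2})^\Lambda}Fe^{-H_\beta}$. The notation $[F\,\delta_{u_0}(u_a)]_\beta$ denotes the superexpectation with the spin at $a$ fixed to $u_0$: $\int_{(\mathbb{H}^{2|2})^{\Lambda\setminus\{a\}}}Fe^{-H_\beta}$ with $z_a=1$ and $x_a=y_a=\xi_a=\eta_a=0$. $\theta_s$ is the Lorentz boost, $\theta_s\boldsymbol{z}=(z_i\cosh s+x_i\sinh s)_{i\in\Lambda}$. VRJP: for initial vertex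 $v$ and initial local times $\boldsymbol{L}_0\in(0,\infty)^\Lambda$, $X_0=v$ and $\mathbb{P}_{v,\boldsymbol{L}_0}[X_{t+dt}=j\mid(X_r)_{r\le t},X_t=i]=\beta_{ij}L_t^j\,dt$, where $L_t^i=L_0^i+\int_0^t1_{X_r=i}\,dr$. *)

(* Defs.v *)
From HB Require Import structures.
From mathcomp Require Import all_boot all_order all_algebra ring.
Set Implicit Arguments. Unset Strict Implicit. Unset Printing Implicit Defensive.
Import Order.TTheory GRing.Theory Num.Theory.
Local Open Scope ring_scope.

Section Grassmann.
Variables (R : comNzRingType) (G : finType).
Implicit Types (A B C S : {set G}).

(* f S is the coefficient of the product of the generators in S taken in
   increasing order (of enum_rank). *)
Definition grassmann : Type := {ffun {set G} -> R}.
HB.instance Definition _ := GRing.Lmodule.copy grassmann {ffun {set G} -> R^o}.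
Implicit Types f g h : grassmann.

Definition inversions A B : nat :=
  (\sum_(p in A) \sum_(q in B) (enum_rank q < enum_rank p))%N.

Definition gone : grassmann := [ffun S : {set G} => (S == set0)%:R].
Definition gmul f g : grassmann :=
  [ffun S : {set G} => \sum_(A : {set G} | A \subset S)
     (-1) ^+ inversions A (S :\: A) * (f A * g (S :\: A))].

Lemma inversions0l A : inversions set0 A = 0%N.
Proof. by rewrite /inversions big_set0. Qed.
Lemma inversions0r A : inversions A set0 = 0%N.
Proof. by rewrite /inversions big1// => p _; rewrite big_set0. Qed.
Lemma inversionsUl A B C : [disjoint A & B] ->
  inversions (A :|: B) C = (inversions A C + inversions B C)%N.
Proof. by move=> AB; rewrite /inversions (eq_bigl _ _ (fun x => in_setU x A B)) bigU. Qed.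
Lemma inversionsUr A B C : [disjoint B & C] ->
  inversions A (B :|: C) = (inversions A B + inversions A C)%N.
Proof.
move=> BC; rewrite /inversions -big_split/=.
by apply: eq_bigr => p _; rewrite (eq_bigl _ _ (fun x => in_setU x B C)) bigU.
Qed.

Lemma gmulA : associative gmul.
Proof.
move=> f g h; apply/ffunP => S; rewrite !ffunE.
transitivity (\sum_(A : {set G} | A \subset S) \sum_(B : {set G} | B \subset S :\: A)
   ((-1) ^+ inversions A (S :\: A) * (-1) ^+ inversions B (S :\: A :\: B)
    * (f A * g B * h (S :\: A :\: B)))).
  apply: eq_bigr => A _; rewrite ffunE !mulr_sumr; apply: eq_bigr => B _.
  by rewrite mulrCA !mulrA [_ * f A]mulrC !mulrA.
transitivity (\sum_(D : {set G} | D \subset S) \sum_(A : {set G} | A \subset D)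
   ((-1) ^+ inversions D (S :\: D) * (-1) ^+ inversions A (D :\: A)
    * (f A * g (D :\: A) * h (S :\: D)))); last first.
  apply: eq_bigr => D _; rewrite ffunE mulr_suml mulr_sumr.
  by apply: eq_bigr => A _; rewrite !mulrA.
rewrite [RHS](exchange_big_dep (fun A : {set G} => A \subset S))/=; last first.
  by move=> D A DS AD; apply: subset_trans AD DS.
apply: eq_bigr => A AS.
rewrite [RHS](reindex_onto (fun B => A :|: B) (fun D => D :\: A))/=; last first.
  by move=> D /andP[_ AD]; rewrite setDE setUIr setUCr setIT; apply/setUidPr.
apply: eq_big => [B|B BSA].
  rewrite subUset AS subsetUl andbT/= setDUl setDv set0U.
  by rewrite subsetD; congr andb; apply/setDidPl/eqP.
have dAB : [disjoint A & B].
  by rewrite disjoint_sym; move: BSA; rewrite subsetD => /andP[].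
have -> : (A :|: B) :\: A = B.
  by rewrite setDUl setDv set0U; apply/setDidPl; rewrite disjoint_sym.
rewrite -setDDl; congr (_ * _).
have -> : S :\: A = B :|: (S :\: A :\: B).
  by rewrite -[LHS](setID _ B) (setIidPr BSA).
have -> : (B :|: S :\: A :\: B) :\: B = S :\: A :\: B.
  by rewrite setDUl setDv set0U setDDl setUid.
have dB : [disjoint B & S :\: A :\: B].
  by rewrite disjoint_sym disjoints_subset setDE subsetIr.
by rewrite inversionsUl// inversionsUr// -!exprD; congr (_ ^+ _); ring.
Qed.

Lemma gmul1 : left_id gone gmul.
Proof.
move=> f; apply/ffunP => S; rewrite !ffunE (bigD1 set0) ?sub0set//= big1.
  by rewrite ffunE eqxx inversions0l setD0 addr0 expr0 !mul1r.
by move=> A /andP[_ /negPf A0]; rewrite ffunE A0 mul0r mulr0.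
Qed.

Lemma gmulr1 : right_id gone gmul.
Proof.
move=> f; apply/ffunP => S; rewrite !ffunE (bigD1 S)//= big1.
  by rewrite ffunE setDv eqxx inversions0r addr0 expr0 mul1r mulr1.
move=> A /andP[AS AnS]; rewrite ffunE; case: eqP => [/eqP|]; last by rewrite !mulr0.
by rewrite setD_eq0 => SA; rewrite eqEsubset AS SA in AnS.
Qed.

Lemma gmulDl : left_distributive gmul +%R.
Proof.
move=> f g h; apply/ffunP => S; rewrite !ffunE -big_split/=.
by apply: eq_bigr => A _; rewrite !ffunE mulrDl mulrDr.
Qed.
Lemma gmulDr : right_distributive gmul +%R.
Proof.
move=> f g h; apply/ffunP => S; rewrite !ffunE -big_split/=.
by apply: eq_bigr => A _; rewrite !ffunE !mulrDr.
Qed.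
Lemma gone_neq0 : gone != 0.
Proof. by apply/eqP => /ffunP/(_ set0); rewrite !ffunE eqxx; apply/eqP/oner_neq0. Qed.

HB.instance Definition _ := GRing.Zmodule_isNzRing.Build grassmann
  gmulA gmul1 gmulr1 gmulDl gmulDr gone_neq0.

Lemma gscaleAl (k : R) f g : k *: (f * g) = (k *: f) * g.
Proof.
apply/ffunP => S; rewrite !ffunE /GRing.scale/= mulr_sumr; apply: eq_bigr => A _.
by rewrite ffunE mulrCA !mulrA.
Qed.
Lemma gscaleAr (k : R) f g : k *: (f * g) = f * (k *: g).
Proof.
apply/ffunP => S; rewrite !ffunE /GRing.scale/= mulr_sumr; apply: eq_bigr => A _.
by rewrite ffunE mulrCA; congr (_ * _); rewrite mulrCA.
Qed.
HB.instance Definition _ := GRing.Lmodule_isLalgebra.Build R grassmann gscaleAl.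
HB.instance Definition _ := GRing.Lalgebra_isAlgebra.Build R grassmann gscaleAr.

Definition gen (p : G) : grassmann := [ffun S : {set G} => (S == [set p])%:R].

(* The left derivative, cf. gderiv_genM. *)
Definition gderiv (p : G) (f : grassmann) : grassmann :=
  [ffun S : {set G} =>
     if p \in S then 0 else (-1) ^+ inversions [set p] S * f (p |: S)].

Lemma genME p f S : (gen p * f) S =
  if p \in S then (-1) ^+ inversions [set p] (S :\ p) * f (S :\ p) else 0.
Proof.
rewrite ffunE; case: ifPn => [pS|pS].
  rewrite (bigD1 [set p]) ?sub1set//= big1 ?addr0 ?ffunE ?eqxx ?mul1r//.
  by move=> A /andP[_ /negPf A0]; rewrite ffunE A0 mul0r mulr0.
rewrite big1// => A AS; rewrite ffunE; case: eqP => [Ap|]; last by rewrite mul0r mulr0.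
by move: AS; rewrite Ap sub1set (negPf pS).
Qed.

Lemma inversions11 p q : inversions [set p] [set q] = (enum_rank q < enum_rank p)%N.
Proof. by rewrite /inversions !big_set1. Qed.

Lemma gen_sqr p : gen p * gen p = 0.
Proof.
apply/ffunP => S; rewrite genME !ffunE; case: ifP => // pS.
by case: eqP => [/setP/(_ p)|]; rewrite ?mulr0// !inE eqxx.
Qed.

Lemma sign_inversions11 p q : p != q ->
  (-1) ^+ inversions [set p] [set q] = - (-1) ^+ inversions [set q] [set p] :> R.
Proof.
move=> pq; rewrite /inversions !big_set1; case: ltngtP; rewrite ?opprK//.
by move=> /ord_inj/enum_rank_inj /eqP; rewrite eq_sym (negPf pq).
Qed.

Lemma gen_anticomm p q : gen p * gen q = - (gen q * gen p).
Proof.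
have [<-|pq] := eqVneq p q; first by rewrite gen_sqr oppr0.
have E x y : x != y -> gen x * gen y =
    [ffun S : {set G} => (S == [set x; y])%:R * (-1) ^+ inversions [set x] [set y]].
  move=> xy; apply/ffunP => S; rewrite genME !ffunE.
  case: ifPn => xS; last first.
    by case: eqP xS => [->|]; rewrite ?mul0r// !inE eqxx.
  have -> : (S :\ x == [set y]) = (S == [set x; y]).
    apply/eqP/eqP => [H|->]; first by rewrite -(setD1K xS) H.
    by rewrite setU1K// inE.
  case: eqP => [->|]; last by rewrite mulr0 mul0r.
  by rewrite setU1K ?inE// mul1r mulr1.
rewrite !E// 1?eq_sym//; apply/ffunP => S; rewrite !ffunE.
by rewrite sign_inversions11// mulrN [[set q; p]]setUC.
Qed.

Lemma gderiv_genM p q f :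
  gderiv p (gen q * f) = (p == q)%:R *: f - gen q * gderiv p f.
Proof.
apply/ffunP => S.
have -> : ((p == q)%:R *: f - gen q * gderiv p f) S =
  (p == q)%:R * f S - (gen q * gderiv p f) S.
  by rewrite !ffunE.
rewrite [LHS]ffunE !genME ffunE !inE.
have [<-|pq] := eqVneq p q; rewrite /= ?eqxx/= ?mul1r ?mul0r ?add0r.
  case: ifPn => pS; last by rewrite setU1K// mulrA -expr2 sqrr_sign mul1r subr0.
  by rewrite setD1K// mulrA -expr2 sqrr_sign mul1r subrr.
case: ifPn => pS; case: ifPn => qS; rewrite ?andbF ?mulr0 ?oppr0//.
have -> : (p |: S) :\ q = p |: S :\ q.
  rewrite setDUl (_ : [set p] :\ q = [set p])//; apply/setDidPl.
  by rewrite disjoints1 inE.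
rewrite -[in inversions [set p] S](setD1K qS) !inversionsUr; last 2 first.
- by rewrite disjoints1 !inE (negPf pS) andbF.
- by rewrite disjoints1 setD11.
rewrite !exprD sign_inversions11//.
set s1 := (-1) ^+ inversions [set q] [set p].
have s1K : s1 * s1 = 1 by rewrite /s1 -expr2 sqrr_sign.
rewrite -mulrA mulNr; congr (- _).
rewrite -[RHS]mul1r -s1K; ring.
Qed.

End Grassmann.

(* Imported only here: classical_sets shadows the finset notations used above. *)
From mathcomp Require Import all_classical all_reals all_analysis.
Import numFieldNormedType.Exports.
Local Open Scope classical_set_scope.
Local Open Scope ring_scope.

Section Smooth.
Variables (R : realType) (I : finType).
Implicit Types (g : (I -> R) -> R) (x : I -> R).

Definition partial (i : I) g : (I -> R) -> R :=
  fun x => derive1 (fun t : R => g (dfwith x i t)) (x i).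

Definition partials (s : seq I) g : (I -> R) -> R := foldr partial g s.

Definition multi_partial (alpha : I -> nat) g : (I -> R) -> R :=
  partials (flatten [seq nseq (alpha i) i | i <- enum I]) g.

Definition smooth g : Prop := forall s : seq I,
  continuous (partials s g : {ptws I -> R} -> R) /\
  forall i x, derivable (fun t : R => partials s g (dfwith x i t)) (x i) 1.

Definition compactly_supported g : Prop :=
  compact (closure [set x : {ptws I -> R} | g x != 0]).

End Smooth.

Section SigmaFiniteProduct.
Local Open Scope ereal_scope.
Context d1 d2 (T1 : measurableType d1) (T2 : measurableType d2) (R : realType).
Variable m1 : {sigma_finite_measure set T1 -> \bar R}.
Variable m2 : {sigma_finite_measure set T2 -> \bar R}.

(* The library's sigma-finite instance on [m1 \x m2] is shadowed by the one for
   subprobabilities and is not inferred, hence this alias. *)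
Definition sigma_finite_prod : set (T1 * T2) -> \bar R := m1 \x m2.

HB.instance Definition _ := Measure.on sigma_finite_prod.

Let sigma_finite_prodT : sigma_finite setT sigma_finite_prod.
Proof.
have /sigma_finiteP[F [TF ndF Foo]] := sigma_finiteT m1.
have /sigma_finiteP[G [TG ndG Goo]] := sigma_finiteT m2.
exists (fun n => F n `*` G n).
  rewrite -setXTT TF TG predeqE => -[x y]; split.
    move=> [/= [n _ Fnx] [k _ Gky]]; exists (maxn n k) => //; split.
    - by move: x Fnx; exact/subsetPset/ndF/leq_maxl.
    - by move: y Gky; exact/subsetPset/ndG/leq_maxr.
  by move=> [n _ []/= ? ?]; split; exists n.
move=> k; have [? ?] := Foo k; have [? ?] := Goo k.
split; first exact: measurableX.
by rewrite /sigma_finite_prod product_measure1E// lte_mul_pinfty// ge0_fin_numE.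
Qed.

HB.instance Definition _ := Measure_isSigmaFinite.Build _ _ _
  sigma_finite_prod sigma_finite_prodT.

End SigmaFiniteProduct.

(* [planes n] is (R^2)^n with its Borel sigma-algebra and Lebesgue measure. *)
Section Planes.
Variable R : realType.
Local Notation plane := (measurableTypeR R * measurableTypeR R)%type.

Fixpoint planes_display (n : nat) : measure_display :=
  if n is m.+1 then
    measure_prod_display
      (measure_prod_display
         ((R.-ocitv.-measurable).-sigma, (R.-ocitv.-measurable).-sigma)%mdisp,
       planes_display m)
  else default_measure_display.

Fixpoint planes (n : nat) : measurableType (planes_display n) :=
  if n is m.+1 then (plane * planes m)%type : measurableType _
  else unit : measurableType _.

Definition plane_lebesgue : {sigma_finite_measure set plane -> \bar R} :=
  sigma_finite_prod (@lebesgue_measure R) (@lebesgue_measure R).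

Fixpoint planes_lebesgue (n : nat) :
    {sigma_finite_measure set (planes n) -> \bar R} :=
  if n is m.+1 return {sigma_finite_measure set (planes n) -> \bar R} then
    sigma_finite_prod plane_lebesgue (planes_lebesgue m)
  else @dirac _ unit tt R.

Fixpoint planes_coord (n : nat) : planes n -> nat -> R * R :=
  if n is m.+1 return planes n -> nat -> R * R then
    fun w k => if k is k'.+1 then planes_coord w.2 k' else w.1
  else fun _ _ => (0, 0).

End Planes.

Section Forms.
Variables (R : realType) (Lambda : finType).
Implicit Types (i j : Lambda) (A : {set Lambda}).

(* A point of R^(2 Lambda), i |-> (x_i, y_i). *)
Definition config : Type := Lambda -> R * R.

(* [inl i] indexes xi_i and [inr i] indexes eta_i. *)
Definition fermion : finType := (Lambda + Lambda)%type.

(* Coefficients are arbitrary functions on R^(2 Lambda): the forms with C^oo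
   coefficients are a subalgebra, and no operation below differentiates a
   coefficient. *)
Definition superform : Type := config -> grassmann R fermion.
HB.instance Definition _ := GRing.PzRing.on superform.
HB.instance Definition _ :=
  GRing.Lmodule.copy superform (config -> grassmann R fermion).
Implicit Types F : superform.

Definition body F : config -> R := fun c => F c finset.set0.

Definition x_ i : superform := fun c => (c i).1%:A.
Definition y_ i : superform := fun c => (c i).2%:A.
Definition xi_ i : superform := fun=> gen R (inl i : fermion).
Definition eta_ i : superform := fun=> gen R (inr i : fermion).
Definition d_xi i F : superform := fun c => gderiv (inl i : fermion) (F c).
Definition d_eta i F : superform := fun c => gderiv (inr i : fermion) (F c).

(* g(F^1, ..., F^k) for even forms, by Taylor expansion at the bodies.  As
   F^k - F^k_0 has no term of degree < 2, its powers beyond the number of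
   generators vanish, so bounding each alpha_k by that number loses nothing. *)
Definition form_apply (I : finType) (g : (I -> R) -> R) (F : I -> superform) :
    superform :=
  fun c => \sum_(alpha : {ffun I -> 'I_#|fermion|.+1})
    (multi_partial (fun k => alpha k) g (fun k => body (F k) c)
       / (\prod_k (alpha k)`!)%:R)
    *: \prod_k (F k c - (body (F k) c)%:A) ^+ alpha k.

Definition form_apply1 (f : R -> R) F : superform :=
  form_apply (fun v : unit -> R => f (v tt)) (fun=> F).

Definition z_ i : superform :=
  form_apply1 Num.sqrt (1 + x_ i * x_ i + y_ i * y_ i - (xi_ i * eta_ i) *+ 2).

Definition udot i j : superform :=
  - (z_ i * z_ j) + x_ i * x_ j + y_ i * y_ j - xi_ i * eta_ j + eta_ i * xi_ j.

Definition hamiltonian (beta : Lambda -> Lambda -> R) : superform :=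
  (2^-1 : R) *: \sum_i \sum_j beta i j *: (-1 - udot i j).

Definition d_fermions A F : superform :=
  foldr (fun i G => d_eta i (d_xi i G)) F (enum A).

Definition update_config A (c : config) (w : planes R #|A|) : config :=
  fun i => if i \in A then planes_coord w (index i (enum A)) else c i.

(* The integral over (H^{2|2})^A, as a form in the variables outside A. *)
Definition superint A F : superform := fun c =>
  [ffun S : {set fermion} => ((2 * pi) ^+ #|A|)^-1 *
    \int[planes_lebesgue R #|A|]_w
      d_fermions A (form_apply1 GRing.inv (\prod_(i in A) z_ i) * F)
        (update_config c w) S].

(* Substitution of x_a = y_a = xi_a = eta_a = 0 (hence z_a = 1), i.e. u_a = u_0. *)
Definition pin (a : Lambda) F : superform := fun c =>
  [ffun S : {set fermion} => if (inl a \in S) || (inr a \in S) then 0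
                             else F (dfwith c a (0, 0)) S].

(* [F delta_{u_0}(u_a)]_beta.  The integral is a form in the variables at a
   only, on which it does not depend after pinning: it is a constant. *)
Definition superexp_pinned (beta : Lambda -> Lambda -> R) (a : Lambda) F : R :=
  body (superint (~: [set a])%SET
          (pin a (F * form_apply1 expR (- hamiltonian beta))))
       (fun=> (0, 0)).

Definition cosh (s : R) : R := (expR s + expR (- s)) / 2.
Definition sinh (s : R) : R := (expR s - expR (- s)) / 2.

Definition boost_z (s : R) i : superform := cosh s *: z_ i + sinh s *: x_ i.

End Forms.

Section VRJP.
Context {R : realType} {Lambda : finType} {d : measure_display}.
Context {T : measurableType d}.
Implicit Types (P : probability T R) (X : R -> T -> Lambda) (ell : Lambda -> R).

Definition local_time ell X (t : R) (w : T) (i : Lambda) : R :=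
  ell i + \int[@lebesgue_measure R]_(r in `[0, t]) (X r w == i)%:R.

(* The sigma-algebra generated by (X_r)_{0 <= r <= t}. *)
Definition history X (t : R) : set (set T) :=
  <<s [set E | exists (r : R) k, 0 <= r <= t /\ E = [set w | X r w = k]] >>.

(* [q] is a version of the conditional probability P[E | G]. *)
Definition cond_prob P (G : set (set T)) (E : set T) (q : T -> R) : Prop :=
  [/\ forall B : set R, measurable B -> G (q @^-1` B),
      P.-integrable setT (EFin \o q) &
      forall A, G A -> (\int[P]_(w in A) (q w)%:E = P (A `&` E))%E].

(* X is, under P, a VRJP started from v with initial local times ell.  In
   [vrjp_rate], P[X_{t+h} = j | (X_r)_{r <= t}] = beta_{ij} L_t^j h + o(h) on
   {X_t = i} for j != i, uniformly for t in bounded intervals: with an o(h)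
   depending on t, jumps at deterministic times would be allowed. *)
Record vrjp (beta : Lambda -> Lambda -> R) (v : Lambda) ell P X : Prop := Vrjp {
  vrjp_measurable : forall (t : R) i, 0 <= t -> measurable [set w | X t w = i] ;
  vrjp_right : forall w (t : R), 0 <= t ->
    exists2 e : R, 0 < e & forall r : R, t <= r < t + e -> X r w = X t w ;
  vrjp_left : forall w (t : R), 0 < t ->
    exists2 e : R, 0 < e &
    exists i, forall r : R, 0 <= r -> t - e < r < t -> X r w = i ;
  vrjp_start : P [set w | X 0 w = v] = 1%E ;
  vrjp_rate : forall i j, i != j -> forall K e : R, 0 < e ->
    exists2 delta : R, 0 < delta & forall t h : R, 0 <= t <= K -> 0 < h < delta ->
    exists2 q, cond_prob P (history X t) [set w | X (t + h) w = j] q &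
      {ae P, forall w, X t w = i ->
         `|q w - beta i j * local_time ell X t w j * h| <= e * h}
}.

(* inf {t >= 0 | L_t^a >= gamma}; on the null event where the set is empty,
   [inf] returns 0. *)
Definition hitting_time ell X (a : Lambda) (gamma : R) (w : T) : R :=
  inf [set t | 0 <= t /\ gamma <= local_time ell X t w a].

End VRJP.

(* Main.v *)
Require Import Defs.
From HB Require Import structures.
From mathcomp Require Import all_boot all_order all_algebra ring lra zify.
Set Implicit Arguments. Unset Strict Implicit. Unset Printing Implicit Defensive.
Import Order.TTheory GRing.Theory Num.Theory.
Local Open Scope ring_scope.

(* Off the diagonal let H_ij = - beta_ij, let H be diagonally dominant away from a,
   and put q(l) = - l.Hl / 2.  Both sides are computed exactly for the functions
   e^q prod_(j != a) l_j; as changing the diagonal of H by 2 k gives the functions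
   e^q prod_(j != a) l_j e^(- k_j l_j^2), Bernstein approximation in the variables
   e^(- l_j^2), together with all mixed partial derivatives, yields the identity
   for g.  Let psi be the vector with psi_a = 1 and (H psi)_i = 0 for i != a, and
   let h = - (H psi)_a.  Both sides are e^(- 1.H1 / 2 + h sinh^2 s / 2).

   Spins: the change of variables x_i -> x_i cosh s + z_i sinh s turns the boosted
   integrand into the unboosted one, up to an exact derivative, at one site after the
   other.  There remains a Gaussian superintegral, in which the determinants of the
   bosons and the fermions cancel.

   VRJP: f_i(l) = psi_i prod_(j != i) l_j e^(q(l) - h l_a^2 / 2) is annihilated by the
   generator d_i f_i + sum_j beta_ij l_j (f_j - f_i) of (X, L), so that f_X(L) stopped
   at tau is a bounded martingale.  Moreover tau is finite almost surely: for a proper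
   nonempty subset B with outer boundary B', and S = sum_(B') l_j, the functions
   e^(- C sum_B l_j) (1 + ln S + C' 1_(i not in B) / S) give a supermartingale, which
   would tend to infinity if L stayed bounded on B but not elsewhere. *)

(** Two cancellations dictate the test functions. Spins: a boost changes z_i z_j and x_i x_j by the
    same amount, so H_ij = - beta_ij removes every product z_i z_j of distinct sites from the total
    exponent, whereas z_i^2 is polynomial in any case, as u_i.u_i = -1; hence the diagonal of H is
    free. The factor l_j combines with the density 1 / z_j into the Jacobian of the boost. VRJP: the
    product of the l_j makes l_j f_j(l) equal to psi_j times a quantity independent of j, so that
    the generator equation becomes a linear system for psi. As l_a is cosh s on both sides, nothing
    has to decay in l_a, and a multiple of l_a^2 may be added to the exponent.

    Nilpotent parts of square zero make g(theta_s z) depend on partial derivatives of g of order at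
    most one at each site; uniform approximation of g would not control them.

    The process is given only through conditional probabilities over short times, uniformly on
    bounded time intervals. The martingale argument is therefore run on a grid, with one-sided
    inequalities up to errors of second order in the step, applied to f and to - f. *)

(* [n] stands for the square-zero form [xi_i eta_i] and [f] for the embedding of
   the coefficients into the even forms. *)
Section SquareZeroIdentities.
Variables (F : numFieldType) (A : comNzRingType) (f : {rmorphism F -> A}).

Lemma sz_jetM (n x y x' y' : A) : n * n = 0 ->
  x * y + n * (x' * y + x * y') = (x + n * x') * (y + n * y').
Proof.
move=> nn; have -> : (x + n * x') * (y + n * y') = x * y + n * (x' * y + x * y') + (n * n) * (x' * y') by ring.
by rewrite nn mul0r addr0.
Qed.

Lemma sz_jet_exp (n x u : A) : u + n * (x * u) = u * (1 + n * x).
Proof. ring. Qed.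

Lemma sz_binomial (u v x y : A) : u * (x * y * v) = u * v * (y * x).
Proof. ring. Qed.

Lemma sz_einv (p q r s : A) : p * (q * (r * s)) = q * (p * r) * s.
Proof. ring. Qed.

Lemma sz_einvM (b c e : A) : b * c = 1 -> (b + e) * c = 1 - - (c * e).
Proof. by move=> bc; rewrite mulrDl bc opprK [e * c]mulrC. Qed.

Lemma sz_arg (u v : F) (n : A) :
  f (1 + u ^+ 2 + v ^+ 2) + f (-2) * n = 1 + f u * f u + f v * f v - (n + n).
Proof. ring. Qed.

Lemma sz_boost_z (C S z x : F) (n : A) :
  f (C * z + S * x) + f (- (C / z)) * n = f C * (f z - f z^-1 * n) + f S * f x.
Proof. ring. Qed.

Lemma sz_boost_x (C S z x : F) (n : A) :
  f (C * x + S * z) + f (- (S / z)) * n = f C * f x + f S * (f z - f z^-1 * n).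
Proof. ring. Qed.

Lemma sz_udot (x x' y y' : F) (u b b' : A) :
  - u + f (x * x' + y * y') - b - b' = - u + f x * f x' + f y * f y' - b - b'.
Proof. ring. Qed.

Lemma sz_sqrt (z : F) (n : A) : z != 0 ->
  f z + f (2 * z)^-1 * (f (-2) * n) = f z - f z^-1 * n.
Proof.
move=> z0; have -> : (2 * z)^-1 = 2^-1 * z^-1 :> F by rewrite invfM.
rewrite mulrA -rmorphM -mulNr -rmorphN; congr (_ + f _ * _); field; exact: z0.
Qed.

(** The second factor is the expansion of [1 / (z - n / z)], which stops after the first order
    because [n] has square zero. *)
Lemma sz_zinv (z : F) (n : A) : z != 0 -> n * n = 0 ->
  (f z - f z^-1 * n) * (f z^-1 + f (z^-1 ^+ 3) * n) = 1.
Proof.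
move=> z0 nn; have zz : f z * f z^-1 = 1 by rewrite -rmorphM divff// rmorph1.
have -> : f (z^-1 ^+ 3) = f z^-1 ^+ 3 by rewrite rmorphXn.
move: zz; move: (f z) (f z^-1) => u v uv.
transitivity (u * v + (u * v - 1) * v ^+ 2 * n - v ^+ 4 * (n * n)); first by ring.
by rewrite nn uv subrr !mul0r mulr0 subr0 addr0.
Qed.

Lemma sz_zsqr (z x y : F) (n : A) : z != 0 -> n * n = 0 -> z ^+ 2 = 1 + x ^+ 2 + y ^+ 2 ->
  (f z - f z^-1 * n) * (f z - f z^-1 * n) = f (1 + x ^+ 2 + y ^+ 2) - n *+ 2.
Proof.
move=> z0 nn <-; have zz : f z * f z^-1 = 1 by rewrite -rmorphM divff// rmorph1.
rewrite rmorphXn; move: zz; move: (f z) (f z^-1) => u v uv.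
transitivity (u ^+ 2 - (u * v) * n *+ 2 + v ^+ 2 * (n * n)); first by ring.
by rewrite nn uv mulr0 addr0 mul1r.
Qed.

Lemma sz_cosh2 (C S : F) : C ^+ 2 - S ^+ 2 = 1 -> f C ^+ 2 = 1 + f S ^+ 2.
Proof.
by move=> /eqP; rewrite subr_eq => /eqP H0; rewrite -(rmorphXn f) H0; ring.
Qed.

(** Boosts preserve the Lorentz form [z z' - x x']. *)
Lemma sz_pair (x x' : F) (C S z z' : A) : C ^+ 2 = 1 + S ^+ 2 ->
  (C * z + S * f x) * (C * z' + S * f x') - z * z' =
  (C * f x + S * z) * (C * f x' + S * z') - f (x * x').
Proof.
rewrite rmorphM; move: (f x) (f x') => u u' CS; apply/eqP; rewrite -subr_eq0; apply/eqP.
transitivity ((C ^+ 2 - (1 + S ^+ 2)) * (z * z' - u * u')); first by ring.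
by rewrite CS subrr mul0r.
Qed.

Lemma sz_sqr (x y : F) (X n : A) :
  X * X - f (x * x) + (f (1 + x ^+ 2 + y ^+ 2) - n *+ 2) =
  1 + X * X + f (y * y) - n - n.
Proof. ring. Qed.

Lemma sz_udot_diag (x y : F) (n : A) :
  -1 - (- (f (1 + x ^+ 2 + y ^+ 2) - n *+ 2) + f (x * x + y * y) - n - n) = 0.
Proof. ring. Qed.

Lemma sz_offdiag (b x x' y y' : F) (X Z n n' : A) :
  f (- b) * (X - f (x * x') + Z) + f b * (-1 - (- Z + f (x * x' + y * y') - n - n')) =
  f (- b) * (1 + X + f (y * y') - n - n').
Proof. ring. Qed.

Lemma sz_jac (C S z x : F) (n : A) : z != 0 -> n * n = 0 ->
  (f z^-1 + f (z^-1 ^+ 3) * n) * (f (C * z + S * x) + f (- (C / z)) * n) =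
  f ((C * z + S * x) / z) + f (S * x / z ^+ 3) * n.
Proof.
move=> z0 nn; set B := C * z + S * x.
transitivity (f (B / z) + f (z^-1 ^+ 3 * B - z^-1 * (C / z)) * n
   - f (z^-1 ^+ 3 * (C / z)) * (n * n)); first by ring.
rewrite nn mulr0 subr0.
suff -> : z^-1 ^+ 3 * B - z^-1 * (C / z) = S * x / z ^+ 3 by [].
by rewrite /B; field.
Qed.

(** [f u + f m * n] is a boosted coordinate at the site being integrated. Its nilpotent part enters
    the quadratic exponent only linearly, multiplied by the derivative [- (h u + p)] of that
    exponent. *)
Lemma sz_gauss (h u m : F) (t n p : A) : n * n = 0 ->
  t - f (2^-1 * h) * ((f u + f m * n) * (f u + f m * n)) - (f u + f m * n) * p =
  (t - f (2^-1 * h * u ^+ 2) - f u * p) + - (f m * n * (f (h * u) + p)).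
Proof.
move=> nn.
have hE : f h = f (2^-1 * h) + f (2^-1 * h) by rewrite -rmorphD; congr (f _); field.
have -> : f (2^-1 * h * u ^+ 2) = f (2^-1 * h) * f u ^+ 2 by rewrite rmorphM rmorphXn.
rewrite [f (h * u)]rmorphM hE.
move: (f (2^-1 * h)) (f u) (f m) => g v w.
transitivity (t - g * (v * v) - (g + g) * (v * w * n) - g * w * w * (n * n) - v * p - w * n * p); first by ring.
by rewrite nn; ring.
Qed.

(** The factor [n] comes either from the Jacobian, with coefficient [j'], or from the exponential,
    with coefficient [j * m]. *)
Lemma sz_site (j j' m hu : F) (A1 n p psi : A) : n * n = 0 ->
  (f j + f j' * n) * A1 * (psi * (1 + - (f m * n * (f hu + p)))) =
  f j * (A1 * psi) + f j' * (A1 * n * psi) + f (j * m) * (A1 * n * (- (f hu + p)) * psi).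
Proof.
move=> nn; rewrite rmorphM; move: (f j) (f j') (f m) (f hu) => x x' y z.
transitivity (x * (A1 * psi) + x' * (A1 * n * psi) + x * y * (A1 * n * (- (z + p)) * psi)
  - x' * y * A1 * (z + p) * psi * (n * n)); first by ring.
by rewrite nn mulr0 subr0.
Qed.

Lemma sz_site0 (m : F) (n p h psi : A) : n * n = 0 ->
  f m * n * (psi * (1 + - (f m * n * (h + p)))) = f m * (n * psi).
Proof.
move=> nn; transitivity (f m * (n * psi) - f m * f m * (n * n) * psi * (h + p)); first by ring.
by rewrite nn mulr0 !mul0r subr0.
Qed.

(** Expansion of [Y = X0 + d X] with [d] the indicator of [i]. It isolates what the total exponent
    owes to the form at a single site. *)
Lemma quad_split (J : finType) (i : J) (h : J -> J -> A) (X0 Y : J -> A) (r : J -> J -> A) (X : A) :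
  (forall j k, h j k = h k j) -> X0 i = 0 -> (forall j, Y j = if j == i then X else X0 j) ->
  \sum_j \sum_k h j k * (1 + Y j * Y k + r j k) =
  \sum_j \sum_k h j k * (1 + X0 j * X0 k + r j k) + h i i * (X * X)
   + (X * (\sum_k h i k * X0 k)) *+ 2.
Proof.
move=> hs X0i YE.
pose d j : A := (j == i)%:R.
have YD j : Y j = X0 j + d j * X.
  by rewrite YE /d; case: eqP => [->|]; rewrite ?X0i ?add0r ?mul1r ?mul0r ?addr0.
have pick (g : J -> A) : \sum_j d j * g j = g i.
  rewrite (bigD1 i)//= {1}/d eqxx mul1r big1 ?addr0// => j /negPf ji.
  by rewrite /d ji mul0r.
transitivity (\sum_j (\sum_k h j k * (1 + X0 j * X0 k + r j k) +
    d j * (X * (\sum_k h j k * X0 k)) + d j * (h j i * (X * X)) + X * (h j i * X0 j))).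
  apply: eq_bigr => j _.
  have -> : d j * (X * \sum_k h j k * X0 k) = \sum_k d j * X * (h j k * X0 k).
    by rewrite mulrA mulr_sumr.
  have -> : d j * (h j i * (X * X)) = \sum_k d k * (d j * h j k * (X * X)).
    by rewrite pick mulrA.
  have -> : X * (h j i * X0 j) = \sum_k d k * (X * (h j k * X0 j)) by rewrite pick.
  rewrite -!big_split/=; apply: eq_bigr => k _; rewrite !YD; ring.
rewrite !big_split/= pick pick -mulr_sumr mulr2n addrA -!addrA; congr (_ + _).
rewrite addrCA; congr (_ + (_ + _ * _)).
by apply: eq_bigr => k _; rewrite hs.
Qed.

End SquareZeroIdentities.

Section Shuffles.
Variable A : comNzRingType.
Implicit Types (b t p q w x y z : A).

Lemma shuffle_exp b t p q w : b * (t * p * (q * w)) = p * q * (b * t * w).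
Proof. ring. Qed.
Lemma shuffle_pow b t x y : b * x * t * y = b * t * (x * y).
Proof. ring. Qed.
Lemma shuffle_neg b x y z : b * - (x + (y + z)) = - (x + y) * b + -1 * (b * z).
Proof. ring. Qed.
Lemma shuffle_neg2 b x y : b * - (x + y) = - x * b + -1 * (b * y).
Proof. ring. Qed.
Lemma shuffle_sqr p x q : p * x * q * (p * x * q) = p * p * q * q * (x * x).
Proof. ring. Qed.
Lemma shuffle_front b p x q : b * (p * (x * q)) = p * (b * x * q).
Proof. ring. Qed.
Lemma shuffle_jet p t x y : p * (t * x) * y = p * x * (t * y).
Proof. ring. Qed.
Lemma shuffle_tot h x y p q : - (h * (1 + x + y - p - q)) = - (h * (1 + x + y)) + (h * p + h * q).
Proof. ring. Qed.
End Shuffles.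

(** * Even elements of the Grassmann algebra *)

Section GrassmannTheory.
Variables (R : comNzRingType) (G : finType).
Local Notation gr := (grassmann R G).
Implicit Types (f g h : gr) (S A B : {set G}) (p q : G).

Lemma gmulE f g S : (f * g) S = \sum_(A : {set G} | A \subset S)
  (-1) ^+ inversions A (S :\: A) * (f A * g (S :\: A)).
Proof. by rewrite ffunE. Qed.

Lemma gaddE f g S : (f + g) S = f S + g S. Proof. by rewrite ffunE. Qed.
Lemma goppE f S : (- f) S = - f S. Proof. by rewrite ffunE. Qed.
Lemma gzeroE S : (0 : gr) S = 0. Proof. by rewrite ffunE. Qed.
Lemma goneE S : (1 : gr) S = (S == set0)%:R. Proof. by rewrite ffunE. Qed.
Lemma gscaleE (k : R) f S : (k *: f) S = k * f S. Proof. by rewrite ffunE. Qed.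
Definition gbody f : R := f set0.

Lemma gbodyM f g : gbody (f * g) = gbody f * gbody g.
Proof.
rewrite /gbody gmulE (bigD1 set0)//= big1 ?addr0 => [|A /andP[/[!subset0]->]//].
by rewrite inversions0l expr0 mul1r setD0.
Qed.

Lemma gbody_is_zmod : zmod_morphism gbody.
Proof. by move=> f g; rewrite /gbody gaddE goppE. Qed.
HB.instance Definition _ := GRing.isZmodMorphism.Build gr R gbody gbody_is_zmod.
Lemma gbody_is_monoid : monoid_morphism gbody.
Proof. by split=> [|f g]; rewrite ?gbodyM// /gbody goneE eqxx. Qed.
HB.instance Definition _ := GRing.isMonoidMorphism.Build gr R gbody gbody_is_monoid.

Lemma gbodyZ (k : R) f : gbody (k *: f) = k * gbody f.
Proof. exact: gscaleE. Qed.
Lemma gbodyA (k : R) : gbody k%:A = k.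
Proof. by rewrite gbodyZ rmorph1 mulr1. Qed.

Definition gdeg_ge (k : nat) f : Prop := forall S, (#|S| < k)%N -> f S = 0.

Lemma gdeg_geM k l f g : gdeg_ge k f -> gdeg_ge l g -> gdeg_ge (k + l) (f * g).
Proof.
move=> fk gl S Skl; rewrite gmulE big1// => A AS.
have cS : #|S| = (#|A| + #|S :\: A|)%N by rewrite -(cardsID A S) (setIidPr AS).
have [Ak|Ak] := ltnP #|A| k; first by rewrite fk// mul0r mulr0.
rewrite gl ?mulr0//; rewrite cS in Skl.
by rewrite -(ltn_add2l #|A|) (leq_trans Skl)// leq_add2r.
Qed.

Lemma gdeg_ge1 f : gbody f = 0 -> gdeg_ge 1 f.
Proof. by move=> f0 S; rewrite ltnS leqn0 cards_eq0 => /eqP ->. Qed.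

Lemma gdeg_geX f k : gbody f = 0 -> gdeg_ge k (f ^+ k).
Proof.
move=> f0; elim: k => [//|k IH]; rewrite exprS.
exact: (gdeg_geM (gdeg_ge1 f0) IH).
Qed.

Lemma gdeg_ge_eq0 k f : (#|G| < k)%N -> gdeg_ge k f -> f = 0.
Proof.
move=> Gk fk; apply/ffunP => S; rewrite gzeroE fk//.
by rewrite (leq_ltn_trans _ Gk)// max_card.
Qed.

Definition geven : {pred gr} := fun f => [forall S : {set G}, odd #|S| ==> (f S == 0)].

Lemma gevenP f : reflect (forall S, odd #|S| -> f S = 0) (f \in geven).
Proof.
apply: (iffP forallP) => H S; last by apply/implyP => oS; apply/eqP/H.
by move=> oS; apply/eqP; have := H S; rewrite oS.
Qed.

Lemma geven_subring : subring_closed geven.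
Proof.
split=> [|f g /gevenP fe /gevenP ge|f g /gevenP fe /gevenP ge]; apply/gevenP => S oS.
- by rewrite goneE; case: eqP oS => // ->; rewrite cards0.
- by rewrite gaddE goppE fe// ge// subr0.
rewrite gmulE big1// => A AS; move: oS.
rewrite -(cardsID A S) (setIidPr AS) oddD.
case: (boolP (odd #|A|)) => [oA _|_ /= oB]; first by rewrite fe// mul0r mulr0.
by rewrite [g _]ge// !mulr0.
Qed.
HB.instance Definition _ := GRing.isSubringClosed.Build gr geven geven_subring.

Lemma gevenZ (k : R) f : f \in geven -> k *: f \in geven.
Proof. by move=> /gevenP fe; apply/gevenP => S /fe fS; rewrite gscaleE fS mulr0. Qed.

(** Each pair in the product of [A] and [B] is an inversion in exactly one of the two orders. *)
Lemma inversions_disj A B : [disjoint A & B] ->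
  (inversions A B + inversions B A = #|A| * #|B|)%N.
Proof.
move=> dAB; rewrite /inversions [X in (_ + X)%N]exchange_big/= -big_split/=.
rewrite -sum_nat_const; apply: eq_bigr => p pA; rewrite -[#|B|]sum1_card.
rewrite -big_split/=; apply: eq_bigr => q qB.
have : p != q by apply: contraTneq pA => ->; rewrite (disjointFl dAB).
by case: ltngtP => // /ord_inj /enum_rank_inj ->; rewrite eqxx.
Qed.

(** Passing to the complement exchanges the two factors. By [inversions_disj] the signs then differ
    by [(-1)^(|A| |B|)], which is 1, as [f] has coefficients on even [A] only. *)
Lemma geven_comm f g : f \in geven -> f * g = g * f.
Proof.
move=> /gevenP fe; apply/ffunP => S; rewrite !gmulE.
rewrite [RHS](reindex_onto (fun A => S :\: A) (fun A => S :\: A))/=; last first.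
  by move=> A AS; rewrite setDDr setDv set0U; apply/setIidPr.
apply: eq_big => [A|A AS].
  by rewrite subsetDl/= setDDr setDv set0U; apply/idP/eqP => [/setIidPr//|<-]; rewrite subsetIl.
have -> : S :\: (S :\: A) = A by rewrite setDDr setDv set0U; apply/setIidPr.
rewrite [f A * _]mulrC.
case: (boolP (odd #|A|)) => [oA|eA]; first by rewrite fe// !mulr0.
congr (_ * _).
have dAB : [disjoint A & S :\: A] by rewrite disjoint_sym disjoints_subset setDE subsetIr.
rewrite -(signr_odd _ (inversions A _)) -(signr_odd _ (inversions _ A)).
have := congr1 odd (inversions_disj dAB).
by rewrite oddD oddM (negPf eA)/=; case: (odd _); case: (odd _).
Qed.

(** The forms under the integral are even. Packed as a commutative ring, the even elements are open
    to [ring], to the binomial formula and to products over sets of sites. *)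
Record evenG := EvenG { evenG_val :> gr; evenG_prop : evenG_val \in geven }.
HB.instance Definition _ := [isSub for evenG_val].
HB.instance Definition _ := [Choice of evenG by <:].
HB.instance Definition _ := [SubChoice_isSubNzRing of evenG by <:].
Lemma evenG_mulC : commutative (@GRing.mul evenG).
Proof. by move=> f g; apply: val_inj; rewrite !rmorphM/= geven_comm// (valP f). Qed.
HB.instance Definition _ := GRing.PzRing_hasCommutativeMul.Build evenG evenG_mulC.

Definition evc (k : R) : evenG := EvenG (gevenZ k (rpred1 geven)).

Lemma evc_is_zmod : zmod_morphism evc.
Proof. by move=> k l; apply: val_inj; rewrite /= scalerBl. Qed.
HB.instance Definition _ := GRing.isZmodMorphism.Build R evenG evc evc_is_zmod.
Lemma evc_is_monoid : monoid_morphism evc.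
Proof.
split=> [|k l]; apply: val_inj; rewrite /= ?scale1r//.
by rewrite -scalerAl mul1r scalerA.
Qed.
HB.instance Definition _ := GRing.isMonoidMorphism.Build R evenG evc evc_is_monoid.

Definition ebody (f : evenG) : R := gbody (val f).
Lemma ebody_is_zmod : zmod_morphism ebody.
Proof. by move=> f g; rewrite /ebody !rmorphB. Qed.
HB.instance Definition _ := GRing.isZmodMorphism.Build evenG R ebody ebody_is_zmod.
Lemma ebody_is_monoid : monoid_morphism ebody.
Proof. by split=> [|f g]; rewrite /ebody ?rmorph1// !rmorphM. Qed.
HB.instance Definition _ := GRing.isMonoidMorphism.Build evenG R ebody ebody_is_monoid.

Lemma ebodyC k : ebody (evc k) = k. Proof. exact: gbodyA. Qed.

Lemma val_evcM (k : R) (f : evenG) : val (evc k * f) = k *: val f.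
Proof. by rewrite rmorphM/= -scalerAl mul1r. Qed.

Lemma enilp (f : evenG) k : ebody f = 0 -> (#|G| < k)%N -> f ^+ k = 0.
Proof.
move=> f0 Gk; apply: val_inj; rewrite rmorphXn rmorph0/=.
apply: (gdeg_ge_eq0 Gk); apply: gdeg_geX; exact: f0.
Qed.

Lemma enilpM (f g : evenG) k l : ebody f = 0 -> ebody g = 0 -> (#|G| < k + l)%N ->
  f ^+ k * g ^+ l = 0.
Proof.
move=> f0 g0 Gk; apply: val_inj; rewrite rmorphM !rmorphXn rmorph0/=.
by apply: (gdeg_ge_eq0 Gk); apply: gdeg_geM; apply: gdeg_geX; [exact: f0|exact: g0].
Qed.

Lemma gderivD p f g : gderiv p (f + g) = gderiv p f + gderiv p g.
Proof.
apply/ffunP => S; rewrite gaddE !ffunE; case: ifP => _; first by rewrite addr0.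
by rewrite mulrDr.
Qed.
Lemma gderivZ p (k : R) f : gderiv p (k *: f) = k *: gderiv p f.
Proof.
apply/ffunP => S; rewrite gscaleE !ffunE; case: ifP => _; first by rewrite mulr0.
by rewrite mulrCA.
Qed.

Lemma gderiv_anticomm p q f : gderiv p (gderiv q f) = - gderiv q (gderiv p f).
Proof.
apply/ffunP => S; rewrite goppE !ffunE !inE.
have [pS|pS] := boolP (p \in S).
  by rewrite orbT mulr0; case: ifP; rewrite oppr0.
have [qS|qS] := boolP (q \in S).
  by rewrite orbT mulr0 oppr0.
have [->|pq] := eqVneq p q; first by rewrite /= ?mulr0 ?oppr0.
rewrite /=.
rewrite !inversionsUr ?disjoints1 ?inE//.
rewrite !exprD (sign_inversions11 R pq) setUCA; ring.
Qed.

Definition gfree p f : Prop := forall S, p \in S -> f S = 0.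

Lemma gfree_deriv p f : gfree p f -> gderiv p f = 0.
Proof.
move=> fp; apply/ffunP => S; rewrite !ffunE; case: ifP => // _.
by rewrite fp ?mulr0// setU11.
Qed.
Lemma gfreeD p f g : gfree p f -> gfree p g -> gfree p (f + g).
Proof. by move=> fp gp S pS; rewrite gaddE fp// gp// addr0. Qed.
Lemma gfreeN p f : gfree p f -> gfree p (- f).
Proof. by move=> fp S pS; rewrite goppE fp// oppr0. Qed.
Lemma gfreeZ p (k : R) f : gfree p f -> gfree p (k *: f).
Proof. by move=> fp S pS; rewrite gscaleE fp// mulr0. Qed.
Lemma gfree0 p : gfree p 0. Proof. by move=> S _; rewrite gzeroE. Qed.
Lemma gfree1 p : gfree p 1.
Proof. by move=> S pS; rewrite goneE; case: eqP pS => // ->; rewrite inE. Qed.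
Lemma gfree_gen p q : p != q -> gfree p (gen R q).
Proof.
by move=> pq S pS; rewrite ffunE; case: eqP pS => // ->; rewrite inE (negPf pq).
Qed.
Lemma gfreeM p f g : gfree p f -> gfree p g -> gfree p (f * g).
Proof.
move=> fp gp S pS; rewrite gmulE big1// => A AS.
have [pA|pA] := boolP (p \in A); first by rewrite fp// mul0r mulr0.
by rewrite gp ?mulr0// inE pA.
Qed.
Lemma gfree_sum p (I : Type) (r : seq I) (P : pred I) (F : I -> gr) :
  (forall i, P i -> gfree p (F i)) -> gfree p (\sum_(i <- r | P i) F i).
Proof.
by move=> H; apply: big_ind => //; [exact: gfree0|exact: gfreeD].
Qed.
Lemma gfreeX p f k : gfree p f -> gfree p (f ^+ k).
Proof. by move=> fp; elim: k => [|k IH]; [exact: gfree1|rewrite exprS; apply: gfreeM]. Qed.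

(** Sets the generators in [K] to zero. This is the Grassmann half of [pin]; being a ring morphism
    that preserves bodies, it passes through Taylor expansions ([gkill_apply]). *)
Definition gkill (K : {set G}) f : gr := [ffun S : {set G} => if [disjoint S & K] then f S else 0].

Lemma gkill_is_zmod K : zmod_morphism (gkill K).
Proof. by move=> f g; apply/ffunP => S; rewrite gaddE goppE !ffunE; case: ifP => _; rewrite ?subr0// ffunE goppE. Qed.
HB.instance Definition _ K := GRing.isZmodMorphism.Build gr gr (gkill K) (gkill_is_zmod K).
Lemma gkill_is_monoid K : monoid_morphism (gkill K).
Proof.
split=> [|f g]; apply/ffunP => S; rewrite ffunE.
  by rewrite goneE; case: ifP => //; case: eqP => // ->; rewrite disjoint_sym disjoints_subset setC0 subsetT.
rewrite !gmulE; case: ifP => [SK|SK].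
  apply: eq_bigr => A AS; rewrite !ffunE (disjointWl AS SK).
  by rewrite (disjointWl _ SK)// subsetDl.
rewrite big1// => A AS; rewrite !ffunE.
case: ifP => [AK|_]; last by rewrite mul0r mulr0.
case: ifP => [BK|_]; last by rewrite !mulr0.
move: SK; rewrite -(setID S A) (setIidPr AS) disjoints_subset subUset.
by rewrite -!disjoints_subset AK BK.
Qed.
HB.instance Definition _ K := GRing.isMonoidMorphism.Build gr gr (gkill K) (gkill_is_monoid K).
Lemma gkillZ K (k : R) f : gkill K (k *: f) = k *: gkill K f.
Proof. by apply/ffunP => S; rewrite gscaleE ffunE [in RHS]ffunE gscaleE; case: ifP; rewrite // mulr0. Qed.
Lemma gkill_gen K p : gkill K (gen R p) = if p \in K then 0 else gen R p.
Proof.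
apply/ffunP => S; rewrite ffunE; case: ifP => [SK|SK]; case: ifP => pK; rewrite ?ffunE//.
  by case: eqP SK => // ->; rewrite disjoints1 pK.
by case: eqP SK => // ->; rewrite disjoints1 pK.
Qed.
Lemma gbody_kill K f : gbody (gkill K f) = gbody f.
Proof. by rewrite /gbody ffunE disjoint_sym disjoints_subset setC0 subsetT. Qed.
End GrassmannTheory.

From mathcomp Require Import all_classical all_reals all_analysis measurable_realfun.
Import numFieldNormedType.Exports.
Local Open Scope classical_set_scope.
Local Open Scope ring_scope.

(** * Iterated partial derivatives *)

Section IteratedPartials.
Variables (R : realType) (I : finType).
Implicit Types (g h : (I -> R) -> R) (x : I -> R) (i j : I).

Lemma dfwith_id x i : dfwith x i (x i) = x.
Proof. by apply: funext => j; case: dfwithP. Qed.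

Lemma dfwith_dfwith x i (s t : R) : dfwith (dfwith x i s) i t = dfwith x i t.
Proof.
apply: funext => j; case: (eqVneq i j) => [<-|ij]; first by rewrite !dfwithin.
by rewrite !dfwithout.
Qed.

Lemma dfwithC x i j (s t : R) : i != j ->
  dfwith (dfwith x i s) j t = dfwith (dfwith x j t) i s.
Proof.
move=> ij; apply: funext => k.
case: (eqVneq j k) => [<-|jk]; first by rewrite dfwithin dfwithout// dfwithin.
rewrite dfwithout//; case: (eqVneq i k) => [<-|ik]; first by rewrite !dfwithin.
by rewrite !dfwithout.
Qed.

Definition pderivable i g := forall x, derivable (fun t : R => g (dfwith x i t)) (x i) 1.

Lemma is_derive_partial i g x : pderivable i g ->
  is_derive (x i) (1 : R) (fun t : R => g (dfwith x i t)) (partial i g x).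
Proof. by move=> /(_ x) H; rewrite /partial derive1E; exact/derivableP. Qed.

Lemma is_derive_partial_at i g x (t : R) : pderivable i g ->
  is_derive t (1 : R) (fun t : R => g (dfwith x i t)) (partial i g (dfwith x i t)).
Proof.
move=> /(is_derive_partial (dfwith x i t)); rewrite dfwithin.
by under eq_fun do rewrite dfwith_dfwith.
Qed.

Lemma partialE i g x d :
  is_derive (x i) (1 : R) (fun t : R => g (dfwith x i t)) d -> partial i g x = d.
Proof. by move=> H; rewrite /partial derive1E derive_val. Qed.

Lemma pderivable_partial i g dg :
  (forall x, is_derive (x i) (1 : R) (fun t : R => g (dfwith x i t)) (dg x)) ->
  pderivable i g /\ partial i g = dg.
Proof.
move=> H; split; first by move=> x; exact: (@ex_derive _ _ _ _ _ _ _ (H x)).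
by apply: funext => x; exact: partialE.
Qed.

(** A finite order of differentiability, unlike [smooth], lends itself to induction: a partial
    derivative of a product or of an exponential is built from functions of one order less. *)
Fixpoint Cn (n : nat) g : Prop :=
  continuous (g : {ptws I -> R} -> R) /\
  if n is m.+1 then forall i, pderivable i g /\ Cn m (partial i g) else True.

Lemma Cn_continuous n g : Cn n g -> continuous (g : {ptws I -> R} -> R).
Proof. by case: n => [|n] []. Qed.

Lemma CnS n g : Cn n.+1 g -> Cn n g.
Proof.
elim: n g => [|n IH] g; first by case.
by move=> [cg H]; split=> // i; have [Hi Ci] := H i; split=> //; exact: IH.
Qed.

Lemma Cn_le m n g : (m <= n)%N -> Cn n g -> Cn m g.
Proof.
move=> /subnK <-; elim: (n - m)%N => [//|k IH]; rewrite addSn => /CnS; exact: IH.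
Qed.

Lemma smooth_Cn n g : smooth g -> Cn n g.
Proof.
elim: n g => [|n IH] g sg; first by split=> //; have [] := sg [::].
split=> [|i]; first by have [] := sg [::].
split; first by move=> x; have [_] := sg [::]; exact.
apply: IH => s; have := sg (rcons s i).
by rewrite /partials -cats1 foldr_cat.
Qed.

Lemma pderivable_cst (c : R) i :
  pderivable i (fun=> c) /\ partial i (fun=> c) = fun=> 0.
Proof. by apply: pderivable_partial => x; exact: is_derive_cst. Qed.

Lemma Cn_cst n (c : R) : Cn n (fun=> c).
Proof.
elim: n c => [|n IH] c; first by split=> //; exact: cst_continuous.
split; first exact: cst_continuous.
move=> i; have [? ->] := pderivable_cst c i; split=> //; exact: IH.
Qed.

Lemma pderivable_coord k i :
  pderivable i (fun x => x k) /\ partial i (fun x => x k) = fun=> (i == k)%:R.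
Proof.
apply: pderivable_partial => x; have [<-|ik] := eqVneq i k.
  by under eq_fun do rewrite dfwithin; exact: is_derive_id.
by under eq_fun do rewrite dfwithout//; exact: is_derive_cst.
Qed.

Lemma Cn_coord n k : Cn n (fun x => x k).
Proof.
have H : continuous ((fun x => x k) : {ptws I -> R} -> R) by exact: proj_continuous.
case: n => [|n]; split=> // i.
by have [? ->] := pderivable_coord k i; split=> //; exact: Cn_cst.
Qed.

Lemma pderivableD i g h : pderivable i g -> pderivable i h ->
  pderivable i (fun x => g x + h x) /\
  partial i (fun x => g x + h x) = fun x => partial i g x + partial i h x.
Proof.
move=> dg dh; apply: pderivable_partial => x.
exact: is_deriveD (is_derive_partial x dg) (is_derive_partial x dh).
Qed.

Lemma CnD n g h : Cn n g -> Cn n h -> Cn n (fun x => g x + h x).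
Proof.
elim: n g h => [|n IH] g h [cg Hg] [ch Hh];
  (split; first by move=> x; exact: (cvgD (cg x) (ch x))) => //.
move=> i; have [dg Cg] := Hg i; have [dh Ch] := Hh i.
by have [? ->] := pderivableD dg dh; split=> //; exact: IH.
Qed.

Lemma pderivableM i g h : pderivable i g -> pderivable i h ->
  pderivable i (fun x => g x * h x) /\
  partial i (fun x => g x * h x) = fun x => partial i g x * h x + g x * partial i h x.
Proof.
move=> dg dh; apply: pderivable_partial => x.
apply: is_derive_eq; first exact: is_deriveM (is_derive_partial x dg) (is_derive_partial x dh).
rewrite /= dfwith_id /GRing.scale/=; ring.
Qed.

Lemma CnM n g h : Cn n g -> Cn n h -> Cn n (fun x => g x * h x).
Proof.
elim: n g h => [|n IH] g h [cg Hg] [ch Hh];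
  (split; first by move=> x; exact: (cvgM (cg x) (ch x))) => //.
move=> i; have [dg Cg] := Hg i; have [dh Ch] := Hh i.
have [? ->] := pderivableM dg dh; split=> //.
have Cgn : Cn n g by apply: (@CnS n).
have Chn : Cn n h by apply: (@CnS n).
by apply: CnD; apply: IH.
Qed.

Lemma pderivable_exp i g : pderivable i g ->
  pderivable i (fun x => expR (g x)) /\
  partial i (fun x => expR (g x)) = fun x => partial i g x * expR (g x).
Proof.
move=> dg; apply: pderivable_partial => x.
have := is_derive_partial x dg => dgx.
have H := is_derive1_comp (is_derive_expR _) dgx.
apply: (@is_derive_eq _ _ _ _ _ _ _ _ H).
by rewrite /= dfwith_id mulrC.
Qed.

Lemma Cn_exp n g : Cn n g -> Cn n (fun x => expR (g x)).
Proof.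
elim: n g => [|n IH] g [cg Hg].
  by split=> // x; apply: continuous_comp; [exact: cg|exact: continuous_expR].
split; first by move=> x; apply: continuous_comp; [exact: cg|exact: continuous_expR].
move=> i; have [dg Cg] := Hg i; have [? ->] := pderivable_exp dg; split=> //.
by apply: CnM => //; apply: IH; exact: CnS.
Qed.

Lemma CnZ n (c : R) g : Cn n g -> Cn n (fun x => c * g x).
Proof. by move=> Cg; apply: CnM => //; exact: Cn_cst. Qed.

Lemma CnN n g : Cn n g -> Cn n (fun x => - g x).
Proof. by move=> /(CnZ (-1)); under eq_fun do rewrite mulN1r. Qed.

Lemma Cn_sum n (J : Type) (r : seq J) (P : pred J) (F : J -> (I -> R) -> R) :
  (forall j : J, P j -> Cn n (F j)) -> Cn n (fun x => \sum_(j <- r | P j) F j x).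
Proof.
move=> H; elim: r => [|j r IH].
  by under eq_fun do rewrite big_nil; exact: Cn_cst.
under eq_fun do rewrite big_cons; case: (boolP (P j)) => // Pj.
by apply: CnD => //; exact: H.
Qed.

Lemma Cn_prod n (J : Type) (r : seq J) (P : pred J) (F : J -> (I -> R) -> R) :
  (forall j : J, P j -> Cn n (F j)) -> Cn n (fun x => \prod_(j <- r | P j) F j x).
Proof.
move=> H; elim: r => [|j r IH].
  by under eq_fun do rewrite big_nil; exact: Cn_cst.
under eq_fun do rewrite big_cons; case: (boolP (P j)) => // Pj.
by apply: CnM => //; exact: H.
Qed.

Lemma Cn_partials n (s : seq I) g : Cn (size s + n) g -> Cn n (partials s g).
Proof.
elim: s n => [//|i s IH] n; rewrite addSnnS => /IH /= [_ /(_ i)[]//].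
Qed.

End IteratedPartials.

(** * Exponential and inverse of even elements *)

Section EvenFunctions.
Variables (R : realType) (G : finType).
Local Notation E := (evenG R G).
Local Notation m := #|G|.
Implicit Types (f g : E).

Lemma evcM (p q : R) : evc G (p * q) = evc G p * evc G q.
Proof. exact: rmorphM. Qed.

Definition epart f : E := f - evc G (ebody f).

Lemma ebody_part f : ebody (epart f) = 0.
Proof. by rewrite /epart rmorphB /= ebodyC subrr. Qed.

Lemma epartK f : f = evc G (ebody f) + epart f. Proof. by rewrite /epart addrC subrK. Qed.

Lemma epartD f g : epart (f + g) = epart f + epart g.
Proof. by rewrite /epart !rmorphD/= opprD addrACA. Qed.

(** The exponential series of a nilpotent element, cut at the number of generators, beyond which the
    powers are zero by [enilp]. *)
Definition eexp_nil f : E := \sum_(k < m.+1) evc G (k`!%:R^-1) * f ^+ k.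
Definition eexp f : E := evc G (expR (ebody f)) * eexp_nil (epart f).

Lemma eexp_nil_wide f n : ebody f = 0 -> (m < n)%N ->
  eexp_nil f = \sum_(k < n) evc G (k`!%:R^-1) * f ^+ k.
Proof.
move=> f0 mn; rewrite /eexp_nil (big_ord_widen n (fun k => evc G (k`!%:R^-1) * f ^+ k))//.
rewrite big_mkcond/=; apply: eq_bigr => k _; case: ifPn => //.
by rewrite -leqNgt => mk; rewrite enilp ?mulr0.
Qed.

(** Cauchy product of the two truncated series. The product runs over a square of pairs [(k, l)] and
    the series of the sum over a triangle; the difference consists of terms that vanish by
    [enilpM]. *)
Lemma eexp_nilD f g : ebody f = 0 -> ebody g = 0 ->
  eexp_nil (f + g) = eexp_nil f * eexp_nil g.
Proof.
move=> f0 g0; rewrite /eexp_nil.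
pose F k l : E := evc G (k`!%:R^-1) * f ^+ k * (evc G (l`!%:R^-1) * g ^+ l).
transitivity (\sum_(n < m.+1) \sum_(k < m.+1 | (k <= n)%N) F k (n - k)%N).
  apply: eq_bigr => n _; rewrite addrC exprDn mulr_sumr.
  rewrite (big_ord_widen_cond m.+1 xpredT
     (fun k => evc G (n`!%:R^-1) * (g ^+ (n - k) * f ^+ k *+ 'C(n, k))))//=.
  apply: eq_big => [k|k kn]; first by rewrite ltnS.
  rewrite /F -(mulr_natr (g ^+ _ * _)) -(rmorph_nat (evc G)).
  have -> : evc G n`!%:R^-1 * (g ^+ (n - k) * f ^+ k * evc G 'C(n, k)%:R) =
    evc G (n`!%:R^-1 * 'C(n, k)%:R) * (f ^+ k * g ^+ (n - k)).
    by rewrite evcM; exact: sz_binomial.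
  have -> : n`!%:R^-1 * 'C(n, k)%:R = k`!%:R^-1 * (n - k)`!%:R^-1 :> R.
    rewrite ltnS in kn; rewrite -(bin_fact kn) !natrM.
    have := bin_gt0 n k; rewrite kn => C0.
    field; rewrite !pnatr_eq0 -!lt0n !fact_gt0; exact: C0.
  by rewrite evcM; exact: mulrACA.
rewrite (exchange_big_dep xpredT)//= mulr_suml; apply: eq_bigr => k _.
rewrite mulr_sumr.
have -> : \sum_(l < m.+1) F k l = \sum_(l < m.+1 | (l < m.+1 - k)%N) F k l.
  rewrite [RHS]big_mkcond/=; apply: eq_bigr => l _; case: ifPn => //.
  rewrite -leqNgt => kl.
  have : f ^+ k * g ^+ l = 0 by apply: enilpM => //; rewrite -leq_subLR.
  by rewrite /F mulrACA => ->; rewrite mulr0.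
rewrite -(big_ord_widen m.+1 (F k)) ?leq_subr//.
transitivity (\sum_(k <= n < m.+1) F k (n - k)%N).
  by rewrite [RHS](big_nat_widenl k 0)//= big_mkord; apply: eq_bigl => n; rewrite /= ?andbT.
rewrite -{1}[k : nat]add0n big_addn big_mkord.
by apply: eq_bigr => l _; rewrite addnK.
Qed.

Lemma eexpD f g : eexp (f + g) = eexp f * eexp g.
Proof.
rewrite /eexp epartD eexp_nilD ?ebody_part// rmorphD/= expRD evcM.
exact: mulrACA.
Qed.

Lemma eexp_nil0 : eexp_nil 0 = 1.
Proof.
rewrite /eexp_nil big_ord_recl/= expr0 fact0 invr1 rmorph1 mulr1 big1 ?addr0// => k _.
by rewrite expr0n/= mulr0.
Qed.

Lemma epartC (c : R) : epart (evc G c) = 0.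
Proof. by rewrite /epart ebodyC subrr. Qed.

Lemma eexpC (c : R) : eexp (evc G c) = evc G (expR c).
Proof. by rewrite /eexp epartC eexp_nil0 ebodyC mulr1. Qed.

Lemma eexp_sqz f : ebody f = 0 -> f * f = 0 -> eexp f = 1 + f.
Proof.
move=> f0 ff; rewrite /eexp f0 expR0 rmorph1 mul1r.
have -> : epart f = f by rewrite /epart f0 rmorph0 subr0.
rewrite (@eexp_nil_wide _ m.+2)// 2!big_ord_recl/= big1 => [|k _].
  by rewrite fact0 factS fact0 muln1 invr1 rmorph1 !mul1r expr0 expr1 addr0.
by rewrite /bump/= add1n exprS exprS mulrA ff mul0r mulr0.
Qed.

(** Geometric series: with [b] the body of [f], one has [f = b (1 - x)] with [x] nilpotent. *)
Definition einv f : E := evc G (ebody f)^-1 *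
  \sum_(k < m.+1) (- (evc G (ebody f)^-1 * epart f)) ^+ k.

Lemma einvM f : ebody f != 0 -> f * einv f = 1.
Proof.
move=> f0; rewrite /einv; set b := ebody f; set x := - _.
have xb : ebody x = 0 by rewrite /x rmorphN rmorphM/= ebody_part mulr0 oppr0.
have fE : f * evc G b^-1 = 1 - x.
  by rewrite {1}(epartK f) -/b /x; apply: sz_einvM; rewrite -evcM divff// rmorph1.
rewrite mulrA fE -opprB mulNr -subrX1 enilp// sub0r opprK//.
Qed.

Lemma einv_uniq f g : ebody f != 0 -> f * g = 1 -> einv f = g.
Proof. by move=> /einvM H fg; rewrite -[LHS]mulr1 -fg mulrA [einv f * f]mulrC H mul1r. Qed.

End EvenFunctions.

(** * Taylor expansion in square-zero directions *)

Section Jets.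
Variables (R : realType) (G I : finType).
Local Notation E := (evenG R G).
Variables (nu : I -> E) (b : I -> R).
Hypothesis nu_sqr : forall i, nu i * nu i = 0.
Hypothesis nu_body : forall i, ebody (nu i) = 0.
Implicit Types (g h : (I -> R) -> R) (i : I) (s : seq I).

(* For square-zero [nu], this is [g (b + nu)] expanded in the directions [s]. *)
Fixpoint jet s g : E :=
  if s is i :: s' then jet s' g + nu i * jet s' (partial i g) else evc G (g b).

Lemma jetD s g h : Cn (size s) g -> Cn (size s) h ->
  jet s (fun x => g x + h x) = jet s g + jet s h.
Proof.
elim: s g h => [|i s IH] g h Cg Ch /=; first by rewrite rmorphD.
have [dg Cg'] := proj2 Cg i; have [dh Ch'] := proj2 Ch i.
rewrite (proj2 (pderivableD dg dh)) !IH//; try exact: CnS.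
by rewrite mulrDr addrACA.
Qed.

Lemma jetM s g h : Cn (size s) g -> Cn (size s) h ->
  jet s (fun x => g x * h x) = jet s g * jet s h.
Proof.
elim: s g h => [|i s IH] g h Cg Ch /=; first by rewrite rmorphM.
have [dg Cg'] := proj2 Cg i; have [dh Ch'] := proj2 Ch i.
have Cgn : Cn (size s) g by apply: CnS.
have Chn : Cn (size s) h by apply: CnS.
rewrite (proj2 (pderivableM dg dh)) jetD ?IH//; try exact: CnM.
exact: sz_jetM.
Qed.

Lemma jet_cst s (c : R) : jet s (fun=> c) = evc G c.
Proof.
elim: s c => [//|i s IH] c /=; rewrite IH (proj2 (pderivable_cst c i)) IH.
by rewrite rmorph0 mulr0 addr0.
Qed.

Lemma jetZ s (c : R) g : Cn (size s) g -> jet s (fun x => c * g x) = evc G c * jet s g.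
Proof. by move=> Cg; rewrite jetM ?jet_cst//; exact: Cn_cst. Qed.

Lemma jetN s g : Cn (size s) g -> jet s (fun x => - g x) = - jet s g.
Proof.
move=> Cg; under [in LHS]eq_fun do rewrite -mulN1r.
by rewrite jetZ// rmorphN1 mulN1r.
Qed.

Lemma jet_coord_notin s k : k \notin s -> jet s (fun x => x k) = evc G (b k).
Proof.
elim: s => [//|i s IH] /=; rewrite inE negb_or eq_sym => /andP[/negPf ik ks].
by rewrite IH// (proj2 (pderivable_coord R k i)) ik jet_cst rmorph0 mulr0 addr0.
Qed.

Lemma jet_coord s k : uniq s -> k \in s -> jet s (fun x => x k) = evc G (b k) + nu k.
Proof.
elim: s => [//|i s IH] /= /andP[is_ us]; rewrite inE (proj2 (pderivable_coord R k i)).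
case: eqVneq => [->|ki] /= ks; rewrite jet_cst.
  by rewrite jet_coord_notin// rmorph1 mulr1.
by rewrite IH// rmorph0 mulr0 addr0.
Qed.

Lemma jet_sum s (J : Type) (r : seq J) (P : pred J) (F : J -> (I -> R) -> R) :
  (forall j : J, P j -> Cn (size s) (F j)) ->
  jet s (fun x => \sum_(j <- r | P j) F j x) = \sum_(j <- r | P j) jet s (F j).
Proof.
move=> CF; elim: r => [|j r IH].
  by under [in LHS]eq_fun do rewrite big_nil; rewrite big_nil jet_cst rmorph0.
under [in LHS]eq_fun do rewrite big_cons; rewrite big_cons.
case: (boolP (P j)) => // Pj; rewrite jetD ?IH//; first exact: CF.
exact: Cn_sum.
Qed.

Lemma jet_prod s (J : Type) (r : seq J) (P : pred J) (F : J -> (I -> R) -> R) :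
  (forall j : J, P j -> Cn (size s) (F j)) ->
  jet s (fun x => \prod_(j <- r | P j) F j x) = \prod_(j <- r | P j) jet s (F j).
Proof.
move=> CF; elim: r => [|j r IH].
  by under [in LHS]eq_fun do rewrite big_nil; rewrite big_nil jet_cst rmorph1.
under [in LHS]eq_fun do rewrite big_cons; rewrite big_cons.
case: (boolP (P j)) => // Pj; rewrite jetM ?IH//; first exact: CF.
exact: Cn_prod.
Qed.

Lemma jet_exp s g : Cn (size s) g -> jet s (fun x => expR (g x)) = eexp (jet s g).
Proof.
elim: s g => [|i s IH] g Cg /=; first by rewrite eexpC.
have [dg Cg'] := proj2 Cg i.
have Cgn : Cn (size s) g by apply: CnS.
rewrite (proj2 (pderivable_exp dg)) jetM//; last exact: Cn_exp.
rewrite IH// eexpD [eexp (nu i * _)]eexp_sqz.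
- exact: sz_jet_exp.
- by rewrite rmorphM/= nu_body mul0r.
- by rewrite mulrACA nu_sqr mul0r.
Qed.

(** As each [nu i] squares to zero, each direction is differentiated at most once, and the terms
    correspond to the sets [A] of directions that occur. The list is reversed because [jet] applies
    the derivative of its head first and [partials] applies it last. *)
Lemma jet_subsets s g : uniq s ->
  jet (rev s) g = \sum_(A : {set I} | A \subset [set:: s]%SET)
    evc G (partials [seq i <- s | i \in A] g b) * \prod_(i in A) nu i.
Proof.
elim/last_ind: s g => [|s i IH] g us.
  rewrite (big_pred1 finset.set0) => [|A]; first by rewrite big_set0 mulr1.
  by rewrite /= -finset.subset0; congr (_ \subset _); apply/setP => k; rewrite !inE.
move: us; rewrite rcons_uniq => /andP[is_ us].
rewrite rev_rcons /= !IH//.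
rewrite [RHS](bigID (fun A : {set I} => i \in A))/= addrC; congr (_ + _).
  apply: eq_big => [A|A As].
    apply/idP/andP => [As|[As iA]].
      split; last by apply: contra is_ => /(fintype.subsetP As); rewrite inE.
      by apply/fintype.subsetP => k /(fintype.subsetP As); rewrite !inE mem_rcons inE => ->; rewrite orbT.
    apply/fintype.subsetP => k kA; move/fintype.subsetP: As => /(_ k kA).
    by rewrite !inE mem_rcons inE => /predU1P[ki|//]; move: iA; rewrite -ki kA.
  rewrite filter_rcons ifN//; apply: contra is_ => /(fintype.subsetP As).
  by rewrite inE.
rewrite mulr_sumr.
rewrite [RHS](reindex_onto (fun A : {set I} => i |: A)%SET (fun A : {set I} => A :\ i)%SET)/=; last first.
  by move=> A /andP[_ iA]; rewrite finset.setD1K.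
apply: eq_big => [A|A As].
  apply/idP/andP => [As|[/andP[As _] /eqP Ai]].
    have iA : i \notin A by apply: contra is_ => /(fintype.subsetP As); rewrite inE.
    split; last by apply/eqP; rewrite setU1K.
    rewrite setU11 andbT; apply/fintype.subsetP => k; rewrite !inE mem_rcons inE.
    by case/predU1P => [->|/(fintype.subsetP As)]; rewrite ?eqxx// inE => ->; rewrite orbT.
  apply/fintype.subsetP => k kA; move/fintype.subsetP: As => /(_ k).
  rewrite !inE mem_rcons inE kA orbT => /(_ isT) /predU1P[ki|//].
  by move: kA; rewrite -Ai !inE ki eqxx.
have iA : i \notin A by apply: contra is_ => /(fintype.subsetP As); rewrite inE.
rewrite big_setU1//= filter_rcons setU11 mulrCA; congr (_ * (_ * _)).
congr (evc _ _); rewrite -cats1 /partials foldr_cat/=.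
congr (foldr _ _ _ _); apply: eq_in_filter => k ks.
by rewrite !inE; case: eqVneq => // ki; move: is_; rewrite -ki ks.
Qed.

End Jets.

Lemma val_evenG_sum (R : comNzRingType) (G : finType) (J : Type) (r : seq J) (P : pred J)
    (F : J -> evenG R G) :
  val (\sum_(j <- r | P j) F j) = \sum_(j <- r | P j) val (F j).
Proof. exact: rmorph_sum. Qed.

Lemma val_evenG_prod (R : comNzRingType) (G : finType) (J : Type) (r : seq J) (P : pred J)
    (F : J -> evenG R G) :
  val (\prod_(j <- r | P j) F j) = \prod_(j <- r | P j) val (F j).
Proof. exact: rmorph_prod. Qed.

Lemma val_evenGD (R : comNzRingType) (G : finType) (f g : evenG R G) :
  val (f + g) = val f + val g.
Proof. exact: rmorphD. Qed.

Lemma val_evenGX (R : comNzRingType) (G : finType) (f : evenG R G) k : val (f ^+ k) = val f ^+ k.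
Proof. exact: rmorphXn. Qed.

(** * Smooth functions of Grassmann elements *)

Section GrassmannApply.
Variables (R : realType) (G I : finType).
Local Notation gr := (grassmann R G).
Local Notation E := (evenG R G).

(** [form_apply] at a fixed configuration, which leaves pure Grassmann algebra. *)
Definition gapply (g : (I -> R) -> R) (f : I -> gr) : gr :=
  \sum_(alpha : {ffun I -> 'I_#|G|.+1})
    (multi_partial (fun k => alpha k) g (fun k => gbody (f k))
       / (\prod_k (alpha k)`!)%:R)
    *: \prod_k (f k - (gbody (f k))%:A) ^+ alpha k.

Lemma gkill_apply (K : {set G}) g f : gkill K (gapply g f) = gapply g (fun k => gkill K (f k)).
Proof.
rewrite /gapply rmorph_sum/=; apply: eq_bigr => alpha _.
rewrite gkillZ [gkill K (\prod_k _)]rmorph_prod/=; congr (_ *: _).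
  by congr (multi_partial _ _ _ / _); apply: funext => k; rewrite gbody_kill.
apply: eq_bigr => k _; rewrite rmorphXn rmorphB/= gkillZ rmorph1 gbody_kill//.
Qed.

(** Exponents [alpha] with a value above 1 contribute nothing, and the others are indicators of
    subsets of [I], as in [jet_subsets]. The condition [G0] ensures that the exponent 1 is among
    those allowed in [gapply]. *)
Lemma gapply_jet g (nu : I -> E) (b : I -> R) (G0 : (0 < #|G|)%N) :
  (forall i, nu i * nu i = 0) -> (forall i, ebody (nu i) = 0) ->
  gapply g (fun k => val (evc G (b k) + nu k)) = val (jet nu b (rev (enum I)) g).
Proof.
move=> nu2 nu0; rewrite jet_subsets ?enum_uniq// /gapply.
have bodyE k : gbody (val (evc G (b k) + nu k)) = b k.
  by rewrite -[LHS]/(ebody _) rmorphD/= ebodyC nu0 addr0.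
have -> : (fun k => gbody (val (evc G (b k) + nu k))) = b by apply: funext.
transitivity (val (\sum_(alpha : {ffun I -> 'I_#|G|.+1})
   evc G (multi_partial (fun k => alpha k) g b / (\prod_k (alpha k)`!)%:R)
    * \prod_k nu k ^+ alpha k)).
  rewrite val_evenG_sum; apply: eq_bigr => alpha _.
  rewrite val_evcM; congr (_ *: _).
  rewrite val_evenG_prod; apply: eq_bigr => k _; rewrite bodyE val_evenGX.
  by congr (_ ^+ _); rewrite /= addrC addKr.
congr (val _).
(* Keep the multi-indices with values in {0, 1}; any other one contains a factor [nu k ^+ 2]. *)
rewrite (bigID (fun alpha : {ffun I -> 'I_#|G|.+1} => [forall k, (alpha k <= 1)%N]))/=.
rewrite [X in _ + X]big1 ?addr0; last first.
  move=> alpha; rewrite negb_forall => /existsP[k]; rewrite -ltnNge => ak.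
  have nk : nu k ^+ alpha k = 0.
    by case: (nat_of_ord _) ak => [|[|n]]// _; rewrite exprS exprS mulrA nu2 mul0r.
  by rewrite [\prod_k nu k ^+ _](bigD1 k)//= nk mul0r mulr0.
rewrite (reindex_onto (fun A : {set I} => [ffun k => inord (k \in A) : 'I_#|G|.+1])
   (fun alpha => [set k | alpha k != ord0]%SET))/=; last first.
  move=> alpha /forallP a1; apply/ffunP => k; rewrite ffunE inE.
  apply: val_inj; rewrite /= inordK; last by rewrite ltnS (leq_trans _ G0)// leq_b1.
  by have := a1 k; rewrite -[alpha k == ord0]/(alpha k == 0%N :> nat); case: (nat_of_ord _) => [|[|]].
have inordE (A : {set I}) k : nat_of_ord (inord (k \in A) : 'I_#|G|.+1) = (k \in A).
  by rewrite inordK// ltnS (leq_trans _ G0)// leq_b1.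
apply: eq_big => [A|A _].
  have -> : A \subset [set:: enum I]%SET by apply/fintype.subsetP => k _; rewrite inE mem_enum.
  apply/andP; split; first by apply/forallP => k; rewrite ffunE inordE leq_b1.
  apply/eqP/setP => k; rewrite inE ffunE -[_ == ord0]/(nat_of_ord _ == 0%N) inordE.
  by case: (k \in A).
congr (evc _ _ * _).
  rewrite [X in X%:R]big1 ?divr1 => [|k _]; last by rewrite ffunE inordE; case: (k \in A).
  rewrite /multi_partial; congr (partials _ _ _).
  elim: (enum I) => [//|k s IH] /=; rewrite ffunE inordE IH.
  by case: (k \in A).
rewrite [RHS]big_mkcond/=; apply: eq_bigr => k _.
by rewrite ffunE inordE; case: (k \in A).
Qed.

End GrassmannApply.

Section GrassmannApply1.
Variables (R : realType) (G : finType).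
Local Notation gr := (grassmann R G).
Local Notation E := (evenG R G).

Definition gapply1 (h : R -> R) (f : gr) : gr :=
  gapply (fun v : unit -> R => h (v tt)) (fun=> f).

Lemma partials_unit (h : R -> R) k :
  partials (nseq k tt) (fun v : unit -> R => h (v tt)) = fun v => derive1n k h (v tt).
Proof.
elim: k => [|k IH] //=; rewrite /partials/= -/(partials _ _) IH.
apply: funext => v; rewrite /partial -derive1nS; congr (derive1 _ _).
by apply: funext => t; rewrite dfwithin.
Qed.

Lemma gapply1E h f : gapply1 h f = \sum_(k < #|G|.+1)
  (derive1n k h (gbody f) / k`!%:R) *: (f - (gbody f)%:A) ^+ k.
Proof.
rewrite /gapply1 /gapply.
rewrite (reindex (fun k : 'I_#|G|.+1 => [ffun _ : unit => k])); last first.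
  exists (fun alpha : {ffun unit -> 'I_#|G|.+1} => alpha tt) => [k _|alpha _]; first by rewrite ffunE.
  by apply/ffunP => -[]; rewrite ffunE.
apply: eq_bigr => k _.
have Eu : enum {: unit} = [:: tt] by rewrite enumT unlock.
rewrite /multi_partial Eu /= cats0 ffunE partials_unit.
by rewrite !(big_pred1 tt) ?ffunE//; case.
Qed.

Lemma gapply1_sqz h (c : R) (v : E) (G0 : (0 < #|G|)%N) : ebody v = 0 -> v * v = 0 ->
  gapply1 h (val (evc G c + v)) = val (evc G (h c) + evc G (derive1 h c) * v).
Proof.
move=> v0 vv; rewrite gapply1E.
have -> : gbody (val (evc G c + v)) = c by rewrite -[LHS]/(ebody _) rmorphD/= ebodyC v0 addr0.
have -> : val (evc G c + v) - c%:A = val v by rewrite /= addrC addKr.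
case: #|G| G0 => // m _; rewrite 2!big_ord_recl big1 ?addr0 => [|k _]; last first.
  have /= vv' := congr1 val vv.
  by rewrite -[(val v) ^+ _]/(val v ^+ k.+2) exprS exprS mulrA vv' mul0r scaler0.
rewrite val_evenGD val_evcM !divr1 expr0 expr1 /=; congr (_ *: _ + _).
Qed.

Lemma derive1n_expR k : derive1n k (@expR R) = @expR R.
Proof. by elim: k => [//|k IH]; rewrite derive1nS IH; apply: funext => x; rewrite derive1E derive_val. Qed.

Lemma gapply1_exp (f : E) : gapply1 expR (val f) = val (eexp f).
Proof.
rewrite gapply1E /eexp /eexp_nil mulr_sumr val_evenG_sum; apply: eq_bigr => k _.
rewrite derive1n_expR mulrA -rmorphM val_evcM; congr (_ *: _); rewrite val_evenGX.
by congr (_ ^+ _).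
Qed.

Lemma derive1n_inv k (x : R) : x != 0 ->
  derive1n k (@GRing.inv R) x = (-1) ^+ k * k`!%:R * x^-1 ^+ k.+1.
Proof.
elim: k x => [|k IH] x x0; first by rewrite /= expr0 fact0 !mul1r expr1.
rewrite derive1nS derive1E.
have near_x : \forall y \near x, derive1n k (@GRing.inv R) y = (-1) ^+ k * k`!%:R * (y^-1) ^+ k.+1.
  have : \forall y \near x, y != 0.
    by apply: open_nbhs_nbhs; split=> //; exact: open_neq.
  by apply: filterS => y; exact: IH.
rewrite (near_eq_derive _ near_x).
have H1 : is_derive x (1 : R) (fun y : R => y^-1) (- x ^- 2 *: (1 : R)).
  exact: (@is_deriveV R id x 1 1 x0 _).
have H2 := is_deriveX k.+1 H1.
have H3 := is_deriveZ ((-1) ^+ k * k`!%:R) H2.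
have -> : (fun y : R => (-1) ^+ k * k`!%:R * (y^-1) ^+ k.+1)
  = ((-1) ^+ k * k`!%:R) *: ((fun y : R => y^-1) ^+ k.+1).
  by apply: funext => y; rewrite exprfctE.
rewrite derive_val.
rewrite /GRing.scale/= -?exprVn factS natrM; move: x^-1 => y; rewrite !exprS.
ring.
Qed.

Lemma gapply1_inv (f : E) : ebody f != 0 -> gapply1 GRing.inv (val f) = val (einv f).
Proof.
move=> f0; rewrite gapply1E /einv mulr_sumr val_evenG_sum; apply: eq_bigr => k _.
rewrite derive1n_inv// [(- (evc _ _ * _)) ^+ k]exprNn exprMn -(rmorphXn (evc G)).
have -> : evc G (ebody f)^-1 * ((-1) ^+ k * (evc G ((ebody f)^-1 ^+ k) * epart f ^+ k))
  = evc G ((-1) ^+ k * (ebody f)^-1 ^+ k.+1) * epart f ^+ k.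
  by rewrite evcM exprS evcM (rmorphXn (evc G) k (-1)) rmorphN1; exact: sz_einv.
rewrite val_evcM; congr (_ *: _); last by rewrite val_evenGX.
rewrite -[gbody _]/(ebody f).
have : k`!%:R != 0 :> R by rewrite pnatr_eq0 -lt0n fact_gt0.
by move=> ?; field.
Qed.

End GrassmannApply1.

(** * The pinned superexpectation in coordinates *)

Section Pinned.
Variables (R : realType) (Lambda : finType) (a : Lambda).
Local Notation G := (fermion Lambda).
Local Notation gr := (grassmann R G).
Local Notation E := (evenG R G).
Local Notation config := (Lambda -> R * R).
Implicit Types (i j : Lambda) (c : config) (s : R) (sigma : Lambda -> R).

Lemma geven_gen2 (p q : G) : gen R p * gen R q \in @geven R G.
Proof.
apply/gevenP => S oS; rewrite genME; case: ifP => // pS; rewrite ffunE.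
case: eqP => [SE|]; last by rewrite mulr0.
by move: oS; rewrite (cardsD1 p) pS SE cards1.
Qed.

Definition bil i j : E := EvenG (geven_gen2 (inl i) (inr j)).
Definition pair_at_a : {set G} := [set inl a; inr a]%SET.
(** The product [xi_i eta_j] as it stands once the generators at [a] have been set to zero. *)
Definition bilp i j : E := if (i == a) || (j == a) then 0 else bil i j.
Local Notation N i := (bilp i i).

Lemma in_pair_at_a_l i : ((inl i : G) \in pair_at_a) = (i == a).
Proof. by rewrite !inE /= orbF. Qed.
Lemma in_pair_at_a_r i : ((inr i : G) \in pair_at_a) = (i == a).
Proof. by rewrite !inE. Qed.

Lemma gkill_xi_eta i j :
  gkill pair_at_a (gen R (inl i : G) * gen R (inr j : G)) = val (bilp i j).
Proof.
rewrite rmorphM/= !gkill_gen in_pair_at_a_l in_pair_at_a_r /bilp.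
by case: (i == a); case: (j == a); rewrite /= ?mul0r ?mulr0.
Qed.

Lemma ebody_bilp i j : ebody (bilp i j) = 0.
Proof.
rewrite /bilp; case: ifP => _; first by rewrite rmorph0.
by rewrite /ebody/= gbodyM /gbody ffunE eq_sym -cards_eq0 cards1 mul0r.
Qed.

Lemma bilp_sqr i j : bilp i j * bilp i j = 0.
Proof.
rewrite /bilp; case: ifP => _; first by rewrite mulr0.
apply: val_inj; rewrite rmorphM rmorph0/= -[gen R _ * _ * _]mulrA.
rewrite [gen R (inr j : G) * _]mulrA [gen R (inr j : G) * gen R (inl i : G)]gen_anticomm.
by rewrite mulNr mulrN mulrA mulrA gen_sqr !mul0r oppr0.
Qed.

Lemma gkillC (k : R) : gkill pair_at_a k%:A = k%:A :> gr.
Proof. by rewrite gkillZ rmorph1. Qed.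

Lemma gkill_eta_xi i j :
  gkill pair_at_a (gen R (inr i : G) * gen R (inl j : G)) = - val (bilp j i).
Proof. by rewrite gen_anticomm rmorphN/= gkill_xi_eta. Qed.

Definition z0 c i : R := Num.sqrt (1 + (c i).1 ^+ 2 + (c i).2 ^+ 2).

Lemma z0_arg_gt0 (x y : R) : 0 < 1 + x ^+ 2 + y ^+ 2.
Proof. by rewrite ltr_wpDr ?sqr_ge0// ltr_wpDr ?sqr_ge0. Qed.
Lemma z0_gt0 c i : 0 < z0 c i. Proof. by rewrite sqrtr_gt0 z0_arg_gt0. Qed.
Lemma z0_neq0 c i : z0 c i != 0. Proof. by rewrite gt_eqF// z0_gt0. Qed.
Lemma z0_sqr c i : z0 c i ^+ 2 = 1 + (c i).1 ^+ 2 + (c i).2 ^+ 2.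
Proof. by rewrite sqr_sqrtr// ltW// z0_arg_gt0. Qed.

(** The pinned form [z_i], that is [sqrt (z0 ^+ 2 - 2 N)]; its expansion at [z0] is exact at first
    order because [N] has square zero. *)
Definition zE c i : E := evc G (z0 c i) - evc G (z0 c i)^-1 * N i.

Lemma card_fermion_gt0 : (0 < #|G|)%N.
Proof. by apply/card_gt0P; exists (inl a). Qed.

Lemma val_evcE (k : R) : val (evc G k) = k%:A :> gr. Proof. by []. Qed.
Lemma val_evenGM (f g : E) : val (f * g) = val f * val g.
Proof. by []. Qed.
Lemma val_evenGN (f : E) : val (- f) = - val f.
Proof. by []. Qed.
Lemma val_evenG1 : val (1 : E) = 1. Proof. by []. Qed.
Lemma gkillD (f g : gr) : gkill pair_at_a (f + g) = gkill pair_at_a f + gkill pair_at_a g.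
Proof. exact: rmorphD. Qed.
Lemma gkillM (f g : gr) : gkill pair_at_a (f * g) = gkill pair_at_a f * gkill pair_at_a g.
Proof. exact: rmorphM. Qed.
Lemma gkillN (f : gr) : gkill pair_at_a (- f) = - gkill pair_at_a f.
Proof. exact: rmorphN. Qed.
Lemma gkill1 : gkill pair_at_a (1 : gr) = 1. Proof. exact: rmorph1. Qed.
Lemma gkill_sum (J : Type) (r : seq J) (P : pred J) (F : J -> gr) :
  gkill pair_at_a (\sum_(j <- r | P j) F j) = \sum_(j <- r | P j) gkill pair_at_a (F j).
Proof. exact: rmorph_sum. Qed.

Lemma sqrt_jet (u : R) (v : E) : 0 < u -> ebody v = 0 -> v * v = 0 ->
  gapply1 Num.sqrt (val (evc G u + v)) =
  val (evc G (Num.sqrt u) + evc G (2 * Num.sqrt u)^-1 * v).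
Proof.
move=> u0 v0 vv; rewrite (gapply1_sqz Num.sqrt u card_fermion_gt0 v0 vv).
have -> // : derive1 Num.sqrt u = (2 * Num.sqrt u)^-1.
by rewrite derive1E; have H := is_derive1_sqrt u0; rewrite derive_val.
Qed.

Lemma gkill_z c i : gkill pair_at_a (z_ i c) = val (zE c i).
Proof.
transitivity (gkill pair_at_a (gapply1 Num.sqrt
  (1 + (c i).1%:A * (c i).1%:A + (c i).2%:A * (c i).2%:A
  - (gen R (inl i : G) * gen R (inr i : G)) *+ 2))); first by [].
rewrite gkill_apply -/(gapply1 _ _).
have -> : gkill pair_at_a (1 + (c i).1%:A * (c i).1%:A + (c i).2%:A * (c i).2%:A
  - (gen R (inl i : G) * gen R (inr i : G)) *+ 2)
  = val (evc G (1 + (c i).1 ^+ 2 + (c i).2 ^+ 2) + evc G (-2) * N i).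
  rewrite sz_arg.
  rewrite mulr2n gkillD gkillN !gkillD gkill_xi_eta !gkillM !gkillC gkill1.
  by rewrite !val_evenGD !val_evenGM !val_evenGN !val_evenGD val_evenG1 !val_evcE.
rewrite sqrt_jet.
- by rewrite /zE -/(z0 c i) (sz_sqrt (evc G) _ (z0_neq0 c i)).
- exact: z0_arg_gt0.
- by rewrite rmorphM/= ebody_bilp mulr0.
- by rewrite mulrACA bilp_sqr mulr0.
Qed.

(** In the superintegral the density [1 / z_i] stands outside [pin]. Away from [a], the form [z_i]
    contains no generator at [a], so it has the pinned value anyway. *)
Lemma z_notin c i : i != a -> z_ i c = val (zE c i).
Proof.
move=> ia.
have -> : z_ i c = gapply1 Num.sqrt
  (1 + (c i).1%:A * (c i).1%:A + (c i).2%:A * (c i).2%:A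
  - (gen R (inl i : G) * gen R (inr i : G)) *+ 2) by [].
have -> : 1 + (c i).1%:A * (c i).1%:A + (c i).2%:A * (c i).2%:A
  - (gen R (inl i : G) * gen R (inr i : G)) *+ 2
  = val (evc G (1 + (c i).1 ^+ 2 + (c i).2 ^+ 2) + evc G (-2) * N i).
  have -> : gen R (inl i : G) * gen R (inr i : G) = val (N i) by rewrite /bilp (negPf ia).
  rewrite sz_arg.
  by rewrite mulr2n !val_evenGD !val_evenGM !val_evenGN !val_evenGD val_evenG1 !val_evcE.
rewrite sqrt_jet.
- by rewrite /zE -/(z0 c i) (sz_sqrt (evc G) _ (z0_neq0 c i)).
- exact: z0_arg_gt0.
- by rewrite rmorphM/= ebody_bilp mulr0.
- by rewrite mulrACA bilp_sqr mulr0.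
Qed.

(** [zeta] and [nuE] are the body and the nilpotent part of the boosted [z_i]; [x0'] is the body of
    the boosted [x_i] and [m0] its coefficient of [N]. The boost depends on the site so that it can
    be switched off at one site at a time. *)
Definition zeta sigma c i : R := cosh (sigma i) * z0 c i + sinh (sigma i) * (c i).1.
Definition nuE sigma c i : E := evc G (- (cosh (sigma i) / z0 c i)) * N i.
Definition x0' sigma c i : R := cosh (sigma i) * (c i).1 + sinh (sigma i) * z0 c i.
Definition m0 sigma c i : R := - (sinh (sigma i) / z0 c i).
Definition XE sigma c i : E := evc G (x0' sigma c i) + evc G (m0 sigma c i) * N i.
Definition zinvE c i : E := evc G (z0 c i)^-1 + evc G ((z0 c i)^-1 ^+ 3) * N i.
(** The Jacobian of the boost: for fixed [N], the derivative of [XE] with respect to [x_i]. It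
    arises as the boosted [z_i] divided by [z_i], see [zinv_thz]. *)
Definition jacE sigma c i : E :=
  evc G (zeta sigma c i / z0 c i) + evc G (sinh (sigma i) * (c i).1 / z0 c i ^+ 3) * N i.

Lemma nuE_sqr sigma c i : nuE sigma c i * nuE sigma c i = 0.
Proof. by rewrite mulrACA bilp_sqr mulr0. Qed.
Lemma ebody_nuE sigma c i : ebody (nuE sigma c i) = 0.
Proof. by rewrite rmorphM/= ebody_bilp mulr0. Qed.

Lemma gkill_boost s c i :
  gkill pair_at_a (boost_z s i c) = val (evc G (zeta (fun=> s) c i) + nuE (fun=> s) c i).
Proof.
have -> : boost_z s i c = cosh s *: z_ i c + sinh s *: (c i).1%:A by [].
rewrite gkillD !gkillZ gkill_z gkill1.
rewrite /zeta /nuE sz_boost_z -/(zE c i).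
by rewrite [RHS]val_evenGD !val_evcM val_evcE.
Qed.

Definition udotE c i j : E := - (zE c i * zE c j) + evc G ((c i).1 * (c j).1 + (c i).2 * (c j).2)
  - bilp i j - bilp j i.

Lemma gkill_udot c i j : gkill pair_at_a (udot i j c) = val (udotE c i j).
Proof.
have -> : udot i j c = - (z_ i c * z_ j c) + (c i).1%:A * (c j).1%:A
  + (c i).2%:A * (c j).2%:A - gen R (inl i : G) * gen R (inr j : G)
  + gen R (inr i : G) * gen R (inl j : G) by [].
move: (gkill_z c i) (gkill_z c j); move: (z_ i c) (z_ j c) => zi zj hi hj.
rewrite 4!gkillD 2!gkillN gkill_xi_eta gkill_eta_xi 3!gkillM hi hj 4!gkillC.
rewrite /udotE sz_udot.
by move: (zE c i) (zE c j) (bilp i j) (bilp j i) => u v b b';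
  rewrite 4!val_evenGD 3!val_evenGN 3!val_evenGM 4!val_evcE.
Qed.

Variable beta : Lambda -> Lambda -> R.

Definition hamE c : E := evc G 2^-1 * \sum_i \sum_j evc G (beta i j) * (-1 - udotE c i j).

Lemma superform_sumE (J : Type) (r : seq J) (P : pred J) (F : J -> superform R Lambda) c :
  (\sum_(j <- r | P j) F j) c = \sum_(j <- r | P j) F j c.
Proof. by elim/big_rec2: _ => [//|j x y _ <-]. Qed.

Lemma superform_prodE (J : Type) (r : seq J) (P : pred J) (F : J -> superform R Lambda) c :
  (\prod_(j <- r | P j) F j) c = \prod_(j <- r | P j) F j c.
Proof. by elim/big_rec2: _ => [//|j x y _ <-]. Qed.

Lemma gkill_hamiltonian c : gkill pair_at_a (hamiltonian beta c) = val (hamE c).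
Proof.
have -> : hamiltonian beta c = 2^-1 *: (\sum_i \sum_j beta i j *: (-1 - udot i j) : superform R Lambda) c by [].
rewrite gkillZ superform_sumE gkill_sum val_evcM; congr (_ *: _).
rewrite val_evenG_sum; apply: eq_bigr => i _.
rewrite superform_sumE gkill_sum val_evenG_sum; apply: eq_bigr => j _.
have -> : (beta i j *: (-1 - udot i j) : superform R Lambda) c = beta i j *: (-1 - udot i j c) by [].
by rewrite gkillZ gkillD !gkillN gkill1 gkill_udot val_evcM val_evenGD !val_evenGN.
Qed.

Lemma gkill_exp_ham c :
  gkill pair_at_a (form_apply1 expR (- hamiltonian beta) c) = val (eexp (- hamE c)).
Proof.
have -> : form_apply1 expR (- hamiltonian beta) c = gapply1 expR (- hamiltonian beta c) by [].
rewrite gkill_apply -/(gapply1 _ _) gkillN gkill_hamiltonian -val_evenGN.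
exact: gapply1_exp.
Qed.

Lemma zinvEM c i : zE c i * zinvE c i = 1.
Proof.
exact: sz_zinv (z0_neq0 c i) (bilp_sqr i i).
Qed.

Lemma ebody_zE c i : ebody (zE c i) = z0 c i.
Proof. by rewrite rmorphB rmorphM/= ebody_bilp mulr0 subr0 ebodyC. Qed.

Lemma inv_prod_z c (A : {set Lambda}) : a \notin A ->
  form_apply1 GRing.inv (\prod_(i in A) z_ i) c = val (\prod_(i in A) zinvE c i).
Proof.
move=> aA.
have -> : form_apply1 GRing.inv (\prod_(i in A) z_ i) c
  = gapply1 GRing.inv ((\prod_(i in A) z_ i : superform R Lambda) c) by [].
rewrite superform_prodE.
have -> : \prod_(i in A) z_ i c = val (\prod_(i in A) zE c i).
  rewrite val_evenG_prod; apply: eq_bigr => i iA; apply: z_notin.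
  by apply: contraNneq aA => <-.
have bodyE : ebody (\prod_(i in A) zE c i) != 0.
  by rewrite rmorph_prod/= prodf_seq_neq0; apply/allP => i _; rewrite ebody_zE z0_neq0 implybT.
rewrite gapply1_inv//; congr (val _); apply: einv_uniq => //.
by rewrite -big_split/= big1// => i _; exact: zinvEM.
Qed.

Definition gd (f : gr) i : gr := gderiv (inr i : G) (gderiv (inl i : G) f).
(** The Berezin integral over the sites of [l], followed by setting the remaining generators to
    zero. *)
Definition ber (l : seq Lambda) (f : gr) : R := gbody (foldr (fun i f => gd f i) f l).

Lemma d_fermionsE (A : {set Lambda}) (F : superform R Lambda) c :
  d_fermions A F c = foldr (fun i f => gd f i) (F c) (enum A).
Proof. by rewrite /d_fermions; elim: (enum A) => [//|i l IH] /=; rewrite /d_eta /d_xi IH. Qed.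

Lemma gapply_form (I : finType) (g : (I -> R) -> R) (F : I -> superform R Lambda) c :
  form_apply g F c = gapply g (fun k => F k c).
Proof. by []. Qed.

Local Notation I := (~: [set a])%SET.

Definition conf (w : planes R #|I|) : config := update_config (fun=> (0, 0)) w.

Lemma conf_a w : conf w a = (0, 0).
Proof. by rewrite /conf /update_config !inE eqxx. Qed.

(** The configurations [conf w] already vanish at [a], so on them [pin] only sets generators to
    zero. That operation is a ring morphism, passes inside [form_apply], and turns the arguments
    into a body plus a square-zero part, where [gapply_jet] applies. *)
Theorem superexp_pinned_boost (g : (Lambda -> R) -> R) s :
  superexp_pinned beta a (form_apply g (boost_z s)) =
  ((2 * pi) ^+ #|I|)^-1 * \int[planes_lebesgue R #|I|]_w
    ber (enum I) (val (\prod_(i in I) zinvE (conf w) i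
      * jet (nuE (fun=> s) (conf w)) (zeta (fun=> s) (conf w)) (rev (enum Lambda)) g
      * eexp (- hamE (conf w)))).
Proof.
rewrite /superexp_pinned /body /superint ffunE; congr (_ * _).
apply: eq_Rintegral => w _; rewrite d_fermionsE -/(conf w).
rewrite -[LHS]/(ber (enum I) _); congr (ber _ _).
transitivity (form_apply1 GRing.inv (\prod_(i in I) z_ i : superform R Lambda) (conf w) *
   pin a (form_apply g (boost_z s) * form_apply1 expR (- hamiltonian beta)) (conf w)).
  by [].
rewrite inv_prod_z ?inE ?eqxx//.
have -> : pin a (form_apply g (boost_z s) * form_apply1 expR (- hamiltonian beta)) (conf w)
  = gkill pair_at_a (form_apply g (boost_z s) (conf w) * form_apply1 expR (- hamiltonian beta) (conf w)).
  rewrite /pin; apply/ffunP => S; rewrite !ffunE.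
  have -> : dfwith (conf w) a (0, 0) = conf w.
    by apply: funext => i; case: dfwithP => //; rewrite conf_a.
  rewrite disjoint_sym finset.disjoints_subset finset.subUset !finset.sub1set !inE.
  by case: (inl a \in S); case: (inr a \in S).
rewrite gkillM gkill_exp_ham gapply_form gkill_apply.
have -> : (fun k => gkill pair_at_a (boost_z s k (conf w))) =
  (fun k => val (evc G (zeta (fun=> s) (conf w) k) + nuE (fun=> s) (conf w) k)).
  by apply: funext => k; rewrite gkill_boost.
rewrite gapply_jet ?card_fermion_gt0//; last 2 first.
- by move=> i; exact: nuE_sqr.
- by move=> i; exact: ebody_nuE.
by rewrite -!val_evenGM mulrA.
Qed.

Variable H : Lambda -> Lambda -> R.

(** The exponent [q] at the boosted [z] minus the Hamiltonian ([total_exponent]), rewritten as a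
    quadratic expression in the boosted [x], in [y] and in the fermions. The expression makes sense
    for different boosts at different sites too, which is how the boost is undone. *)
Definition totE sigma c : E := - (evc G 2^-1 * \sum_i \sum_j evc G (H i j) *
  (1 + XE sigma c i * XE sigma c j + evc G ((c i).2 * (c j).2) - bilp i j - bilp j i)).

Definition quad (l : Lambda -> R) : R := - (2^-1 * \sum_i \sum_j H i j * (l i * l j)).

Lemma cosh2_sinh2 (t : R) : cosh t ^+ 2 - sinh t ^+ 2 = 1.
Proof.
rewrite /cosh /sinh; have := expRxMexpNx_1 t; move: (expR t) (expR (- t)) => u v.
by move=> uv; rewrite -[RHS]uv; field.
Qed.

Lemma zEE c i : zE c i * zE c i = evc G (1 + (c i).1 ^+ 2 + (c i).2 ^+ 2) - N i *+ 2.
Proof.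
exact: sz_zsqr (z0_neq0 c i) (bilp_sqr i i) (z0_sqr c i).
Qed.

Definition thzE sigma c i : E := evc G (zeta sigma c i) + nuE sigma c i.

Lemma thzE_boost sigma c i : thzE sigma c i =
  evc G (cosh (sigma i)) * zE c i + evc G (sinh (sigma i)) * evc G (c i).1.
Proof. exact: sz_boost_z. Qed.

Lemma XE_boost sigma c i : XE sigma c i =
  evc G (cosh (sigma i)) * evc G (c i).1 + evc G (sinh (sigma i)) * zE c i.
Proof. exact: sz_boost_x. Qed.

Lemma evc_cosh2 (t : R) : evc G (cosh t) ^+ 2 = 1 + evc G (sinh t) ^+ 2.
Proof.
exact: sz_cosh2 (cosh2_sinh2 t).
Qed.

Lemma thzE_pair s c i j : thzE (fun=> s) c i * thzE (fun=> s) c j - zE c i * zE c j =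
  XE (fun=> s) c i * XE (fun=> s) c j - evc G ((c i).1 * (c j).1).
Proof.
rewrite !thzE_boost !XE_boost; exact: sz_pair (evc_cosh2 s).
Qed.

Lemma thzE_sqr s c i : thzE (fun=> s) c i * thzE (fun=> s) c i =
  1 + XE (fun=> s) c i * XE (fun=> s) c i + evc G ((c i).2 * (c i).2) - bilp i i - bilp i i.
Proof.
have := thzE_pair s c i i; rewrite zEE => /eqP; rewrite subr_eq => /eqP ->.
exact: sz_sqr.
Qed.

(** With one and the same boost at all sites, [thzE_pair] trades the products of boosted [z] for
    those of [z], which cancel off the diagonal since [H = - beta] there. On the diagonal the
    Hamiltonian vanishes because [u_i . u_i = -1], and the square of the boosted [z_i] is given by
    [thzE_sqr]. *)
Lemma total_exponent s c : (forall i j, i != j -> H i j = - beta i j) -> c a = (0, 0) ->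
  - (evc G 2^-1 * \sum_i \sum_j evc G (H i j) * (thzE (fun=> s) c i * thzE (fun=> s) c j))
   - hamE c = totE (fun=> s) c.
Proof.
move=> Hbeta ca.
rewrite /hamE /totE -opprD -mulrDr -big_split/=; congr (- (_ * _)).
apply: eq_bigr => i _; rewrite -big_split/=; apply: eq_bigr => j _.
have [<-|ij] := eqVneq i j.
  have -> : -1 - udotE c i i = 0.
    by rewrite /udotE zEE; exact: sz_udot_diag.
  by rewrite mulr0 addr0 thzE_sqr.
rewrite Hbeta// /udotE.
have := thzE_pair s c i j => /eqP; rewrite subr_eq => /eqP ->.
exact: sz_offdiag.
Qed.

Lemma zinv_thz c i s : zinvE c i * thzE (fun=> s) c i = jacE (fun=> s) c i.
Proof.
exact: sz_jac (z0_neq0 c i) (bilp_sqr i i).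
Qed.

End Pinned.

(** * Gaussian superintegrals *)

Section SchurElimination.
Variables (R : realFieldType) (Lambda : eqType).
Implicit Types (H : Lambda -> Lambda -> R) (s : seq Lambda) (i j k : Lambda).

Definition schur i H j k := H j k - H j i * H i k / H i i.

(** The determinant of [H] restricted to [s], as the product of the pivots of Gaussian elimination.
    The bosonic and the fermionic integral are both computed by this elimination, so that the two
    factors have literally the same form. *)
Fixpoint detl s H : R := if s is i :: s' then H i i * detl s' (schur i H) else 1.

Definition qform s H (x : Lambda -> R) := \sum_(j <- s) \sum_(k <- s) H j k * (x j * x k).

Definition posdef s H := forall x, (exists2 i, i \in s & x i != 0) -> 0 < qform s H x.

(** Completion of the square in the variable [x i]. *)
Lemma qform_schur i s H x : (forall j k, H j k = H k j) -> H i i != 0 ->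
  qform (i :: s) H x = H i i * (x i + \sum_(k <- s) H i k / H i i * x k) ^+ 2 + qform s (schur i H) x.
Proof.
move=> Hs Hi; rewrite /qform big_cons big_cons.
have -> : \sum_(j <- s) \sum_(k <- i :: s) H j k * (x j * x k) =
  x i * (\sum_(k <- s) H i k * x k) + \sum_(j <- s) \sum_(k <- s) H j k * (x j * x k).
  rewrite mulr_sumr -big_split/=; apply: eq_bigr => j _; rewrite big_cons Hs; congr (_ + _); ring.
have -> : \sum_(k <- s) H i k * (x i * x k) = x i * (\sum_(k <- s) H i k * x k).
  by rewrite mulr_sumr; apply: eq_bigr => k _; ring.
have -> : \sum_(k <- s) H i k / H i i * x k = (H i i)^-1 * (\sum_(k <- s) H i k * x k).
  by rewrite mulr_sumr; apply: eq_bigr => k _; ring.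
have -> : \sum_(j <- s) \sum_(k <- s) schur i H j k * (x j * x k) =
  \sum_(j <- s) \sum_(k <- s) H j k * (x j * x k) - (H i i)^-1 * (\sum_(k <- s) H i k * x k) ^+ 2.
  rewrite expr2 mulr_suml mulr_sumr -sumrB; apply: eq_bigr => j _.
  rewrite mulr_sumr mulr_sumr -sumrB; apply: eq_bigr => k _.
  by rewrite /schur (Hs j i); ring.
by set S := \sum_(k <- s) _; set T := \sum_(k <- s) _; field.
Qed.

Lemma posdef_pivot i s H : uniq (i :: s) -> posdef (i :: s) H -> 0 < H i i.
Proof.
move=> /= /andP[is_ _] pd; have := pd (fun j => (j == i)%:R).
rewrite /qform !big_cons big1_seq => [|k /andP[_ ks]]; last first.
  by rewrite (_ : (k == i) = false) ?mulr0//; apply: contraNF is_ => /eqP <-.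
rewrite big1_seq => [|j /andP[_ js]]; last first.
  rewrite (_ : (j == i) = false) ?mulr0//; first by rewrite big1 // => k _; rewrite mul0r mulr0.
  by apply: contraNF is_ => /eqP <-.
rewrite eqxx !mulr1 !addr0; apply; exists i; first by rewrite mem_head.
by rewrite eqxx oner_neq0.
Qed.

Lemma schur_sym i H : (forall j k, H j k = H k j) -> forall j k, schur i H j k = schur i H k j.
Proof. by move=> Hs j k; rewrite /schur (Hs j k) (Hs j i) (Hs i k); ring. Qed.

(** Given [x] on [s], the coordinate at [i] is chosen so that the completed square of [qform_schur]
    vanishes. *)
Lemma posdef_schur i s H : (forall j k, H j k = H k j) -> uniq (i :: s) ->
  posdef (i :: s) H -> posdef s (schur i H).
Proof.
move=> Hs us pd x [j js xj]; have Hi := posdef_pivot us pd.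
pose c := \sum_(k <- s) H i k / H i i * x k.
pose y k := if k == i then - c else x k.
have is_ : i \notin s by case/andP: us.
have yE k : k \in s -> y k = x k.
  by move=> ks; rewrite /y; case: eqP => // ki; rewrite -ki ks in is_.
have := pd y; rewrite (qform_schur _ _ Hs) ?gt_eqF//.
have -> : \sum_(k <- s) H i k / H i i * y k = c by apply: eq_big_seq => k ks; rewrite yE.
have -> : qform s (schur i H) y = qform s (schur i H) x.
  by apply: eq_big_seq => k ks; apply: eq_big_seq => l ls; rewrite !yE.
have yi : y i = - c by rewrite /y eqxx.
rewrite yi addNr expr0n/= mulr0 add0r; apply.
by exists j; [rewrite inE js orbT|rewrite yE].
Qed.

Lemma detl_gt0 s H : (forall j k, H j k = H k j) -> uniq s -> posdef s H -> 0 < detl s H.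
Proof.
elim: s H => [//|i s IH] H Hs us pd /=.
rewrite mulr_gt0 ?(posdef_pivot us pd)// IH//; first exact: schur_sym.
  by case/andP: us.
exact: posdef_schur.
Qed.

End SchurElimination.

(** * Fermionic Gaussian integrals *)

Section BerezinGaussian.
Variables (R : realType) (Lambda : finType).
Local Notation G := (fermion Lambda).
Local Notation gr := (grassmann R G).
Local Notation E := (evenG R G).
Implicit Types (i j k : Lambda) (s : seq Lambda) (f g : gr).

Lemma gdC f i j : gd (gd f i) j = gd (gd f j) i.
Proof.
rewrite /gd [gderiv (inl j) (gderiv (inr i) _)]gderiv_anticomm.
rewrite [gderiv (inl j) (gderiv (inl i) _)]gderiv_anticomm.
have gN (p : G) f' : gderiv p (- f') = - gderiv p f' by rewrite -scaleN1r gderivZ scaleN1r.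
rewrite !gN opprK [gderiv (inr j) _]gderiv_anticomm.
by rewrite [gderiv (inr j) (gderiv (inl i) _)]gderiv_anticomm !gN opprK.
Qed.

Lemma gdD f g i : gd (f + g) i = gd f i + gd g i.
Proof. by rewrite /gd !gderivD. Qed.
Lemma gdZ (c : R) f i : gd (c *: f) i = c *: gd f i.
Proof. by rewrite /gd !gderivZ. Qed.

(** The pairs of derivatives [gd] at two sites commute, so the head may be integrated first. *)
Lemma ber_cons i s f : ber (i :: s) f = ber s (gd f i).
Proof.
rewrite /ber /=; congr (gbody _); elim: s f => [//|j s IH] f /=.
by rewrite -IH gdC.
Qed.

Lemma berD s f g : ber s (f + g) = ber s f + ber s g.
Proof.
elim: s f g => [|i s IH] f g; first by rewrite /ber rmorphD.
by rewrite !ber_cons gdD IH.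
Qed.

Lemma berZ s (c : R) f : ber s (c *: f) = c * ber s f.
Proof.
elim: s f => [|i s IH] f; first by rewrite /ber gbodyZ.
by rewrite !ber_cons gdZ IH.
Qed.

Lemma ber0 s : ber s (0 : gr) = 0.
Proof. by rewrite -(scale0r (0 : gr)) berZ mul0r. Qed.

Lemma ber_sum s (J : Type) (r : seq J) (P : pred J) (F : J -> gr) :
  ber s (\sum_(j <- r | P j) F j) = \sum_(j <- r | P j) ber s (F j).
Proof. by apply: (big_morph _ (berD s) (ber0 s)). Qed.

Lemma gfreeE_evc p (c : R) (f : E) : gfree p (val f) -> gfree p (val (evc G c * f)).
Proof. by rewrite val_evcM; exact: gfreeZ. Qed.

Lemma gfree_evc p (c : R) : gfree p (val (evc G c)).
Proof. exact/gfreeZ/gfree1. Qed.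

Lemma gfree_eexp p (f : E) : gfree p (val f) -> gfree p (val (eexp f)).
Proof.
move=> fp; apply: gfreeE_evc; rewrite val_evenG_sum; apply: gfree_sum => k _.
apply: gfreeE_evc; rewrite val_evenGX; apply: gfreeX.
by rewrite val_evenGD; apply: gfreeD => //; apply: gfreeN; exact: gfree_evc.
Qed.

Definition bilsum s (H : Lambda -> Lambda -> R) : E :=
  \sum_(j <- s) \sum_(k <- s) evc G (H j k) * bil R j k.

Definition linl s (c : Lambda -> R) : gr := \sum_(j <- s) c j *: gen R (inl j : G).
Definition linr s (c : Lambda -> R) : gr := \sum_(j <- s) c j *: gen R (inr j : G).

Lemma lin_anticomm (p : G) (J : Type) (r : seq J) (P : J -> G) (c : J -> R) :
  gen R p * (\sum_(j <- r) c j *: gen R (P j)) = - ((\sum_(j <- r) c j *: gen R (P j)) * gen R p).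
Proof.
rewrite mulr_sumr mulr_suml -sumrN; apply: eq_bigr => j _.
by rewrite -scalerAr -scalerAl gen_anticomm scalerN.
Qed.

Lemma lin_sqr0 (J : Type) (r : seq J) (P : J -> G) (c : J -> R) :
  (\sum_(j <- r) c j *: gen R (P j)) * (\sum_(j <- r) c j *: gen R (P j)) = 0 :> gr.
Proof.
elim: r => [|j r IH]; first by rewrite big_nil mul0r.
rewrite big_cons mulrDl !mulrDr IH addr0 -scalerAl -scalerAr gen_sqr !scaler0 add0r.
by rewrite -scalerAl lin_anticomm -scalerAr scalerN addNr.
Qed.

Lemma linl_linr s (c d : Lambda -> R) :
  linl s c * linr s d = val (\sum_(j <- s) \sum_(k <- s) evc G (c j * d k) * bil R j k).
Proof.
rewrite /linl /linr mulr_suml val_evenG_sum; apply: eq_bigr => j _.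
rewrite mulr_sumr val_evenG_sum; apply: eq_bigr => k _.
by rewrite val_evcM -scalerAl -scalerAr scalerA.
Qed.

Lemma linr_linl s (c d : Lambda -> R) : linr s d * linl s c = - (linl s c * linr s d).
Proof.
rewrite {1}/linr mulr_suml /linr mulr_sumr -sumrN; apply: eq_bigr => j _.
rewrite -scalerAl -scalerAr.
by rewrite /linl lin_anticomm scalerN.
Qed.

Lemma bilsum_cons_schur i s (H : Lambda -> Lambda -> R) : H i i != 0 ->
  bilsum (i :: s) (schur i H) = bilsum s (schur i H).
Proof.
move=> Hi; have row0 k : schur i H i k = 0 by rewrite /schur; field.
have col0 k : schur i H k i = 0 by rewrite /schur; field.
rewrite /bilsum big_cons big1 ?add0r => [|k _]; last by rewrite row0 rmorph0 mul0r.
by apply: eq_bigr => j _; rewrite big_cons col0 rmorph0 mul0r add0r.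
Qed.

(** The fermionic completion of the square: what is split off is of rank one, hence a product of two
    linear forms ([linl_linr]). *)
Lemma bilsum_schur i s (H : Lambda -> Lambda -> R) : H i i != 0 ->
  bilsum (i :: s) H = evc G (H i i) *
    (\sum_(j <- i :: s) \sum_(k <- i :: s) evc G (H j i / H i i * (H i k / H i i)) * bil R j k)
  + bilsum s (schur i H).
Proof.
move=> Hi; rewrite -(bilsum_cons_schur s Hi) /bilsum mulr_sumr -big_split/=.
apply: eq_bigr => j _; rewrite mulr_sumr -big_split/=; apply: eq_bigr => k _.
rewrite mulrA -rmorphM -mulrDl -rmorphD; congr (evc G _ * _).
by rewrite /schur; field.
Qed.

Lemma gfree_bilsum i s H : i \notin s ->
  gfree (inl i : G) (val (bilsum s H)) /\ gfree (inr i : G) (val (bilsum s H)).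
Proof.
move=> is_; split; rewrite val_evenG_sum big_seq; apply: gfree_sum => j js;
  rewrite val_evenG_sum big_seq; apply: gfree_sum => k ks; apply: gfreeE_evc;
  apply: gfreeM; apply: gfree_gen => //; apply/eqP => -[] E; by rewrite E ?js ?ks in is_.
Qed.

Lemma gderiv_lin_head (p : G) s (P : Lambda -> G) (c : Lambda -> R) i (f : gr) :
  injective P -> i \notin s -> p = P i -> c i = 1 -> gfree p f ->
  gderiv p ((\sum_(j <- i :: s) c j *: gen R (P j)) * f) = f.
Proof.
move=> injP is_ -> ci fp; rewrite big_cons ci scale1r mulrDl gderivD gderiv_genM eqxx scale1r.
rewrite (gfree_deriv fp) mulr0 subr0 gfree_deriv ?addr0//.
apply: gfreeM => //; rewrite big_seq; apply: gfree_sum => j js.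
apply/gfreeZ/gfree_gen; rewrite inj_eq//.
by apply: contraNneq is_ => ->.
Qed.

(** By [bilsum_schur] the exponent is [H i i * M] plus a Schur complement free of the generators at
    [i]. Being a product of a linear form in the [xi] and one in the [eta], [M] has square zero, so
    its exponential is [1 + H i i * M]. The two derivatives remove the two linear factors, whose
    coefficients at [i] are 1. *)
Lemma gd_exp_bilsum i s H : i \notin s -> H i i != 0 ->
  gd (val (eexp (bilsum (i :: s) H))) i = H i i *: val (eexp (bilsum s (schur i H))).
Proof.
move=> is_ Hi; rewrite bilsum_schur// eexpD.
set M := (\sum_(j <- i :: s) _); set W := eexp (bilsum s _).
pose c j := H j i / H i i; pose d k := H i k / H i i.
have valM : val M = linl (i :: s) c * linr (i :: s) d by rewrite linl_linr.
have M0 : ebody M = 0.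
  rewrite /M rmorph_sum big1// => j _; rewrite rmorph_sum big1// => k _.
  rewrite rmorphM/=; suff -> : ebody (bil R j k) = 0 by rewrite mulr0.
  by rewrite /ebody/= gbodyM /gbody ffunE eq_sym -cards_eq0 cards1 mul0r.
have MM : M * M = 0.
  apply: val_inj; rewrite val_evenGM valM.
  rewrite -mulrA [linr _ _ * _]mulrA linr_linl mulNr mulrN !mulrA.
  by rewrite [linl _ _ * linl _ _]lin_sqr0 !mul0r oppr0.
have -> : eexp (evc G (H i i) * M) = 1 + evc G (H i i) * M.
  apply: eexp_sqz; first by rewrite rmorphM/= M0 mulr0.
  by rewrite mulrACA MM mulr0.
have [bl br] := gfree_bilsum (schur i H) is_.
have Wl : gfree (inl i : G) (val W) by exact: gfree_eexp.
have Wr : gfree (inr i : G) (val W) by exact: gfree_eexp.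
clearbody W M.
rewrite mulrDl mul1r -mulrA val_evenGD val_evcM gdD gdZ.
have -> : gd (val W) i = 0.
  by rewrite /gd (gfree_deriv Wl) gfree_deriv//; exact: gfree0.
rewrite add0r; congr (_ *: _).
rewrite val_evenGM valM -mulrA /gd.
have gl : gfree (inl i : G) (linr (i :: s) d * val W).
  by apply: gfreeM => //; apply: gfree_sum => j _; apply/gfreeZ/gfree_gen.
rewrite (gderiv_lin_head (P := fun j => inl j : G) (i := i)) ?/c ?divff//; last first.
  by move=> x y [].
by rewrite (gderiv_lin_head (P := fun j => inr j : G) (i := i)) ?/d ?divff// => x y [].
Qed.

Theorem ber_exp_bilsum s H : (forall j k, H j k = H k j) -> uniq s -> posdef s H ->
  ber s (val (eexp (bilsum s H))) = detl s H.
Proof.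
elim: s H => [|i s IH] H Hs us pd.
  rewrite /bilsum big_nil -(rmorph0 (evc G)) eexpC.
  by rewrite -[LHS]/(ebody (evc G (expR 0))) ebodyC expR0.
have Hi : H i i != 0 by rewrite gt_eqF// (posdef_pivot us pd).
have /andP[is_ us'] := us.
rewrite ber_cons gd_exp_bilsum// berZ IH//; first exact: schur_sym.
exact: posdef_schur.
Qed.

End BerezinGaussian.

(** * Gaussian integrals and partial integration over products of planes *)

Section PlanesIntegration.
Variable R : realType.
Local Notation mu := (@lebesgue_measure R).
Local Notation plane := (measurableTypeR R * measurableTypeR R)%type.
Implicit Types (n k : nat).

Lemma measurable_coord n k :
  measurable_fun setT (fun w : planes R n => (planes_coord w k).1 : measurableTypeR R) /\
  measurable_fun setT (fun w : planes R n => (planes_coord w k).2 : measurableTypeR R).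
Proof.
elim: n k => [|n IH] [|k] /=; try by split; exact: measurable_cst.
  split.
    exact: (measurableT_comp measurable_fst (@measurable_fst _ _ plane (planes R n))).
  exact: (measurableT_comp measurable_snd (@measurable_fst _ _ plane (planes R n))).
have [H1 H2] := IH k; split.
  exact: (measurableT_comp H1 (@measurable_snd _ _ plane (planes R n))).
exact: (measurableT_comp H2 (@measurable_snd _ _ plane (planes R n))).
Qed.

Lemma integral_gauss1 (h c : R) : 0 < h ->
  (\int[mu]_x (expR (- (2^-1 * (h * (x + c) ^+ 2))))%:E = (Num.sqrt (2 * pi / h))%:E)%E.
Proof.
(* The standard deviation for which the normal density is proportional to the integrand. *)
move=> h0; pose sg := (Num.sqrt h)^-1 : R.
have sh : Num.sqrt h != 0 by rewrite gt_eqF// sqrtr_gt0.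
have sg0 : sg != 0 by rewrite invr_eq0.
have sg2 : sg ^+ 2 = h^-1 by rewrite exprVn sqr_sqrtr// ltW.
have /(congr1 (fun e => (Num.sqrt (2 * pi / h))%:E * e)%E) := integral_normal_pdf (- c) sg.
rewrite mule1 => <-.
have peak : Num.sqrt (2 * pi / h) * normal_peak sg = 1.
  rewrite /normal_peak sg2.
  have -> : h^-1 * pi *+ 2 = 2 * pi / h by rewrite -mulr_natr; ring.
  by rewrite divff// gt_eqF// sqrtr_gt0 divr_gt0// mulr_gt0// pi_gt0.
have mn : measurable_fun setT (fun x : R => (normal_pdf (- c) sg x)%:E).
  by apply/measurable_EFinP; exact: measurable_normal_pdf.
have n0 (x : R) : setT x -> (0 <= (normal_pdf (- c) sg x)%:E)%E.
  by move=> _; rewrite lee_fin normal_pdf_ge0.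
rewrite -ge0_integralZl ?lee_fin ?sqrtr_ge0//.
apply: eq_integral => x _; rewrite -EFinM; congr (_%:E).
rewrite /normal_pdf (negPf sg0) [RHS]mulrA peak mul1r /normal_fun sg2 opprK.
have h00 : h != 0 by rewrite gt_eqF.
by congr expR; field.
Qed.

Lemma planes_tonelli n (F : planes R n.+1 -> R) : measurable_fun setT F -> (forall w, 0 <= F w) ->
  (\int[planes_lebesgue R n.+1]_w (F w)%:E =
   \int[planes_lebesgue R n]_w \int[plane_lebesgue R]_p (F (p, w))%:E)%E.
Proof.
move=> mF F0.
have mF' : measurable_fun setT (fun w => (F w)%:E) by exact/measurable_EFinP.
transitivity (\int[(plane_lebesgue R \x planes_lebesgue R n)%E]_w (F w)%:E)%E; first by [].
have F0' w : (0 <= (F w)%:E)%E by rewrite lee_fin.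
by rewrite fubini_tonelli1// fubini_tonelli.
Qed.

Lemma plane_tonelli (F : plane -> R) : measurable_fun setT F -> (forall w, 0 <= F w) ->
  (\int[plane_lebesgue R]_w (F w)%:E = \int[mu]_x \int[mu]_y (F (x, y))%:E)%E.
Proof.
move=> mF F0.
have mF' : measurable_fun setT (fun w => (F w)%:E) by exact/measurable_EFinP.
transitivity (\int[(mu \x mu)%E]_w (F w)%:E)%E; first by [].
have F0' w : (0 <= (F w)%:E)%E by rewrite lee_fin.
by rewrite fubini_tonelli1.
Qed.

Lemma plane_gauss (h c d : R) : 0 < h ->
  (\int[plane_lebesgue R]_p (expR (- (2^-1 * (h * (p.1 + c) ^+ 2)))
     * expR (- (2^-1 * (h * (p.2 + d) ^+ 2))))%:E = (2 * pi / h)%:E)%E.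
Proof.
move=> h0.
have mg (e : R) : measurable_fun setT (fun x : R => expR (- (2^-1 * (h * (x + e) ^+ 2)))).
  apply: measurableT_comp => //; apply: measurable_funN; apply: measurable_funM => //.
  by apply: measurable_funM => //; apply: measurable_funX; apply: measurable_funD.
rewrite (@plane_tonelli (fun p => expR (- (2^-1 * (h * (p.1 + c) ^+ 2)))
     * expR (- (2^-1 * (h * (p.2 + d) ^+ 2))))); last 2 first.
- apply: measurable_funM.
    exact: (measurableT_comp (mg c) measurable_fst).
  exact: (measurableT_comp (mg d) measurable_snd).
- by move=> p; rewrite mulr_ge0// expR_ge0.
transitivity (\int[mu]_x ((expR (- (2^-1 * (h * (x + c) ^+ 2))))%:E * (Num.sqrt (2 * pi / h))%:E))%E.
  apply: eq_integral => x _ /=.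
  have g0 (y : R) : setT y -> (0 <= (expR (- (2^-1 * (h * (y + d) ^+ 2))))%:E)%E.
    by move=> _; rewrite lee_fin expR_ge0.
  have gm : measurable_fun setT (fun y : R => (expR (- (2^-1 * (h * (y + d) ^+ 2))))%:E).
    exact/measurable_EFinP.
  rewrite -(integral_gauss1 d h0) -ge0_integralZl ?lee_fin ?expR_ge0//.
have g0 (y : R) : setT y -> (0 <= (expR (- (2^-1 * (h * (y + c) ^+ 2))))%:E)%E.
  by move=> _; rewrite lee_fin expR_ge0.
have gm : measurable_fun setT (fun y : R => (expR (- (2^-1 * (h * (y + c) ^+ 2))))%:E).
  exact/measurable_EFinP.
rewrite ge0_integralZr ?lee_fin ?sqrtr_ge0// integral_gauss1// -EFinM -expr2 sqr_sqrtr//.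
by rewrite divr_ge0// ?mulr_ge0 ?pi_ge0// ltW.
Qed.

Section Gaussian.
Variable Lambda : eqType.
Implicit Types (s : seq Lambda) (H : Lambda -> Lambda -> R) (v : Lambda -> R).

Definition xs s (w : planes R (size s)) (j : Lambda) : R := (planes_coord w (index j s)).1.
Definition ys s (w : planes R (size s)) (j : Lambda) : R := (planes_coord w (index j s)).2.

Lemma measurable_xs s j : measurable_fun setT (fun w : planes R (size s) => xs w j).
Proof. exact: (measurable_coord _ _).1. Qed.
Lemma measurable_ys s j : measurable_fun setT (fun w : planes R (size s) => ys w j).
Proof. exact: (measurable_coord _ _).2. Qed.

Lemma measurable_qform s H (f : forall s, planes R (size s) -> Lambda -> R) v :
  (forall j, measurable_fun setT (fun w : planes R (size s) => f s w j)) ->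
  measurable_fun setT (fun w : planes R (size s) => qform s H (fun j => f s w j + v j)).
Proof.
move=> mf; rewrite /qform; apply: measurable_sum => j; apply: measurable_sum => k.
apply: measurable_funM => //; apply: measurable_funM; exact: measurable_funD.
Qed.

(** One site is integrated at a time. By [qform_schur] the plane at [i] enters through two completed
    squares, centred at points that depend on the other sites, and contributes [2 * pi / H i i]
    wherever these are; the Schur complement remains. The shift [v] acts on the x-coordinates only,
    where the boost at the root will produce it. *)
Theorem integral_gaussian s H v : (forall j k : Lambda, H j k = H k j) -> uniq s -> posdef s H ->
  (\int[planes_lebesgue R (size s)]_w
     (expR (- (2^-1 * (qform s H (fun j => xs w j + v j) + qform s H (ys w)))))%:E
   = ((2 * pi) ^+ size s / detl s H)%:E)%E.
Proof.
elim: s H => [|i s IH] H Hs us pd.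
  transitivity (\int[dirac (tt : unit)]_w (1%R : R)%:E)%E.
    by apply: eq_integral => w _; rewrite /qform !big_nil addr0 mulr0 oppr0 expR0.
  by rewrite integral_cst//= diracT mule1 expr0 divr1.
have Hi := posdef_pivot us pd.
have /andP[is_ us'] := us.
have mqx : measurable_fun setT (fun w : planes R (size (i :: s)) => qform (i :: s) H (fun j => xs w j + v j)).
  by apply: (@measurable_qform _ _ xs) => j; exact: measurable_xs.
have mqy : measurable_fun setT (fun w : planes R (size (i :: s)) => qform (i :: s) H (ys w)).
  have := @measurable_qform (i :: s) H ys (fun=> 0) (@measurable_ys _).
  by congr (measurable_fun _ _); apply: funext => w; congr qform; apply: funext => j; rewrite addr0.
rewrite [size _]/=.
rewrite (@planes_tonelli (size s) (fun w : planes R (size (i :: s)) =>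
  expR (- (2^-1 * (qform (i :: s) H (fun j => xs w j + v j) + qform (i :: s) H (ys w)))))); last 2 first.
- apply: measurableT_comp => //; apply: measurable_funN; apply: measurable_funM => //.
  exact: measurable_funD.
- by move=> w; rewrite expR_ge0.
have xsi (p : plane) (w : planes R (size s)) : @xs (i :: s) (p, w) i = p.1.
  by rewrite /xs /= eqxx.
have ysi (p : plane) (w : planes R (size s)) : @ys (i :: s) (p, w) i = p.2.
  by rewrite /ys /= eqxx.
have xsj (p : plane) (w : planes R (size s)) j : j \in s -> @xs (i :: s) (p, w) j = xs w j.
  by move=> js; rewrite /xs /= ifN//; apply: contraNneq is_ => ->.
have ysj (p : plane) (w : planes R (size s)) j : j \in s -> @ys (i :: s) (p, w) j = ys w j.
  by move=> js; rewrite /ys /= ifN//; apply: contraNneq is_ => ->.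
transitivity (\int[planes_lebesgue R (size s)]_w
   ((expR (- (2^-1 * (qform s (schur i H) (fun j => xs w j + v j) + qform s (schur i H) (ys w)))))%:E
    * (2 * pi / H i i)%:E))%E.
  apply: eq_integral => w _.
  set c := v i + \sum_(k <- s) H i k / H i i * (xs w k + v k).
  set d := \sum_(k <- s) H i k / H i i * (ys w k).
  have g0 (p : plane) : setT p -> (0 <= (expR (- (2^-1 * (H i i * (p.1 + c) ^+ 2)))
     * expR (- (2^-1 * (H i i * (p.2 + d) ^+ 2))))%:E)%E.
    by move=> _; rewrite lee_fin mulr_ge0// expR_ge0.
  have gm : measurable_fun setT (fun p : plane => (expR (- (2^-1 * (H i i * (p.1 + c) ^+ 2)))
     * expR (- (2^-1 * (H i i * (p.2 + d) ^+ 2))))%:E).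
    have mg (e : R) : measurable_fun setT (fun x : R => expR (- (2^-1 * (H i i * (x + e) ^+ 2)))).
      apply: measurableT_comp => //; apply: measurable_funN; apply: measurable_funM => //.
      by apply: measurable_funM => //; apply: measurable_funX; apply: measurable_funD.
    apply/measurable_EFinP; apply: measurable_funM.
      exact: (measurableT_comp (mg c) measurable_fst).
    exact: (measurableT_comp (mg d) measurable_snd).
  rewrite -(plane_gauss c d Hi) -ge0_integralZl ?lee_fin ?expR_ge0//.
  apply: eq_integral => p _; rewrite -EFinM -!expRD; congr (expR _)%:E.
  rewrite !(qform_schur _ _ Hs) ?gt_eqF// xsi ysi.
  have -> : \sum_(k <- s) H i k / H i i * (@xs (i :: s) (p, w) k + v k) =
    \sum_(k <- s) H i k / H i i * (xs w k + v k).
    by apply: eq_big_seq => k ks; rewrite xsj.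
  have -> : \sum_(k <- s) H i k / H i i * @ys (i :: s) (p, w) k = d.
    by apply: eq_big_seq => k ks; rewrite ysj.
  have -> : qform s (schur i H) (fun j => @xs (i :: s) (p, w) j + v j) =
    qform s (schur i H) (fun j => xs w j + v j).
    by apply: eq_big_seq => k ks; apply: eq_big_seq => l ls; rewrite !xsj.
  have -> : qform s (schur i H) (@ys (i :: s) (p, w)) = qform s (schur i H) (ys w).
    by apply: eq_big_seq => k ks; apply: eq_big_seq => l ls; rewrite !ysj.
  by rewrite /c; ring.
have gm : measurable_fun setT (fun w : planes R (size s) => (expR (- (2^-1 *
   (qform s (schur i H) (fun j => xs w j + v j) + qform s (schur i H) (ys w)))))%:E).
  apply/measurable_EFinP; apply: measurableT_comp => //; apply: measurable_funN; apply: measurable_funM => //.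
  apply: measurable_funD; first by apply: (@measurable_qform _ _ xs) => j; exact: measurable_xs.
  have := @measurable_qform s (schur i H) ys (fun=> 0) (@measurable_ys _).
  by congr (measurable_fun _ _); apply: funext => w; congr qform; apply: funext => j; rewrite addr0.
have g0 (w : planes R (size s)) : setT w -> (0 <= (expR (- (2^-1 *
   (qform s (schur i H) (fun j => xs w j + v j) + qform s (schur i H) (ys w)))))%:E)%E.
  by move=> _; rewrite lee_fin expR_ge0.
have p0 : (0 <= (2 * pi / H i i)%:E)%E by rewrite lee_fin divr_ge0// ?mulr_ge0 ?pi_ge0// ltW.
rewrite ge0_integralZr// IH//; [|exact: schur_sym|exact: posdef_schur].
rewrite -EFinM; congr (_%:E); rewrite /= exprS.
have := detl_gt0 (schur_sym i Hs) us' (posdef_schur Hs us pd) => dp.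
by field; rewrite !gt_eqF.
Qed.

Corollary integral_gaussian_planes n s H v : size s = n ->
  (forall j k : Lambda, H j k = H k j) -> uniq s -> posdef s H ->
  (\int[planes_lebesgue R n]_w
     (expR (- (2^-1 * (qform s H (fun j => (planes_coord w (index j s)).1 + v j)
       + qform s H (fun j => (planes_coord w (index j s)).2)))))%:E
   = ((2 * pi) ^+ n / detl s H)%:E)%E.
Proof. by move=> <-; exact: integral_gaussian. Qed.

End Gaussian.

Definition scons (p : R * R) (c : nat -> R * R) : nat -> R * R :=
  fun l => if l is l'.+1 then c l' else p.

Definition setx (c : nat -> R * R) (k : nat) (x : R) : nat -> R * R :=
  fun l => if l == k then (x, (c k).2) else c l.

Lemma planes_coord_scons n (p : plane) (w : planes R n) :
  planes_coord ((p, w) : planes R n.+1) = scons p (planes_coord w).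
Proof. by apply: funext => -[|k]. Qed.

(** Fubini, with the x-coordinate of the plane number [k] integrated first. [F] is taken on all
    sequences, and the hypothesis is about every sequence [c], so that the induction can absorb the
    first plane into [F] by [scons]. *)
Lemma integral_partial_eq0 n k (F : (nat -> R * R) -> R) : (k < n)%N ->
  (planes_lebesgue R n).-integrable setT (fun w => (F (planes_coord w))%:E) ->
  (forall c, \int[mu]_x (F (setx c k x))%:E = 0)%E ->
  (\int[planes_lebesgue R n]_w (F (planes_coord w))%:E = 0)%E.
Proof.
elim: n k F => [//|n IH] [|k] F kn iF F0.
  have iF' : (plane_lebesgue R \x planes_lebesgue R n)%E.-integrable setT
     (fun w => (F (planes_coord (w : planes R n.+1)))%:E) by exact: iF.
  transitivity (\int[planes_lebesgue R n]_w
     fubini_G (plane_lebesgue R) (fun w => (F (planes_coord (w : planes R n.+1)))%:E) w)%E.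
    by rewrite integral21_prod_meas1.
  transitivity (\int[planes_lebesgue R n]_w (0%R)%:E)%E; last by rewrite integral0.
  apply: ae_eq_integral => //.
    exact: (measurable_fubini_G iF').
  have := ae_integrable2 iF'; apply: filterS => w iw _.
  rewrite /fubini_G.
  have iw' : (mu \x mu)%E.-integrable setT
     (fun p => (F (planes_coord ((p, w) : planes R n.+1)))%:E) by exact: iw.
  transitivity (\int[mu]_y fubini_G mu (fun p => (F (planes_coord ((p, w) : planes R n.+1)))%:E) y)%E.
    by rewrite integral21_prod_meas1.
  transitivity (\int[mu]_y (0%R)%:E)%E; last by rewrite integral0.
  apply: eq_integral => y _; rewrite /fubini_G.
  apply: (etrans _ (F0 (scons (0, y) (planes_coord w)))); apply: eq_integral => x _.
  congr (F _)%:E; rewrite planes_coord_scons; apply: funext => -[|l] //.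
have iF' : (plane_lebesgue R \x planes_lebesgue R n)%E.-integrable setT
   (fun w => (F (planes_coord (w : planes R n.+1)))%:E) by exact: iF.
transitivity (\int[plane_lebesgue R]_p
   fubini_F (planes_lebesgue R n) (fun w => (F (planes_coord (w : planes R n.+1)))%:E) p)%E.
  by rewrite integral12_prod_meas1.
transitivity (\int[plane_lebesgue R]_p (0%R)%:E)%E; last by rewrite integral0.
apply: ae_eq_integral => //.
  exact: (measurable_fubini_F iF').
have := ae_integrable1 iF'; apply: filterS => p ip _.
rewrite /fubini_F.
under eq_integral do rewrite planes_coord_scons.
apply: (IH k (fun c => F (scons p c))) => //.
move=> c; apply: (etrans _ (F0 (scons p c))); apply: eq_integral => x _.
by congr (F _)%:E; apply: funext => -[|l].
Qed.

End PlanesIntegration.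

(** * Integrals over the real line *)

Section LineIntegrals.
Variable R : realType.
Local Notation mu := (@lebesgue_measure R).

Lemma is_derive_continuous (f : R -> R) (x d : R) : is_derive x (1 : R) f d -> {for x, continuous f}.
Proof.
move=> fd; apply: differentiable_continuous; apply/derivable1_diffP.
exact: (@ex_derive _ _ _ _ _ _ _ fd).
Qed.

Lemma FTC2_everywhere (f F : R -> R) (a b : R) : a < b -> continuous f ->
  (forall x, is_derive x (1 : R) F (f x)) ->
  (\int[mu]_(x in `[a, b]) (f x)%:E = (F b - F a)%:E)%E.
Proof.
move=> ab cf dF; rewrite (@continuous_FTC2 _ f F)//.
- exact: continuous_subspaceT.
- have cF x : {for x, continuous F} by exact: is_derive_continuous (dF x).
  split; first by move=> x _; exact: (@ex_derive _ _ _ _ _ _ _ (dF x)).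
  + exact: cvg_at_right_filter (cF a).
  + exact: cvg_at_left_filter (cF b).
- by move=> x _; rewrite derive1E; have := dF x => H; rewrite derive_val.
Qed.

Lemma cvg_integral_growing (f : R -> R) (a b : nat -> R) :
  mu.-integrable setT (EFin \o f) -> a n @[n --> \oo] --> -oo -> b n @[n --> \oo] --> +oo ->
  (\int[mu]_(x in `[a n, b n]) (f x)%:E @[n --> \oo] --> \int[mu]_x (f x)%:E)%E.
Proof.
move=> intf ay by_.
have mf : measurable_fun setT (EFin \o f) by exact: (measurable_int mu intf).
pose g n x := (EFin \o f) \_ `[a n, b n] x.
have mg n : measurable_fun setT (g n).
  apply/(measurable_restrictT _ _).1; first exact: measurable_itv.
  exact: measurable_funTS.
have cg x : setT x -> g n x @[n --> \oo] --> (EFin \o f) x.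
  move=> _; apply: cvg_near_cst.
  have A : \forall n \near \oo, a n <= x by move/cvgrNyPle : ay; exact.
  have B : \forall n \near \oo, x <= b n by move/cvgryPge : by_; exact.
  near=> n; rewrite /g patchT// inE/= in_itv/=; apply/andP; split; first by near: n.
  by near: n.
have ia : mu.-integrable setT (abse \o (EFin \o f)) by exact: integrable_abse.
have bg n x : setT x -> (`|g n x| <= (abse \o (EFin \o f)) x)%E.
  by move=> _; rewrite /g /patch; case: ifP => // _; rewrite abse0 abse_ge0.
have fn x : setT x -> (abse \o (EFin \o f)) x \is a fin_num by [].
have := @dominated_cvg _ _ _ mu setT measurableT _ _ _ mg cg fn ia bg.
by under eq_fun do rewrite -integral_mkcond.
Unshelve. all: end_near. Qed.

Lemma antiderivative (G : R -> R) : continuous G -> mu.-integrable setT (EFin \o G) ->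
  exists F : R -> R, forall x, is_derive x (1 : R) F (G x).
Proof.
move=> cG iG; exists (fun x => \int[mu]_(t in `]-oo, x]) G t) => x.
have iu : mu.-integrable `]-oo, (x + 1)] (EFin \o G) by exact: integrableS iG.
have [] := @continuous_FTC1 _ G -oo%O x (x + 1) _ iu _ (cG x).
- by rewrite ltrDl.
- by rewrite ltNyr.
move=> dF eF; rewrite -eF derive1E; exact/derivableP.
Qed.

(* Change of variables [u = phi x] up to the exact term [V']; [kap] is allowed to change sign. *)
Lemma integral_change (G kap phi V : R -> R) :
  continuous G -> mu.-integrable setT (EFin \o G) ->
  continuous kap -> mu.-integrable setT (EFin \o kap) ->
  (exists dphi, (forall x, is_derive x (1 : R) phi (dphi x)) /\
    forall x, is_derive x (1 : R) V (kap x - dphi x * G (phi x))) ->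
  (forall x y, x < y -> phi x < phi y) ->
  phi (n%:R) @[n --> \oo] --> +oo -> phi (- n%:R) @[n --> \oo] --> -oo ->
  V (n%:R) @[n --> \oo] --> (0 : R) -> V (- n%:R) @[n --> \oo] --> (0 : R) ->
  (\int[mu]_x (kap x)%:E = \int[mu]_x (G x)%:E)%E.
Proof.
move=> cG iG ck ik [dphi [dp dV]] phi_incr phiy phiNy Vy VNy.
have [F dF] := antiderivative cG iG.
have nyR : (n%:R : R) @[n --> \oo] --> +oo by exact: cvgr_idn.
have nNyR : (- n%:R : R) @[n --> \oo] --> -oo by exact/cvgNrNy.
have lhs := cvg_integral_growing ik nNyR nyR.
have rhs := cvg_integral_growing iG phiNy phiy.
have VV : (V n%:R - V (- n%:R))%:E @[n --> \oo] --> (0%:E : \bar R).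
  apply: cvg_EFin; first by near=> n.
  by rewrite -[X in _ --> X](subr0 (0 : R)); exact: cvgB.
have fG : (\int[mu]_x (G x)%:E)%E \is a fin_num by exact: integrable_fin_num.
have dd : (\int[mu]_x (G x)%:E +? 0%:E)%E by exact: fin_num_adde_defr.
have := cvgeD dd rhs VV; rewrite adde0 => rhs'.
apply: (cvg_unique _ lhs); first exact: ereal_hausdorff.
rewrite /=; apply: (cvg_trans _ (rhs' _)); apply: near_eq_cvg; near=> n.
have n0 : (0 : R) < n%:R by rewrite ltr0n; near: n; exact: nbhs_infty_gt.
have nn : (- n%:R : R) < n%:R by rewrite (@lt_trans _ _ 0)// oppr_lt0.
rewrite (FTC2_everywhere (phi_incr _ _ nn) cG dF).
(* [F (phi x) + V x] is an antiderivative of [kap]. Its increments over growing intervals are those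
   of [F] between points tending to both infinities, up to values of [V] that tend to 0. *)
have dW x : is_derive x (1 : R) (fun x => F (phi x) + V x) (kap x).
  have H := is_deriveD (is_derive1_comp (dF (phi x)) (dp x)) (dV x).
  apply: (@is_derive_eq _ _ _ _ _ _ _ _ H); ring.
rewrite (FTC2_everywhere nn ck dW) -EFinD; congr (_%:E); ring.
Unshelve. all: end_near. Qed.

End LineIntegrals.

(** The [K]-th root of the inequality follows from [1 + u <= expR u] at [u = e * t / K]. *)
Lemma pow_le_exp (R : realType) (K : nat) (e t : R) : 0 < e -> 0 <= t ->
  (1 + t) ^+ K <= (1 + K%:R / e) ^+ K * expR (e * t).
Proof.
move=> e0 t0; case: K => [|K].
  by rewrite !expr0 mul1r -expR0 ler_expR mulr_ge0// ltW.
have K0 : (0 : R) < K.+1%:R by rewrite ltr0n.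
have -> : expR (e * t) = expR (e * t / K.+1%:R) ^+ K.+1.
  by rewrite -expRM_natl; congr expR; field; rewrite gt_eqF.
rewrite -exprMn; apply: lerXn2r.
- by rewrite nnegrE addr_ge0.
- by rewrite nnegrE mulr_ge0 ?expR_ge0// addr_ge0// divr_ge0// ltW.
have h : 1 + e * t / K.+1%:R <= expR (e * t / K.+1%:R) by exact: expR_ge1Dx.
apply: (@le_trans _ _ ((1 + K.+1%:R / e) * (1 + e * t / K.+1%:R))); last first.
  by rewrite ler_wpM2l// addr_ge0// divr_ge0// ltW.
have -> : (1 + K.+1%:R / e) * (1 + e * t / K.+1%:R) = 1 + t + (K.+1%:R / e + e * t / K.+1%:R).
  by field; rewrite !gt_eqF.
by rewrite lerDl addr_ge0// divr_ge0// ?mulr_ge0// ltW.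
Qed.

(** * Polynomial growth and Gaussian decay of the coefficients *)

Section Tame.
Variables (R : realType) (Lambda : finType) (a : Lambda).
Local Notation G := (fermion Lambda).
Local Notation gr := (grassmann R G).
Local Notation E := (evenG R G).
Local Notation config := (Lambda -> R * R).
Local Notation I := (~: [set a])%SET.
Local Notation conf := (@conf R Lambda a).
Implicit Types (f g : config -> R) (F : config -> E) (c : config) (i j : Lambda).

Definition nrm c : R := \sum_(i in I) ((c i).1 ^+ 2 + (c i).2 ^+ 2).

Lemma nrm_ge0 c : 0 <= nrm c.
Proof. by apply: sumr_ge0 => i _; rewrite addr_ge0// sqr_ge0. Qed.

Definition measurable_cfg f := measurable_fun setT (fun w => f (conf w)).

Lemma measurable_conf i : measurable_cfg (fun c => (c i).1) /\ measurable_cfg (fun c => (c i).2).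
Proof.
rewrite /measurable_cfg /conf /update_config; case: (boolP (i \in I)) => _.
  exact: measurable_coord.
by split; exact: measurable_cst.
Qed.

(** Polynomial growth on the configurations that vanish at [a], the ones integrated over. Stability
    under the Grassmann operations gives control over every coefficient of the forms below without
    computing it. *)
Definition tame f := measurable_cfg f /\
  exists (C : R) (K : nat), 0 <= C /\ forall c, c a = (0, 0) -> `|f c| <= C * (1 + nrm c) ^+ K.

Lemma one_nrm c : 1 <= 1 + nrm c. Proof. by rewrite lerDl nrm_ge0. Qed.

Lemma tame_bounded f (C : R) : 0 <= C -> measurable_cfg f ->
  (forall c, c a = (0, 0) -> `|f c| <= C) -> tame f.
Proof. by move=> C0 mf fC; split=> //; exists C, 0%N; split=> // c ca; rewrite expr0 mulr1 fC. Qed.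

Lemma tame_cst (k : R) : tame (fun=> k).
Proof. by apply: (@tame_bounded _ `|k|) => //; exact: measurable_cst. Qed.

Lemma nrm_pow_le c (K L : nat) : (K <= L)%N -> (1 + nrm c) ^+ K <= (1 + nrm c) ^+ L.
Proof. by move=> KL; rewrite ler_weXn2l// one_nrm. Qed.

Lemma tameD f g : tame f -> tame g -> tame (fun c => f c + g c).
Proof.
move=> [mf [C [K [C0 fC]]]] [mg [D [L [D0 gD]]]]; split; first exact: measurable_funD.
exists (C + D), (maxn K L); split=> [|c ca]; first exact: addr_ge0.
rewrite mulrDl (le_trans (ler_normD _ _))// lerD//.
  by rewrite (le_trans (fC c ca))// ler_wpM2l// nrm_pow_le// leq_maxl.
by rewrite (le_trans (gD c ca))// ler_wpM2l// nrm_pow_le// leq_maxr.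
Qed.

Lemma tameM f g : tame f -> tame g -> tame (fun c => f c * g c).
Proof.
move=> [mf [C [K [C0 fC]]]] [mg [D [L [D0 gD]]]]; split; first exact: measurable_funM.
exists (C * D), (K + L)%N; split=> [|c ca]; first exact: mulr_ge0.
by rewrite normrM exprD mulrACA ler_pM// ?fC// gD.
Qed.

Lemma tame_sum (J : Type) (r : seq J) (P : pred J) (f : J -> config -> R) :
  (forall j : J, P j -> tame (f j)) -> tame (fun c => \sum_(j <- r | P j) f j c).
Proof.
move=> H; elim: r => [|j r IH].
  by under eq_fun do rewrite big_nil; exact: tame_cst.
by under eq_fun do rewrite big_cons; case: (boolP (P j)) => // Pj; apply: tameD => //; exact: H.
Qed.

Lemma tameN f : tame f -> tame (fun c => - f c).
Proof. by move=> tf; under eq_fun do rewrite -mulN1r; apply: tameM => //; exact: tame_cst. Qed.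

Lemma tameX f k : tame f -> tame (fun c => f c ^+ k).
Proof.
move=> tf; elim: k => [|k IH]; first by under eq_fun do rewrite expr0; exact: tame_cst.
by under eq_fun do rewrite exprS; exact: tameM.
Qed.

Lemma le_nrm c i : c a = (0, 0) -> (c i).1 ^+ 2 + (c i).2 ^+ 2 <= nrm c.
Proof.
move=> ca; have [->|ia] := eqVneq i a; first by rewrite ca expr0n/= addr0 nrm_ge0.
rewrite /nrm (bigD1 i)/= ?inE// lerDl sumr_ge0// => j _.
by rewrite addr_ge0// sqr_ge0.
Qed.

Lemma norm_le_sqr (x t : R) : x ^+ 2 <= t -> `|x| <= 1 + t.
Proof.
move=> xt; apply: (@le_trans _ _ (1 + x ^+ 2)); last by rewrite lerD2l.
rewrite -real_normK ?num_real//; have := normr_ge0 x; move: `|x| => y y0.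
have := sqr_ge0 (y - 1); nra.
Qed.

Lemma tame_coord i : tame (fun c => (c i).1) /\ tame (fun c => (c i).2).
Proof.
split; (split; first by have [] := measurable_conf i);
  exists 1, 1%N; split=> // c ca; rewrite mul1r expr1; apply: norm_le_sqr;
  apply: le_trans (le_nrm i ca); rewrite ?lerDl ?lerDr sqr_ge0//.
Qed.

Lemma tame_z0 i : tame (fun c => z0 c i).
Proof.
have [[m1 _] [m2 _]] := tame_coord i; split.
  apply: (measurableT_comp (f := @Num.sqrt R)).
    by apply: continuous_measurable_fun; exact: sqrt_continuous.
  apply: measurable_funD; last exact: measurable_funX.
  by apply: measurable_funD => //; exact: measurable_funX.
exists 1, 1%N; split=> // c ca; rewrite mul1r expr1 ger0_norm ?sqrtr_ge0//.
have h := le_nrm i ca; have n0 := nrm_ge0 c.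
rewrite /z0 -[leRHS]ger0_norm ?addr_ge0// -sqrtr_sqr ler_wsqrtr//.
have := one_nrm c; rewrite -addrA; move: h; set u := _ + _ => h h1.
apply: (@le_trans _ _ (1 + nrm c)); first by rewrite lerD2l.
by rewrite expr2 ler_peMl// addr_ge0.
Qed.

Lemma tame_z0V i : tame (fun c => (z0 c i)^-1).
Proof.
have [[m1 _] [m2 _]] := tame_coord i.
apply: (@tame_bounded _ 1) => // [|c ca]; last first.
  rewrite ger0_norm ?invr_ge0 ?sqrtr_ge0// invf_le1 ?z0_gt0//.
  by rewrite -sqrtr1 ler_wsqrtr// -addrA lerDl addr_ge0// sqr_ge0.
(* The absolute value extends the function of [u] continuously to the whole line, whence
   measurability. *)
have -> : (fun c => (z0 c i)^-1) = (fun c : config =>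
   ((fun u : R => (Num.sqrt (1 + `|u|))^-1) \o (fun c => (c i).1 ^+ 2 + (c i).2 ^+ 2)) c).
  apply: funext => c /=; rewrite /z0 ger0_norm ?addr_ge0 ?sqr_ge0//.
  by rewrite addrA.
apply: (measurableT_comp (f := fun u : R => (Num.sqrt (1 + `|u|))^-1)).
  apply: continuous_measurable_fun => u; apply: cvgV.
    by rewrite gt_eqF// sqrtr_gt0 ltr_wpDr.
  apply: (continuous_comp (f := fun u : R => 1 + `|u|)); last exact: sqrt_continuous.
  by apply: cvgD; [exact: cvg_cst|exact: norm_continuous].
by apply: measurable_funD; exact: measurable_funX.
Qed.

Definition tameg (F : config -> gr) := forall S, tame (fun c => F c S).
Definition tameE F := tameg (fun c => val (F c)).

Lemma tame_eq f g : tame f -> f =1 g -> tame g.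
Proof. by move=> tf /funext <-. Qed.

Lemma tameE_eq F1 F2 : tameE F1 -> F1 =1 F2 -> tameE F2.
Proof. by move=> tf /funext <-. Qed.

Lemma tamegD (F1 F2 : config -> gr) : tameg F1 -> tameg F2 -> tameg (fun c => F1 c + F2 c).
Proof. by move=> t1 t2 S; apply: (tame_eq (tameD (t1 S) (t2 S))) => c; rewrite gaddE. Qed.

Lemma tamegM (F1 F2 : config -> gr) : tameg F1 -> tameg F2 -> tameg (fun c => F1 c * F2 c).
Proof.
move=> t1 t2 S; apply: (tame_eq (f := fun c => \sum_(A : {set G} | A \subset S)
  (-1) ^+ inversions A (S :\: A)%SET * (F1 c A * F2 c (S :\: A)%SET))) => [|c].
  by apply: tame_sum => A _; apply: tameM; [exact: tame_cst|exact: tameM].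
by rewrite gmulE.
Qed.

Lemma tameg_cst (f : gr) : tameg (fun=> f).
Proof. by move=> S; exact: tame_cst. Qed.

Lemma tamegZ f (F : config -> gr) : tame f -> tameg F -> tameg (fun c => f c *: F c).
Proof. by move=> tf tF S; apply: (tame_eq (tameM tf (tF S))) => c; rewrite gscaleE. Qed.

Lemma tameE_cst (f : E) : tameE (fun=> f). Proof. exact: tameg_cst. Qed.
Lemma tameE_evc f : tame f -> tameE (fun c => evc G (f c)).
Proof. by move=> tf; apply: tamegZ => //; exact: tameg_cst. Qed.
Lemma tameED F1 F2 : tameE F1 -> tameE F2 -> tameE (fun c => F1 c + F2 c).
Proof. by move=> t1 t2; exact: (tamegD t1 t2). Qed.
Lemma tameEM F1 F2 : tameE F1 -> tameE F2 -> tameE (fun c => F1 c * F2 c).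
Proof. by move=> t1 t2; exact: (tamegM t1 t2). Qed.
Lemma tameEN F : tameE F -> tameE (fun c => - F c).
Proof.
move=> tF; apply: (tameE_eq (F1 := fun c => (-1) * F c)) => [|c].
  by apply: tameEM => //; exact: tameE_cst.
by rewrite mulN1r.
Qed.
Lemma tameE_sum (J : Type) (r : seq J) (P : pred J) (F : J -> config -> E) :
  (forall j : J, P j -> tameE (F j)) -> tameE (fun c => \sum_(j <- r | P j) F j c).
Proof.
move=> H; elim: r => [|j r IH].
  by under eq_fun do rewrite big_nil; exact: tameE_cst.
by under eq_fun do rewrite big_cons; case: (boolP (P j)) => // Pj; apply: tameED => //; exact: H.
Qed.
Lemma tameE_prod (J : Type) (r : seq J) (P : pred J) (F : J -> config -> E) :
  (forall j : J, P j -> tameE (F j)) -> tameE (fun c => \prod_(j <- r | P j) F j c).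
Proof.
move=> H; elim: r => [|j r IH].
  by under eq_fun do rewrite big_nil; exact: tameE_cst.
by under eq_fun do rewrite big_cons; case: (boolP (P j)) => // Pj; apply: tameEM => //; exact: H.
Qed.
Lemma tameEX F k : tameE F -> tameE (fun c => F c ^+ k).
Proof.
move=> tF; elim: k => [|k IH]; first by under eq_fun do rewrite expr0; exact: tameE_cst.
by under eq_fun do rewrite exprS; exact: tameEM.
Qed.

Lemma tame_ebody F : tameE F -> tame (fun c => ebody (F c)).
Proof. by move=> tF; exact: tF. Qed.

Lemma tameE_nil F : tameE F -> tameE (fun c => eexp_nil (epart (F c))).
Proof.
move=> tF; apply: tameE_sum => k _; apply: tameEM; first exact: tameE_cst.
apply: tameEX; apply: tameED => //; apply: tameEN; apply: tameE_evc; exact: tame_ebody.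
Qed.

Lemma tameg_gderiv (p : G) (F : config -> gr) : tameg F -> tameg (fun c => gderiv p (F c)).
Proof.
move=> tF S; case: (boolP (p \in S)) => pS.
  by apply: (tame_eq (tame_cst 0)) => c; rewrite ffunE pS.
apply: (tame_eq (f := fun c => (-1) ^+ inversions [set p]%SET S * F c (p |: S)%SET)) => [|c].
  by apply: tameM; [exact: tame_cst|exact: tF].
by rewrite ffunE (negPf pS).
Qed.

Lemma tame_ber l F : tameE F -> tame (fun c => ber l (val (F c))).
Proof.
move=> tF; rewrite /ber.
have : tameg (fun c => foldr (fun i h => gd h i) (val (F c)) l).
  by elim: l => [//|i l IH] /=; apply: tameg_gderiv; apply: tameg_gderiv.
exact.
Qed.

Definition gauss_bounded f := measurable_cfg f /\ exists (C e : R), [/\ 0 <= C, 0 < e &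
  forall c, c a = (0, 0) -> `|f c| <= C * expR (- (e * nrm c))].

Lemma integrable_gauss f : gauss_bounded f ->
  (planes_lebesgue R #|I|).-integrable setT (fun w => (f (conf w))%:E).
Proof.
move=> [mf [C [e [C0 e0 fC]]]].
have sz : size (enum I) = #|I| by rewrite -cardE.
(* For the diagonal matrix [2 e] the Gaussian integrand is exactly [expR (- (e * nrm))]. *)
pose H (i j : Lambda) : R := if i == j then e *+ 2 else 0.
have Hs i j : H i j = H j i by rewrite /H eq_sym.
have qE (x : Lambda -> R) : qform (enum I) H x = (e *+ 2) * \sum_(i in I) x i ^+ 2.
  rewrite /qform mulr_sumr big_enum/=; apply: eq_bigr => i iI.
  rewrite big_enum/= (bigD1 i)//= {1}/H eqxx big1 ?addr0 ?expr2// => j /andP[_ ji].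
  by rewrite /H eq_sym (negPf ji) mul0r.
have pd : posdef (enum I) H.
  move=> x [i]; rewrite mem_enum => iI xi; rewrite qE mulr_gt0 ?mulrn_wgt0//.
  rewrite (bigD1 i)//= ltr_pwDl ?exprn_even_gt0//.
  by apply: sumr_ge0 => j _; exact: sqr_ge0.
have gi : (planes_lebesgue R #|I|).-integrable setT (fun w => (expR (- (e * nrm (conf w))))%:E).
  have mg : measurable_fun setT (fun w => expR (- (e * nrm (conf w)))).
    apply: measurableT_comp => //; apply: measurable_funN; apply: measurable_funM => //.
    have -> : (fun w => nrm (conf w)) = (fun w => \sum_(i <- enum I)
      (((conf w) i).1 ^+ 2 + ((conf w) i).2 ^+ 2)) by apply: funext => w; rewrite /nrm big_enum.
    apply: measurable_sum => i; have [m1 m2] := measurable_conf i.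
    by apply: measurable_funD; exact: measurable_funX.
  apply/integrableP; split; first exact/measurable_EFinP.
  under eq_integral do rewrite gee0_abs ?lee_fin ?expR_ge0//.
  have HG := integral_gaussian_planes (fun=> 0) sz Hs (enum_uniq _) pd.
  rewrite (_ : (\int[_]_x _)%E = ((2 * pi) ^+ #|I| / detl (enum I) H)%:E) ?ltry//.
  rewrite -HG; apply: eq_integral => w _; congr (expR (- _))%:E.
  have half (S : R) : 2^-1 * (e *+ 2 * S) = e * S by field.
  rewrite !qE -mulrDr half -big_split/= /nrm.
  congr (_ * _); apply: eq_bigr => i iI.
  by rewrite /conf /update_config iI addr0.
apply: (le_integrable measurableT _ _ (integrableZl measurableT C gi)).
  exact/measurable_EFinP.
move=> w _; rewrite -EFinM lee_fin (le_trans (fC _ (conf_a w)))//.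
exact: ler_norm.
Qed.

(** Half of the Gaussian exponent absorbs the polynomial, by [pow_le_exp]. *)
Lemma gauss_boundedM f g : tame f -> gauss_bounded g -> gauss_bounded (fun c => f c * g c).
Proof.
move=> [mf [C [K [C0 fC]]]] [mg [D [e [D0 e0 gD]]]]; split; first exact: measurable_funM.
exists (C * ((1 + K%:R / (e / 2)) ^+ K) * D), (e / 2); split.
- by rewrite !mulr_ge0// exprn_ge0// addr_ge0// !divr_ge0// ltW.
- by rewrite divr_gt0.
move=> c ca; rewrite normrM.
apply: (@le_trans _ _ (C * (1 + nrm c) ^+ K * (D * expR (- (e * nrm c))))).
  by rewrite ler_pM// ?fC// gD.
have h := @pow_le_exp R K (e / 2) (nrm c) (divr_gt0 e0 (ltr0Sn _ 1)) (nrm_ge0 c).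
apply: (@le_trans _ _ (C * ((1 + K%:R / (e / 2)) ^+ K * expR (e / 2 * nrm c)) * (D * expR (- (e * nrm c))))).
  by rewrite ler_wpM2r ?mulr_ge0 ?expR_ge0// ler_wpM2l.
rewrite le_eqVlt; apply/orP; left; apply/eqP.
have -> : expR (- (e / 2 * nrm c)) = expR (e / 2 * nrm c) * expR (- (e * nrm c)).
  by rewrite -expRD; congr expR; field.
by ring.
Qed.

End Tame.

(** * Lower bounds from diagonal dominance *)

Section DiagonallyDominant.
Variables (R : realType) (Lambda : finType) (a : Lambda) (H : Lambda -> Lambda -> R).
Hypothesis H_sym : forall i j, H i j = H j i.
Hypothesis H_dom : forall i, i != a -> 1 + \sum_(j | j != i) `|H i j| <= H i i.
Local Notation G := (fermion Lambda).
Local Notation gr := (grassmann R G).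
Local Notation E := (evenG R G).
Local Notation config := (Lambda -> R * R).
Local Notation I := (~: [set a])%SET.
Local Notation conf := (@conf R Lambda a).
Implicit Types (i j k : Lambda) (c : config) (sigma : Lambda -> R) (v : Lambda -> R).

(** An upper bound for the failure of dominance in the row of [a], on which nothing is assumed;
    [v a] is fixed wherever [quad_lower] is used for an upper bound. *)
Definition deficit : R := \sum_j `|H a j|.

Lemma deficit_ge0 : 0 <= deficit.
Proof. by apply: sumr_ge0. Qed.

(** Each off-diagonal entry is estimated by [2 |v i v j| <= v i ^ 2 + v j ^ 2]. Dominance leaves a
    surplus of at least 1 in each row other than that of [a]. *)
Lemma quad_lower v : \sum_(i in I) v i ^+ 2 - deficit * v a ^+ 2 <= \sum_i \sum_j H i j * (v i * v j).
Proof.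
pose o i j : R := if j == i then 0 else `|H i j|.
have oE i : \sum_j o i j = \sum_(j | j != i) `|H i j|.
  by rewrite [RHS]big_mkcond/=; apply: eq_bigr => j _; rewrite /o; case: eqP.
have oC i j : o i j = o j i by rewrite /o eq_sym H_sym.
have sub : \sum_i (H i i - \sum_j o i j) * v i ^+ 2 <= \sum_i \sum_j H i j * (v i * v j).
  have -> : \sum_i (H i i - \sum_j o i j) * v i ^+ 2 =
     \sum_i \sum_j ((j == i)%:R * (H i i * v i ^+ 2) - 2^-1 * o i j * (v i ^+ 2 + v j ^+ 2)).
    under [RHS]eq_bigr do rewrite big_split/= sumrN.
    rewrite [RHS]big_split/= sumrN.
    under eq_bigr do rewrite mulrBl.
    rewrite big_split/= sumrN; congr (_ - _).
      apply: eq_bigr => i _; rewrite (bigD1 i)//= eqxx mul1r big1 ?addr0// => j /negPf ->.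
      by rewrite mul0r.
    have -> : \sum_i \sum_j 2^-1 * o i j * (v i ^+ 2 + v j ^+ 2) =
      \sum_i \sum_j (2^-1 * (o i j * v i ^+ 2)) + \sum_i \sum_j (2^-1 * (o i j * v j ^+ 2)).
      rewrite -big_split/=; apply: eq_bigr => i _; rewrite -big_split/=.
      by apply: eq_bigr => j _; rewrite -mulrA mulrDr mulrDr.
    have -> : \sum_i \sum_j 2^-1 * (o i j * v j ^+ 2) = \sum_i \sum_j 2^-1 * (o i j * v i ^+ 2).
      rewrite exchange_big/=; apply: eq_bigr => i _; apply: eq_bigr => j _.
      by rewrite oC.
    rewrite -big_split/=; apply: eq_bigr => i _.
    rewrite -mulr_sumr -mulrDl mulr_suml.
    have half (S : R) : S = 2^-1 * S + 2^-1 * S by field.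
    by rewrite mulrDl -half.
  apply: ler_sum => i _; apply: ler_sum => j _; rewrite /o.
  case: eqP => [->|_]; first by rewrite mul1r mulr0 mul0r subr0 expr2.
  rewrite mul0r sub0r; case: (real_ltP (num_real 0) (num_real (H i j))) => h.
    by rewrite gtr0_norm//; have := sqr_ge0 (v i + v j); nra.
  by rewrite ler0_norm//; have := sqr_ge0 (v i - v j); nra.
apply: le_trans sub; rewrite [leRHS](bigD1 a)//= [leLHS]addrC; apply: lerD.
  rewrite -mulNr ler_wpM2r ?sqr_ge0//.
  rewrite /deficit (bigD1 a)//= opprD lerD//; first by rewrite lerNl -normrN ler_norm.
  by rewrite lerN2 oE.
rewrite (eq_bigl (fun i => i != a)); last by move=> i; rewrite !inE.
apply: ler_sum => i ia; rewrite -[leLHS]mul1r ler_wpM2r ?sqr_ge0// lerBrDr.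
by apply: le_trans (H_dom ia); rewrite lerD2l oE.
Qed.

Lemma posdef_dominant : posdef (enum I) H.
Proof.
move=> x [i]; rewrite mem_enum => iI xi.
pose v j := if j == a then 0 else x j.
have -> : qform (enum I) H x = \sum_i \sum_j H i j * (v i * v j).
  rewrite [RHS](bigD1 a)//= big1 ?add0r => [|j _]; last by rewrite /v eqxx mul0r mulr0.
  rewrite /qform big_enum/=; apply: eq_big => [j|j ja]; first by rewrite !inE.
  rewrite [RHS](bigD1 a)//= /v eqxx !mulr0 add0r big_enum/=.
  apply: eq_big => [k|k ka]; first by rewrite !inE.
  by move: ja ka; rewrite !inE => /negPf -> /negPf ->.
apply: lt_le_trans (quad_lower v); rewrite {2}/v eqxx expr0n/= mulr0 subr0.
rewrite (bigD1 i)//= ltr_pwDl//; last by apply: sumr_ge0 => j _; exact: sqr_ge0.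
by rewrite /v ifN ?exprn_even_gt0//; move: iI; rewrite !inE.
Qed.

Lemma ebodyM (f g : E) : ebody (f * g) = ebody f * ebody g. Proof. exact: rmorphM. Qed.
Lemma ebodyD (f g : E) : ebody (f + g) = ebody f + ebody g. Proof. exact: rmorphD. Qed.
Lemma ebodyN (f : E) : ebody (- f) = - ebody f. Proof. exact: rmorphN. Qed.

Lemma ebody_sum (J : Type) (r : seq J) (P : pred J) (F : J -> E) :
  ebody (\sum_(j <- r | P j) F j) = \sum_(j <- r | P j) ebody (F j).
Proof. exact: rmorph_sum. Qed.

Lemma ebody_totE sigma c : ebody (totE a H sigma c) =
  - (2^-1 * \sum_i \sum_j H i j * (1 + x0' sigma c i * x0' sigma c j + (c i).2 * (c j).2)).
Proof.
rewrite /totE ebodyN ebodyM ebodyC; congr (- (_ * _)).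
rewrite ebody_sum; apply: eq_bigr => i _; rewrite ebody_sum; apply: eq_bigr => j _.
rewrite ebodyM ebodyC; congr (_ * _).
rewrite !ebodyD !ebodyN !ebody_bilp !subr0 ebodyC rmorph1 ebodyM /XE !ebodyD !ebodyC.
by rewrite !ebodyM !ebody_bilp !mulr0 !addr0.
Qed.

Lemma tame_x0 sigma i : tame a (fun c => x0' sigma c i).
Proof.
apply: tameD; apply: tameM; try exact: tame_cst; [exact: (tame_coord R a i).1|exact: tame_z0].
Qed.

Lemma tame_zeta sigma i : tame a (fun c => zeta sigma c i).
Proof.
apply: tameD; apply: tameM; try exact: tame_cst; [exact: tame_z0|exact: (tame_coord R a i).1].
Qed.

Lemma tameE_XE sigma i : tameE a (fun c => XE a sigma c i).
Proof.
apply: tameED; first by apply: tameE_evc; exact: tame_x0.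
apply: tameEM; last exact: tameE_cst.
apply: tameE_evc; apply: tameN; apply: tameM; [exact: tame_cst|exact: tame_z0V].
Qed.

Lemma tameE_totE sigma : tameE a (totE a H sigma).
Proof.
apply: tameEN; apply: tameEM; first exact: tameE_cst.
apply: tameE_sum => i _; apply: tameE_sum => j _; apply: tameEM; first exact: tameE_cst.
apply: tameED; last exact: tameE_cst.
apply: tameED; last exact: tameE_cst.
apply: tameED.
  apply: tameED; first exact: tameE_cst.
  by apply: tameEM; exact: tameE_XE.
by apply: tameE_evc; apply: tameM; exact: (tame_coord R a _).2.
Qed.

Lemma x0_sqr sigma c i : zeta sigma c i ^+ 2 = 1 + x0' sigma c i ^+ 2 + (c i).2 ^+ 2.
Proof.
have := z0_sqr c i; have := cosh2_sinh2 (sigma i); rewrite /zeta /x0'.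
move: (cosh _) (sinh _) (z0 c i) (c i).1 (c i).2 => C S z x y CS zz.
transitivity ((C * x + S * z) ^+ 2 + (C ^+ 2 - S ^+ 2) * (z ^+ 2 - x ^+ 2)); first by ring.
by rewrite CS zz; ring.
Qed.

Lemma x_unboost sigma c i : (c i).1 = cosh (sigma i) * x0' sigma c i - sinh (sigma i) * zeta sigma c i.
Proof.
rewrite /zeta /x0'; have := cosh2_sinh2 (sigma i).
move: (cosh _) (sinh _) (z0 c i) (c i).1 => C S z x CS.
by rewrite -[LHS]mul1r -CS; ring.
Qed.

(** The inverse boost [x_unboost] writes [x] as a difference of two terms, whose square is at most
    twice the sum of their squares; [zeta ^+ 2] is itself [1 + x0' ^+ 2 + y ^+ 2] by [x0_sqr]. *)
Lemma nrm_le_boosted sigma : exists2 D : R, 0 < D & forall c,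
  nrm a c <= D * (\sum_(i in I) (1 + x0' sigma c i ^+ 2 + (c i).2 ^+ 2)).
Proof.
pose D i : R := 2 * cosh (sigma i) ^+ 2 + 2 * sinh (sigma i) ^+ 2 + 1.
have D1 i : 1 <= D i by rewrite /D lerDr addr_ge0// mulr_ge0// sqr_ge0.
exists (\sum_i D i).
  by rewrite (bigD1 a)//= ltr_pwDl ?sumr_ge0// => [|i _]; [rewrite (lt_le_trans _ (D1 a))|rewrite (le_trans _ (D1 i))].
move=> c; rewrite mulr_sumr; apply: ler_sum => i _.
set w := (X in _ * X).
have w1 : 1 <= w by rewrite /w -addrA lerDl addr_ge0// sqr_ge0.
apply: (@le_trans _ _ (D i * w)); last first.
  rewrite ler_wpM2r ?(le_trans _ w1)// (bigD1 i)//= lerDl sumr_ge0// => j _.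
  by rewrite (le_trans _ (D1 j)).
have xb : (c i).1 ^+ 2 <= 2 * (cosh (sigma i) ^+ 2 * x0' sigma c i ^+ 2)
     + 2 * (sinh (sigma i) ^+ 2 * zeta sigma c i ^+ 2).
  rewrite [in leLHS](x_unboost sigma) -!exprMn.
  move: (_ * x0' _ _ _) (_ * zeta _ _ _) => p q; have := sqr_ge0 (p + q); nra.
rewrite x0_sqr -/w in xb.
have yw : (c i).2 ^+ 2 <= w by rewrite /w lerDr addr_ge0// sqr_ge0.
have xw : x0' sigma c i ^+ 2 <= w by rewrite /w -addrA addrCA lerDl addr_ge0// sqr_ge0.
have := sqr_ge0 (cosh (sigma i)); have := sqr_ge0 (sinh (sigma i)); rewrite /D.
by move: (cosh _ ^+ 2) (sinh _ ^+ 2) xb => C2 S2 xb S0 C0; nra.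
Qed.

Lemma gauss_tot sigma : gauss_bounded a (fun c => expR (ebody (totE a H sigma c))).
Proof.
split.
  by apply: measurableT_comp => //; case: (tame_ebody (tameE_totE sigma)).
have [D D0 HD] := nrm_le_boosted sigma.
(* The part that is constant in the configuration. At [a] the boosted [x] is [sinh (sigma a)], and
   [#|I|] stems from the summands 1 in [nrm_le_boosted]. *)
pose K : R := expR (- (2^-1 * (\sum_i \sum_j H i j - deficit * sinh (sigma a) ^+ 2 - #|I|%:R))).
exists K, (2^-1 / D); split; [exact: expR_ge0|by rewrite divr_gt0|move=> c ca].
rewrite ger0_norm ?expR_ge0// /K -expRD ler_expR ebody_totE -opprD lerN2 -!mulrA -mulrDr.
rewrite ler_wpM2l ?invr_ge0//.
have := HD c; rewrite mulrC -ler_pdivrMr// mulrC => HD'.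
rewrite (le_trans (lerD (lexx _) HD'))//.
have -> : \sum_i \sum_j H i j * (1 + x0' sigma c i * x0' sigma c j + (c i).2 * (c j).2) =
  \sum_i \sum_j H i j + \sum_i \sum_j H i j * (x0' sigma c i * x0' sigma c j)
   + \sum_i \sum_j H i j * ((c i).2 * (c j).2).
  rewrite -!big_split/=; apply: eq_bigr => i _; rewrite -!big_split/=; apply: eq_bigr => j _.
  by rewrite !mulrDr mulr1.
have := quad_lower (x0' sigma c); have := quad_lower (fun i => (c i).2).
have -> : x0' sigma c a = sinh (sigma a).
  by rewrite /x0' /z0 ca /= expr0n/= !addr0 sqrtr1 mulr0 add0r mulr1.
rewrite ca expr0n/= mulr0 subr0.
have -> : \sum_(i in I) (1 + x0' sigma c i ^+ 2 + (c i).2 ^+ 2) =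
  #|I|%:R + \sum_(i in I) x0' sigma c i ^+ 2 + \sum_(i in I) (c i).2 ^+ 2.
  by rewrite !big_split/= sumr_const.
by lra.
Qed.

(** The exponential is the Gaussian of the body times a polynomial in the nilpotent part, whose
    coefficients are tame. *)
Lemma gauss_ber l (A : config -> E) sigma : tameE a A ->
  gauss_bounded a (fun c => ber l (val (A c * eexp (totE a H sigma c)))).
Proof.
move=> tA.
have := gauss_boundedM (tame_ber l (tameEM tA (tameE_nil (tameE_totE sigma)))) (gauss_tot sigma).
congr gauss_bounded; apply: funext => c.
rewrite /eexp mulrCA val_evcM berZ mulrC; congr (_ * _).
Qed.

End DiagonallyDominant.

(** * Undoing the boost site by site *)

Section ExponentialSeries.
Variable R : realType.

(** Differentiation shifts the coefficients and loses the last term of the sum. In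
    [is_derive_ber_exp] the lost coefficient is zero by nilpotency, so the truncated series behaves
    like the full one. *)
Lemma is_derive_trunc_exp (n : nat) (b : nat -> R) (u : R) :
  is_derive u (1 : R) (fun u => \sum_(k < n.+1) (- u) ^+ k / k`!%:R * b k)
    (- \sum_(k < n) (- u) ^+ k / k`!%:R * b k.+1).
Proof.
elim: n => [|n IH].
  rewrite big_ord0 oppr0.
  have -> : (fun u => \sum_(k < 1) (- u) ^+ k / k`!%:R * b k) = fun=> b 0%N.
    by apply: funext => v; rewrite big_ord1 expr0 fact0 invr1 !mul1r.
  exact: is_derive_cst.
have -> : (fun u => \sum_(k < n.+2) (- u) ^+ k / k`!%:R * b k) = fun u =>
   \sum_(k < n.+1) (- u) ^+ k / k`!%:R * b k + (- u) ^+ n.+1 / n.+1`!%:R * b n.+1.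
  by apply: funext => v; rewrite big_ord_recr.
have dX : is_derive u (1 : R) (fun u : R => (- u) ^+ n.+1 / n.+1`!%:R * b n.+1)
    (- ((- u) ^+ n / n`!%:R * b n.+1)).
  have dp : is_derive u (1 : R) (fun u : R => (- u) ^+ n.+1) (n.+1%:R * (- u) ^+ n * -1).
    have dN : is_derive u (1 : R) (fun u : R => - u) (- 1) by exact: is_deriveN.
    have := is_deriveX n.+1 dN; congr (is_derive _ _ _ _).
    by apply: funext => v; rewrite fctE.
  have := is_deriveZ (b n.+1 / n.+1`!%:R) dp; congr (is_derive _ _ _ _).
    apply: funext => v; rewrite -[LHS]/((b n.+1 / n.+1`!%:R) * (- v) ^+ n.+1).
    ring.
  rewrite /GRing.scale/= factS natrM; field.
  by rewrite pnatr_eq0 -lt0n fact_gt0/= addrC natr1 pnatr_eq0.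
have := is_deriveD IH dX; congr (is_derive _ _ _ _).
by rewrite big_ord_recr /= opprD.
Qed.

End ExponentialSeries.

Section SiteChange.
Variables (R : realType) (Lambda : finType) (a : Lambda) (H : Lambda -> Lambda -> R).
Hypothesis H_sym : forall i j, H i j = H j i.
Hypothesis H_dom : forall i, i != a -> 1 + \sum_(j | j != i) `|H i j| <= H i i.
Local Notation mu := (@lebesgue_measure R).
Local Notation G := (fermion Lambda).
Local Notation gr := (grassmann R G).
Local Notation E := (evenG R G).
Local Notation config := (Lambda -> R * R).
Local Notation I := (~: [set a])%SET.
Local Notation conf := (@conf R Lambda a).
Implicit Types (i j : Lambda) (c : config) (sigma : Lambda -> R) (l : seq Lambda).

Lemma eexp_line (P : E) (u : R) : eexp (- (evc G u * P)) =
  evc G (expR (- (u * ebody P))) *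
   \sum_(k < #|G|.+1) evc G ((- u) ^+ k / k`!%:R) * epart P ^+ k.
Proof.
have -> : - (evc G u * P) = evc G (- u) * P by rewrite rmorphN mulNr.
have eM (r : R) (f : E) : epart (evc G r * f) = evc G r * epart f.
  by rewrite /epart ebodyM ebodyC (rmorphM (evc G)) -mulrBr.
rewrite /eexp ebodyM ebodyC eM mulNr; congr (_ * _).
rewrite /eexp_nil; apply: eq_bigr => k _.
by rewrite exprMn -rmorphXn mulrA -rmorphM mulrC [X in evc G X]mulrC mulrC.
Qed.

Lemma ber_lin l (r : R) (A B C : E) :
  ber l (val ((evc G r * A + evc G (-1) * B) * C)) =
  r * ber l (val (A * C)) - ber l (val (B * C)).
Proof.
rewrite mulrDl -2!mulrA; move: (A * C) (B * C) => U V.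
by rewrite val_evenGD berD (val_evcM r U) (val_evcM (-1) V) !berZ mulN1r.
Qed.

Lemma ber_lin3 l (p q r : R) (A B C : E) :
  ber l (val (evc G p * A + evc G q * B + evc G r * C)) =
  p * ber l (val A) + q * ber l (val B) + r * ber l (val C).
Proof.
by rewrite !val_evenGD !berD (val_evcM p A) (val_evcM q B) (val_evcM r C) !berZ.
Qed.

Lemma ber_minus l (q : R) (A B C : E) :
  ber l (val (A * - (evc G q + B) * C)) =
  - q * ber l (val (A * C)) - ber l (val (A * B * C)).
Proof.
rewrite -ber_lin; congr (ber l (val (_ * C))).
have -> : evc G (- q) = - evc G q by rewrite rmorphN.
have -> : evc G (-1 : R) = -1 by exact: rmorphN1.
exact: shuffle_neg2.
Qed.

(** As a function of the real variable [u], the Berezin integral is a Gaussian factor [e u] times a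
    polynomial, with coefficients read off from the powers of the nilpotent part of [P].
    Differentiating under [ber] is thus elementary calculus. *)
Lemma is_derive_ber_exp l (A T P : E) (h u : R) :
  is_derive u (1 : R)
    (fun u => ber l (val (A * eexp (T - evc G (2^-1 * h * u ^+ 2) - evc G u * P))))
    (ber l (val (A * (- (evc G (h * u) + P)) * eexp (T - evc G (2^-1 * h * u ^+ 2) - evc G u * P)))).
Proof.
pose b (k : nat) := ber l (val (A * eexp T * epart P ^+ k)).
pose S n (c : nat -> R) (u : R) := \sum_(k < n) (- u) ^+ k / k`!%:R * c k.
pose e (u : R) : R := expR (- (2^-1 * h * u ^+ 2 + u * ebody P)).
have expand (B : E) (v : R) :
    ber l (val (B * eexp (T - evc G (2^-1 * h * v ^+ 2) - evc G v * P))) =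
    e v * S #|G|.+1 (fun k : nat => ber l (val (B * eexp T * epart P ^+ k))) v.
  have eC (r : R) : eexp (- evc G r) = evc G (expR (- r)) by rewrite -rmorphN eexpC.
  rewrite !eexpD eC eexp_line.
  set Q := \sum_(k < _) _.
  transitivity (ber l (val (evc G (e v) * (B * eexp T * Q)))).
    congr (ber l (val _)).
    have -> : e v = expR (- (2^-1 * h * v ^+ 2)) * expR (- (v * ebody P)).
      by rewrite /e opprD expRD.
    rewrite evcM.
    exact: shuffle_exp.
  rewrite val_evcM berZ; congr (_ * _); rewrite /Q mulr_sumr val_evenG_sum ber_sum.
  apply: eq_bigr => k _; rewrite -berZ -val_evcM; congr (ber l (val _)).
  exact: mulrCA.
have -> : (fun u => ber l (val (A * eexp (T - evc G (2^-1 * h * u ^+ 2) - evc G u * P)))) =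
   fun u => e u * S #|G|.+1 b u by apply: funext => v; rewrite expand.
have -> : ber l (val (A * - (evc G (h * u) + P) * eexp (T - evc G (2^-1 * h * u ^+ 2) - evc G u * P)))
  = - (h * u + ebody P) * (e u * S #|G|.+1 b u) - e u * S #|G| (fun k => b k.+1) u.
  have -> : A * - (evc G (h * u) + P) =
     evc G (- (h * u + ebody P)) * A + evc G (-1) * (A * epart P).
    have -> : evc G (- (h * u + ebody P)) = - (evc G (h * u) + evc G (ebody P)).
      by rewrite rmorphN rmorphD.
    have -> : evc G (-1 : R) = -1 by exact: rmorphN1.
    rewrite {1}(epartK P).
    exact: shuffle_neg.
  rewrite ber_lin !expand; congr (_ - _ * _).
  have last0 n (c : nat -> R) v : c n = 0 -> S n.+1 c v = S n c v.
    by rewrite /S big_ord_recr /= => ->; rewrite mulr0 addr0.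
  rewrite last0; last first.
    have -> : A * epart P * eexp T * epart P ^+ #|G| = A * eexp T * epart P ^+ #|G|.+1.
      by rewrite exprS; exact: shuffle_pow.
    by rewrite enilp ?ebody_part// mulr0 ber0.
  apply: eq_bigr => k _; congr (_ * ber l (val _)).
  by rewrite exprS; exact: shuffle_pow.
have de : is_derive u (1 : R) e (- (h * u + ebody P) * e u).
  rewrite /e; apply: is_derive_eq; rewrite /GRing.scale/=.
  by move: (expR _) => w; field.
have dS := is_derive_trunc_exp #|G| b u.
have := is_deriveM de dS; congr (is_derive _ _ _ _).
by rewrite /GRing.scale/=; rewrite -/(S _ _ _) -/(S #|G| (fun k => b k.+1) u); ring.
Qed.

Definition setX c i (x : R) : config := fun j => if j == i then (x, (c i).2) else c j.

(** With the same boost everywhere this is the density for the test function [e^q prod l_j]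
    ([superexp_density_prod]). With a boost at the root only, the Jacobians are 1 and a Gaussian
    superintegral is left ([KE_boost_root]). *)
Definition KE l sigma c : R := ber l (val (\prod_(j in I) jacE a sigma c j * eexp (totE a H sigma c))).

Definition unboost sigma i : Lambda -> R := fun j => if j == i then 0 else sigma j.

Lemma cosh0 : cosh (0 : R) = 1. Proof. by rewrite /cosh oppr0 expR0; field. Qed.
Lemma sinh0 : sinh (0 : R) = 0. Proof. by rewrite /sinh oppr0 subrr mul0r. Qed.

Section Line.
Variables (l : seq Lambda) (sigma : Lambda -> R) (c : config) (i : Lambda).
Hypotheses (ca : c a = (0, 0)) (ia : i != a).
Let C := cosh (sigma i).
Let S := sinh (sigma i).
Let y := (c i).2.
Let z (x : R) := Num.sqrt (1 + x ^+ 2 + y ^+ 2).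
Let n := bilp R a i i.
Let u (x : R) := C * x + S * z x.
Let m (x : R) := - (S / z x).
Let j0 (x : R) := (C * z x + S * x) / z x.
Let j1 (x : R) := S * x / z x ^+ 3.
Let A1 := \prod_(j in I | j != i) jacE a sigma c j.
(** The dependence on the coordinate [x_i] is isolated. If [X] denotes the boosted form at [i], the
    exponent is [T - H i i X^2 / 2 - X P], where [T] and [P] only involve the boosted forms at the
    other sites, and [Psi v] is its exponential at [X = v]. *)
Let X0 j : E := if j == i then 0 else XE a sigma c j.
Let r j k : E := evc G ((c j).2 * (c k).2) - bilp R a j k - bilp R a k j.
Let T : E := - (evc G 2^-1 * \sum_j \sum_k evc G (H j k) * (1 + X0 j * X0 k + r j k)).
Let P : E := \sum_k evc G (H i k) * X0 k.
Let Psi (v : R) : E := eexp (T - evc G (2^-1 * H i i * v ^+ 2) - evc G v * P).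

Let setX_neq x j : j != i -> setX c i x j = c j. Proof. by rewrite /setX => /negPf ->. Qed.
Let setX_i x : setX c i x i = (x, y). Proof. by rewrite /setX eqxx. Qed.
Let setX_a x : setX c i x a = (0, 0). Proof. by rewrite setX_neq// eq_sym. Qed.

Let XE_setX sg x : (forall j, j != i -> sg j = sigma j) -> forall j,
  XE a sg (setX c i x) j = if j == i then XE a sg (setX c i x) i else X0 j.
Proof.
move=> sgE j; rewrite /X0; case: eqP => [->//|/eqP ji].
by rewrite /XE /x0' /m0 /z0 setX_neq// sgE.
Qed.

Let tot_setX sg x : (forall j, j != i -> sg j = sigma j) ->
  totE a H sg (setX c i x) = T - evc G (2^-1 * H i i) * (XE a sg (setX c i x) i * XE a sg (setX c i x) i)
    - XE a sg (setX c i x) i * P.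
Proof.
move=> sgE; rewrite /totE.
have rE j k : evc G ((setX c i x j).2 * (setX c i x k).2) - bilp R a j k - bilp R a k j = r j k.
  by rewrite /r /setX; case: (eqVneq j i) => [->|_]; case: (eqVneq k i) => [->|_].
rewrite (_ : \sum_j \sum_k _ = \sum_j \sum_k evc G (H j k) *
    (1 + XE a sg (setX c i x) j * XE a sg (setX c i x) k + r j k)); last first.
  by apply: eq_bigr => j _; apply: eq_bigr => k _; rewrite -rE !addrA.
rewrite (quad_split (i := i) (X0 := X0) r (X := XE a sg (setX c i x) i)).
- rewrite /T /P evcM.
  have half : evc G (2^-1 : R) *+ 2 = 1.
    by rewrite -(rmorphMn (evc G)) -mulr_natr mulVf ?rmorph1 ?pnatr_eq0.
  move: half; move: (evc G 2^-1) => h half.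
  have hx (v : E) : h * (v *+ 2) = v by rewrite mulrnAr -mulrnAl half mul1r.
  by rewrite 2!mulrDr hx !opprD [h * (evc G (H i i) * _)]mulrA.
- by move=> j k; rewrite H_sym.
- by rewrite /X0 eqxx.
- exact: XE_setX.
Qed.

Let prod_setX sg x : (forall j, j != i -> sg j = sigma j) ->
  \prod_(j in I) jacE a sg (setX c i x) j = jacE a sg (setX c i x) i * A1.
Proof.
move=> sgE; rewrite (bigD1 i)/=; last by rewrite !inE.
congr (_ * _); apply: eq_bigr => j /andP[_ ji].
by rewrite /jacE /zeta /z0 setX_neq// sgE.
Qed.

Let nn : n * n = 0. Proof. exact: bilp_sqr. Qed.

Let eexp_setX x : eexp (totE a H sigma (setX c i x)) =
  Psi (u x) * (1 + - (evc G (m x) * n * (evc G (H i i * u x) + P))).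
Proof.
rewrite (tot_setX _ (fun=> fun=> erefl)).
have -> : XE a sigma (setX c i x) i = evc G (u x) + evc G (m x) * n.
  by rewrite /XE /x0' /m0 /z0 setX_i.
rewrite (sz_gauss (evc G) _ _ _ _ _ nn) eexpD -/(Psi (u x)); congr (_ * _); apply: eexp_sqz.
  by rewrite ebodyN !ebodyM ebody_bilp mulr0 mul0r oppr0.
by rewrite mulrNN shuffle_sqr nn mulr0.
Qed.

Let KE_setX x : KE l sigma (setX c i x) =
  j0 x * ber l (val (A1 * Psi (u x))) + j1 x * ber l (val (A1 * n * Psi (u x)))
  + j0 x * m x * ber l (val (A1 * n * (- (evc G (H i i * u x) + P)) * Psi (u x))).
Proof.
rewrite /KE (prod_setX _ (fun=> fun=> erefl)) eexp_setX.
have -> : jacE a sigma (setX c i x) i = evc G (j0 x) + evc G (j1 x) * n.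
  by rewrite /jacE /zeta /z0 setX_i.
by rewrite (sz_site (evc G) _ _ _ _ _ _ _ nn) ber_lin3.
Qed.

Let KE0_setX x : KE l (unboost sigma i) (setX c i x) = ber l (val (A1 * Psi x)).
Proof.
have sgE j : j != i -> unboost sigma i j = sigma j by rewrite /unboost => /negPf ->.
have zn0 : Num.sqrt (1 + x ^+ 2 + y ^+ 2) != 0 by rewrite gt_eqF// sqrtr_gt0 z0_arg_gt0.
rewrite /KE (prod_setX _ sgE) (tot_setX _ sgE).
have -> : jacE a (unboost sigma i) (setX c i x) i = 1.
  rewrite /jacE /zeta /z0 setX_i /unboost eqxx cosh0 sinh0 !mul0r addr0 mul1r divff//.
  by rewrite rmorph1 rmorph0 mul0r addr0.
have -> : XE a (unboost sigma i) (setX c i x) i = evc G x.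
  rewrite /XE /x0' /m0 setX_i /unboost eqxx cosh0 sinh0 !mul0r addr0 mul1r oppr0.
  by rewrite rmorph0 mul0r addr0.
have -> : evc G (2^-1 * H i i) * (evc G x * evc G x) = evc G (2^-1 * H i i * x ^+ 2).
  by rewrite -!rmorphM expr2.
by rewrite mul1r.
Qed.

(** The term whose derivative makes up for the nilpotent parts in the change of variables. The
    definition displays it as a Berezin integral against the full exponential, so that [gauss_ber]
    yields its decay; [VE] is the form in which it is differentiated. *)
Let V x := ber l (val (A1 * (evc G (m x) * n) * eexp (totE a H sigma (setX c i x)))).

Let VE x : V x = m x * ber l (val (A1 * n * Psi (u x))).
Proof.
have h0 : evc G (m x) * n * (Psi (u x) * (1 + - (evc G (m x) * n * (evc G (H i i * u x) + P)))) =
    evc G (m x) * (n * Psi (u x)) := sz_site0 (evc G) _ _ _ _ nn.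
rewrite /V eexp_setX -mulrA h0.
transitivity (ber l (val (evc G (m x) * (A1 * n * Psi (u x))))); last by rewrite val_evcM berZ.
congr (ber l (val _)).
exact: shuffle_front.
Qed.

Let D0 : C ^+ 2 - S ^+ 2 = 1. Proof. exact: cosh2_sinh2. Qed.
Let C0 : 0 < C. Proof. by rewrite divr_gt0// addr_gt0// expR_gt0. Qed.
Let CS : `|S| < C.
Proof.
rewrite -(ltr_pXn2r (n := 2))// ?nnegrE ?normr_ge0//; last exact: ltW.
by rewrite real_normK ?num_real// -subr_gt0 D0.
Qed.
Let zpos x : 0 < z x. Proof. by rewrite sqrtr_gt0 z0_arg_gt0. Qed.
Let zn0 x : z x != 0. Proof. by rewrite gt_eqF. Qed.
Let zsqr x : z x ^+ 2 = 1 + x ^+ 2 + y ^+ 2.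
Proof. by rewrite sqr_sqrtr// ltW// z0_arg_gt0. Qed.
Let zle x : `|x| <= z x.
Proof. by rewrite -sqrtr_sqr ler_wsqrtr// [1 + _]addrC -addrA lerDl addr_ge0// sqr_ge0. Qed.
Let zlip x x' : `|z x - z x'| <= `|x - x'|.
Proof.
have zz : 0 < z x + z x' by rewrite addr_gt0.
rewrite -(ler_pM2r zz) -[X in _ * X]gtr0_norm// -normrM.
have -> : (z x - z x') * (z x + z x') = (x - x') * (x + x').
  by transitivity (z x ^+ 2 - z x' ^+ 2); [ring|rewrite !zsqr; ring].
rewrite normrM ler_wpM2l// (le_trans (ler_normD _ _))//; exact: (lerD (zle _) (zle _)).
Qed.

(** [z] is 1-Lipschitz and [|S| < C], so the term [C x] prevails. *)
Let u_incr x x' : x < x' -> u x < u x'.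
Proof.
move=> xx; rewrite -subr_gt0.
have -> : u x' - u x = C * (x' - x) + S * (z x' - z x) by rewrite /u; ring.
have h := zlip x' x; have d0 : 0 < x' - x by rewrite subr_gt0.
rewrite (gtr0_norm d0) in h.
have : `|S * (z x' - z x)| <= `|S| * (x' - x) by rewrite normrM ler_wpM2l.
rewrite ler_norml => /andP[h1 _].
apply: (@lt_le_trans _ _ ((C - `|S|) * (x' - x))); first by rewrite mulr_gt0// subr_gt0.
by rewrite mulrBl lerD2l.
Qed.

Let u_bound x : `|u x - C * x| <= `|S| * (`|x| + z 0).
Proof.
have -> : u x - C * x = S * z x by rewrite /u; ring.
rewrite normrM ler_wpM2l// gtr0_norm// -lerBlDr (le_trans (ler_norm _))//.
by rewrite (le_trans (zlip _ _))// subr0.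
Qed.

Let u_pinfty : u n%:R @[n --> \oo] --> +oo.
Proof.
apply/cvgryPge => A; have CS0 : 0 < C - `|S| by rewrite subr_gt0.
near=> k.
have : (A + `|S| * z 0) / (C - `|S|) <= k%:R by near: k; exact: nbhs_infty_ger.
rewrite ler_pdivrMr// => hk.
have := u_bound k%:R; rewrite normr_nat ler_norml => /andP[+ _]; lra.
Unshelve. all: end_near. Qed.

Let u_ninfty : u (- n%:R) @[n --> \oo] --> -oo.
Proof.
apply/cvgrNyPle => A; have CS0 : 0 < C - `|S| by rewrite subr_gt0.
near=> k.
have : (`|S| * z 0 - A) / (C - `|S|) <= k%:R by near: k; exact: nbhs_infty_ger.
rewrite ler_pdivrMr// => hk.
have := u_bound (- k%:R); rewrite normrN normr_nat ler_norml => /andP[_]; lra.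
Unshelve. all: end_near. Qed.

Let dz x : is_derive x (1 : R) z (x / z x).
Proof.
have h := is_derive1_sqrt (z0_arg_gt0 x y).
have d1 : is_derive x (1 : R) (fun x : R => 1 + x ^+ 2 + y ^+ 2) (x + x).
  by apply: is_derive_eq; rewrite /GRing.scale/=; ring.
have := @is_derive1_comp _ (@Num.sqrt R) (fun x => 1 + x ^+ 2 + y ^+ 2) x _ _ h d1; congr (is_derive _ _ _ _).
by rewrite -/(z x); have := zn0 x; move: (z x) => w w0; field.
Qed.

Let du x : is_derive x (1 : R) u (j0 x).
Proof.
have := dz x => dzx; rewrite /u; apply: is_derive_eq; rewrite /GRing.scale/= /j0.
by have := zn0 x; move: (z x) => w w0; field.
Qed.

Let dm x : is_derive x (1 : R) m (j1 x).
Proof.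
have dv : is_derive x (1 : R) (fun x => (z x)^-1) (- z x ^- 2 *: (x / z x)).
  exact: (is_deriveV (zn0 x) (dz x)).
have := is_deriveZ (- S) dv; congr (is_derive _ _ _ _).
  by apply: funext => v; rewrite -[LHS]/((- S) * (z v)^-1) mulNr.
by rewrite /GRing.scale/= /j1; have := zn0 x; move: (z x) => w w0; field.
Qed.

Let cz : continuous z. Proof. by move=> x; exact: is_derive_continuous (dz x). Qed.
Let cj0 : continuous j0.
Proof.
move=> x; apply: cvgM; last by apply: cvgV => //; exact: cz.
by apply: cvgD; apply: cvgM; [exact: cvg_cst|exact: cz|exact: cvg_cst|exact: cvg_id].
Qed.
Let cj1 : continuous j1.
Proof.
move=> x; apply: cvgM; first by apply: cvgM; [exact: cvg_cst|exact: cvg_id].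
apply: cvgV; first by rewrite expf_neq0.
by apply: (continuous_comp (f := z) (g := fun v : R => v ^+ 3)); [exact: cz|exact: exprn_continuous].
Qed.

Let cber (A : E) : continuous (fun v => ber l (val (A * Psi v))).
Proof. move=> v; exact: is_derive_continuous (is_derive_ber_exp l A T P (H i i) v). Qed.

Lemma gauss_line (f : config -> R) : gauss_bounded a f -> exists (K e : R),
  [/\ 0 <= K, 0 < e & forall x, `|f (setX c i x)| <= K * expR (- (e * x ^+ 2))].
Proof.
move=> [_ [K [e [K0 e0 fK]]]]; exists K, e; split=> // x.
rewrite (le_trans (fK _ (setX_a x)))// ler_wpM2l// ler_expR lerN2 ler_wpM2l ?(ltW e0)//.
by apply: le_trans (le_nrm i (setX_a x)); rewrite setX_i/= lerDl sqr_ge0.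
Qed.

Lemma integrable_line (f : config -> R) : gauss_bounded a f ->
  continuous (fun x => f (setX c i x)) -> mu.-integrable setT (fun x => (f (setX c i x))%:E).
Proof.
move=> /gauss_line[K [e [K0 e0 fK]]] cf.
have ig : mu.-integrable setT (fun x => (expR (- (e * x ^+ 2)))%:E).
  have mg : measurable_fun setT (fun x : R => expR (- (e * x ^+ 2))).
    apply: measurableT_comp => //; apply: measurable_funN; apply: measurable_funM => //.
  apply/integrableP; split; first exact/measurable_EFinP.
  under eq_integral do rewrite gee0_abs ?lee_fin ?expR_ge0//.
  have e2 : 0 < 2 * e by rewrite mulr_gt0.
  rewrite (_ : (\int[mu]_x _)%E = (Num.sqrt (2 * pi / (2 * e)))%:E) ?ltry//.
  rewrite -(integral_gauss1 0 e2); apply: eq_integral => x _.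
  by rewrite addr0 -mulrA mulKf.
apply: (le_integrable measurableT _ _ (integrableZl measurableT K ig)).
  by apply/measurable_EFinP; exact: continuous_measurable_fun.
move=> x _; rewrite -EFinM lee_fin (le_trans (fK x))//; exact: ler_norm.
Qed.

Lemma cvg0_line (f : config -> R) : gauss_bounded a f ->
  f (setX c i n%:R) @[n --> \oo] --> (0 : R) /\ f (setX c i (- n%:R)) @[n --> \oo] --> (0 : R).
Proof.
move=> /gauss_line[K [e [K0 e0 fK]]].
(* The factor is such that [k + 1 <= 2 * (1 + e^-1) * (1 + e * k ^+ 2)], and the last parenthesis is
   at most [expR (e * k ^+ 2)]. *)
pose D := K * (2 * (1 + e^-1)).
have bnd (x : R) (k : nat) : x ^+ 2 = k%:R ^+ 2 -> `|f (setX c i x)| <= D * harmonic k.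
  move=> xk; rewrite (le_trans (fK x))// xk /D -mulrA ler_wpM2l// expRN /harmonic/=.
  have k0 : (0 : R) <= k%:R by [].
  have ek : 1 + e * k%:R ^+ 2 <= expR (e * k%:R ^+ 2) by exact: expR_ge1Dx.
  have pe : 0 < expR (e * k%:R ^+ 2) by exact: expR_gt0.
  rewrite -[X in X <= _]mul1r ler_pdivrMr// mulrAC ler_pdivlMr ?ltr0n// mul1r.
  apply: (@le_trans _ _ (2 * (1 + e^-1) * (1 + e * k%:R ^+ 2))); last first.
    by rewrite ler_wpM2l// mulr_ge0// addr_ge0// invr_ge0 ltW.
  have -> : 2 * (1 + e^-1) * (1 + e * k%:R ^+ 2) =
    2 + 2 * k%:R ^+ 2 + 2 * e^-1 + 2 * (e * k%:R ^+ 2) :> R.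
    by field; rewrite gt_eqF.
  have h1 : 0 <= e^-1 by rewrite invr_ge0 ltW.
  have h2 : 0 <= e * k%:R ^+ 2 by rewrite mulr_ge0 ?sqr_ge0// ltW.
  by rewrite -natr1; move: (k%:R) k0 h2 => t t0 h2; have := sqr_ge0 (t - 1); nra.
have lim (p : nat -> R) : (forall k, p k ^+ 2 = k%:R ^+ 2) ->
    f (setX c i (p n)) @[n --> \oo] --> (0 : R).
  move=> hp; apply/norm_cvg0P.
  apply: (squeeze_cvgr (f := fun=> 0) (h := fun k => D * harmonic k)).
  - by near=> k; rewrite normr_ge0 bnd.
  - exact: cvg_cst.
  - by rewrite -[X in _ --> X](mulr0 D); apply: cvgM; [exact: cvg_cst|exact: cvg_harmonic].
split; apply: lim => k //; exact: sqrrN.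
Unshelve. all: end_near. Qed.

Lemma tameE_jac sg j : tameE a (fun c => jacE a sg c j).
Proof.
apply: tameED; last (apply: tameEM; last exact: tameE_cst); apply: tameE_evc.
  by apply: tameM; [exact: tame_zeta|exact: tame_z0V].
apply: (tame_eq (f := fun c => sinh (sg j) * (c j).1 * (z0 c j)^-1 ^+ 3)) => [|c'].
  apply: tameM; last by apply: tameX; exact: tame_z0V.
  by apply: tameM; [exact: tame_cst|exact: (tame_coord R a j).1].
by rewrite exprVn.
Qed.

Lemma gauss_KE sg : gauss_bounded a (KE l sg).
Proof. by apply: gauss_ber => //; apply: tameE_prod => j _; exact: tameE_jac. Qed.

Lemma KE_line_continuous : continuous (fun x => KE l sigma (setX c i x)).
Proof.
rewrite (_ : (fun x => _) = fun x => j0 x * ber l (val (A1 * Psi (u x)))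
  + j1 x * ber l (val (A1 * n * Psi (u x)))
  + j0 x * m x * ber l (val (A1 * n * (- (evc G (H i i * u x) + P)) * Psi (u x)))); last first.
  by apply: funext => x; rewrite KE_setX.
have third x : ber l (val (A1 * n * (- (evc G (H i i * u x) + P)) * Psi (u x))) =
   - (H i i * u x) * ber l (val (A1 * n * Psi (u x))) - ber l (val (A1 * n * P * Psi (u x))).
  exact: ber_minus.
have cu : continuous u by move=> x; exact: is_derive_continuous (du x).
have cm : continuous m by move=> x; exact: is_derive_continuous (dm x).
have cb (A : E) : continuous (fun x => ber l (val (A * Psi (u x)))).
  by move=> x; apply: (continuous_comp (f := u) (g := fun v => ber l (val (A * Psi v)))); [exact: cu|exact: cber].
have c3 : continuous (fun x => ber l (val (A1 * n * (- (evc G (H i i * u x) + P)) * Psi (u x)))).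
  rewrite (_ : (fun x => _) = fun x => - (H i i * u x) * ber l (val (A1 * n * Psi (u x)))
    - ber l (val (A1 * n * P * Psi (u x)))); last by apply: funext => x; exact: third.
  move=> x; apply: cvgB; last exact: cb.
  apply: cvgM; last exact: cb.
  by apply: cvgN; apply: cvgM; [exact: cvg_cst|exact: cu].
move=> x; apply: cvgD; first apply: cvgD.
- by apply: cvgM; [exact: cj0|exact: cb].
- by apply: cvgM; [exact: cj1|exact: cb].
- apply: cvgM; first by apply: cvgM; [exact: cj0|exact: cm].
  exact: c3.
Qed.

(** [integral_change] with the substitution [u], whose derivative is [j0]. By [KE_setX] and
    [KE0_setX], what remains after subtracting the substituted integrand are the two nilpotent
    terms. They are the derivative of [V]: one comes from [m' = j1], the other from differentiating
    [Psi (u x)]. *)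
Lemma site_line : (\int[mu]_x (KE l sigma (setX c i x))%:E =
  \int[mu]_x (KE l (unboost sigma i) (setX c i x))%:E)%E.
Proof.
have cG : continuous (fun x => KE l (unboost sigma i) (setX c i x)).
  rewrite (_ : (fun x => _) = fun x => ber l (val (A1 * Psi x))) ?funeqE//; exact: cber.
have ck := KE_line_continuous.
have gV : gauss_bounded a (fun c' => ber l (val ((\prod_(j in I | j != i) jacE a sigma c' j *
    (evc G (m0 sigma c' i) * n)) * eexp (totE a H sigma c')))).
  apply: gauss_ber => //; apply: tameEM; first by apply: tameE_prod => j _; exact: tameE_jac.
  apply: tameEM; last exact: tameE_cst.
  by apply: tameE_evc; apply: tameN; apply: tameM; [exact: tame_cst|exact: tame_z0V].
have VE' x : V x = ber l (val ((\prod_(j in I | j != i) jacE a sigma (setX c i x) j *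
    (evc G (m0 sigma (setX c i x) i) * n)) * eexp (totE a H sigma (setX c i x)))).
  have -> : m0 sigma (setX c i x) i = m x by rewrite /m0 /z0 setX_i.
  have -> // : \prod_(j in I | j != i) jacE a sigma (setX c i x) j = A1.
  by apply: eq_bigr => j /andP[_ ji]; rewrite /jacE /zeta /z0 setX_neq.
have [V1 V2] := cvg0_line gV.
apply: (@integral_change R (fun x => KE l (unboost sigma i) (setX c i x))
  (fun x => KE l sigma (setX c i x)) u V).
- exact: cG.
- exact: integrable_line (gauss_KE _) cG.
- exact: ck.
- exact: integrable_line (gauss_KE _) ck.
- exists j0; split=> // x.
  have dl := is_derive_ber_exp l (A1 * n) T P (H i i) (u x).
  have := is_deriveM (dm x) (is_derive1_comp dl (du x)); congr (is_derive _ _ _ _).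
    by apply: funext => v; rewrite VE.
  rewrite KE_setX KE0_setX /GRing.scale/= -/(Psi (u x)).
  set b1 := ber _ _; set b2 := ber _ _; set b3 := ber _ _.
  ring.
- exact: u_incr.
- exact: u_pinfty.
- exact: u_ninfty.
- by apply: cvg_trans V1; apply: near_eq_cvg; near=> k; rewrite VE'.
- by apply: cvg_trans V2; apply: near_eq_cvg; near=> k; rewrite VE'.
Unshelve. all: end_near. Qed.

End Line.

End SiteChange.

(** * The superintegral of a test function *)

Section Evaluation.
Variables (R : realType) (Lambda : finType) (a : Lambda) (H : Lambda -> Lambda -> R).
Hypothesis H_sym : forall i j, H i j = H j i.
Hypothesis H_dom : forall i, i != a -> 1 + \sum_(j | j != i) `|H i j| <= H i i.
Local Notation mu := (@lebesgue_measure R).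
Local Notation G := (fermion Lambda).
Local Notation gr := (grassmann R G).
Local Notation E := (evenG R G).
Local Notation config := (Lambda -> R * R).
Local Notation I := (~: [set a])%SET.
Local Notation conf := (@conf R Lambda a).
Local Notation nu := (planes_lebesgue R #|I|).
Implicit Types (i j : Lambda) (sigma : Lambda -> R) (l : seq Lambda).

Definition config_of (c : nat -> R * R) : config :=
  fun j => if j \in I then c (index j (enum I)) else (0, 0).

Lemma config_of_a c : config_of c a = (0, 0).
Proof. by rewrite /config_of !inE eqxx. Qed.

Lemma config_of_setx (c : nat -> R * R) i x : i \in I ->
  config_of (setx c (index i (enum I)) x) = setX (config_of c) i x.
Proof.
move=> iI; apply: funext => j; rewrite /config_of /setX /setx.
have [->|ji] := eqVneq j i; first by rewrite iI eqxx.
case: ifP => // jI; rewrite ifN//; apply: contraNneq ji => e.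
by rewrite -(nth_index a (s := enum I) (x := j)) ?mem_enum// e nth_index// mem_enum.
Qed.

(** By [site_line] the two integrands have the same integral along every line in the direction
    [x_i]; Fubini is applied to their difference. *)
Lemma site_change l sigma i : i != a ->
  (\int[nu]_w (KE a H l sigma (conf w))%:E = \int[nu]_w (KE a H l (unboost sigma i) (conf w))%:E)%E.
Proof.
move=> ia; have iI : i \in I by rewrite !inE.
have i1 := integrable_gauss (gauss_KE H_sym H_dom l sigma).
have i2 := integrable_gauss (gauss_KE H_sym H_dom l (unboost sigma i)).
pose F (c : nat -> R * R) := KE a H l sigma (config_of c) - KE a H l (unboost sigma i) (config_of c).
have iF : nu.-integrable setT (fun w => (F (planes_coord w))%:E).
  exact: (eq_integrable measurableT _ _ (fun w _ => erefl) (integrableB measurableT i1 i2)).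
have lt : (index i (enum I) < #|I|)%N by rewrite cardE index_mem mem_enum.
have F0 := integral_partial_eq0 lt iF.
have ci c := config_of_a c.
have sub0 (x y : \bar R) : (x \is a fin_num)%E -> (y \is a fin_num)%E -> (x - y = 0)%E -> x = y.
  by move: x y => [x| |] [y| |]// _ _ []/eqP; rewrite subr_eq0 => /eqP ->.
apply: sub0; [exact: (integrable_fin_num measurableT i1)|exact: (integrable_fin_num measurableT i2)|].
have F0' : (forall c, \int[mu]_x (F (setx c (index i (enum I)) x))%:E = 0)%E ->
    (\int[nu]_w ((KE a H l sigma (conf w))%:E - (KE a H l (unboost sigma i) (conf w))%:E) = 0)%E.
  by move=> /F0 <-.
rewrite -(integralB measurableT i1 i2); apply: F0' => c.
have l1 := integrable_line (ci c) ia (gauss_KE H_sym H_dom l sigma)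
  (@KE_line_continuous R Lambda a H H_sym l sigma (config_of c) i ia).
have l2 := integrable_line (ci c) ia (gauss_KE H_sym H_dom l (unboost sigma i))
  (@KE_line_continuous R Lambda a H H_sym l (unboost sigma i) (config_of c) i ia).
transitivity (\int[mu]_x ((KE a H l sigma (setX (config_of c) i x))%:E
    - (KE a H l (unboost sigma i) (setX (config_of c) i x))%:E))%E.
  by apply: eq_integral => x _; rewrite /F config_of_setx.
have e := site_line H_sym H_dom l sigma (ci c) ia.
have f2 := integrable_fin_num measurableT l2.
exact: (etrans (integralB measurableT l1 l2) (etrans (congr1 (fun z => z - _)%E e) (subee f2))).
Qed.

(** The boost that cannot be removed: the spin at [a] is pinned and not integrated, so no change of
    variables is available there. *)
Definition boost_root (s : R) : Lambda -> R := fun j => if j == a then s else 0.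

Lemma integral_boost_root l s :
  (\int[nu]_w (KE a H l (fun=> s) (conf w))%:E = \int[nu]_w (KE a H l (boost_root s) (conf w))%:E)%E.
Proof.
have -> : boost_root s = foldr (fun i sg => unboost sg i) (fun=> s) (enum I).
  have fE (r : seq Lambda) j :
      foldr (fun i sg => unboost sg i) (fun=> s) r j = if j \in r then 0 else s.
    by elim: r => [//|i r IH] /=; rewrite /unboost inE IH; case: (j == i).
  by apply: funext => j; rewrite fE mem_enum !inE /boost_root; case: (j == a).
have : all (fun i => i != a) (enum I) by apply/allP => i; rewrite mem_enum !inE.
move: (enum I) => r0; elim: r0 => [_|i r IH]; first by [].
move=> /andP[ia /IH e]; exact: (etrans e (site_change l _ ia)).
Qed.

(** The two fermionic terms of each pair are equal after summation, by the symmetry of [H], which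
    compensates the factor 1/2. At [a] only the number [sinh s] survives, and elsewhere the boosted
    [x] is [x] itself, so that body and fermions separate. *)
Lemma tot_boost_root s c : c a = (0, 0) -> totE a H (boost_root s) c =
  evc G (- (2^-1 * (\sum_i \sum_j H i j
    + \sum_i \sum_j H i j * (dfwith (fun j => (c j).1) a (sinh s) i * dfwith (fun j => (c j).1) a (sinh s) j)
    + \sum_i \sum_j H i j * ((c i).2 * (c j).2)))) + bilsum (enum I) H.
Proof.
move=> ca; set X := dfwith _ _ _.
have XEE i : XE a (boost_root s) c i = evc G (X i).
  rewrite /XE /boost_root /x0' /m0 /X; case: eqP => [->|/eqP ia].
    rewrite dfwithin /bilp eqxx/= mulr0 addr0 /z0 ca/= expr0n/= !addr0 sqrtr1.
    by rewrite mulr0 add0r mulr1.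
  rewrite dfwithout 1?eq_sym// cosh0 sinh0 !mul0r oppr0 rmorph0 mul0r !addr0.
  by rewrite mul1r.
have -> : totE a H (boost_root s) c =
  - (evc G 2^-1 * \sum_i \sum_j evc G (H i j * (1 + X i * X j + (c i).2 * (c j).2)))
  + evc G 2^-1 * (\sum_i \sum_j (evc G (H i j) * bilp R a i j + evc G (H j i) * bilp R a j i)).
  rewrite /totE -mulrN -mulrN -mulrDr; congr (_ * _); rewrite -sumrN -sumrN -big_split/=.
  apply: eq_bigr => i _; rewrite -sumrN -sumrN -big_split/=; apply: eq_bigr => j _.
  rewrite !XEE [evc G (H i j * (1 + _ + _))]evcM (H_sym j i).
  have -> : evc G (1 + X i * X j + (c i).2 * (c j).2) =
    1 + evc G (X i) * evc G (X j) + evc G ((c i).2 * (c j).2).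
    have evcD p q : evc G (p + q) = evc G p + evc G q :> E by exact: rmorphD.
    have -> : evc G (1 + X i * X j + (c i).2 * (c j).2) =
        evc G 1 + evc G (X i * X j) + evc G ((c i).2 * (c j).2) by rewrite !evcD.
    by rewrite [evc G (X i * X j)]evcM rmorph1.
  exact: shuffle_tot.
congr (_ + _).
  have -> (u : R) : evc G (- (2^-1 * u)) = - (evc G 2^-1 * evc G u) by rewrite -evcM; exact: (rmorphN (evc G)).
  congr (- (_ * _)).
  have evc_sum (F : Lambda -> R) : \sum_i evc G (F i) = evc G (\sum_i F i) by rewrite rmorph_sum.
  under eq_bigr do rewrite evc_sum.
  rewrite evc_sum; congr (evc G _); rewrite -!big_split/=; apply: eq_bigr => i _.
  by rewrite -!big_split/=; apply: eq_bigr => j _; ring.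
have -> : \sum_i \sum_j (evc G (H i j) * bilp R a i j + evc G (H j i) * bilp R a j i) =
   evc G 2 * \sum_i \sum_j (evc G (H i j) * bilp R a i j).
  under eq_bigr do rewrite big_split/=.
  rewrite big_split/= [X in _ + X]exchange_big/= -mulr2n.
  have -> : evc G (2 : R) = 2%:R by exact: (rmorph_nat (evc G)).
  by rewrite mulr_natl.
rewrite mulrA -evcM mulVf ?rmorph1 ?mul1r//.
rewrite (bigD1 a)//= big1 ?add0r => [|j _]; last by rewrite /bilp eqxx mulr0.
rewrite /bilsum big_enum/=; apply: eq_big => [i|i ia]; first by rewrite !inE.
rewrite (bigD1 a)//= /bilp eqxx orbT mulr0 add0r big_enum/=.
apply: eq_big => [j|j ja]; first by rewrite !inE.
by rewrite (negPf ia) (negPf ja).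
Qed.

Lemma KE_boost_root s c : c a = (0, 0) -> KE a H (enum I) (boost_root s) c =
  expR (- (2^-1 * (\sum_i \sum_j H i j
    + \sum_i \sum_j H i j * (dfwith (fun j => (c j).1) a (sinh s) i * dfwith (fun j => (c j).1) a (sinh s) j)
    + \sum_i \sum_j H i j * ((c i).2 * (c j).2)))) * detl (enum I) H.
Proof.
move=> ca; rewrite /KE tot_boost_root// eexpD eexpC.
rewrite big1 => [|i iI]; last first.
  have ia : i != a by move: iI; rewrite !inE.
  rewrite /jacE /zeta /boost_root (negPf ia) cosh0 sinh0 !mul0r addr0 mul1r divff ?z0_neq0//.
  by rewrite rmorph1 rmorph0 mul0r addr0.
rewrite mul1r val_evcM berZ ber_exp_bilsum//; first exact: enum_uniq.
exact: posdef_dominant.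
Qed.

Lemma qform_vanish (v : Lambda -> R) : v a = 0 ->
  \sum_i \sum_j H i j * (v i * v j) = qform (enum I) H v.
Proof.
move=> va; rewrite (bigD1 a)//= big1 ?add0r => [|j _]; last by rewrite va mul0r mulr0.
rewrite /qform big_enum/=; apply: eq_big => [j|j ja]; first by rewrite !inE.
rewrite (bigD1 a)//= va !mulr0 add0r big_enum/=.
by apply: eq_bigl => k; rewrite !inE.
Qed.

Section Spectral.
Variables (psi : Lambda -> R) (h : R).
Hypotheses (psi_a : psi a = 1) (psi_harm : forall i, i != a -> \sum_j H i j * psi j = 0)
  (h_def : \sum_j H a j * psi j = - h).

(** [H psi] is supported at [a], so [psi] is orthogonal for [H] to all vectors vanishing at [a], and
    [x] is the sum of such a vector and [S psi]. *)
Lemma complete_square (x : Lambda -> R) (S : R) : x a = S ->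
  \sum_i \sum_j H i j * (x i * x j) = qform (enum I) H (fun j => x j - S * psi j) - h * S ^+ 2.
Proof.
move=> xa; pose v j := x j - S * psi j.
have va : v a = 0 by rewrite /v psi_a mulr1 xa subrr.
rewrite -(qform_vanish va).
have lin (w : Lambda -> R) : \sum_i w i * (\sum_j H i j * psi j) = - h * w a.
  rewrite (bigD1 a)//= h_def big1 ?addr0 1?mulrC// => i ia.
  by rewrite psi_harm ?mulr0.
have -> : \sum_i \sum_j H i j * (x i * x j) =
   \sum_i \sum_j H i j * (v i * v j) + \sum_i (2 * S * v i) * (\sum_j H i j * psi j)
   + \sum_i (S ^+ 2 * psi i) * (\sum_j H i j * psi j).
  have -> : \sum_i (2 * S * v i) * (\sum_j H i j * psi j) =
    \sum_i \sum_j H i j * (S * (v i * psi j)) + \sum_i \sum_j H i j * (S * (v j * psi i)).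
    rewrite [X in _ = _ + X]exchange_big/= -big_split/=; apply: eq_bigr => i _.
    rewrite mulr_sumr -big_split/=; apply: eq_bigr => j _; rewrite (H_sym j i); ring.
  rewrite -!big_split/=; apply: eq_bigr => i _; rewrite mulr_sumr -!big_split/=.
  by apply: eq_bigr => j _; rewrite /v; ring.
by rewrite !lin va psi_a; ring.
Qed.

(** The fermions contribute [detl] and the bosons its inverse. Centring the Gaussian at
    [sinh s * psi] leaves the factor [e^(h sinh^2 s / 2)] of [complete_square]. *)
Theorem integral_KE s : (\int[nu]_w (KE a H (enum I) (fun=> s) (conf w))%:E =
  (expR (- (2^-1 * \sum_i \sum_j H i j) + 2^-1 * h * sinh s ^+ 2) * (2 * pi) ^+ #|I|)%:E)%E.
Proof.
rewrite integral_boost_root.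
have sz : size (enum I) = #|I| by rewrite -cardE.
have pd := posdef_dominant H_sym H_dom.
have dp := detl_gt0 H_sym (enum_uniq _) pd.
have HG := integral_gaussian_planes (fun j => - (sinh s * psi j)) sz H_sym (enum_uniq _) pd.
pose K := expR (- (2^-1 * \sum_i \sum_j H i j) + 2^-1 * h * sinh s ^+ 2) * detl (enum I) H.
transitivity (K%:E * ((2 * pi) ^+ #|I| / detl (enum I) H)%:E)%E; last first.
  by rewrite -EFinM /K; congr (_%:E); field; rewrite gt_eqF.
pose g (w : planes R #|I|) : R := expR (- (2^-1 * (qform (enum I) H (fun j => (planes_coord w (index j (enum I))).1
  + - (sinh s * psi j)) + qform (enum I) H (fun j => (planes_coord w (index j (enum I))).2)))).
rewrite -HG -[X in (_ * X)%E]/(\int[nu]_w (g w)%:E)%E.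
have K0 : 0 < K by rewrite mulr_gt0// expR_gt0.
have pw w : KE a H (enum I) (boost_root s) (conf w) = K * g w.
  rewrite KE_boost_root ?conf_a// /K mulrAC -expRD; congr (expR _ * _).
  rewrite (@complete_square _ (sinh s)) ?dfwithin//.
  rewrite (@qform_vanish (fun j => (conf w j).2)) ?conf_a//.
  have -> : qform (enum I) H (fun j => dfwith (fun j => (conf w j).1) a (sinh s) j - sinh s * psi j) =
      qform (enum I) H (fun j => (planes_coord w (index j (enum I))).1 + - (sinh s * psi j)).
    have e j : j \in enum I -> dfwith (fun j => (conf w j).1) a (sinh s) j =
      (planes_coord w (index j (enum I))).1.
      rewrite mem_enum => jI; rewrite dfwithout; first by rewrite /conf /update_config jI.
      by move: jI; rewrite !inE eq_sym.
    by apply: eq_big_seq => j jI; apply: eq_big_seq => k kI; rewrite !e.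
  have -> : qform (enum I) H (fun j => (conf w j).2) =
      qform (enum I) H (fun j => (planes_coord w (index j (enum I))).2).
    have e j : j \in enum I -> (conf w j).2 = (planes_coord w (index j (enum I))).2.
      by rewrite mem_enum => jI; rewrite /conf /update_config jI.
    by apply: eq_big_seq => j jI; apply: eq_big_seq => k kI; rewrite !e.
  by move: (qform _ _ _) (qform _ _ _) => p q; field.
have gE : g = fun w => K^-1 * KE a H (enum I) (boost_root s) (conf w).
  by apply: funext => w; rewrite pw mulrA mulVf ?mul1r// gt_eqF.
have mg : measurable_fun setT (fun w => (g w)%:E).
  apply/measurable_EFinP; rewrite gE; apply: measurable_funM => //.
  by case: (gauss_KE H_sym H_dom (enum I) (boost_root s)).
have g0 w : setT w -> (0 <= (g w)%:E)%E by move=> _; rewrite lee_fin expR_ge0.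
rewrite -(ge0_integralZl _ measurableT mg g0) ?lee_fin ?ltW//.
by apply: eq_integral => w _; rewrite pw EFinM.
Qed.

End Spectral.

End Evaluation.

(** * Continuity and measurability for finitely many coordinates *)

Lemma cvg_ptws (I : Type) (V : topologicalType) (F : set_system {ptws I -> V}) (f : {ptws I -> V}) :
  Filter F -> (forall i, (fun g => g i) @ F --> f i) -> F --> f.
Proof.
move=> FF Ff; apply/cvg_sup => i A; rewrite nbhsE => -[B [oB Bf] BA].
apply: filterS BA _; case: oB Bf => O oO <- Of.
exact: (Ff i O (open_nbhs_nbhs (conj oO Of))).
Qed.

Lemma continuous_ptws (I : Type) (V T : topologicalType) (f : T -> {ptws I -> V}) :
  (forall i, continuous (fun x => f x i)) -> continuous f.
Proof. by move=> cf x; apply: cvg_ptws => i; exact: cf. Qed.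

Section ContinuousOfMeasurable.
Variables (R : realType) (I : finType) (d : measure_display) (T : measurableType d).

Definition grid (n : nat) (x : R) : R := (Num.floor (n.+1%:R * x))%:~R / n.+1%:R.

Lemma grid_bounds n x : 0 <= x - grid n x <= harmonic n.
Proof.
have n0 : (0 : R) < n.+1%:R by [].
have h1 := floor_le (n.+1%:R * x); have h2 := floorD1_gt (n.+1%:R * x).
rewrite intrD in h2; rewrite /grid /harmonic/=; apply/andP; split.
  by rewrite subr_ge0 ler_pdivrMr// [leRHS]mulrC.
rewrite -(ler_pM2r n0) mulrBl divfK ?mulVf ?gt_eqF// mulrC lerBlDr.
by rewrite addrC ltW.
Qed.

Lemma cvg_grid x : grid n x @[n --> \oo] --> x.
Proof.
have h : (x - grid n x) @[n --> \oo] --> (0 : R).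
  apply: (squeeze_cvgr (f := fun=> 0) (h := @harmonic R)).
  - by near=> n; exact: grid_bounds.
  - exact: cvg_cst.
  - exact: cvg_harmonic.
have -> : grid^~ x = fun n => x - (x - grid n x) by apply: funext => n; ring.
by rewrite -[X in _ --> X]subr0; apply: cvgB => //; exact: cvg_cst.
Unshelve. all: end_near. Qed.

(** Rounding the coordinates to a grid leaves countably many values, and continuity lets the grid be
    refined. This avoids comparing the Borel sets of the pointwise topology with the product
    sigma-algebra. *)
Lemma measurable_continuous_ptws (h : (I -> R) -> R) (f : T -> I -> R) :
  continuous (h : {ptws I -> R} -> R) -> (forall i, measurable_fun setT (fun t => f t i)) ->
  measurable_fun setT (fun t => h (f t)).
Proof.
move=> ch mf.
apply: (@measurable_fun_cvg _ _ _ _ (fun n t => h (fun i => grid n (f t i)))) => [n|t _]; last first.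
  apply: (@continuous_cvg _ _ _ _ _ (fun n => (fun i => grid n (f t i)) : {ptws I -> R}) h (f t)).
    exact: ch.
  by apply: cvg_ptws => i; exact: cvg_grid.
move=> _ Y mY; rewrite setTI.
pose D (k : {ffun I -> int}) : set T := \bigcap_(i in [set: I]) [set t | Num.floor (n.+1%:R * f t i) = k i].
pose v (k : {ffun I -> int}) : I -> R := fun i => (k i)%:~R / n.+1%:R.
have -> : (fun t => h (fun i => grid n (f t i))) @^-1` Y =
   \bigcup_(k : {ffun I -> int}) ([set t | Y (h (v k))] `&` D k).
  apply/seteqP; split=> t /=.
    move=> Yt; exists [ffun i => Num.floor (n.+1%:R * f t i)] => //; split=> /=.
      by move: Yt; congr (Y (h _)); apply: funext => i; rewrite /v ffunE.
    by move=> i _ /=; rewrite ffunE.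
  move=> [k _ [Yk Dk]]; move: Yk => /=; congr (Y (h _)).
  by apply: funext => i; rewrite /v /grid -(Dk i Logic.I).
apply: countable_bigcupT_measurable; first exact: countableP.
move=> k; apply: measurableI.
  have [Yk|Yk] := pselect (Y (h (v k))).
    by rewrite (_ : [set _ | _] = setT)//; apply/seteqP; split.
  by rewrite (_ : [set _ | _] = set0)//; apply/seteqP; split.
apply: fin_bigcap_measurable => [|i _]; first exact: finite_finset.
have -> : [set t | Num.floor (n.+1%:R * f t i) = k i] =
  (fun t => n.+1%:R * f t i) @^-1` `[(k i)%:~R, (k i + 1)%:~R[.
  by apply/seteqP; split=> t /=; rewrite in_itv/= -floor_eq => /eqP.
rewrite -[X in measurable X]setTI; apply: (measurable_funM _ (mf i)) => //.
Qed.

End ContinuousOfMeasurable.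

Section HarmonicVector.
Variables (R : realType) (Lambda : finType) (a : Lambda) (H : Lambda -> Lambda -> R).
Hypothesis H_sym : forall i j, H i j = H j i.
Hypothesis H_dom : forall i, i != a -> 1 + \sum_(j | j != i) `|H i j| <= H i i.

(** A discrete Dirichlet problem with boundary [a]. A solution of the homogeneous system is zero at
    [a] and has vanishing quadratic form, hence is zero everywhere by [quad_lower]. *)
Lemma exists_harmonic : exists psi : Lambda -> R, psi a = 1 /\
  forall i, i != a -> \sum_j H i j * psi j = 0.
Proof.
pose n := #|Lambda|.
(* Column [i] carries the equation at [i]; the column of [a] prescribes the value at [a] instead. *)
pose M : 'M[R]_n := \matrix_(j, i)
  if enum_val i == a then (enum_val j == a)%:R else H (enum_val i) (enum_val j).
have Munit : M \in unitmx.
  rewrite -row_free_unit -kermx_eq0; apply/rowV0P => v /sub_kermxP vM.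
  pose x (j : Lambda) := v ord0 (enum_rank j).
  have eqn (i : Lambda) : \sum_j x j * (if i == a then (j == a)%:R else H i j) = 0.
    have := congr1 (fun w : 'rV_n => w ord0 (enum_rank i)) vM; rewrite !mxE => e.
    rewrite -[RHS]e (reindex (@enum_val Lambda Lambda))/=; last first.
      by exists enum_rank => j _; rewrite ?enum_valK ?enum_rankK.
    by apply: eq_bigr => j _; rewrite !mxE /x enum_valK enum_rankK.
  have xa : x a = 0.
    have := eqn a; rewrite eqxx (bigD1 a)//= eqxx mulr1 big1 ?addr0// => j /negPf ->.
    by rewrite mulr0.
  have q0 : \sum_i \sum_j H i j * (x i * x j) = 0.
    apply: big1 => i _; have [->|ia] := eqVneq i a.
      by apply: big1 => j _; rewrite xa mul0r mulr0.
    have := eqn i; rewrite (negPf ia) => e.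
    have -> : \sum_j H i j * (x i * x j) = x i * \sum_j x j * H i j.
      by rewrite mulr_sumr; apply: eq_bigr => j _; ring.
    by rewrite e mulr0.
  have := quad_lower H_sym H_dom x; rewrite q0 xa expr0n/= mulr0 subr0 => s0.
  have s1 : \sum_(i in ~: [set a]%SET) x i ^+ 2 = 0.
    by apply/eqP; rewrite eq_le s0 sumr_ge0// => i _; exact: sqr_ge0.
  apply/rowP => j; rewrite mxE.
  have -> : v ord0 j = x (enum_val j) by rewrite /x enum_valK.
  have [->//|ja] := eqVneq (enum_val j) a.
  have /eqP := s1; rewrite psumr_eq0 => [/allP|i _]; last exact: sqr_ge0.
  move=> /(_ (enum_val j)); rewrite mem_index_enum !inE ja sqrf_eq0 => /(_ isT).
  by move/eqP.
pose w : 'rV[R]_n := delta_mx ord0 (enum_rank a) *m invmx M.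
have wM : w *m M = delta_mx ord0 (enum_rank a) by rewrite /w mulmxKV.
exists (fun j => w ord0 (enum_rank j)).
have eqn (i : Lambda) : \sum_j w ord0 (enum_rank j) * (if i == a then (j == a)%:R else H i j) =
    (i == a)%:R.
  have := congr1 (fun w : 'rV_n => w ord0 (enum_rank i)) wM; rewrite !mxE/= => e.
  transitivity ((enum_rank i == enum_rank a)%:R : R); last by rewrite (inj_eq enum_rank_inj).
  rewrite -e (reindex (@enum_val Lambda Lambda))/=; last first.
    by exists enum_rank => j _; rewrite ?enum_valK ?enum_rankK.
  by apply: eq_bigr => j _; rewrite !mxE enum_valK enum_rankK.
split.
  have := eqn a; rewrite eqxx (bigD1 a)//= eqxx mulr1 big1 ?addr0// => j /negPf ->.
  by rewrite mulr0.
move=> i ia; have := eqn i; rewrite (negPf ia) => e.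
by rewrite -[RHS]e; apply: eq_bigr => j _; rewrite mulrC.
Qed.

End HarmonicVector.

(** * Continuity of the superexpectation as a functional *)

Section Functional.
Variables (R : realType) (Lambda : finType) (a : Lambda) (beta H : Lambda -> Lambda -> R).
Hypothesis H_sym : forall i j, H i j = H j i.
Hypothesis H_dom : forall i, i != a -> 1 + \sum_(j | j != i) `|H i j| <= H i i.
Hypothesis H_beta : forall i j, i != j -> H i j = - beta i j.
Local Notation G := (fermion Lambda).
Local Notation E := (evenG R G).
Local Notation config := (Lambda -> R * R).
Local Notation I := (~: [set a])%SET.
Local Notation conf := (@conf R Lambda a).
Local Notation nu := (planes_lebesgue R #|I|).
Implicit Types (i j : Lambda) (c : config) (F : (Lambda -> R) -> R) (B : {set Lambda}).

Definition superexp_density (s : R) (g : (Lambda -> R) -> R) c : R :=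
  ber (enum I) (val (\prod_(i in I) zinvE a c i
    * jet (nuE a (fun=> s) c) (zeta (fun=> s) c) (rev (enum Lambda)) g * eexp (- hamE a beta c))).

Lemma superexp_pinnedE (s : R) g : superexp_pinned beta a (form_apply g (boost_z s)) =
  ((2 * pi) ^+ #|I|)^-1 * \int[nu]_w superexp_density s g (conf w).
Proof. exact: superexp_pinned_boost. Qed.

Definition quad_mul F (l : Lambda -> R) : R := expR (quad H l) * F l.

Definition jetF (s : R) F c := jet (nuE a (fun=> s) c) (zeta (fun=> s) c) (rev (enum Lambda)) F.

Lemma Cn_quad n : Cn n (quad H).
Proof.
apply: CnN; apply: CnZ; apply: Cn_sum => i _; apply: Cn_sum => j _.
by apply: CnZ; apply: CnM; exact: Cn_coord.
Qed.

Lemma superexp_density_quad (s : R) F c : Cn #|Lambda| F -> c a = (0, 0) ->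
  superexp_density s (quad_mul F) c =
  ber (enum I) (val (\prod_(i in I) zinvE a c i * jetF s F c * eexp (totE a H (fun=> s) c))).
Proof.
move=> CF ca; rewrite /superexp_density; congr (ber _ (val _)).
have ns i : nuE a (fun=> s) c i * nuE a (fun=> s) c i = 0 by exact: nuE_sqr.
have nb i : ebody (nuE a (fun=> s) c i) = 0 by exact: ebody_nuE.
set r := rev (enum Lambda).
have sr : size r = #|Lambda| by rewrite size_rev -cardE.
have ur : uniq r by rewrite rev_uniq enum_uniq.
have mr k : k \in r by rewrite mem_rev mem_enum.
have Cq : Cn (size r) (quad H) by exact: Cn_quad.
rewrite -sr in CF.
rewrite jetM//; last exact: Cn_exp.
rewrite jet_exp// -(total_exponent s H_beta ca) eexpD.
have -> : jet (nuE a (fun=> s) c) (zeta (fun=> s) c) r (quad H) =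
  - (evc G 2^-1 * \sum_i \sum_j evc G (H i j) *
      (thzE a (fun=> s) c i * thzE a (fun=> s) c j)).
  have Cs n i : Cn n (fun l : Lambda -> R => \sum_j H i j * (l i * l j)).
    by apply: Cn_sum => j _; apply: CnZ; apply: CnM; exact: Cn_coord.
  have Cs2 n : Cn n (fun l : Lambda -> R => \sum_i \sum_j H i j * (l i * l j)).
    by apply: Cn_sum.
  rewrite /quad jetN ?jetZ//; last by apply: CnZ.
  rewrite jet_sum//; congr (- (_ * _)); apply: eq_bigr => i _.
  rewrite jet_sum//; last by move=> j _; apply: CnZ; apply: CnM; exact: Cn_coord.
  apply: eq_bigr => j _; rewrite jetZ//; last by apply: CnM; exact: Cn_coord.
  by rewrite jetM ?jet_coord//; (exact: ns || exact: Cn_coord).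
rewrite -/(jetF s F c).
exact: shuffle_jet.
Qed.

(** Each factor [l i] turns into the boosted [z_i], which meets the density [1 / z_i] and gives the
    Jacobian. *)
Lemma superexp_density_prod (s : R) c : c a = (0, 0) ->
  superexp_density s (quad_mul (fun l => \prod_(i in I) l i)) c = KE a H (enum I) (fun=> s) c.
Proof.
move=> ca; rewrite superexp_density_quad//; last by apply: Cn_prod => i _; exact: Cn_coord.
have ns i : nuE a (fun=> s) c i * nuE a (fun=> s) c i = 0 by exact: nuE_sqr.
rewrite /KE; congr (ber _ (val (_ * _))).
rewrite /jetF jet_prod//; last by move=> i _; exact: Cn_coord.
rewrite -big_split/=; apply: eq_bigr => i _.
rewrite jet_coord//; last by rewrite mem_rev mem_enum.
  exact: zinv_thz.
by rewrite rev_uniq enum_uniq.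
Qed.

Definition sub_block B : seq Lambda := [seq i <- enum Lambda | i \in B].

(** The weight with which the derivative of [F] in the directions of [B] enters. It does not depend
    on [F]; this is what makes the superexpectation continuous for the bounds of [block_bounded]. *)
Definition block_weight (s : R) B c : R :=
  ber (enum I) (val (\prod_(i in I) zinvE a c i * \prod_(i in B) nuE a (fun=> s) c i
    * eexp (totE a H (fun=> s) c))).

(** The jet is expanded over sets of sites. Those containing [a] drop out, because the pinned form
    at [a] has no nilpotent part. *)
Lemma superexp_density_blocks (s : R) F c : Cn #|Lambda| F -> c a = (0, 0) ->
  superexp_density s (quad_mul F) c =
  \sum_(B : {set Lambda} | B \subset I) partials (sub_block B) F (zeta (fun=> s) c) * block_weight s B c.
Proof.
move=> CF ca; rewrite superexp_density_quad// /jetF.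
have ns i : nuE a (fun=> s) c i * nuE a (fun=> s) c i = 0 by exact: nuE_sqr.
have -> : jet (nuE a (fun=> s) c) (zeta (fun=> s) c) (rev (enum Lambda)) F =
  \sum_(B : {set Lambda} | B \subset I) evc G (partials (sub_block B) F (zeta (fun=> s) c))
    * \prod_(i in B) nuE a (fun=> s) c i.
  rewrite jet_subsets ?enum_uniq//= (bigID (fun B : {set Lambda} => B \subset I))/=.
  rewrite [X in _ + X]big1 ?addr0 => [|B /andP[_ BI]]; last first.
    have aB : a \in B.
      apply: contraNT BI => aB; apply/fintype.subsetP => i iB; rewrite !inE.
      by apply: contraNneq aB => <-.
    by rewrite (bigD1 a)//= /nuE /bilp eqxx mulr0 mul0r mulr0.
  apply: eq_bigl => B; rewrite andbC; case: (boolP (B \subset I)) => //= _.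
  by apply/fintype.subsetP => i _; rewrite inE mem_enum.
rewrite mulr_sumr mulr_suml val_evenG_sum ber_sum; apply: eq_bigr => B _.
rewrite /block_weight -berZ -val_evcM; congr (ber _ (val _)).
by rewrite [X in X * _]mulrCA -!mulrA.
Qed.

Lemma gauss_block_weight (s : R) B : gauss_bounded a (block_weight s B).
Proof.
apply: gauss_ber => //; apply: tameEM; apply: tameE_prod => i _.
  apply: tameED; last (apply: tameEM; last exact: tameE_cst); apply: tameE_evc; first exact: tame_z0V.
  by apply: tameX; exact: tame_z0V.
apply: tameEM; last exact: tameE_cst.
by apply: tameE_evc; apply: tameN; apply: tameM; [exact: tame_cst|exact: tame_z0V].
Qed.

Lemma zeta_ge1 (s : R) c i : 1 <= zeta (fun=> s) c i.
Proof.
have C0 : 0 < cosh s by rewrite divr_gt0// addr_gt0// expR_gt0.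
have D0 := cosh2_sinh2 s.
have zq := z0_gt0 c i; have zz := z0_sqr c i.
have zp : 0 <= zeta (fun=> s) c i.
  rewrite /zeta; move: C0 D0; move: (cosh s) (sinh s) => C S C0 D0.
  have : - (S * (c i).1) <= C * z0 c i.
    rewrite (le_trans (ler_norm _))// normrN -(ler_pXn2r (n := 2))// ?nnegrE ?normr_ge0//; last first.
      by rewrite mulr_ge0// ltW.
    rewrite real_normK ?num_real// !exprMn zz.
    have -> : C ^+ 2 = 1 + S ^+ 2 by rewrite -D0; ring.
    by have := sqr_ge0 S; have := sqr_ge0 (c i).1; have := sqr_ge0 (c i).2; nra.
  lra.
rewrite -(ler_pXn2r (n := 2))// ?nnegrE// expr1n x0_sqr -addrA lerDl addr_ge0// sqr_ge0//.
Qed.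

Lemma zeta_root (s : R) c : c a = (0, 0) -> zeta (fun=> s) c a = cosh s.
Proof. by move=> ca; rewrite /zeta /z0 ca/= expr0n/= !addr0 sqrtr1 mulr0 addr0 mulr1. Qed.

(** The interpolants used below are close to [F] only relative to a polynomial weight of this kind,
    which the Gaussian decay of the block weights can afford. *)
Definition weight (p : nat) (l : Lambda -> R) : R := \prod_(i in I) (1 + l i) ^+ p.

(** The bound is restricted to the points that occur as bodies of the boosted [z]: they are at least
    1 by [zeta_ge1], and equal to [cosh s] at the pinned site. *)
Definition block_bounded (s : R) (p : nat) (A : R) F := forall B, B \subset I -> forall l,
  l a = cosh s -> (forall i, 1 <= l i) -> `|partials (sub_block B) F l| <= A * weight p l.

Lemma tame_weight (s : R) p : tame a (fun c => weight p (zeta (fun=> s) c)).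
Proof.
have prodT (r : seq Lambda) : tame a (fun c => \prod_(i <- r | i \in I) (1 + zeta (fun=> s) c i) ^+ p).
  elim: r => [|i r IH]; first by under eq_fun do rewrite big_nil; exact: tame_cst.
  under eq_fun do rewrite big_cons; case: (i \in I) => //; apply: tameM => //.
  by apply: tameX; apply: tameD; [exact: tame_cst|exact: tame_zeta].
exact: prodT.
Qed.

Lemma weight_ge0 p l : (forall i, 1 <= l i) -> 0 <= weight p l.
Proof. by move=> l1; apply: prodr_ge0 => i _; rewrite exprn_ge0// addr_ge0// (le_trans _ (l1 i)). Qed.

Lemma measurable_partials (s : R) B F : Cn #|Lambda| F ->
  measurable_cfg a (fun c => partials (sub_block B) F (zeta (fun=> s) c)).
Proof.
move=> CF; apply: measurable_continuous_ptws => [|i]; last by case: (tame_zeta a (fun=> s) i).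
have sz : (size (sub_block B) <= #|Lambda|)%N by rewrite size_filter cardE count_size.
apply: (@Cn_continuous _ _ 0%N); apply: Cn_partials; rewrite addn0; exact: Cn_le CF.
Qed.

(** The density is dominated by [A * W], where [W] collects the absolute block weights multiplied by
    the permitted growth; [K] is the normalised integral of [W], hence the same for all [F]. *)
Lemma superexp_bound (s : R) p : exists2 K : R, 0 <= K & forall F A, Cn #|Lambda| F -> 0 <= A ->
  block_bounded s p A F ->
  nu.-integrable setT (fun w => (superexp_density s (quad_mul F) (conf w))%:E) /\
  `|((2 * pi) ^+ #|I|)^-1 * \int[nu]_w superexp_density s (quad_mul F) (conf w)| <= K * A.
Proof.
pose W c := \sum_(B : {set Lambda} | B \subset I) (weight p (zeta (fun=> s) c) * `|block_weight s B c|).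
have iB B : nu.-integrable setT (fun w => (weight p (zeta (fun=> s) (conf w)) * `|block_weight s B (conf w)|)%:E).
  apply: (integrable_gauss (f := fun c => weight p (zeta (fun=> s) c) * `|block_weight s B c|)).
  apply: gauss_boundedM; first exact: tame_weight.
  have [mb [C [e [C0 e0 bC]]]] := gauss_block_weight s B; split.
    by apply: measurableT_comp => //; exact: normr_measurable.
  by exists C, e; split=> // c ca; rewrite normr_id bC.
have iW : nu.-integrable setT (fun w => (W (conf w))%:E).
  have : nu.-integrable setT (fun w => \sum_(B : {set Lambda} | B \subset I)
    (weight p (zeta (fun=> s) (conf w)) * `|block_weight s B (conf w)|)%:E)%E.
    by apply: integrable_sum => // B _; exact: iB.
  apply: eq_integrable => // w _; by rewrite /W sumEFin.
exists (((2 * pi) ^+ #|I|)^-1 * \int[nu]_w W (conf w)).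
  rewrite mulr_ge0 ?invr_ge0 ?exprn_ge0 ?mulr_ge0 ?pi_ge0//.
  apply: Rintegral_ge0 => w _; apply: sumr_ge0 => B _; rewrite mulr_ge0//.
  by apply: weight_ge0 => i; exact: zeta_ge1.
move=> F A CF A0 FA.
have dom w : `|superexp_density s (quad_mul F) (conf w)| <= A * W (conf w).
  rewrite superexp_density_blocks ?conf_a// (le_trans (ler_norm_sum _ _ _))// /W mulr_sumr.
  apply: ler_sum => B BI; rewrite normrM mulrA ler_wpM2r//.
  by apply: FA => // [|i]; [rewrite zeta_root// conf_a|exact: zeta_ge1].
have mS : measurable_fun setT (fun w => superexp_density s (quad_mul F) (conf w)).
  have -> : (fun w => superexp_density s (quad_mul F) (conf w)) = fun w =>
    \sum_(B <- enum {set Lambda}) (if B \subset I then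
      partials (sub_block B) F (zeta (fun=> s) (conf w)) * block_weight s B (conf w) else 0).
    apply: funext => w; rewrite superexp_density_blocks ?conf_a//.
    by rewrite big_enum/= -big_mkcond.
  apply: measurable_sum => B; case: (B \subset I) => //.
  apply: measurable_funM; first exact: measurable_partials.
  by case: (gauss_block_weight s B).
have iAW := integrableZl measurableT A iW.
have iS : nu.-integrable setT (fun w => (superexp_density s (quad_mul F) (conf w))%:E).
  apply: (le_integrable measurableT _ _ iAW); first exact/measurable_EFinP.
  by move=> w _; rewrite -EFinM lee_fin (le_trans (dom w))// ler_norm.
split=> //.
rewrite normrM ger0_norm ?invr_ge0 ?exprn_ge0 ?mulr_ge0 ?pi_ge0// -mulrA.
rewrite ler_wpM2l ?invr_ge0 ?exprn_ge0 ?mulr_ge0 ?pi_ge0//.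
rewrite (le_trans (le_normr_Rintegral measurableT iS))// mulrC -RintegralZl//.
by apply: (le_Rintegral measurableT (integrable_norm iS) iAW) => w _; exact: dom.
Qed.

Lemma partialsB (r : seq Lambda) F F' : Cn (size r) F -> Cn (size r) F' ->
  partials r (fun l => F l - F' l) = fun l => partials r F l - partials r F' l.
Proof.
move=> CF CF'; elim: r CF CF' => [//|i r IH] CF CF' /=.
rewrite IH; try exact: CnS.
have C1 : Cn (size r + 1) F by rewrite addn1.
have C2 : Cn (size r + 1) F' by rewrite addn1.
have [_ /(_ i) [d1 _]] := Cn_partials C1.
have [_ /(_ i) [d2 _]] := Cn_partials C2.
have := pderivableD d1 (pderivableM (pderivable_cst (-1) i).1 d2).1.
rewrite (pderivableM (pderivable_cst (-1) i).1 d2).2 (pderivable_cst (-1) i).2 => -[_].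
move=> e; transitivity (partial i (fun x => partials r F x + -1 * partials r F' x)).
  by congr (partial i _); apply: funext => x; rewrite mulN1r.
by rewrite e; apply: funext => x; rewrite mul0r add0r mulN1r.
Qed.

Lemma superexp_densityB (s : R) F F' c : Cn #|Lambda| F -> Cn #|Lambda| F' -> c a = (0, 0) ->
  superexp_density s (quad_mul (fun l => F l - F' l)) c =
  superexp_density s (quad_mul F) c - superexp_density s (quad_mul F') c.
Proof.
move=> CF CF' ca; rewrite !superexp_density_blocks//; last first.
  by apply: CnD => //; exact: CnN.
rewrite -sumrB; apply: eq_bigr => B _; rewrite -mulrBl; congr (_ * _).
have sz : (size (sub_block B) <= #|Lambda|)%N by rewrite size_filter cardE count_size.
by rewrite partialsB//; apply: Cn_le sz _.
Qed.

(* The bound on [F - F'] suffices because [F'] is then bounded as well. *)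
Lemma superexp_cvg (s : R) p (F : (Lambda -> R) -> R) (Fn : nat -> (Lambda -> R) -> R) (A : R)
    (eps : nat -> R) :
  Cn #|Lambda| F -> (forall n, Cn #|Lambda| (Fn n)) -> 0 <= A -> block_bounded s p A F ->
  (forall n, block_bounded s p (eps n) (fun l => F l - Fn n l)) -> (forall n, 0 <= eps n) ->
  eps n @[n --> \oo] --> (0 : R) ->
  superexp_pinned beta a (form_apply (quad_mul (Fn n)) (boost_z s)) @[n --> \oo] -->
  superexp_pinned beta a (form_apply (quad_mul F) (boost_z s)).
Proof.
move=> CF CFn A0 FA Fe e0 elim0.
have [K K0 HK] := superexp_bound s p.
have [iF _] := HK _ _ CF A0 FA.
have CD n : Cn #|Lambda| (fun l => F l - Fn n l) by apply: CnD => //; exact: CnN.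
have h n : `|superexp_pinned beta a (form_apply (quad_mul F) (boost_z s))
    - superexp_pinned beta a (form_apply (quad_mul (Fn n)) (boost_z s))| <= K * eps n.
  have [iD bD] := HK _ _ (CD n) (e0 n) (Fe n).
  have dB w : superexp_density s (quad_mul (fun l => F l - Fn n l)) (conf w) =
     superexp_density s (quad_mul F) (conf w) - superexp_density s (quad_mul (Fn n)) (conf w).
    exact: (superexp_densityB s CF (CFn n) (conf_a w)).
  have iFn : nu.-integrable setT (fun w => (superexp_density s (quad_mul (Fn n)) (conf w))%:E).
    have := integrableB measurableT iF iD; apply: eq_integrable => // w _ /=.
    by rewrite dB -EFinB subKr.
  have e : \int[nu]_w superexp_density s (quad_mul (fun l => F l - Fn n l)) (conf w) =
     \int[nu]_w superexp_density s (quad_mul F) (conf w) -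
     \int[nu]_w superexp_density s (quad_mul (Fn n)) (conf w).
    rewrite -(RintegralB measurableT iF iFn); apply: eq_Rintegral => w _; exact: dB.
  by rewrite 2!superexp_pinnedE -mulrBr -e.
apply/cvgrPdist_lt => e epos.
have Ke : (fun n => K * eps n) @ \oo --> (0 : R).
  by rewrite -(mulr0 K); apply: cvgM => //; exact: cvg_cst.
near=> n; rewrite (le_lt_trans (h n))//.
near: n; exact: (cvgr_lt _ Ke).
Unshelve. all: end_near. Qed.

End Functional.

(** * Linear combinations of test functions *)

Section Span.
Variables (R : realType) (Lambda : finType) (a : Lambda) (beta : Lambda -> Lambda -> R).
Local Notation I := (~: [set a])%SET.
Local Notation conf := (@conf R Lambda a).
Local Notation nu := (planes_lebesgue R #|I|).
Implicit Types (i j : Lambda) (H : Lambda -> Lambda -> R).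

Definition admissible H := [/\ forall i j, H i j = H j i,
  forall i, i != a -> 1 + \sum_(j | j != i) `|H i j| <= H i i &
  forall i j, i != j -> H i j = - beta i j].

Definition special H (l : Lambda -> R) : R := quad_mul H (fun l => \prod_(i in I) l i) l.

Lemma superexp_density_sum (s : R) (J : Type) (r : seq J) (g : J -> (Lambda -> R) -> R) (k : J -> R) c :
  (forall t, Cn #|Lambda| (g t)) ->
  superexp_density a beta s (fun l => \sum_(t <- r) k t * g t l) c =
  \sum_(t <- r) k t * superexp_density a beta s (g t) c.
Proof.
move=> Cg; rewrite /superexp_density.
have ns i : nuE a (fun=> s) c i * nuE a (fun=> s) c i = 0 by exact: nuE_sqr.
rewrite jet_sum//; last by move=> t _; apply: CnZ; rewrite size_rev -cardE.
rewrite mulr_sumr mulr_suml val_evenG_sum ber_sum; apply: eq_bigr => t _.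
rewrite jetZ//; last by rewrite size_rev -cardE.
rewrite -berZ -val_evcM; congr (ber _ (val _)).
by rewrite [X in X * _]mulrCA -!mulrA.
Qed.

Lemma superexp_special (s : R) (J : Type) (r : seq J) (H : J -> Lambda -> Lambda -> R) (k h : J -> R) :
  (forall t, admissible (H t)) ->
  (forall t, exists psi : Lambda -> R, [/\ psi a = 1,
     forall i, i != a -> \sum_j H t i j * psi j = 0 & \sum_j H t a j * psi j = - h t]) ->
  superexp_pinned beta a (form_apply (fun l => \sum_(t <- r) k t * special (H t) l) (boost_z s)) =
  \sum_(t <- r) k t * expR (- (2^-1 * \sum_i \sum_j H t i j) + 2^-1 * h t * sinh s ^+ 2).
Proof.
move=> adm hpsi; rewrite superexp_pinnedE.
have CS t : Cn #|Lambda| (special (H t)).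
  apply: CnM; first by apply: Cn_exp; exact: Cn_quad.
  by apply: Cn_prod => i _; exact: Cn_coord.
pose KK t w := KE a (H t) (enum I) (fun=> s) (conf w).
transitivity (((2 * pi) ^+ #|I|)^-1 * \int[nu]_w \sum_(t <- r) k t * KK t w).
  congr (_ * _); apply: eq_Rintegral => w _.
  apply: (etrans (superexp_density_sum s r k (conf w) CS)).
  apply: eq_bigr => t _; congr (_ * _); have [Hs _ Hb] := adm t.
  exact: (superexp_density_prod Hb s (conf_a w)).
have iK t : nu.-integrable setT (fun w => (KK t w)%:E).
  by have [Hs Hd _] := adm t; exact: integrable_gauss (gauss_KE Hs Hd _ _).
have vK t : \int[nu]_w KK t w =
   expR (- (2^-1 * \sum_i \sum_j H t i j) + 2^-1 * h t * sinh s ^+ 2) * (2 * pi) ^+ #|I|.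
  have [Hs Hd _] := adm t; have [psi [p1 p2 p3]] := hpsi t.
  by rewrite /Rintegral (integral_KE Hs Hd p1 p2 p3).
have iS (q : seq J) : nu.-integrable setT (fun w => (\sum_(t <- q) k t * KK t w)%:E).
  have := @integrable_sum _ _ _ nu setT measurableT J q xpredT (fun t w => (k t * KK t w)%:E).
  move=> /(_ (fun t _ => integrableZl measurableT (k t) (iK t))).
  by apply: eq_integrable => // w _; rewrite sumEFin.
have p0 : (2 * pi) ^+ #|I| != 0 :> R by rewrite expf_neq0// mulf_neq0// gt_eqF// pi_gt0.
elim: r => [|t r IH].
  rewrite big_nil; under eq_Rintegral do rewrite big_nil.
  by rewrite Rintegral_cst// mul0r mulr0.
rewrite big_cons -IH; under eq_Rintegral do rewrite big_cons.
have iZ : nu.-integrable setT (EFin \o (fun w => k t * KK t w)).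
  exact: (integrableZl measurableT (k t) (iK t)).
rewrite (RintegralD measurableT iZ (iS r)).
rewrite RintegralZl//; last exact: iK.
by rewrite vK mulrDr; congr (_ + _); field; exact: p0.
Qed.

End Span.

(** * Approximation by Bernstein polynomials *)

Section Bernstein.
Variable R : realType.
Implicit Types (n k : nat) (y c : R) (h : nat -> R) (phi : R -> R).

(* The expectation of [h] at a binomial variable of parameters [n] and [y]. *)
Fixpoint bern n y h : R :=
  if n is m.+1 then (1 - y) * bern m y h + y * bern m y (h \o S) else h 0%N.

Lemma bernD n y h1 h2 : bern n y (fun k => h1 k + h2 k) = bern n y h1 + bern n y h2.
Proof.
elim: n h1 h2 => [//|n IH] h1 h2 /=; rewrite IH.
have -> : (fun k => h1 k + h2 k) \o S = fun k => (h1 \o S) k + (h2 \o S) k by [].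
by rewrite IH; ring.
Qed.

Lemma bernZ n y c h : bern n y (fun k => c * h k) = c * bern n y h.
Proof.
elim: n h => [//|n IH] h /=; rewrite IH.
have -> : (fun k => c * h k) \o S = fun k => c * (h \o S) k by [].
by rewrite IH; ring.
Qed.

Lemma bern_cst n y c : bern n y (fun=> c) = c.
Proof.
elim: n => [//|n IH] /=; have -> : (fun=> c) \o S = fun=> c by [].
by rewrite IH; ring.
Qed.

Lemma bernB n y h1 h2 : bern n y (fun k => h1 k - h2 k) = bern n y h1 - bern n y h2.
Proof.
have -> : (fun k => h1 k - h2 k) = fun k => h1 k + (-1) * h2 k by apply: funext => k; ring.
by rewrite bernD bernZ mulN1r.
Qed.

Lemma le_bern n y h1 h2 : 0 <= y <= 1 -> (forall k, (k <= n)%N -> h1 k <= h2 k) ->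
  bern n y h1 <= bern n y h2.
Proof.
move=> /andP[y0 y1]; elim: n h1 h2 => [|n IH] h1 h2 h12 /=; first exact: h12.
apply: lerD; apply: ler_wpM2l => //; rewrite ?subr_ge0//; apply: IH => k kn; apply: h12 => //.
exact: leq_trans kn _.
Qed.

Lemma eq_bern n y h1 h2 : (forall k, (k <= n)%N -> h1 k = h2 k) -> bern n y h1 = bern n y h2.
Proof.
elim: n h1 h2 => [|n IH] h1 h2 h12 /=; first exact: h12.
by congr (_ * _ + _ * _); apply: IH => k kn; apply: h12 => //; exact: leq_trans kn _.
Qed.

Lemma norm_bern n y h A : 0 <= y <= 1 -> (forall k, (k <= n)%N -> `|h k| <= A) -> `|bern n y h| <= A.
Proof.
move=> y01 hA; rewrite ler_norml -{1}(bern_cst n y (- A)) -{2}(bern_cst n y A).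
by apply/andP; split; apply: le_bern => // k kn; have := hA k kn; rewrite ler_norml => /andP[].
Qed.

(** The variance of the binomial law. The centre [c] is arbitrary because the recursion replaces it
    by [c - 1]. *)
Lemma bern_sqr n y c : bern n y (fun k => (k%:R - c) ^+ 2) = (n%:R * y - c) ^+ 2 + n%:R * (y * (1 - y)).
Proof.
elim: n c => [|n IH] c /=; first by rewrite !mul0r addr0.
have -> : (fun k => (k%:R - c) ^+ 2) \o S = fun k => (k%:R - (c - 1)) ^+ 2.
  by apply: funext => k /=; rewrite -natr1; ring.
by rewrite !IH -natr1; ring.
Qed.

Lemma bern_sum n y h : bern n y h = \sum_(j < n.+1) h j * bern n y (fun k => (k == j :> nat)%:R).
Proof.
transitivity (bern n y (fun k => \sum_(j < n.+1) h j * (k == j :> nat)%:R)).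
  apply: eq_bern => k kn; rewrite (bigD1 (Ordinal (kn : (k < n.+1)%N)))//= eqxx mulr1 big1 ?addr0// => j jk.
  by rewrite (_ : (k == j :> nat) = false) ?mulr0//; apply: contraNF jk => /eqP e; apply/eqP/val_inj.
have sumE (r : seq 'I_n.+1) : bern n y (fun k => \sum_(j <- r) h j * (k == j :> nat)%:R) =
   \sum_(j <- r) h j * bern n y (fun k => (k == j :> nat)%:R).
  elim: r => [|j r IH].
    by rewrite big_nil; under eq_fun do rewrite big_nil; rewrite bern_cst.
  by rewrite big_cons; under eq_fun do rewrite big_cons; rewrite bernD bernZ IH.
exact: sumE.
Qed.

Lemma bern_poly n h : exists p : {poly R}, forall y, bern n y h = p.[y].
Proof.
elim: n h => [|n IH] h /=; first by exists (h 0%N)%:P => y; rewrite hornerC.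
have [p hp] := IH h; have [q hq] := IH (h \o S).
exists ((1 - 'X) * p + 'X * q) => y; rewrite hp hq.
by rewrite hornerD !hornerM hornerD hornerN hornerC hornerX.
Qed.

Lemma is_derive_bern n y h : is_derive y (1 : R) (fun y => bern n.+1 y h)
  (n.+1%:R * bern n y (fun k => h k.+1 - h k)).
Proof.
have split (m : nat) (u : R) (h' : nat -> R) (d1 d2 : R) :
    is_derive u (1 : R) (fun y => bern m y h') d1 ->
    is_derive u (1 : R) (fun y => bern m y (h' \o S)) d2 ->
    is_derive u (1 : R) (fun y => bern m.+1 y h')
      (bern m u (fun k => h' k.+1 - h' k) + (1 - u) * d1 + u * d2).
  move=> D1 D2; rewrite [fun y => _]/=; apply: is_derive_eq.
  by rewrite bernB /GRing.scale/= /comp; ring.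
elim: n h => [|n IH] h.
  have := @split 0%N y h 0 0 (is_derive_cst _ _ _) (is_derive_cst _ _ _).
  by rewrite !mulr0 !addr0 mul1r.
have := split _ _ _ _ _ (IH h) (IH (h \o S)); congr (is_derive _ _ _ _).
rewrite -[n.+2%:R]natr1 /= /comp; ring.
Qed.

(** With [s = sqrt n], the inequality [2 |t| <= 1 / s + s t ^ 2] reduces the mean deviation to the
    variance [n y (1 - y)], which is at most [n]. *)
Lemma le_bern_dist n y c : 0 <= y <= 1 -> (0 < n)%N ->
  bern n y (fun k => `|k%:R / n%:R - y|) <= (Num.sqrt n%:R)^-1.
Proof.
move=> y01 n0; have nR : (0 : R) < n%:R by rewrite ltr0n.
set s := Num.sqrt n%:R; have s0 : 0 < s by rewrite sqrtr_gt0.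
have ss : s ^+ 2 = n%:R by rewrite sqr_sqrtr// ltW.
apply: (@le_trans _ _ (bern n y (fun k => 2^-1 * s^-1 + (2^-1 * s / n%:R ^+ 2) * (k%:R - n%:R * y) ^+ 2))).
  apply: le_bern => // k kn; set t := k%:R / n%:R - y.
  have -> : 2^-1 * s^-1 + 2^-1 * s / n%:R ^+ 2 * (k%:R - n%:R * y) ^+ 2 =
    `|t| + 2^-1 * s^-1 * (1 - s * `|t|) ^+ 2.
    have -> : 2^-1 * s / n%:R ^+ 2 * (k%:R - n%:R * y) ^+ 2 = 2^-1 * s * `|t| ^+ 2.
      by rewrite real_normK ?num_real// /t; field; rewrite gt_eqF.
    by move: (`|t|) => u; field; rewrite gt_eqF.
  by rewrite lerDl mulr_ge0 ?sqr_ge0// mulr_ge0// invr_ge0 ltW.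
rewrite bernD bern_cst bernZ bern_sqr subrr expr0n/= add0r -ss.
move: y01 => /andP[y0 y1].
have -> : 2^-1 * s / (s ^+ 2) ^+ 2 * (s ^+ 2 * (y * (1 - y))) = 2^-1 * s^-1 * (y * (1 - y)).
  by field; rewrite gt_eqF.
have si : 0 < s^-1 by rewrite invr_gt0.
by nra.
Qed.

Lemma bern_approx n phi y L : 0 <= y <= 1 -> (0 < n)%N ->
  (forall u v, 0 <= u <= 1 -> 0 <= v <= 1 -> `|phi u - phi v| <= L * `|u - v|) ->
  `|bern n y (fun k => phi (k%:R / n%:R)) - phi y| <= L / Num.sqrt n%:R.
Proof.
move=> y01 n0 lip; have nR : (0 : R) < n%:R by rewrite ltr0n.
have L0 : 0 <= L.
  have := lip 0 1 _ _; rewrite !lexx ler01 sub0r normrN normr1 mulr1 => /(_ isT isT).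
  exact: le_trans.
rewrite -[X in _ - X](bern_cst n y) -bernB.
have kn01 k : (k <= n)%N -> 0 <= (k%:R / n%:R : R) <= 1.
  by move=> kn; rewrite divr_ge0//= ler_pdivrMr// mul1r ler_nat.
apply: (@le_trans _ _ (bern n y (fun k => L * `|k%:R / n%:R - y|))); last first.
  by rewrite bernZ ler_wpM2l// le_bern_dist.
have bl : forall k, (k <= n)%N -> `|phi (k%:R / n%:R) - phi y| <= L * `|k%:R / n%:R - y|.
  by move=> k kn; apply: lip => //; exact: kn01.
rewrite ler_norml -mulN1r -bernZ; apply/andP; split; apply: le_bern => // k kn;
  by have := bl k kn; rewrite ler_norml ?mulN1r => /andP[].
Qed.

(** The increments of [phi] are values of [dphi] at intermediate points, by the mean value property;
    moving these to the nodes [k / n] costs at most [L / (n + 1)], and [bern_approx] handles the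
    rest. *)
Lemma bern_deriv_approx n phi dphi y L : 0 <= y <= 1 -> (0 < n)%N ->
  (forall u v, 0 <= u -> u < v -> v <= 1 -> exists2 w, u < w < v & phi v - phi u = dphi w * (v - u)) ->
  (forall u v, 0 <= u <= 1 -> 0 <= v <= 1 -> `|dphi u - dphi v| <= L * `|u - v|) ->
  `|n.+1%:R * bern n y (fun k => phi (k.+1%:R / n.+1%:R) - phi (k%:R / n.+1%:R)) - dphi y|
     <= 2 * L / Num.sqrt n%:R.
Proof.
move=> y01 n0 mvt lip; have nR : (0 : R) < n%:R by rewrite ltr0n.
have n1R : (0 : R) < n.+1%:R by rewrite ltr0n.
have L0 : 0 <= L.
  have := lip 0 1 _ _; rewrite !lexx ler01 sub0r normrN normr1 mulr1 => /(_ isT isT).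
  exact: le_trans.
have h1 : `|bern n y (fun k => dphi (k%:R / n%:R)) - dphi y| <= L / Num.sqrt n%:R by exact: bern_approx.
have h2 : `|n.+1%:R * bern n y (fun k => phi (k.+1%:R / n.+1%:R) - phi (k%:R / n.+1%:R))
    - bern n y (fun k => dphi (k%:R / n%:R))| <= L / n.+1%:R.
  rewrite -bernZ -bernB; apply: norm_bern => // k kn.
  have kR : (0 : R) <= k%:R by [].
  have knR : (k%:R : R) <= n%:R by rewrite ler_nat.
  have dk : k.+1%:R / n.+1%:R - k%:R / n.+1%:R = n.+1%:R^-1 :> R by rewrite -natr1; field; rewrite gt_eqF.
  have [|||w /andP[w1 w2] ->] := mvt (k%:R / n.+1%:R) (k.+1%:R / n.+1%:R).
  - by rewrite divr_ge0// ltW.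
  - by rewrite ltr_pM2r ?invr_gt0// ltr_nat.
  - by rewrite ler_pdivrMr// mul1r ler_nat.
  rewrite dk mulrC -mulrA mulVf ?gt_eqF// mulr1.
  have k1 : k.+1%:R / n.+1%:R <= 1 :> R by rewrite ler_pdivrMr// mul1r ler_nat.
  have k0 : 0 <= k%:R / n.+1%:R :> R by rewrite divr_ge0// ltW.
  have q1 : k%:R / n%:R <= 1 :> R by rewrite ler_pdivrMr// mul1r.
  have q0 : 0 <= k%:R / n%:R :> R by rewrite divr_ge0// ltW.
  (* [k / n] and the intermediate point [w] lie in the same interval, from [k / (n + 1)] to
     [(k + 1) / (n + 1)]. *)
  have lo : k%:R / n.+1%:R <= k%:R / n%:R :> R.
    by rewrite ler_wpM2l// lef_pV2 ?posrE// ler_nat.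
  have hi : k%:R / n%:R <= k.+1%:R / n.+1%:R :> R.
    rewrite ler_pdivrMr// mulrAC ler_pdivlMr// -!natr1; nra.
  move: (k%:R / n.+1%:R) (k.+1%:R / n.+1%:R) (k%:R / n%:R) dk k0 k1 q0 q1 lo hi w1 w2.
  move=> p q r dk k0 k1 q0 q1 lo hi w1 w2.
  apply: (le_trans (lip _ _ _ _)); first by apply/andP; split; lra.
    by rewrite q0.
  rewrite ler_wpM2l// -dk ler_norml; apply/andP; split; lra.
have s0 : 0 < Num.sqrt (n%:R : R) by rewrite sqrtr_gt0.
have h3 : L / n.+1%:R <= L / Num.sqrt n%:R.
  rewrite ler_wpM2l// lef_pV2 ?posrE//.
  rewrite -[leRHS]gtr0_norm// -sqrtr_sqr ler_wsqrtr// -natr1.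
  have : (1 : R) <= n%:R by rewrite ler1n.
  by move: (n%:R) => t; nra.
set X := _ * _ in h2 *; set Y := bern _ _ _ in h1 h2.
have -> : X - dphi y = (X - Y) + (Y - dphi y) by ring.
rewrite (le_trans (ler_normD _ _))//.
have -> : 2 * L / Num.sqrt n%:R = L / Num.sqrt n%:R + L / Num.sqrt n%:R by ring.
by apply: lerD => //; exact: le_trans h3.
Qed.

End Bernstein.
Arguments bern : simpl never.

(** * Interpolation in the variable [e^(1 - t^2)] *)

Section LiftedInterpolation.
Variable R : realType.
Implicit Types (F f : R -> R) (u v t x : R).

(** [height] maps the half-line [t >= 1] onto []0, 1]], decreasingly and with infinity corresponding
    to 0; [radius] is its inverse. Functions of bounded support are carried to the unit interval by
    [lift], and polynomials in [height t] are combinations of the functions [e^(- k t^2)]. *)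
Definition radius u : R := Num.sqrt (1 - ln u).
Definition lift F u : R := if 0 < u then F (radius u) else 0.
Definition height t : R := expR (1 - t ^+ 2).

Lemma height_gt0 t : 0 < height t. Proof. exact: expR_gt0. Qed.

Lemma radius_height t : 0 <= t -> radius (height t) = t.
Proof. by move=> t0; rewrite /radius /height expRK opprB addrC subrK sqrtr_sqr ger0_norm. Qed.

Lemma lift_height F t : 0 <= t -> lift F (height t) = F t.
Proof. by move=> t0; rewrite /lift height_gt0 radius_height. Qed.

Lemma radius_arg u : u < expR 1 -> 0 < 1 - ln u.
Proof.
move=> ue; rewrite subr_gt0; have [u0|u0] := ltP 0 u.
  by rewrite -ltr_expR lnK.
by rewrite ln0.
Qed.

Lemma is_derive_radius u : 0 < u -> u < expR 1 ->
  is_derive u (1 : R) radius (- (expR (radius u ^+ 2 - 1) / (2 * radius u))).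
Proof.
move=> u0 ue; have r0 := radius_arg ue; have s0 : 0 < radius u by rewrite sqrtr_gt0.
have d1 : is_derive u (1 : R) (fun u => 1 - ln u) (- u^-1).
  have := is_derive1_ln u0 => d; apply: is_derive_eq; rewrite /GRing.scale/=; ring.
have := @is_derive1_comp _ (@Num.sqrt R) (fun u => 1 - ln u) u _ _ (is_derive1_sqrt r0) d1.
congr (is_derive _ _ _ _); rewrite -/(radius u) sqr_sqrtr ?ltW//.
have -> : 1 - ln u - 1 = - ln u by ring.
by rewrite expRN lnK//; field; rewrite !gt_eqF.
Qed.

Lemma radius_ge (M : R) u : 0 < u -> u <= expR (1 - M ^+ 2) -> M <= radius u.
Proof.
move=> u0 uM; rewrite (le_trans (ler_norm M))// -sqrtr_sqr ler_wsqrtr//.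
by have := uM; rewrite -ler_ln ?posrE ?expR_gt0// expRK; lra.
Qed.

(** A small [u > 0] has a radius beyond [M], so that [lift F] is identically zero near every
    [u <= 0]. The condition [u < expR 1] keeps the radius positive. *)
Lemma is_derive_lift (M : R) F (F1 : R -> R) u : (forall x, 0 < x -> is_derive x (1 : R) F (F1 x)) ->
  (forall x, M <= x -> F x = 0) -> (forall x, M <= x -> F1 x = 0) -> u < expR 1 ->
  is_derive u (1 : R) (lift F) (lift (fun x => - (F1 x * expR (x ^+ 2 - 1) / (2 * x))) u).
Proof.
move=> dF F0 F10 ue; have [u0|u0] := ltP 0 u.
  have s0 : 0 < radius u by rewrite sqrtr_gt0 radius_arg.
  have D := is_derive1_comp (dF _ s0) (is_derive_radius u0 ue).
  have e : \near u, (F \o radius) u = lift F u.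
    near=> v; rewrite /lift ifT//; near: v; exact: lt_nbhsr.
  have := near_eq_is_derive e D; congr (is_derive _ _ _ _).
  by rewrite /lift u0; field; rewrite gt_eqF.
have -> : lift (fun x => - (F1 x * expR (x ^+ 2 - 1) / (2 * x))) u = 0.
  by rewrite /lift ltNge u0.
have e : \near u, (fun=> 0) u = lift F u.
  near=> v; rewrite /lift; case: ifP => // v0; rewrite F0//; apply: radius_ge => //.
  rewrite ltW//; near: v; apply: lt_nbhsl.
  by rewrite (le_lt_trans u0)// expR_gt0.
exact: (near_eq_is_derive e (is_derive_cst _ _ _)).
Unshelve. all: end_near. Qed.

Definition lift_deriv (F1 : R -> R) x : R := - (F1 x * expR (x ^+ 2 - 1) / (2 * x)).

Lemma lift_mvt (M : R) F (F1 : R -> R) u v : (forall x, 0 < x -> is_derive x (1 : R) F (F1 x)) ->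
  (forall x, M <= x -> F x = 0) -> (forall x, M <= x -> F1 x = 0) -> u < v -> v <= 1 ->
  exists2 w, u < w < v & lift F v - lift F u = lift (lift_deriv F1) w * (v - u).
Proof.
move=> dF F0 F10 uv v1.
have dL w : w <= v -> is_derive w (1 : R) (lift F) (lift (lift_deriv F1) w).
  move=> wv; apply: (is_derive_lift dF F0 F10).
  rewrite (le_lt_trans wv)// (le_lt_trans v1)// -[X in X < _]expR0 ltr_expR//.
have [||w] := @MVT R (lift F) (lift (lift_deriv F1)) u v uv.
- by move=> w; rewrite in_itv/= => /andP[_ /ltW]; exact: dL.
- apply: continuous_in_subspaceT => w; rewrite inE/= in_itv/= => /andP[_ wv].
  exact: is_derive_continuous (dL w wv).
by rewrite in_itv/= => wuv e; exists w.
Qed.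

Lemma norm_lift F A u : u <= 1 -> 0 <= A -> (forall x, 1 <= x -> `|F x| <= A) -> `|lift F u| <= A.
Proof.
move=> u1 A0 FA; rewrite /lift; case: ifP => u0; last by rewrite normr0.
apply: FA; rewrite /radius -[leLHS]sqrtr1 ler_wsqrtr// lerDl oppr_ge0.
by rewrite ln_le0.
Qed.

Lemma lift_lipschitz (M : R) F (F1 : R -> R) L : (forall x, 0 < x -> is_derive x (1 : R) F (F1 x)) ->
  (forall x, M <= x -> F x = 0) -> (forall x, M <= x -> F1 x = 0) -> 0 <= L ->
  (forall x, 1 <= x -> `|lift_deriv F1 x| <= L) ->
  forall u v, 0 <= u <= 1 -> 0 <= v <= 1 -> `|lift F u - lift F v| <= L * `|u - v|.
Proof.
move=> dF F0 F10 L0 FL.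
have h u v : u < v -> v <= 1 -> `|lift F u - lift F v| <= L * `|u - v|.
  move=> uv v1; have [w /andP[_ wv] e] := lift_mvt dF F0 F10 uv v1.
  rewrite distrC e normrM distrC [`|u - v|]distrC ler_wpM2r//.
  by apply: norm_lift => //; rewrite ltW// (lt_le_trans wv).
move=> u v /andP[_ u1] /andP[_ v1]; have [uv|vu|->] := ltgtP u v; first exact: h.
  by rewrite distrC [`|u - v|]distrC; exact: h.
by rewrite !subrr normr0 mulr0.
Qed.

(** The test functions contain the factor [t], so it is [f t / t] that is approximated by a
    polynomial in [height t]. The degree [n + 2] of [interp] leaves the positive degree [n + 1] for
    its derivative. *)
Definition ratio f x : R := f x / x.
Definition interp n f t : R := t * bern n.+2 (height t) (fun k => lift (ratio f) (k%:R / n.+2%:R)).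
Definition interp_deriv n f t : R :=
  bern n.+2 (height t) (fun k => lift (ratio f) (k%:R / n.+2%:R)) +
  t * (- (2 * t * height t)) * (n.+2%:R * bern n.+1 (height t)
     (fun k => lift (ratio f) (k.+1%:R / n.+2%:R) - lift (ratio f) (k%:R / n.+2%:R))).

Lemma is_derive_height t : is_derive t (1 : R) height (- (2 * t * height t)).
Proof. by rewrite /height; apply: is_derive_eq; rewrite /GRing.scale/=; move: (expR _) => w; ring. Qed.

Lemma is_derive_interp n f t : is_derive t (1 : R) (interp n f) (interp_deriv n f t).
Proof.
have D := is_derive1_comp (is_derive_bern n.+1 (height t)
   (fun k => lift (ratio f) (k%:R / n.+2%:R))) (is_derive_height t).
have := is_deriveM (is_derive_id t (1 : R)) D; congr (is_derive _ _ _ _).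
by rewrite /GRing.scale/= /interp_deriv; ring.
Qed.

(** A bound on [[1, M]] for [e^(x^2 - 1)], the factor by which lifting enlarges derivatives. *)
Definition kappa (M : R) : R := expR (M ^+ 2 - 1).

Lemma height01 t : 1 <= t -> 0 <= height t <= 1.
Proof.
move=> t1; rewrite expR_ge0/= -expR0 ler_expR subr_le0.
by rewrite -[leLHS](expr1n _ 2%N) lerXn2r ?nnegrE ?(le_trans ler01 t1).
Qed.

Section Bounds.
Variables (M A : R) (f f1 : R -> R).
Hypotheses (M1 : 1 <= M) (A0 : 0 <= A).
Hypotheses (df : forall x, 0 < x -> is_derive x (1 : R) f (f1 x)).
Hypotheses (f0 : forall x, M <= x -> f x = 0) (f10 : forall x, M <= x -> f1 x = 0).
Hypotheses (fA : forall x, 1 <= x -> `|f x| <= A) (f1A : forall x, 1 <= x -> `|f1 x| <= A).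

Let r1 x : R := f1 x / x - f x / x ^+ 2.

Let dratio x : 0 < x -> is_derive x (1 : R) (ratio f) (r1 x).
Proof.
move=> x0; have xn : x != 0 by rewrite gt_eqF.
have := is_deriveM (df x0) (is_deriveV xn (is_derive_id x (1 : R))).
congr (is_derive _ _ _ _); rewrite /GRing.scale/= /r1; field; exact: xn.
Qed.

Let ratio0 x : M <= x -> ratio f x = 0. Proof. by move=> Mx; rewrite /ratio f0// mul0r. Qed.
Let r10 x : M <= x -> r1 x = 0. Proof. by move=> Mx; rewrite /r1 f0// f10// !mul0r subr0. Qed.

Let inv1 x k : 1 <= x -> 0 <= x ^- k <= 1.
Proof.
move=> x1; have xk : 1 <= x ^+ k by exact: exprn_ege1.
by rewrite invr_ge0 (le_trans _ xk)//= invf_le1// (lt_le_trans _ xk).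
Qed.

Let kap1 : 1 <= kappa M.
Proof. by rewrite -expR0 ler_expR subr_ge0; apply: exprn_ege1. Qed.

Let mulV (p q x : R) k : 1 <= x -> `|p| <= q -> `|p / x ^+ k| <= q.
Proof.
move=> x1 pq; have /andP[i0 i1] := inv1 k x1.
by rewrite normrM (ger0_norm i0) (le_trans _ pq)// ler_piMr.
Qed.

Let ldE x : 0 < x -> lift_deriv r1 x = - (2^-1 * (f1 x / x ^+ 2 - f x / x ^+ 3)) * expR (x ^+ 2 - 1).
Proof. by move=> x0; rewrite /lift_deriv /r1; move: (expR _) => w; field; rewrite gt_eqF. Qed.

Let expk x : 1 <= x -> x <= M -> expR (x ^+ 2 - 1) <= kappa M.
Proof. by move=> x1 xM; rewrite ler_expR lerD2r lerXn2r ?nnegrE ?(le_trans ler01 x1) ?(le_trans ler01 M1). Qed.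

Let ldA x : 1 <= x -> `|lift_deriv r1 x| <= A * kappa M.
Proof.
move=> x1; have x0 : 0 < x by rewrite (lt_le_trans _ x1).
have [xM|Mx] := leP x M; last first.
  rewrite ldE// (f0 (ltW Mx)) (f10 (ltW Mx)) !mul0r subr0 mulr0 oppr0 mul0r normr0.
  by rewrite mulr_ge0// expR_ge0.
rewrite ldE// normrM (ger0_norm (expR_ge0 _)) ler_pM ?expk//.
rewrite normrN normrM ger0_norm//.
have := ler_normB (f1 x / x ^+ 2) (f x / x ^+ 3).
by have := mulV 2 x1 (f1A x1); have := mulV 3 x1 (fA x1); lra.
Qed.

Lemma interp_bound n t : 1 <= t -> `|interp n f t| <= A * t.
Proof.
move=> t1; have t0 : 0 <= t by rewrite (le_trans _ t1).
rewrite /interp normrM ger0_norm// mulrC ler_wpM2r//.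
apply: norm_bern; first exact: height01.
move=> k kn; apply: norm_lift => // [|x x1]; first by rewrite ler_pdivrMr// mul1r ler_nat.
by rewrite /ratio -[x in _ / x]expr1; apply: mulV => //; exact: fA.
Qed.

Let lip := lift_lipschitz dratio ratio0 r10 (mulr_ge0 A0 (ltW (lt_le_trans ltr01 kap1))) ldA.

Let e_interp t : 1 <= t -> f t = t * lift (ratio f) (height t).
Proof.
move=> t1; have t0 : 0 < t by rewrite (lt_le_trans _ t1).
by rewrite lift_height ?ltW// /ratio mulrC divfK// gt_eqF.
Qed.

Lemma interp_approx n t : 1 <= t -> `|interp n f t - f t| <= A * kappa M * t / Num.sqrt n.+1%:R.
Proof.
move=> t1; have t0 : 0 <= t by rewrite (le_trans _ t1).
rewrite (e_interp t1) /interp -mulrBr normrM (ger0_norm t0) mulrAC mulrC ler_wpM2r//.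
apply: (le_trans (bern_approx (height01 t1) (ltn0Sn _) lip)).
rewrite ler_wpM2l ?mulr_ge0 ?expR_ge0// lef_pV2 ?posrE ?sqrtr_gt0//.
by rewrite ler_wsqrtr// ler_nat.
Qed.

Let slopes n k : (k <= n.+1)%N ->
  `|n.+2%:R * (lift (ratio f) (k.+1%:R / n.+2%:R) - lift (ratio f) (k%:R / n.+2%:R))| <= A * kappa M.
Proof.
move=> kn; have n0 : (0 : R) < n.+2%:R by [].
have b1 (j : nat) : (j <= n.+2)%N -> 0 <= (j%:R / n.+2%:R : R) <= 1.
  by move=> jn; rewrite divr_ge0//= ler_pdivrMr// mul1r ler_nat.
rewrite normrM (ger0_norm (ltW n0)).
have := lip (b1 k.+1 kn) (b1 k (leqW kn)).
rewrite -mulrBl -[k.+1%:R]natr1 [_ + 1 - _]addrAC subrr add0r mul1r.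
by rewrite (gtr0_norm (x := n.+2%:R^-1))// ler_pdivlMr// mulrC.
Qed.

(** Stability of the interpolation, in which only [f] and [f1] enter. It serves for the errors of
    earlier interpolations, whose second derivatives are not controlled. *)
Lemma interp_deriv_bound n t : 1 <= t -> `|interp_deriv n f t| <= 4 * A * kappa M * t ^+ 2.
Proof.
move=> t1; have t0 : 0 <= t by rewrite (le_trans _ t1).
rewrite /interp_deriv (le_trans (ler_normD _ _))//.
have h1 : `|bern n.+2 (height t) (fun k => lift (ratio f) (k%:R / n.+2%:R))| <= A.
  apply: norm_bern; first exact: height01.
  move=> k kn; apply: norm_lift => // [|x x1]; first by rewrite ler_pdivrMr// mul1r ler_nat.
  by rewrite /ratio -[x in _ / x]expr1; apply: mulV => //; exact: fA.
have h2 : `|n.+2%:R * bern n.+1 (height t) (fun k => lift (ratio f) (k.+1%:R / n.+2%:R) -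
    lift (ratio f) (k%:R / n.+2%:R))| <= A * kappa M.
  rewrite -bernZ; apply: norm_bern; first exact: height01.
  by move=> k kn; exact: slopes.
rewrite normrM mulrN normrN [`|t * _|]ger0_norm; last first.
  by rewrite !mulr_ge0// ltW// height_gt0.
have /andP[y0 y1] := height01 t1; have tt : 1 <= t ^+ 2 by exact: exprn_ege1.
set q := `|n.+2%:R * _| in h2 *.
have hq : t * (2 * t * height t) * q <= 2 * t ^+ 2 * (A * kappa M).
  have -> : t * (2 * t * height t) * q = (2 * t ^+ 2) * (height t * q) by ring.
  by rewrite ler_wpM2l ?mulr_ge0 ?sqr_ge0// (le_trans _ h2)// ler_piMl// normr_ge0.
have hA : A <= A * kappa M * t ^+ 2.
  by rewrite -mulrA ler_peMr//; have := kap1; move: (kappa M) (t ^+ 2) tt => p r; nra.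
apply: (le_trans (lerD h1 hq)).
have := kap1; move: hA; move: (kappa M) (t ^+ 2) tt => p r tt hA p1; have := A0; move: hA;
  have -> : 2 * r * (A * p) = 2 * (A * p * r) by ring.
have -> : 4 * A * p * r = 4 * (A * p * r) by ring.
move: (A * p * r) => m hA0 hA1; lra.
Qed.

Section Second.
Variable (f2 : R -> R).
Hypotheses (df1 : forall x, 0 < x -> is_derive x (1 : R) f1 (f2 x)).
Hypotheses (f20 : forall x, M <= x -> f2 x = 0) (f2A : forall x, 1 <= x -> `|f2 x| <= A).

Let g1 x : R := - (2^-1 * ((f2 x / x ^+ 2 - 3 * f1 x / x ^+ 3 + 3 * f x / x ^+ 4)
   + 2 * (f1 x / x - f x / x ^+ 2))) * expR (x ^+ 2 - 1).

Let dld x : 0 < x -> is_derive x (1 : R) (lift_deriv r1) (g1 x).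
Proof.
move=> x0; have xn : x != 0 by rewrite gt_eqF.
have e : \near x, - (2^-1 * (f1 x * (x^-1 * x^-1) - f x * (x^-1 * x^-1 * x^-1))) * expR (x ^+ 2 - 1) = lift_deriv r1 x.
  near=> v; have v0 : 0 < v by near: v; exact: lt_nbhsr.
  by rewrite ldE//; move: (expR _) => w; field; rewrite gt_eqF.
apply: near_eq_is_derive e _.
have d1 := df1 x0; have d0 := df x0; have di := is_deriveV xn (is_derive_id x (1 : R)).
apply: is_derive_eq; rewrite /GRing.scale/= /g1; move: (expR _) => w; field; exact: xn.
Unshelve. all: end_near. Qed.

Let ld0 x : M <= x -> lift_deriv r1 x = 0.
Proof. by move=> Mx; rewrite /lift_deriv r10// !mul0r oppr0. Qed.
Let g10 x : M <= x -> g1 x = 0.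
Proof. by move=> Mx; rewrite /g1 f0 ?f10 ?f20// !mulr0 !mul0r !(subr0, addr0) mulr0 addr0 mulr0 oppr0 mul0r. Qed.

Let lld x : 1 <= x -> `|lift_deriv g1 x| <= 3 * A * kappa M ^+ 2.
Proof.
move=> x1; have x0 : 0 < x by rewrite (lt_le_trans _ x1).
have K0 : 0 <= 3 * A * kappa M ^+ 2 by rewrite mulr_ge0 ?sqr_ge0// mulr_ge0.
have [xM|Mx] := leP x M; last first.
  by rewrite /lift_deriv (g10 (ltW Mx)) !mul0r oppr0 normr0.
(* The coefficients in [b] add up to 1 + 3 + 3 + 2 + 2 = 11 in absolute value, and 11 / 4 is at most
   3. *)
pose b := f2 x / x ^+ 3 - 3 * (f1 x / x ^+ 4) + 3 * (f x / x ^+ 5) + 2 * (f1 x / x ^+ 2 - f x / x ^+ 3).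
have -> : lift_deriv g1 x = (4^-1 * b) * expR (x ^+ 2 - 1) ^+ 2.
  by rewrite /lift_deriv /g1 /b; move: (expR _) => w; field; rewrite gt_eqF.
rewrite normrM ler_pM//; last first.
  by rewrite ger0_norm ?sqr_ge0// lerXn2r// ?nnegrE ?expR_ge0// expk.
have h0 := mulV 3 x1 (f2A x1); have h1 := mulV 4 x1 (f1A x1); have h2 := mulV 5 x1 (fA x1).
have h3 := mulV 2 x1 (f1A x1); have h4 := mulV 3 x1 (fA x1).
move: h0 h1 h2 h3 h4; rewrite !ler_norml /b.
move: (f2 x / x ^+ 3) (f1 x / x ^+ 4) (f x / x ^+ 5) (f1 x / x ^+ 2) (f x / x ^+ 3) => p q r s t.
move=> /andP[? ?] /andP[? ?] /andP[? ?] /andP[? ?] /andP[? ?]; apply/andP; split; lra.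
Qed.

(** The constant 13 is 1 for the approximation of the lifted function plus 2 * 2 * 3 for that of its
    derivative: the factors come from the derivative of [height], from [bern_deriv_approx] and from
    the Lipschitz bound [lld]. *)
Lemma interp_deriv_approx n t : 1 <= t ->
  `|interp_deriv n f t - f1 t| <= 13 * A * kappa M ^+ 2 * t ^+ 2 / Num.sqrt n.+1%:R.
Proof.
move=> t1; have t0 : 0 < t by rewrite (lt_le_trans _ t1).
have s0 : 0 < Num.sqrt (n.+1%:R : R) by rewrite sqrtr_gt0.
have K0 : 0 <= 3 * A * kappa M ^+ 2 by rewrite mulr_ge0 ?sqr_ge0// mulr_ge0.
have /andP[y0 y1] := height01 t1; have tt : 1 <= t ^+ 2 by exact: exprn_ege1.
have h1 : `|bern n.+2 (height t) (fun k => lift (ratio f) (k%:R / n.+2%:R)) - lift (ratio f) (height t)|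
    <= A * kappa M / Num.sqrt n.+1%:R.
  apply: (le_trans (bern_approx (height01 t1) (ltn0Sn _) lip)).
  rewrite ler_wpM2l ?mulr_ge0 ?expR_ge0// lef_pV2 ?posrE ?sqrtr_gt0//.
  by rewrite ler_wsqrtr// ler_nat.
have lip2 := lift_lipschitz dld ld0 g10 K0 lld.
have h2 := bern_deriv_approx (height01 t1) (ltn0Sn n)
  (fun u v _ uv hv => lift_mvt dratio ratio0 r10 uv hv) lip2.
have -> : f1 t = lift (ratio f) (height t) + t * (- (2 * t * height t)) * lift (lift_deriv r1) (height t).
  rewrite !lift_height ?ltW// ldE// /ratio /height.
  have -> : expR (t ^+ 2 - 1) = (expR (1 - t ^+ 2))^-1 by rewrite -expRN opprB.
  have := expR_gt0 (1 - t ^+ 2); move: (expR _) => w w0; field; rewrite !gt_eqF//.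
rewrite /interp_deriv; set P := bern _ _ _ in h1 *; set Q := _ * bern _ _ _ in h2 *.
set m := t * _; have -> (p q r : R) : p + m * Q - (q + m * r) = (p - q) + m * (Q - r) by move=> *; ring.
rewrite (le_trans (ler_normD _ _))// normrM.
have mle : `|m| <= 2 * t ^+ 2.
  rewrite /m mulrN normrN ger0_norm; last by rewrite !mulr_ge0// ltW.
  have -> : t * (2 * t * height t) = 2 * t ^+ 2 * height t by ring.
  by rewrite ler_piMr// mulr_ge0// sqr_ge0.
have h3 := ler_pM (normr_ge0 _) (normr_ge0 _) mle h2.
apply: (le_trans (lerD h1 h3)); have si : 0 < (Num.sqrt (n.+1%:R : R))^-1 by rewrite invr_gt0.
have -> : 2 * t ^+ 2 * (2 * (3 * A * kappa M ^+ 2) / Num.sqrt n.+1%:R) =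
   12 * A * kappa M ^+ 2 * t ^+ 2 / Num.sqrt n.+1%:R by ring.
rewrite -mulrDl ler_wpM2r ?(ltW si)//.
have hA : A * kappa M <= A * kappa M ^+ 2 * t ^+ 2.
  rewrite -mulrA ler_wpM2l//; have := kap1; move: (kappa M) (t ^+ 2) tt => p r; nra.
by lra.
Qed.

End Second.
End Bounds.

End LiftedInterpolation.

(** * Symmetry of mixed partial derivatives *)

Section MixedPartials.
Variables (R : realType) (I : finType).
Implicit Types (g : (I -> R) -> R) (x : I -> R) (i j : I).

Lemma smooth_partial i g : smooth g -> smooth (partial i g).
Proof. by move=> sg s; have := sg (rcons s i); rewrite /partials foldr_rcons. Qed.

Lemma smooth_partials s g : smooth g -> smooth (partials s g).
Proof. by elim: s => [//|i s IH] /IH; exact: smooth_partial. Qed.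

Lemma smooth_pderivable g i : smooth g -> pderivable i g.
Proof. by move=> sg; have [_ /(_ i)] := sg [::]. Qed.

Lemma smooth_of_Cn g : (forall n, Cn n g) -> smooth g.
Proof.
move=> Cg s; have C1 : Cn (size s + 1) g by [].
have := Cn_partials C1 => -[cs H]; split; first exact: cs.
by move=> i; have [+ _] := H i; exact.
Qed.

Lemma partial_mvt g i x (h : R) : pderivable i g -> 0 < h ->
  exists2 t, x i < t < x i + h & g (dfwith x i (x i + h)) - g x = h * partial i g (dfwith x i t).
Proof.
move=> dg h0; have xh : x i < x i + h by rewrite ltrDl.
have D t : is_derive t (1 : R) (fun t => g (dfwith x i t)) (partial i g (dfwith x i t)).
  exact: is_derive_partial_at.
have [|t] := MVT xh (fun t _ => D t).
  by apply: continuous_subspaceT => t; exact: is_derive_continuous (D t).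
rewrite in_itv/= => tI e; exists t => //; move: e; rewrite dfwith_id => ->.
by rewrite addrAC subrr add0r mulrC.
Qed.

(** The mean value theorem in the direction [i] for the increment of [g] in the direction [j], then
    again in the direction [j]. *)
Lemma mixed_mvt g i j x (h : R) : i != j -> smooth g -> 0 < h ->
  exists st : R * R, [/\ x i < st.1 < x i + h, x j < st.2 < x j + h &
    g (dfwith (dfwith x i (x i + h)) j (x j + h)) - g (dfwith x i (x i + h))
    - g (dfwith x j (x j + h)) + g x =
    h ^+ 2 * partial j (partial i g) (dfwith (dfwith x i st.1) j st.2)].
Proof.
move=> ij sg h0; pose g2 y := g (dfwith y j (x j + h)) - g (dfwith y j (x j)).
have dslice (c : R) : pderivable i (fun y => g (dfwith y j c)) /\
    partial i (fun y => g (dfwith y j c)) = fun y => partial i g (dfwith y j c).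
  apply: pderivable_partial => y.
  have := is_derive_partial (dfwith y j c) (smooth_pderivable (i := i) sg).
  rewrite dfwithout 1?eq_sym//; congr (is_derive _ _ _ _).
  by apply: funext => t; rewrite (dfwithC _ _ _ ij).
have d2 : pderivable i g2 /\ partial i g2 = fun y => partial i g (dfwith y j (x j + h)) - partial i g (dfwith y j (x j)).
  apply: pderivable_partial => y.
  have := is_deriveB (is_derive_partial y (dslice (x j + h)).1) (is_derive_partial y (dslice (x j)).1).
  by rewrite (dslice _).2 (dslice _).2.
have [t tI e1] := partial_mvt x d2.1 h0.
have [t' tI' e2] := partial_mvt (dfwith x i t) (smooth_pderivable (i := j) (smooth_partial i sg)) h0.
have xj : dfwith x i t j = x j by rewrite dfwithout.
exists (t, t'); split=> //=; first by move: tI'; rewrite xj.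
have e3 : dfwith (dfwith x i t) j (x j) = dfwith x i t.
  by have := dfwith_id (dfwith x i t) j; rewrite xj.
have e4 : dfwith (dfwith x i (x i + h)) j (x j) = dfwith x i (x i + h).
  by have := dfwith_id (dfwith x i (x i + h)) j; rewrite dfwithout.
rewrite xj in e2; move: e1; rewrite d2.2 e3 e2 /g2 e4 dfwith_id expr2 -mulrA => <-; ring.
Qed.

(** The second difference is symmetric in the two directions. By [mixed_mvt] it is the squared step
    times either mixed derivative at a point that tends to [x], and both are continuous. *)
Lemma schwarz g i j : smooth g -> partial i (partial j g) = partial j (partial i g).
Proof.
move=> sg; have [->//|ij] := eqVneq i j.
apply: funext => x; have h0 n : 0 < harmonic n :> R by rewrite /harmonic/= invr_gt0.
have [p hp] := choice (fun n => mixed_mvt x ij sg (h0 n)).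
have ji : j != i by rewrite eq_sym.
have [q hq] := choice (fun n => mixed_mvt x ji sg (h0 n)).
have sq (u : nat -> R) (c : R) : (forall n, c < u n < c + harmonic n) -> u n @[n --> \oo] --> c.
  move=> hu; apply: (squeeze_cvgr (f := fun=> c) (h := fun n => c + harmonic n)).
  - by near=> n; have /andP[/ltW -> /ltW ->] := hu n.
  - exact: cvg_cst.
  - by rewrite -[X in _ --> X]addr0; apply: cvgD; [exact: cvg_cst|exact: cvg_harmonic].
have lim (f : (I -> R) -> R) k l (u v : nat -> R) : continuous (f : {ptws I -> R} -> R) ->
    u n @[n --> \oo] --> x k -> v n @[n --> \oo] --> x l -> k != l ->
    f (dfwith (dfwith x k (u n)) l (v n)) @[n --> \oo] --> f x.
  move=> cf cu cv kl.
  apply: (@continuous_cvg _ _ _ _ _ (fun n => dfwith (dfwith x k (u n)) l (v n) : {ptws I -> R}) f x).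
    exact: cf.
  apply: cvg_ptws => m.
  suff [w ew cw] : exists2 w : nat -> R,
      (forall n, dfwith (dfwith x k (u n)) l (v n) m = w n) & w n @[n --> \oo] --> x m.
    rewrite (_ : w = (fun n => dfwith (dfwith x k (u n)) l (v n) m)) in cw; first exact: cw.
    by apply: funext => n; rewrite ew.
  have [->|ml] := eqVneq m l; first by exists v => // n; rewrite dfwithin.
  have [->|mk] := eqVneq m k.
    by exists u => // n; rewrite dfwithout 1?eq_sym// dfwithin.
  by exists (fun=> x m) => [n|]; [rewrite !dfwithout 1?eq_sym|exact: cvg_cst].
have cij : continuous (partial i (partial j g) : {ptws I -> R} -> R).
  exact: (smooth_partial i (smooth_partial j sg) [::]).1.
have cji : continuous (partial j (partial i g) : {ptws I -> R} -> R).
  exact: (smooth_partial j (smooth_partial i sg) [::]).1.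
have p1 : (p n).1 @[n --> \oo] --> x i by apply: sq => n; have [] := hp n.
have p2 : (p n).2 @[n --> \oo] --> x j by apply: sq => n; have [] := hp n.
have q1 : (q n).1 @[n --> \oo] --> x j by apply: sq => n; have [] := hq n.
have q2 : (q n).2 @[n --> \oo] --> x i by apply: sq => n; have [] := hq n.
have l1 := lim _ i j _ _ cji p1 p2 ij; have l2 := lim _ j i _ _ cij q1 q2 ji.
have e : (fun n => partial i (partial j g) (dfwith (dfwith x j (q n).1) i (q n).2)) =
    (fun n => partial j (partial i g) (dfwith (dfwith x i (p n).1) j (p n).2)).
  apply: funext => n.
  have [_ _ e1] := hp n; have [_ _ e2] := hq n.
  have hn : harmonic n ^+ 2 != 0 :> R by rewrite expf_neq0// gt_eqF// h0.
  apply: (mulfI hn); rewrite -[LHS]e2 -[RHS]e1 [in LHS]dfwithC//; ring.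
rewrite e in l2; exact: (cvg_unique (@Rhausdorff R) l2 l1).
Unshelve. all: end_near. Qed.

Lemma partials_cat s1 s2 g : partials (s1 ++ s2) g = partials s1 (partials s2 g).
Proof. exact: foldr_cat. Qed.

Lemma partials_partial s i g : smooth g -> partials s (partial i g) = partial i (partials s g).
Proof.
move=> sg; elim: s => [|j s IH]; first by [].
exact: (etrans (congr1 (partial j) IH) (schwarz _ _ (smooth_partials s sg))).
Qed.

End MixedPartials.

(** * Interpolation in several variables *)

Section Interpolation.
Variables (R : realType) (I : finType) (n : nat).
Implicit Types (g : (I -> R) -> R) (x : I -> R) (i j : I) (k : nat) (t : R) (b : bool).

(** The point at which [height] equals [k / (n + 2)]. For [k = 0] it should lie at infinity, where
    lifted functions vanish; accordingly [node_coef] is 0 there and the value of [node 0] does not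
    matter. *)
Definition node k : R := radius (k%:R / n.+2%:R).
Definition node_coef k : R := if 0 < (k%:R / n.+2%:R : R) then (node k)^-1 else 0.
Definition node_weight k t : R :=
  t * (node_coef k * bern n.+2 (height t) (fun m => (m == k)%:R)).
Definition node_weight_deriv k t : R :=
  node_coef k * (bern n.+2 (height t) (fun m => (m == k)%:R)
   + t * (- (2 * t * height t)) * (n.+2%:R * bern n.+1 (height t)
       (fun m => (m.+1 == k)%:R - (m == k)%:R))).

Lemma lift_ratio (f : R -> R) k : lift (ratio f) (k%:R / n.+2%:R) = node_coef k * f (node k).
Proof. by rewrite /lift /node_coef; case: ifP => _; rewrite ?mul0r// /ratio mulrC. Qed.

Lemma interpE (f : R -> R) t : interp n f t = \sum_(k < n.+3) node_weight k t * f (node k).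
Proof.
rewrite /interp bern_sum mulr_sumr; apply: eq_bigr => k _.
by rewrite lift_ratio /node_weight; ring.
Qed.

Lemma interp_derivE (f : R -> R) t :
  interp_deriv n f t = \sum_(k < n.+3) node_weight_deriv k t * f (node k).
Proof.
rewrite /interp_deriv bern_sum.
have -> : bern n.+1 (height t) (fun k => lift (ratio f) (k.+1%:R / n.+2%:R) - lift (ratio f) (k%:R / n.+2%:R)) =
  \sum_(k < n.+3) lift (ratio f) (k%:R / n.+2%:R) * bern n.+1 (height t) (fun m => (m.+1 == k :> nat)%:R - (m == k :> nat)%:R).
  have sumE (r : seq 'I_n.+3) (h : nat -> R) (e : nat -> nat -> R) :
     bern n.+1 (height t) (fun m => \sum_(k <- r) h k * e k m) =
     \sum_(k <- r) h k * bern n.+1 (height t) (e k).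
    elim: r => [|k r IH]; first by rewrite big_nil; under eq_fun do rewrite big_nil; rewrite bern_cst.
    by rewrite big_cons; under eq_fun do rewrite big_cons; rewrite bernD bernZ IH.
  rewrite -(sumE _ (fun k => lift (ratio f) (k%:R / n.+2%:R)) (fun k m => (m.+1 == k :> nat)%:R - (m == k :> nat)%:R)).
  apply: eq_bern => m mn.
  have pick (q : nat) : (q < n.+3)%N -> \sum_(k < n.+3) lift (ratio f) (k%:R / n.+2%:R) * (q == k :> nat)%:R
     = lift (ratio f) (q%:R / n.+2%:R).
    move=> qn; rewrite (bigD1 (Ordinal qn))//= eqxx mulr1 big1 ?addr0// => k kq.
    by rewrite (_ : (q == k :> nat) = false) ?mulr0//; apply: contraNF kq => /eqP e; apply/eqP/val_inj.
  rewrite -(pick m.+1)// -(pick m); last by rewrite ltnS (leq_trans mn).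
  by rewrite -sumrB; apply: eq_bigr => k _; rewrite mulrBr.
rewrite !mulr_sumr -big_split/=; apply: eq_bigr => k _.
by rewrite lift_ratio /node_weight_deriv; ring.
Qed.

(** One-variable interpolation in the direction [i], or its derivative if [b] holds. By [opE] it is
    a finite combination of restrictions of [g] with coefficients depending on [x i] alone, hence
    commutes with the derivatives in the other directions. *)
Definition op b i g x : R :=
  (if b then interp_deriv n else interp n) (fun t => g (dfwith x i t)) (x i).

Lemma opE b i g x : op b i g x =
  \sum_(k < n.+3) (if b then node_weight_deriv k (x i) else node_weight k (x i)) * g (dfwith x i (node k)).
Proof. by rewrite /op; case: b; rewrite (interpE, interp_derivE). Qed.

Lemma partial_op_same i g : pderivable i (op false i g) /\ partial i (op false i g) = op true i g.
Proof.
apply: pderivable_partial => x.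
have := is_derive_interp n (fun t => g (dfwith x i t)) (x i); congr (is_derive _ _ _ _).
apply: funext => t; rewrite /op dfwithin; congr (interp n _ t).
by apply: funext => u; rewrite dfwith_dfwith.
Qed.

Lemma partial_op b i j g : i != j -> pderivable j g ->
  pderivable j (op b i g) /\ partial j (op b i g) = op b i (partial j g).
Proof.
move=> ij dg; apply: pderivable_partial => x.
pose w (k : nat) := if b then node_weight_deriv k (x i) else node_weight k (x i).
have -> : (fun t => op b i g (dfwith x j t)) =
   fun t => \sum_(k < n.+3) w k * g (dfwith (dfwith x i (node k)) j t).
  apply: funext => t; rewrite opE; apply: eq_bigr => k _.
  by rewrite dfwithout 1?eq_sym// dfwithC// eq_sym.
rewrite opE -/(w _).
have D k : is_derive (x j) (1 : R) (fun t => g (dfwith (dfwith x i (node k)) j t))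
    (partial j g (dfwith x i (node k))).
  by have := is_derive_partial (dfwith x i (node k)) dg; rewrite dfwithout.
have sumD (r : seq 'I_n.+3) : is_derive (x j) (1 : R)
    (fun t => \sum_(k <- r) w k * g (dfwith (dfwith x i (node k)) j t))
    (\sum_(k <- r) w k * partial j g (dfwith x i (node k))).
  elim: r => [|k r IH].
    by rewrite big_nil; under eq_fun do rewrite big_nil; exact: is_derive_cst.
  rewrite big_cons; under eq_fun do rewrite big_cons.
  exact: (is_deriveD (is_deriveZ (w k) (D k)) IH).
exact: sumD.
Qed.

Lemma continuous_dfwith i t :
  continuous ((fun x => dfwith x i t) : {ptws I -> R} -> {ptws I -> R}).
Proof.
apply: continuous_ptws => j; have [<-|ij] := eqVneq i j.
  rewrite (_ : (fun x => _) = fun=> t); first exact: cst_continuous.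
  by apply: funext => x; rewrite dfwithin.
rewrite (_ : (fun x => _) = fun x : {ptws I -> R} => x j); first exact: proj_continuous.
by apply: funext => x; rewrite dfwithout.
Qed.

Lemma Cn_dfwith m i t g : Cn m g -> Cn m (fun x => g (dfwith x i t)).
Proof.
elim: m g => [|m IH] g [cg Hg]; (split;
  first by move=> x; apply: (@continuous_comp _ _ _ (fun x : {ptws I -> R} => dfwith x i t : {ptws I -> R}) g);
    [exact: continuous_dfwith|exact: cg]) => //.
move=> j; have [dj Cj] := Hg j; have [ij|ij] := eqVneq i j.
  have [d0 e0] : pderivable j (fun x => g (dfwith x i t)) /\ partial j (fun x => g (dfwith x i t)) = fun=> 0.
    apply: pderivable_partial => x; rewrite -ij.
    by under eq_fun do rewrite dfwith_dfwith; exact: is_derive_cst.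
  by split=> //; rewrite e0; exact: Cn_cst.
have [d1 e1] : pderivable j (fun x => g (dfwith x i t)) /\
    partial j (fun x => g (dfwith x i t)) = fun x => partial j g (dfwith x i t).
  apply: pderivable_partial => x.
  have := is_derive_partial (dfwith x i t) dj; rewrite dfwithout//; congr (is_derive _ _ _ _).
  by apply: funext => u; rewrite dfwithC.
by split=> //; rewrite e1; exact: IH.
Qed.

Lemma Cn_bern m q (h : nat -> R) i : Cn m (fun x => bern q (height (x i)) h).
Proof.
have CY : Cn m (fun x : I -> R => height (x i)).
  rewrite /height; apply: Cn_exp; apply: CnD; first exact: Cn_cst.
  by apply: CnN; under eq_fun do rewrite expr2; apply: CnM; exact: Cn_coord.
elim: q h => [|q IH] h; first exact: Cn_cst.
apply: CnD; apply: CnM => //.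
by apply: CnD; [exact: Cn_cst|exact: CnN].
Qed.

Lemma Cn_op m i g : Cn m g -> Cn m (op false i g).
Proof.
move=> Cg; have -> : op false i g = fun x =>
    \sum_(k < n.+3) node_weight k (x i) * g (dfwith x i (node k)).
  by apply: funext => x; rewrite opE.
apply: Cn_sum => k _; apply: CnM; last exact: Cn_dfwith.
apply: CnM; first exact: Cn_coord.
by apply: CnZ; exact: Cn_bern.
Qed.

Lemma partials_op b i s g : i \notin s -> Cn (size s) g -> partials s (op b i g) = op b i (partials s g).
Proof.
elim: s g => [//|j s IH] g; rewrite inE negb_or => /andP[ij is_] Cg /=.
rewrite IH//; last exact: CnS.
have C1 : Cn (size s + 1) g by rewrite addn1.
have [_ /(_ j) [d _]] := Cn_partials C1.
by rewrite (partial_op b ij d).2.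
Qed.

Fixpoint interpolate (l : seq I) g : (I -> R) -> R :=
  if l is i :: l' then op false i (interpolate l' g) else g.

Lemma Cn_interpolate m l g : Cn m g -> Cn m (interpolate l g).
Proof. by move=> Cg; elim: l => [//|i l IH] /=; exact: Cn_op. Qed.

(* The derivative [partials r (partials [seq i <- l | i \in B] _)] of [interpolate l g],
   computed operator by operator. *)
Fixpoint interpolate_deriv (B : {set I}) (l r : seq I) g : (I -> R) -> R :=
  if l is i :: l' then op (i \in B) i (interpolate_deriv B l' r g) else partials r g.

Lemma interpolate_derivE (B : {set I}) l g : uniq l -> (forall m, Cn m g) ->
  partials [seq i <- l | i \in B] (interpolate l g) = interpolate_deriv B l [::] g.
Proof.
move=> + Cg; elim: l => [//|i l IH] /= /andP[il ul]; rewrite -IH//.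
have Cl m : Cn m (interpolate l g) by exact: Cn_interpolate.
have nf : i \notin [seq i <- l | i \in B] by rewrite mem_filter negb_and il orbT.
case: ifP => iB /=; last by rewrite partials_op.
by rewrite partials_op//(partial_op_same i _).2.
Qed.

Lemma partial_interpolate_deriv (B : {set I}) l r g j : smooth g -> j \notin l ->
  pderivable j (interpolate_deriv B l r g) /\
  partial j (interpolate_deriv B l r g) = interpolate_deriv B l (j :: r) g.
Proof.
move=> sg; elim: l => [_|i l IH] /=.
  by split=> //; exact: (smooth_pderivable (smooth_partials r sg)).
rewrite inE negb_or eq_sym => /andP[ij jl]; have [d e] := IH jl.
by have [d' e'] := partial_op (i \in B) ij d; rewrite e' e.
Qed.

Lemma interpolate_deriv_eq0 (B : {set I}) l r g (M : R) j x : j \notin l ->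
  (forall s x, M <= x j -> partials s g x = 0) -> M <= x j -> interpolate_deriv B l r g x = 0.
Proof.
move=> + g0; elim: l x => [|i l IH] x /=; first by move=> _; exact: g0.
rewrite inE negb_or => /andP[ji jl] Mx; rewrite opE big1// => k _.
by rewrite IH ?mulr0// dfwithout// eq_sym.
Qed.

Section Error.
Variables (B : {set I}) (g : (I -> R) -> R) (M A : R) (N : nat).
Hypotheses (g_smooth : smooth g) (M1 : 1 <= M) (A0 : 0 <= A).
Hypotheses (g_van : forall s x j, M <= x j -> partials s g x = 0).
Hypotheses (g_bound : forall s x, (size s <= N)%N -> `|partials s g x| <= A).

(** Each further direction multiplies the previous error by the stability constant of
    [interp_deriv_bound] and adds the error of [interp_deriv_approx]. *)
Fixpoint interp_const (l : seq I) : R :=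
  if l is _ :: l' then 4 * kappa M * interp_const l' + 13 * A * kappa M ^+ 2 else 0.

Lemma interp_const_ge0 l : 0 <= interp_const l.
Proof.
elim: l => [//|i l IH] /=; have k0 : 0 <= kappa M by exact: expR_ge0.
by rewrite addr_ge0// mulr_ge0// ?mulr_ge0// sqr_ge0.
Qed.

Definition wt (l : seq I) x : R := \prod_(i <- l) x i ^+ 2.

Lemma wt_ge1 l x : (forall i, 1 <= x i) -> 1 <= wt l x.
Proof.
move=> x1; elim: l => [|i l IH]; first by rewrite /wt big_nil.
by rewrite /wt big_cons mulr_ege1// exprn_ege1.
Qed.

(** [interpolate_deriv] at [i :: l] applies [op] to [Q = (Q - P) + P]. Stability bounds the first
    part by the error at [l], approximation bounds the second. Stability needs the derivative of
    [Q - P] in the direction [i] as well, hence the list [r] of further derivatives; each site may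
    use up two derivatives of [g], which explains the condition on [N]. *)
Lemma interpolate_error l r x : uniq l -> {in l, forall i, i \notin r} ->
  (size l + size l + size r <= N)%N -> (forall i, 1 <= x i) ->
  `|interpolate_deriv B l r g x - partials r (partials [seq i <- l | i \in B] g) x|
    <= interp_const l * wt l x / Num.sqrt n.+1%:R.
Proof.
elim: l r x => [|i l IH] r x /=; first by rewrite subrr normr0 !mul0r.
move=> /andP[il ul] lr szN x1.
pose P := partials r (partials [seq i <- l | i \in B] g).
have sP : smooth P by do 2 apply: smooth_partials.
pose Q := interpolate_deriv B l r g.
have [dQ eQ] := partial_interpolate_deriv B r g_smooth il; rewrite -/Q in dQ eQ.
pose h t := Q (dfwith x i t) - P (dfwith x i t).
pose dh t := partial i Q (dfwith x i t) - partial i P (dfwith x i t).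
have Dh t : 0 < t -> is_derive t (1 : R) h (dh t).
  move=> _; apply: is_deriveB; first exact: is_derive_partial_at dQ.
  exact: (is_derive_partial_at _ _ (smooth_pderivable sP)).
pose e := interp_const l * wt l x / Num.sqrt n.+1%:R.
have s0 : 0 < Num.sqrt (n.+1%:R : R) by rewrite sqrtr_gt0.
have w1 := wt_ge1 l x1.
have e0 : 0 <= e by rewrite divr_ge0 ?(ltW s0)// mulr_ge0 ?interp_const_ge0// (le_trans _ w1).
have xt1 t : 1 <= t -> forall j, 1 <= dfwith x i t j.
  by move=> t1 j; case: dfwithP.
have wt_t t : wt l (dfwith x i t) = wt l x.
  apply: eq_big_seq => j jl; rewrite dfwithout//.
  by apply: contraNneq il => ->.
have Pi : partial i P = partials (i :: r) (partials [seq i <- l | i \in B] g) by [].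
have lr' : {in l, forall j, j \notin r} by move=> j jl; apply: lr; rewrite inE jl orbT.
have hb t : 1 <= t -> `|h t| <= e.
  move=> t1; rewrite /e -(wt_t t); apply: IH => //; last exact: xt1.
  by apply: leq_trans szN; rewrite !addSn !addnS; do 2 apply: leqW.
have dhb t : 1 <= t -> `|dh t| <= e.
  move=> t1; rewrite /dh eQ Pi /e -(wt_t t); apply: IH => //; last exact: xt1.
    move=> j jl; rewrite inE negb_or lr' ?andbT//.
    by apply: contraNneq il => <-.
  by apply: leq_trans szN; rewrite /= !addSn !addnS; apply: leqW.
have P0 t : M <= t -> P (dfwith x i t) = 0.
  by move=> Mt; rewrite /P -partials_cat; apply: (@g_van _ _ i); rewrite dfwithin.
have Q0 t : M <= t -> Q (dfwith x i t) = 0.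
  move=> Mt; apply: (@interpolate_deriv_eq0 B l r g M i _ il) => [s y|]; first exact: g_van.
  by rewrite dfwithin.
have h0 t : M <= t -> h t = 0 by move=> Mt; rewrite /h P0// Q0// subrr.
have dP0 t : M <= t -> partial i P (dfwith x i t) = 0.
  by move=> Mt; rewrite Pi -partials_cat; apply: (@g_van _ _ i); rewrite dfwithin.
have dh0 t : M <= t -> dh t = 0.
  move=> Mt; rewrite /dh dP0// eQ.
  rewrite (@interpolate_deriv_eq0 B l (i :: r) g M i _ il) ?subrr// => [s y|]; first exact: g_van.
  by rewrite dfwithin.
pose f t := P (dfwith x i t).
pose f1 t := partial i P (dfwith x i t).
pose f2 t := partial i (partial i P) (dfwith x i t).
have sP1 := smooth_partial i sP.
have Df t : 0 < t -> is_derive t (1 : R) f (f1 t).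
  by move=> _; apply: is_derive_partial_at; exact: smooth_pderivable.
have Df1 t : 0 < t -> is_derive t (1 : R) f1 (f2 t).
  by move=> _; apply: is_derive_partial_at; exact: smooth_pderivable.
have f20 t : M <= t -> f2 t = 0.
  by move=> Mt; rewrite /f2 Pi -[partial i _]/(partials [:: i, i & r] _) -partials_cat;
    apply: (@g_van _ _ i); rewrite dfwithin.
have sz : (size [seq i <- l | i \in B] + size r + 2 <= N)%N.
  have := count_size (fun i => i \in B) l; move: szN; rewrite size_filter.
  by move: (count _ l) (size l) (size r) => p q m; lia.
have fA t : 1 <= t -> `|f t| <= A.
  by move=> _; rewrite /f /P -partials_cat; apply: g_bound; rewrite size_cat (leq_trans _ sz)// addnC leq_addr.
have f1A t : 1 <= t -> `|f1 t| <= A.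
  move=> _; rewrite /f1 Pi -partials_cat; apply: g_bound; rewrite size_cat (leq_trans _ sz)//=.
  by rewrite addSn addn2 [(size r + _)%N]addnC.
have f2A t : 1 <= t -> `|f2 t| <= A.
  move=> _; rewrite /f2 Pi -[partial i _]/(partials [:: i, i & r] _) -partials_cat.
  by apply: g_bound; rewrite size_cat (leq_trans _ sz)//= !addSn addn2 [(size r + _)%N]addnC.
have x1i := x1 i; have k1 : 1 <= kappa M by rewrite -expR0 ler_expR subr_ge0 exprn_ege1.
have x0i : 0 < x i by rewrite (lt_le_trans _ x1i).
have opD b : op b i Q x = (if b then interp_deriv n else interp n) h (x i)
    + (if b then interp_deriv n else interp n) f (x i).
  rewrite /op; case: b; rewrite ?interpE ?interp_derivE -big_split/=; apply: eq_bigr => k _;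
    rewrite /h /f; ring.
have wE : wt (i :: l) x = x i ^+ 2 * wt l x by rewrite /wt big_cons.
rewrite opD wE.
have tgt : (4 * kappa M * interp_const l + 13 * A * kappa M ^+ 2) * (x i ^+ 2 * wt l x) / Num.sqrt n.+1%:R =
   4 * e * kappa M * x i ^+ 2 + 13 * A * kappa M ^+ 2 * x i ^+ 2 / Num.sqrt n.+1%:R * wt l x.
  by rewrite /e; field; rewrite gt_eqF.
rewrite tgt.
have Pe : f (x i) = P x by rewrite /f dfwith_id.
have P1e : f1 (x i) = partial i P x by rewrite /f1 dfwith_id.
have c0 : 0 <= 13 * A * kappa M ^+ 2 * x i ^+ 2 / Num.sqrt n.+1%:R.
  by rewrite divr_ge0 ?(ltW s0)// mulr_ge0 ?sqr_ge0// mulr_ge0 ?sqr_ge0// mulr_ge0.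
case: ifP => iB.
  have ePi : partials r (partial i (partials [seq i <- l | i \in B] g)) = partial i P.
    exact: (partials_partial r i (smooth_partials [seq i <- l | i \in B] g_smooth)).
  rewrite [partials (i :: _) g]/= ePi.
  have b1 := interp_deriv_bound M1 e0 Dh h0 dh0 hb dhb n x1i.
  have b2 := interp_deriv_approx M1 A0 Df P0 dP0 fA f1A Df1 f20 f2A n x1i.
  rewrite -P1e -addrA (le_trans (ler_normD _ _))// lerD// (le_trans b2)//.
  by rewrite ler_peMr.
rewrite -/P.
have b1 := interp_bound e0 hb n x1i.
have b2 := interp_approx M1 A0 Df P0 dP0 fA f1A n x1i.
rewrite -Pe -addrA (le_trans (ler_normD _ _))// lerD//.
  rewrite (le_trans b1)// -2!mulrA mulrCA ler_wpM2l// mulrCA.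
  have : x i <= x i ^+ 2 by rewrite expr2 ler_peMl// ltW.
  move: (kappa M) (x i) (x i ^+ 2) k1 x0i x1i => p q q2 p1 q0 q1 qq; nra.
rewrite (le_trans b2)//; apply: (@le_trans _ _ (13 * A * kappa M ^+ 2 * x i ^+ 2 / Num.sqrt n.+1%:R)).
  rewrite ler_wpM2r ?invr_ge0 ?(ltW s0)//.
  rewrite -[X in _ <= X](_ : A * (13 * (kappa M ^+ 2 * x i ^+ 2)) = _); last by ring.
  rewrite -mulrA ler_wpM2l//.
  have h1 : x i <= x i ^+ 2 by rewrite expr2 ler_peMl// ltW.
  have h2 : kappa M <= kappa M ^+ 2 by rewrite expr2 ler_peMl// (le_trans _ k1).
  have h3 : kappa M * x i <= kappa M ^+ 2 * x i ^+ 2.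
    by rewrite ler_pM// ?(ltW x0i)// (le_trans _ k1).
  have : 0 <= kappa M * x i by rewrite mulr_ge0 ?(ltW x0i)// (le_trans _ k1).
  lra.
by rewrite ler_peMr.
Qed.

End Error.

End Interpolation.

(** * Functions of compact support *)

Section CompactSupport.
Variables (R : realType) (I : finType).
Implicit Types (g : (I -> R) -> R) (x : I -> R) (i j : I) (M : R).

Definition vanishes_beyond M g := forall x j, M < `|x j| -> g x = 0.

Lemma compactly_supported_vanishes g : compactly_supported g -> exists2 M, 1 <= M & vanishes_beyond M g.
Proof.
rewrite /compactly_supported; set K := closure _ => cg.
have bd j : exists M : R, forall x, K x -> `|x j| <= M.
  have cK : compact ((fun x : {ptws I -> R} => x j) @` K).
    apply: continuous_compact => //; apply: continuous_subspaceT; exact: proj_continuous.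
  have [M [_ HM]] := compact_bounded cK.
  by exists (M + 1) => x Kx; apply: (HM (M + 1)); [rewrite ltrDl|exists x].
have [M HM] := choice bd.
exists (1 + \sum_j `|M j|); first by rewrite lerDl sumr_ge0.
move=> x j; apply: contraTeq => gx; rewrite -leNgt.
have Kx : K x by apply: subset_closure; exact: gx.
rewrite (le_trans (HM j x Kx))// (le_trans (ler_norm _))// (bigD1 j)//=.
by rewrite addrCA lerDl addr_ge0// sumr_ge0.
Qed.

Lemma vanishes_partial M i g : vanishes_beyond M g -> vanishes_beyond M (partial i g).
Proof.
move=> vg x j Mx; rewrite /partial derive1E.
have e : \forall t \near x i, 0 = g (dfwith x i t).
  have [ij|ij] := eqVneq i j; last first.
    by near=> t; rewrite (vg _ j)// dfwithout.
  rewrite -ij in Mx; near=> t; rewrite (vg _ i)// dfwithin.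
  by near: t; have := @norm_continuous _ _ (x i); move/cvgr_gt; exact.
by have := near_eq_is_derive e (is_derive_cst (0 : R) (x i) 1) => H; rewrite derive_val.
Unshelve. all: end_near. Qed.

Lemma vanishes_partials M s g : vanishes_beyond M g -> vanishes_beyond M (partials s g).
Proof. by elim: s => [//|i s IH] /IH; exact: vanishes_partial. Qed.

Lemma vanishes_bounded M g : continuous (g : {ptws I -> R} -> R) -> vanishes_beyond M g ->
  exists A, forall x, `|g x| <= A.
Proof.
move=> cg vg.
have cbox := tychonoff (fun _ : I => @segment_compact R (- M) M).
have cgb : compact (g @` [set x : {ptws I -> R} | forall i, `[- M, M]%classic (x i)]).
  by apply: continuous_compact => //; exact: continuous_subspaceT.
have [A [_ HA]] := compact_bounded cgb.
exists (Num.max 0 (A + 1)) => x; rewrite le_max.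
have [bx|bx] := pselect (forall j, `|x j| <= M).
  apply/orP; right; apply: (HA (A + 1)); first by rewrite ltrDl.
  by exists x => // j; rewrite /= in_itv/= -ler_norml.
move/existsNP: bx => [j /negP]; rewrite -ltNge => /vg ->.
by rewrite normr0 lexx.
Qed.

Lemma vanishes_partials_bounded M g N : smooth g -> vanishes_beyond M g ->
  exists2 A, 0 <= A & forall s x, (size s <= N)%N -> `|partials s g x| <= A.
Proof.
move=> sg vg; elim: N => [|N [A A0 HA]].
  have [A HA] := vanishes_bounded (sg [::]).1 vg.
  exists (Num.max 0 A); first by rewrite le_max lexx.
  by move=> [|//] x _; rewrite le_max HA orbT.
(* There are finitely many lists of a given length, so the individual bounds may be added up. *)
have bd (t : N.+1.-tuple I) : exists A, forall x, `|partials t g x| <= A.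
  exact: vanishes_bounded (sg t).1 (vanishes_partials t vg).
have [C HC] := choice bd.
exists (A + \sum_t `|C t|) => [|s x]; first by rewrite addr_ge0// sumr_ge0.
rewrite leq_eqVlt => /orP[/eqP sN|sN]; last first.
  by rewrite (le_trans (HA s x _))// lerDl sumr_ge0.
have e : s = in_tuple s by [].
pose t : N.+1.-tuple I := Tuple (introT eqP sN).
rewrite (le_trans (HC t x))// (le_trans (ler_norm _))// (bigD1 t)//= addrCA lerDl.
by rewrite addr_ge0// sumr_ge0.
Qed.

End CompactSupport.

(** * Density of the test functions *)

Section Monomials.
Variables (R : realType) (I : finType) (n : nat).
Implicit Types (g : (I -> R) -> R) (x y : I -> R) (i j : I) (l : seq I).

Definition monomial l (k : I -> nat) x : R := \prod_(i <- l) (x i * expR (- ((k i)%:R * x i ^+ 2))).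

Lemma node_weight_span (m : nat) : exists r : seq (R * nat),
  forall t : R, node_weight n m t = \sum_(u <- r) u.1 * (t * expR (- (u.2%:R * t ^+ 2))).
Proof.
have [p hp] := bern_poly n.+2 (fun k => (k == m)%:R : R).
exists [seq (node_coef R n m * p`_k * expR k%:R, k) | k <- index_iota 0 (size p)] => t.
rewrite /node_weight hp horner_coef big_map mulr_sumr mulr_sumr.
rewrite big_mkord; apply: eq_bigr => k _ /=.
have -> : height t ^+ k = expR k%:R * expR (- (k%:R * t ^+ 2)).
  by rewrite /height -expRM_natl -expRD; congr expR; ring.
by ring.
Qed.

Lemma interpolate_span l g y : uniq l -> exists r : seq (R * (I -> nat)),
  forall x, (forall i, i \notin l -> x i = y i) ->
  interpolate n l g x = \sum_(u <- r) u.1 * monomial l u.2 x.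
Proof.
elim: l y => [|i l IH] y /=.
  move=> _; exists [:: (g y, fun=> 0%N)] => x xy.
  rewrite big_seq1 /monomial big_nil mulr1; congr g; apply: funext => i; exact: xy.
move=> /andP[il ul].
have [r hr] := choice (fun k : nat => IH (dfwith y i (node R n k)) ul).
have [w hw] := choice node_weight_span.
exists (flatten [seq (flatten [seq [seq (u.1 * v.1, fun j => if j == i then u.2 else v.2 j) | v <- r k] | u <- w k])
   | k <- index_iota 0 n.+3]) => x xy.
rewrite -[LHS]/(op n false i (interpolate n l g) x) opE big_flatten big_map big_mkord.
apply: eq_bigr => k _; rewrite hw big_flatten big_map mulr_suml; apply: eq_bigr => u _.
rewrite big_map (hr k (dfwith x i (node R n k))); last first.
  move=> j jl; have [<-|ij] := eqVneq i j; first by rewrite !dfwithin.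
  by rewrite !dfwithout// xy// inE eq_sym negb_or ij.
rewrite mulr_sumr; apply: eq_bigr => v _ /=.
have -> : monomial l v.2 (dfwith x i (node R n k)) = monomial l v.2 x.
  apply: eq_big_seq => j jl; rewrite dfwithout//.
  by apply: contraNneq il => ->.
rewrite /monomial big_cons eqxx.
have -> : \prod_(j <- l) (x j * expR (- ((if j == i then u.2 else v.2 j)%:R * x j ^+ 2))) =
   \prod_(j <- l) (x j * expR (- ((v.2 j)%:R * x j ^+ 2))).
  apply: eq_big_seq => j jl; rewrite ifN//; apply: contraNneq il => <- //.
ring.
Qed.

Lemma partials_dfwith s g a (c : R) : a \notin s -> Cn (size s) g ->
  partials s (fun x => g (dfwith x a c)) = fun x => partials s g (dfwith x a c).
Proof.
elim: s => [//|i s IH]; rewrite inE negb_or => /andP[ai as_] Cg /=.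
rewrite IH//; last exact: CnS.
have C1 : Cn (size s + 1) g by rewrite addn1.
have [_ /(_ i) [d _]] := Cn_partials C1.
apply: (proj2 (@pderivable_partial _ _ _ _ _ _)) => x.
have := is_derive_partial (dfwith x a c) d; rewrite dfwithout//; congr (is_derive _ _ _ _).
by apply: funext => t; rewrite dfwithC.
Qed.

End Monomials.

Lemma cvg_inv_sqrt (R : realType) : (Num.sqrt (n.+1%:R : R))^-1 @[n --> \oo] --> (0 : R).
Proof.
have -> : (fun n => (Num.sqrt (n.+1%:R : R))^-1) = fun n => Num.sqrt (harmonic n).
  by apply: funext => n; rewrite /harmonic/= sqrtrV.
rewrite -[X in _ --> X]sqrtr0.
by apply: continuous_cvg; [exact: sqrt_continuous|exact: cvg_harmonic].
Qed.

Section Density.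
Variables (R : realType) (Lambda : finType) (a : Lambda).
Local Notation I := (~: [set a])%SET.

(** [F] is interpolated in all coordinates except that of [a], which is held at [cosh s], its value
    in all conditions. The derivatives at [a] never matter, as the blocks are contained in [I]. *)
Theorem density (F : (Lambda -> R) -> R) (M s : R) : smooth F -> vanishes_beyond M F ->
  exists A (Fn : nat -> (Lambda -> R) -> R) (eps : nat -> R),
  [/\ 0 <= A /\ block_bounded a s 2 A F, forall n, Cn #|Lambda| (Fn n),
    forall n, 0 <= eps n /\ block_bounded a s 2 (eps n) (fun l => F l - Fn n l),
    eps n @[n --> \oo] --> (0 : R) &
    forall n, exists r : seq (R * (Lambda -> nat)),
      forall l, Fn n l = \sum_(u <- r) u.1 * monomial (enum I) u.2 l].
Proof.
move=> sF vF; pose N := (#|I| + #|I|)%N.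
have CF n : Cn n F by exact: smooth_Cn.
have [A A0 HA] := vanishes_partials_bounded (N + #|Lambda|) sF vF.
(* The margin 1 is there because [vanishes_beyond M] only speaks of points strictly beyond [M]; the
   maximum provides [1 <= M']. *)
pose M' := Num.max 1 (M + 1).
have M1 : 1 <= M' by rewrite le_max lexx.
have van r x j : M' <= x j -> partials r F x = 0.
  move=> Mx; apply: (vanishes_partials r vF (j := j)).
  rewrite (lt_le_trans _ (ler_norm _))// (lt_le_trans _ Mx)// lt_max ltrDl ltr01.
  by rewrite orbT.
pose C := interp_const M' A (enum I).
pose Fn n l := interpolate n (enum I) F (dfwith l a (cosh s)).
pose eps n : R := C / Num.sqrt n.+1%:R.
have C0 : 0 <= C by exact: interp_const_ge0.
have blockE (B : {set Lambda}) : (B \subset I)%SET -> sub_block B = [seq i <- enum I | i \in B].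
  move=> BI; rewrite /sub_block {2}/enum_mem -enumT -filter_predI; apply: eq_filter => i /=.
  by case: (boolP (i \in B)) => //= iB; rewrite (fintype.subsetP BI).
have aB (B : {set Lambda}) : (B \subset I)%SET -> a \notin sub_block B.
  by move=> BI; rewrite mem_filter; apply/negP => /andP[/(fintype.subsetP BI)]; rewrite !inE eqxx.
have szB (B : {set Lambda}) : (size (sub_block B) <= #|Lambda|)%N by rewrite size_filter cardE count_size.
have w1 (l : Lambda -> R) : (forall i : Lambda, 1 <= l i) -> wt (enum I) l <= weight a 2 l /\ 1 <= weight a 2 l.
  move=> l1; rewrite /wt /weight big_enum/=; split.
    apply: ler_prod => i _; have := l1 i; move: (l i) => t t1.
    by rewrite sqr_ge0/=; nra.
  elim/big_ind: _ => // [u v u1 v1|i _]; first exact: mulr_ege1.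
  by rewrite exprn_ege1// lerDl (le_trans _ (l1 i)).
have Cint n m : Cn m (interpolate n (enum I) F) by exact: Cn_interpolate.
exists A, Fn, eps; split.
- split=> // B BI l la l1; rewrite (le_trans (HA _ _ _)) ?(leq_trans (szB B))// ?leq_addl//.
  by rewrite ler_peMr//; case: (w1 l l1).
- by move=> n; exact: Cn_dfwith.
- move=> n; split=> [|B BI l la l1]; first by rewrite divr_ge0 ?sqrtr_ge0.
  have CFn : Cn (size (sub_block B)) (Fn n) by exact: Cn_dfwith.
  rewrite partialsB// partials_dfwith ?aB// -la dfwith_id blockE//.
  rewrite interpolate_derivE ?enum_uniq// distrC.
  have E := @interpolate_error R Lambda n B F M' A (N + #|Lambda|) sF M1 A0 van HA (enum I) [::] l
    (enum_uniq _) (fun _ _ => isT) _ l1.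
  apply: (le_trans (E _)); first by rewrite addn0 -!cardE leq_addr.
  have [h1 _] := w1 l l1.
  by rewrite /eps mulrAC ler_wpM2l// divr_ge0 ?sqrtr_ge0.
- rewrite /eps -(mulr0 C); apply: cvgM; first exact: cvg_cst.
  exact: cvg_inv_sqrt.
- move=> n; have [r hr] := interpolate_span n F (fun=> cosh s) (enum_uniq I).
  exists r => l; rewrite /Fn hr; last first.
    move=> i; rewrite mem_enum !inE negbK => /eqP ->; by rewrite dfwithin.
  apply: eq_bigr => u _; congr (_ * _); apply: eq_big_seq => i.
  by rewrite mem_enum !inE => ia; rewrite dfwithout// eq_sym.
Qed.

End Density.

(** * Occupation times of a right-continuous path *)

Lemma cvg_Rintegral_bounded d (T : measurableType d) (R : realType)
    (mu : {measure set T -> \bar R}) (D : set T) (h : (T -> R)^nat) (f : T -> R) (C : R) :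
  measurable D -> mu.-integrable D (cst C%:E) ->
  (forall n, measurable_fun D (h n)) -> measurable_fun D f ->
  {ae mu, forall x, D x -> h n x @[n --> \oo] --> f x} ->
  (forall n x, D x -> `|h n x| <= C) ->
  \int[mu]_(x in D) h n x @[n --> \oo] --> \int[mu]_(x in D) f x.
Proof.
move=> mD iC mh mf hf hC.
have [||||| fi _ cv] := @dominated_convergence _ _ _ mu D mD (fun n => EFin \o h n) (EFin \o f) (cst C%:E).
- by move=> n; exact/measurable_EFinP.
- exact/measurable_EFinP.
- by apply: filterS hf => x hx Dx; apply: cvg_EFin; [exact: nearW|exact: hx].
- exact: iC.
- by apply/aeW => x n Dx; rewrite /= lee_fin hC.
apply: (fine_cvg _).
by rewrite fineK//; exact: integrable_fin_num.
Qed.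

Lemma cvg_sumr (R : realType) (I : finType) (h : I -> nat -> R) (f : I -> R) :
  (forall i, h i n @[n --> \oo] --> f i) -> \sum_i h i n @[n --> \oo] --> \sum_i f i.
Proof. by move=> hf; apply: cvg_big => //; exact: add_continuous. Qed.

Lemma integrable_itvoc_cst (R : realType) (s t C : R) :
  (@lebesgue_measure R).-integrable `]s, t] (cst C%:E).
Proof.
apply/integrableP; split; first exact: measurable_cst.
rewrite integral_cst//= lebesgue_measure_itv/=; case: ifP => _; last by rewrite mule0 ltry.
by rewrite -EFinB -EFinM ltry.
Qed.

Section Path.
Variables (R : realType) (Lambda : finType) (x : R -> Lambda).
Hypothesis x_right : forall t : R, 0 <= t ->
  exists2 e : R, 0 < e & forall r : R, t <= r < t + e -> x r = x t.
Implicit Types (s t r : R) (i : Lambda) (n k : nat).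

Local Notation mu := (@lebesgue_measure R).

Definition mesh s t n k : R := s + k%:R * ((t - s) / n.+1%:R).

Lemma mesh0 s t n : mesh s t n 0 = s. Proof. by rewrite /mesh mul0r addr0. Qed.

Lemma meshS s t n k : mesh s t n k.+1 = mesh s t n k + (t - s) / n.+1%:R.
Proof. by rewrite /mesh -natr1 mulrDl mul1r addrA. Qed.

Lemma mesh_last s t n : mesh s t n n.+1 = t.
Proof. by rewrite /mesh mulrC divfK// addrC subrK. Qed.

Lemma mesh_ge s t n k : s <= t -> s <= mesh s t n k.
Proof. by move=> st; rewrite lerDl mulr_ge0// divr_ge0// subr_ge0. Qed.

Lemma mesh_le s t n k : s <= t -> (k <= n.+1)%N -> mesh s t n k <= t.
Proof.
move=> st kn; rewrite -[leRHS](mesh_last s t n) lerD2l ler_wpM2r ?ler_nat//.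
by rewrite divr_ge0// subr_ge0.
Qed.

(** The path replaced on each mesh cell by its value at the right end, which is the correct value
    once the mesh is fine, by right-continuity. Occupation times thus become limits of sums over
    finitely many times, and inherit their measurability with respect to the history. *)
Definition sample s t n i r : R :=
  \sum_(k < n.+1) (x (mesh s t n k.+1) == i)%:R * \1_`]mesh s t n k, mesh s t n k.+1] r.

Lemma indic_itvoc (b c r : R) : b <= c -> \1_`]b, c] r = (b < r)%R%:R - (c < r)%R%:R :> R.
Proof.
move=> bc; rewrite indicE mem_setE in_itv/= leNgt.
case: ltP => br; case: ltP => cr //=; rewrite ?subr0 ?subrr//.
by move: (le_lt_trans bc cr); rewrite ltNge br.
Qed.

(** The right end of the cell containing [r] lies in [[r, r + e[], where the path is constant; the
    indicators of the cells telescope to 1. *)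
Lemma sampleE s t n i r e : s < r <= t -> (t - s) / n.+1%:R < e ->
  (forall r', r <= r' < r + e -> x r' = x r) -> sample s t n i r = (x r == i)%:R.
Proof.
move=> /andP[sr rt] ne xe.
have st := ltW (lt_le_trans sr rt).
have stn : 0 <= (t - s) / n.+1%:R by rewrite divr_ge0// subr_ge0.
have mono k : mesh s t n k <= mesh s t n k.+1 by rewrite meshS lerDl.
transitivity (\sum_(k < n.+1) (x r == i)%:R * ((mesh s t n k < r)%R%:R - (mesh s t n k.+1 < r)%R%:R) : R).
  apply: eq_bigr => k _; rewrite indic_itvoc//.
  case: (ltP (mesh s t n k) r) => k1; case: (ltP (mesh s t n k.+1) r) => k2.
  - by rewrite subrr !mulr0.
  - rewrite xe// k2 meshS/=; exact: ltrD.
  - by move: (le_lt_trans (mono k) k2); rewrite ltNge k1.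
  - by rewrite subrr !mulr0.
rewrite -mulr_sumr -[RHS]mulr1; congr (_ * _).
rewrite -(big_mkord xpredT (fun k => (mesh s t n k < r)%R%:R - (mesh s t n k.+1 < r)%R%:R)).
under eq_bigr do rewrite -opprB.
by rewrite sumrN telescope_sumr// mesh_last mesh0 sr ltNge rt sub0r opprK.
Qed.

Lemma sample_bounds s t n i r : s <= t -> 0 <= sample s t n i r <= 1.
Proof.
move=> st; rewrite sumr_ge0/=; last by move=> k _; rewrite mulr_ge0.
have stn : 0 <= (t - s) / n.+1%:R by rewrite divr_ge0// subr_ge0.
have mono k : mesh s t n k <= mesh s t n k.+1 by rewrite meshS lerDl.
apply: (@le_trans _ _ (\sum_(k < n.+1) ((mesh s t n k < r)%R%:R - (mesh s t n k.+1 < r)%R%:R))).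
  by apply: ler_sum => k _; rewrite -indic_itvoc// ler_piMl//; case: (_ == _).
rewrite -(big_mkord xpredT (fun k => (mesh s t n k < r)%R%:R - (mesh s t n k.+1 < r)%R%:R)).
under eq_bigr do rewrite -opprB.
rewrite sumrN telescope_sumr// opprB mesh_last mesh0.
by case: (s < r); case: (t < r) => /=; lra.
Qed.

Lemma cvg_sample s t i r : 0 <= s -> s < r <= t ->
  sample s t n i r @[n --> \oo] --> ((x r == i)%:R : R).
Proof.
move=> s0 srt; have /andP[sr rt] := srt.
have [e e0 xe] := x_right (le_trans s0 (ltW sr)).
have h : (t - s) * @harmonic R n @[n --> \oo] --> (0 : R).
  by rewrite -[X in _ --> X](mulr0 (t - s)); apply: cvgM; [exact: cvg_cst|exact: cvg_harmonic].
apply: cvg_near_cst; near=> n; rewrite (@sampleE s t n i r e)//.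
near: n; exact: (cvgr_lt 0 h).
Unshelve. all: end_near. Qed.

Lemma measurable_sample s t n i D : measurable_fun D (sample s t n i).
Proof.
apply: measurable_sum => k; exact: measurable_funM.
Qed.

Lemma measurable_path s t i : 0 <= s ->
  measurable_fun `]s, t] (fun r => (x r == i)%:R : R).
Proof.
move=> s0; apply: (@measurable_fun_cvg _ _ _ _ (fun n => sample s t n i)).
  by move=> n; exact: measurable_sample.
by move=> r; rewrite /= in_itv/= => srt; exact: cvg_sample.
Qed.

Lemma integral_sample s t n i : s <= t ->
  (\int[mu]_(r in `]s, t]) (sample s t n i r)%:E =
   (\sum_(k < n.+1) (x (mesh s t n k.+1) == i)%:R * ((t - s) / n.+1%:R))%:E)%E.
Proof.
move=> st.
have stn : 0 <= (t - s) / n.+1%:R by rewrite divr_ge0// subr_ge0.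
under eq_integral do rewrite -sumEFin.
rewrite ge0_integral_sum//=; last 1 first.
  by move=> k; apply/measurable_EFinP; exact: measurable_funM.
rewrite -sumEFin; apply: eq_bigr => k _.
under eq_integral do rewrite EFinM.
rewrite ge0_integralZl//=; last first.
- by apply/measurable_EFinP; exact: measurable_indic.
rewrite integral_indic// setIidl; last first.
  move=> r /=; rewrite !in_itv/= => /andP[r1 r2]; rewrite (le_lt_trans (mesh_ge _ _ _) r1)//=.
  by rewrite (le_trans r2)// mesh_le// ltnS.
have e : (mu `]mesh s t n k, mesh s t n k.+1] = ((t - s) / n.+1%:R)%:E)%E.
  rewrite lebesgue_measure_itv/= lte_fin meshS ltrDl.
  case: ltP => h; first by rewrite -EFinB addrC addKr.
  by have -> : (t - s) / n.+1%:R = 0 by apply/le_anti; rewrite h stn.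
by rewrite EFinM; congr (_ * _)%E; exact: e.
Qed.

Lemma integrable_path s t i : 0 <= s -> mu.-integrable `]s, t] (EFin \o (fun r => (x r == i)%:R : R)).
Proof.
move=> s0; apply: (@le_integrable _ _ _ mu _ _ _ (cst 1%E)) => //=.
- by apply/measurable_EFinP; exact: measurable_path.
- by move=> r _; rewrite normr1 lee_fin; case: (x r == i); rewrite ?normr1// normr0.
- exact: integrable_itvoc_cst.
Qed.

Lemma cvg_integral_sample s t i : 0 <= s -> s <= t ->
  \sum_(k < n.+1) (x (mesh s t n k.+1) == i)%:R * ((t - s) / n.+1%:R) @[n --> \oo] -->
  \int[mu]_(r in `]s, t]) (x r == i)%:R.
Proof.
move=> s0 st.
have -> : (fun n => \sum_(k < n.+1) (x (mesh s t n k.+1) == i)%:R * ((t - s) / n.+1%:R)) =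
  (fun n => \int[mu]_(r in `]s, t]) sample s t n i r).
  by apply: funext => n; rewrite /Rintegral integral_sample.
apply: (@cvg_Rintegral_bounded _ _ _ mu `]s, t] (sample s t ^~ i) _ 1) => //.
- exact: integrable_itvoc_cst.
- by move=> n; exact: measurable_sample.
- exact: measurable_path.
- by apply/aeW => r; rewrite /= in_itv/= => srt; exact: cvg_sample.
- move=> n r; rewrite /= in_itv/= => srt; have /andP[s1 s2] := sample_bounds n i r st.
  by rewrite ger0_norm.
Qed.

Definition occupation t i : R := \int[mu]_(r in `[0, t]) (x r == i)%:R.

Lemma occupationB s t i : 0 <= s -> s <= t ->
  occupation t i - occupation s i = \int[mu]_(r in `]s, t]) (x r == i)%:R.
Proof.
move=> s0 st; rewrite /occupation.
rewrite -!Rintegral_itv_obnd_cbnd; try exact: integrable_path.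
rewrite Rintegral_itvB ?bnd_simp//; exact: integrable_path.
Qed.

Lemma occupation0 i : occupation 0 i = 0.
Proof. by rewrite /occupation set_itv1 Rintegral_set1. Qed.

Definition visits s t n i : R := \sum_(k < n.+1) (x (mesh s t n k.+1) == i)%:R * ((t - s) / n.+1%:R).

Lemma cvg_visits s t i : 0 <= s -> s <= t ->
  visits s t n i @[n --> \oo] --> occupation t i - occupation s i.
Proof. by move=> s0 st; rewrite occupationB//; exact: cvg_integral_sample. Qed.

Lemma visits_ge0 s t n i : s <= t -> 0 <= visits s t n i.
Proof.
by move=> st; apply: sumr_ge0 => k _; rewrite mulr_ge0// divr_ge0// subr_ge0.
Qed.

Lemma occupation_le s t i : 0 <= s -> s <= t -> occupation s i <= occupation t i.
Proof.
move=> s0 st; rewrite -subr_ge0; apply: (ler_cvg_to (cvg_cst (0 : R)) (cvg_visits (i := i) s0 st)).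
by apply: nearW => n; exact: visits_ge0.
Qed.

Lemma occupation_sum s t : 0 <= s -> s <= t ->
  \sum_i (occupation t i - occupation s i) = t - s.
Proof.
move=> s0 st.
have h : \sum_i visits s t n i @[n --> \oo] --> \sum_i (occupation t i - occupation s i).
  by apply: cvg_sumr => i; exact: cvg_visits.
apply: (cvg_unique (@Rhausdorff R) h).
apply: cvg_near_cst; apply: nearW => n; rewrite exchange_big/=.
under eq_bigr do rewrite -mulr_suml.
rewrite (eq_bigr (fun=> (t - s) / n.+1%:R)); last first.
  move=> k _; rewrite (bigD1 (x (mesh s t n k.+1)))//= eqxx big1 ?addr0 ?mul1r//.
  by move=> j /negPf; rewrite eq_sym => ->.
by rewrite sumr_const card_ord -[LHS]mulr_natr divfK.
Qed.

Lemma occupation_lip s t i : 0 <= s -> s <= t -> occupation t i - occupation s i <= t - s.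
Proof.
move=> s0 st; rewrite -(occupation_sum s0 st) (bigD1 i)//= lerDl.
by apply: sumr_ge0 => j _; rewrite subr_ge0 occupation_le.
Qed.

Lemma occupation_idle s t i : 0 <= s -> s <= t ->
  (forall r, s < r <= t -> x r != i) -> occupation t i = occupation s i.
Proof.
move=> s0 st xi; apply/eqP; rewrite -subr_eq0; apply/eqP.
apply: (cvg_unique (@Rhausdorff R) (cvg_visits (i := i) s0 st)).
apply: cvg_near_cst; apply: nearW => n; apply: big1 => k _.
have [->|st'] := eqVneq s t; first by rewrite subrr mul0r mulr0.
rewrite (negPf (xi _ _)) ?mul0r// mesh_le// andbT.
rewrite (@le_lt_trans _ _ (mesh s t n k)) ?mesh_ge// meshS ltrDl.
by rewrite divr_gt0// subr_gt0 lt_neqAle st'.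
Qed.

End Path.

(** * Layer-cake approximation and expectations *)

Section LayerCake.
Variable R : realType.

Definition layers (m : nat) (z : R) : R := m.+1%:R^-1 * \sum_(k < m.+1) (k.+1%:R / m.+1%:R <= z)%R%:R.

Lemma layers_approx m z : 0 <= z <= 1 -> `|z - layers m z| <= harmonic m.
Proof.
move=> /andP[z0 z1].
have count (n : nat) (y : R) : 0 <= y -> y <= n.+1%:R ->
    y - 1 <= \sum_(k < n.+1) (k.+1%:R <= y)%R%:R <= y.
  elim: n y => [|n IH] y y0 yn.
    by rewrite big_ord1; move: yn; case: (leP 1 y) => /= h1 h2; lra.
  rewrite big_ord_recr/=; case: (leP y n.+1%:R) => h.
    have /andP[I1 I2] := IH y y0 h.
    have -> : (n.+2%:R <= y) = false by apply/negbTE; rewrite -ltNge (le_lt_trans h)// ltr_nat.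
    by rewrite addr0 I1.
  have -> : \sum_(i < n.+1) (i.+1%:R <= y)%R%:R = n.+1%:R :> R.
    rewrite (eq_bigr (fun=> 1)) ?sumr_const ?card_ord// => i _.
    by rewrite (le_trans _ (ltW h))// ler_nat ltn_ord.
  move: yn h; rewrite -[n.+2%:R]natr1; case: (leP (n.+1%:R + 1) y) => h1 h2 h3 /=; lra.
have m0 : (0 : R) < m.+1%:R by [].
have := count m (z * m.+1%:R); rewrite mulr_ge0// => /(_ isT); rewrite ler_piMl// => /(_ isT).
have -> : \sum_(k < m.+1) (k.+1%:R <= z * m.+1%:R)%R%:R = m.+1%:R * layers m z.
  rewrite /layers mulrA divff// mul1r; apply: eq_bigr => k _.
  by rewrite ler_pdivrMr.
rewrite /harmonic/= => /andP[h1 h2]; rewrite -(ler_pM2l m0) divff//.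
rewrite -[X in X * _](gtr0_norm m0) -normrM mulrBr ger0_norm; lra.
Qed.
End LayerCake.

Section Expectation.
Context {d : measure_display} {T : measurableType d} {R : realType} (P : probability T R).
Implicit Types (f g Z D : T -> R) (A : set T).

Lemma integrable_bounded f C : measurable_fun setT f -> (forall w, `|f w| <= C) ->
  P.-integrable setT (EFin \o f).
Proof.
move=> mf fC; apply: (@le_integrable _ _ _ P _ _ _ (cst C%:E)) => //.
- exact/measurable_EFinP.
- by move=> w _ /=; rewrite lee_fin (le_trans (fC w))// ler_norm.
- by apply: finite_measure_integrable_cst.
Qed.

Lemma Rintegral_probability (c : R) : \int[P]_(w in setT) c = c.
Proof.
by rewrite Rintegral_cst// (_ : fine _ = 1) ?mulr1//; rewrite (congr1 fine (probability_setT P)).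
Qed.

Lemma integral_le_ae f (C : R) : 0 <= C ->
  P.-integrable setT (EFin \o f) -> {ae P, forall w, `|f w| <= C} -> `|\int[P]_w f w| <= C.
Proof.
move=> C0 fi fC; apply: (le_trans (le_normr_Rintegral _ fi)) => //.
rewrite -[leRHS]Rintegral_probability.
have iN := integrable_norm fi.
apply: fine_le.
- exact: (integrable_fin_num measurableT iN).
- exact: (integrable_fin_num measurableT (finite_measure_integrable_cst P _ measurableT)).
apply: ae_ge0_le_integral => //=.
- exact: (measurable_int _ iN).
- by apply: filterS fC => w fw _; rewrite lee_fin.
Qed.

Lemma integral_le_bounded f C : measurable_fun setT f -> (forall w, `|f w| <= C) ->
  `|\int[P]_w f w| <= C.
Proof.
move=> mf fC; apply: integral_le_ae; first exact: le_trans (fC point).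
  exact: integrable_bounded fC.
by apply: aeW.
Qed.

Lemma integrable_boundedM Z D C : measurable_fun setT Z -> (forall w, `|Z w| <= C) ->
  P.-integrable setT (EFin \o D) -> P.-integrable setT (EFin \o (fun w => Z w * D w)).
Proof.
move=> mZ ZC iD; have mD : measurable_fun setT D by apply/measurable_EFinP; exact: measurable_int iD.
apply: (@le_integrable _ _ _ P _ _ _ (fun w => C%:E * (EFin \o (Num.norm \o D)) w)%E) => //.
- by apply/measurable_EFinP; exact: measurable_funM.
- move=> w _ /=; rewrite lee_fin normrM [leRHS]ger0_norm ?mulr_ge0//; last exact: le_trans (ZC w).
  by rewrite ler_wpM2r.
- by apply: integrableZl => //; exact: integrable_norm iD.
Qed.

Lemma Rintegral_sum (I : Type) (r : seq I) (h : I -> T -> R) :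
  (forall i, P.-integrable setT (EFin \o h i)) ->
  P.-integrable setT (EFin \o (fun w => \sum_(i <- r) h i w)) /\
  \int[P]_w (\sum_(i <- r) h i w) = \sum_(i <- r) \int[P]_w h i w.
Proof.
move=> ih; elim: r => [|i r [IH1 IH2]].
  split; first by under [X in EFin \o X]funext do rewrite big_nil; exact: (finite_measure_integrable_cst P 0 measurableT).
  rewrite big_nil; under eq_Rintegral do rewrite big_nil.
  by rewrite Rintegral_cst// mul0r.
have e : (fun w => \sum_(i <- i :: r) h i w) = (fun w => h i w + \sum_(i <- r) h i w).
  by apply: funext => w; rewrite big_cons.
rewrite e big_cons -IH2 RintegralD//; split => //.
exact: (integrableD measurableT (ih i) IH1).
Qed.

(** [Z] is normalised to take values in [[0, 1]] and approximated uniformly by averages of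
    indicators of its superlevel sets, which belong to [Q]. *)
Lemma integral_orthogonal (Q : set (set T)) D Z C :
  measurable_fun setT Z -> (forall A, Q A -> measurable A) -> (forall c, Q [set w | c <= Z w]) ->
  P.-integrable setT (EFin \o D) -> (forall A, Q A -> \int[P]_(w in A) D w = 0) ->
  (forall w, `|Z w| <= C) -> \int[P]_w (Z w * D w) = 0.
Proof.
move=> mZ Qm QZ iD QD ZC'.
pose c := `|C| + 1; have c0 : 0 < c by rewrite ltr_wpDl.
have ZC w : `|Z w| <= c by rewrite (le_trans (ZC' w))// (le_trans (ler_norm C))// lerDl.
pose Y w := (2 * c)^-1 * (Z w + c).
have Y01 w : 0 <= Y w <= 1.
  have := ZC w; rewrite ler_norml => /andP[z1 z2].
  by rewrite /Y mulr_ge0 ?invr_ge0 ?mulr_ge0 ?(ltW c0)//=; [rewrite ler_pdivrMl ?mulr_gt0//|]; lra.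
have mY : measurable_fun setT Y.
  by apply: measurable_funM => //; exact: measurable_funD.
have iQ A : Q A -> P.-integrable setT (EFin \o (fun w => \1_A w * D w)).
  move=> QA; apply: (@integrable_boundedM _ _ 1) => //.
    by apply: measurable_indic; exact: Qm.
  by move=> w; rewrite indicE; case: (_ \in _); rewrite ?normr1 ?normr0.
have D1 A : Q A -> \int[P]_w (\1_A w * D w) = 0.
  move=> QA; rewrite -[RHS](QD A QA) [RHS]Rintegral_mkcond patch_indic.
  by apply: eq_Rintegral => w _ /=; rewrite mulrC.
have QY (m k : nat) : Q [set w | k.+1%:R / m.+1%:R <= Y w].
  rewrite (_ : [set w | _] = [set w | 2 * c * (k.+1%:R / m.+1%:R) - c <= Z w]); first exact: QZ.
  by apply/seteqP; split=> w /=; rewrite /Y ler_pdivlMl ?mulr_gt0// lerBlDr.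
have lay m w : layers m (Y w) * D w = m.+1%:R^-1 * \sum_(k < m.+1) \1_[set w | k.+1%:R / m.+1%:R <= Y w] w * D w.
  rewrite /layers -mulrA mulr_suml; congr (_ * _); apply: eq_bigr => k _; congr (_ * _).
  by rewrite indicE; congr ((nat_of_bool _)%:R); apply/idP/idP => [h|]; rewrite ?inE.
have ilay m : P.-integrable setT (EFin \o (fun w => layers m (Y w) * D w)) /\ \int[P]_w (layers m (Y w) * D w) = 0.
  have [i1 i2] := Rintegral_sum (index_enum 'I_m.+1) (fun k : 'I_m.+1 => iQ _ (QY m k)).
  have e := funext (lay m).
  rewrite e; split.
    exact: (integrableZl measurableT _ i1).
  by rewrite RintegralZl// i2 big1 ?mulr0// => k _; rewrite D1.
have iY : P.-integrable setT (EFin \o (fun w => Y w * D w)).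
  by apply: (@integrable_boundedM _ _ 1) => // w; have /andP[y0 y1] := Y01 w; rewrite ger0_norm.
have YD : \int[P]_w (Y w * D w) = 0.
  apply/eqP; rewrite -normr_eq0; apply/eqP/le_anti; rewrite normr_ge0 andbT.
  have h : (harmonic m : R) * \int[P]_w `|D w| @[m --> \oo] --> (0 : R).
    rewrite -[X in _ --> X](mul0r (\int[P]_w `|D w|)).
    by apply: cvgM; [exact: cvg_harmonic|exact: cvg_cst].
  apply: (ler_cvg_to (cvg_cst _) h); apply: nearW => m.
  have [i1 i2] := ilay m.
  have -> : \int[P]_w (Y w * D w) = \int[P]_w (Y w * D w - layers m (Y w) * D w).
    by rewrite RintegralB// i2 subr0.
  have iB := integrableB measurableT iY i1.
  apply: (le_trans (le_normr_Rintegral _ _)) => //.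
  have iN := integrable_norm iD.
  rewrite -RintegralZl//.
  apply: le_Rintegral => //; [exact: (integrable_norm iB)|exact: (integrableZl measurableT _ iN)|].
  by move=> w _ /=; rewrite -mulrBl normrM ler_wpM2r// layers_approx.
have e w : Z w * D w = 2 * c * (Y w * D w) - c * D w.
  by rewrite /Y; field; rewrite gt_eqF.
under eq_Rintegral do rewrite e.
rewrite RintegralB//; last 2 first.
- exact: (integrableZl measurableT _ iY).
- exact: (integrableZl measurableT _ iD).
rewrite !RintegralZl// YD mulr0 sub0r.
have QT : Q setT.
  rewrite (_ : setT = [set w | - c <= Z w]) //; apply/seteqP; split=> w //= _.
  by have := ZC w; rewrite ler_norml => /andP[].
by rewrite (QD _ QT) mulr0 oppr0.
Qed.

End Expectation.

(** * Conditional jump rates of the VRJP *)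

Section Vrjp.
Context {R : realType} {Lambda : finType} {d : measure_display} {T : measurableType d}.
Variables (P : probability T R) (X : R -> T -> Lambda).
Variables (beta : Lambda -> Lambda -> R) (a : Lambda).
Hypothesis beta_ge0 : forall i j, 0 <= beta i j.
Hypothesis X_vrjp : vrjp beta a (fun=> 1) P X.
Implicit Types (s t r h : R) (i j : Lambda) (w : T) (A : set T).

Local Notation L := (local_time (fun=> 1) X).

Definition past t : set (set T) := [set E | exists (r : R) k, 0 <= r <= t /\ E = [set w | X r w = k]].
(** [T] equipped with the history as sigma-algebra, so that adapted functions are measurable
    functions in the ordinary sense. *)
Definition historyT t := g_sigma_algebraType (past t).
Definition adapted t (f : T -> R) := measurable_fun (setT : set (historyT t)) (f : historyT t -> R).

Lemma past_history t r i : 0 <= r <= t -> history X t [set w | X r w = i].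
Proof. by move=> rt; apply: sub_sigma_algebra; exists r, i. Qed.

Lemma history_measurable t A : history X t A -> measurable A.
Proof.
apply: smallest_sub; first exact: sigma_algebra_measurable.
by move=> E [r [k [/andP[r0 _] ->]]]; exact: (vrjp_measurable X_vrjp).
Qed.

Lemma adapted_measurable t f : adapted t f -> measurable_fun (setT : set T) f.
Proof.
move=> mf _ B mB; rewrite setTI; apply: (@history_measurable t).
by have := mf measurableT B mB; rewrite setTI.
Qed.

Lemma adaptedP t f B : adapted t f -> measurable B -> history X t (f @^-1` B).
Proof. by move=> mf mB; have := mf measurableT B mB; rewrite setTI. Qed.

Lemma adapted_indic t A : history X t A -> adapted t (\1_A).
Proof. by move=> hA; apply: (@measurable_indic _ (historyT t)). Qed.

Lemma adapted_state t r i : 0 <= r <= t -> adapted t (fun w => (X r w == i)%:R).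
Proof.
move=> rt; rewrite (_ : (fun w => _) = \1_[set w | X r w = i]).
  by apply: adapted_indic; exact: past_history.
apply: funext => w; rewrite indicE; congr ((nat_of_bool _)%:R).
by apply/eqP/idP; rewrite inE.
Qed.

Lemma path_right w : forall t, 0 <= t ->
  exists2 e : R, 0 < e & forall r : R, t <= r < t + e -> X r w = X t w.
Proof. exact: (vrjp_right X_vrjp). Qed.

Lemma local_timeE t w i : L t w i = 1 + occupation (X^~ w) t i.
Proof. by []. Qed.

Lemma local_time0 w i : L 0 w i = 1.
Proof. by rewrite local_timeE occupation0 addr0. Qed.

Lemma local_timeB s t w i :
  L t w i - L s w i = occupation (X^~ w) t i - occupation (X^~ w) s i.
Proof. by rewrite !local_timeE; ring. Qed.

Lemma local_time_le s t w i : 0 <= s -> s <= t -> L s w i <= L t w i.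
Proof. by move=> s0 st; rewrite -subr_ge0 local_timeB subr_ge0; exact: (occupation_le (path_right w)). Qed.

Lemma local_time_lip s t w i : 0 <= s -> s <= t -> L t w i - L s w i <= t - s.
Proof. by move=> s0 st; rewrite local_timeB; exact: (occupation_lip (path_right w)). Qed.

Lemma local_time_sum s t w : 0 <= s -> s <= t -> \sum_i (L t w i - L s w i) = t - s.
Proof.
move=> s0 st; under eq_bigr do rewrite local_timeB.
exact: (occupation_sum (path_right w)).
Qed.

Lemma local_time_idle s t w i : 0 <= s -> s <= t ->
  (forall r, s < r <= t -> X r w != i) -> L t w i = L s w i.
Proof.
move=> s0 st h; apply/eqP; rewrite -subr_eq0 local_timeB subr_eq0; apply/eqP.
exact: (occupation_idle (path_right w)).
Qed.

Lemma local_time_ge1 t w i : 0 <= t -> 1 <= L t w i.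
Proof. by move=> t0; rewrite -{1}(local_time0 w i) local_time_le. Qed.

Lemma local_time_bound t w i : 0 <= t -> L t w i <= 1 + t.
Proof. by move=> t0; have := local_time_lip w i (lexx 0) t0; rewrite local_time0; lra. Qed.

Lemma adapted_visits s t r n i : 0 <= s -> s <= t -> t <= r -> adapted r (fun w => visits (X^~ w) s t n i).
Proof.
move=> s0 st tr; apply: measurable_sum => k.
apply: (@measurable_funM _ (historyT r)) => //; apply: adapted_state.
by rewrite (le_trans s0) ?mesh_ge//= (le_trans _ tr)// mesh_le.
Qed.

Lemma adapted_local_time t r i : 0 <= t <= r -> adapted r (fun w => L t w i).
Proof.
move=> /andP[t0 tr]; rewrite /adapted.
apply: (@measurable_fun_cvg _ (historyT r) _ _ (fun n w => 1 + visits (X^~ w) 0 t n i)) => [n|w _].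
  by apply: measurable_funD => //; exact: adapted_visits.
rewrite local_timeE -[X in 1 + X]subr0 -{2}(occupation0 (X^~ w) i).
by apply: cvgD; [exact: cvg_cst|exact: (cvg_visits (path_right w))].
Qed.

End Vrjp.

Lemma finite_small (R : realType) (I : finType) (Q : I -> R -> Prop) :
  (forall i, exists2 delta : R, 0 < delta & forall h, 0 < h < delta -> Q i h) ->
  exists2 delta : R, 0 < delta & forall i h, 0 < h < delta -> Q i h.
Proof.
move=> hQ.
have {hQ} /choice[delta hd] : forall i, exists delta : R, 0 < delta /\ forall h, 0 < h < delta -> Q i h.
  by move=> i; have [delta d0 hd] := hQ i; exists delta.
exists (\big[Num.min/1]_i delta i).
  by apply/bigmin_gtP; split => // i _; have [] := hd i.
move=> i r /andP[r0 rd]; have [_] := hd i; apply.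
by rewrite r0 (lt_le_trans rd)// bigmin_le_cond.
Qed.

Section Rates.
Context {R : realType} {Lambda : finType} {d : measure_display} {T : measurableType d}.
Variables (P : probability T R) (X : R -> T -> Lambda).
Variables (beta : Lambda -> Lambda -> R) (a : Lambda).
Hypothesis beta_ge0 : forall i j, 0 <= beta i j.
Hypothesis X_vrjp : vrjp beta a (fun=> 1) P X.
Implicit Types (s t r h : R) (i j : Lambda) (w : T) (A : set T).

Local Notation L := (local_time (fun=> 1) X).
Local Notation adapted := (adapted X).

Lemma indic_state t i w : \1_[set w | X t w = i] w = (X t w == i)%:R :> R.
Proof. by rewrite indicE; congr ((nat_of_bool _)%:R); apply/idP/eqP; rewrite inE. Qed.

Lemma measurable_state t i : 0 <= t -> measurable_fun setT (fun w => (X t w == i)%:R : R).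
Proof. by move=> t0; apply: (adapted_measurable X_vrjp (t := t)); apply: adapted_state; rewrite t0 lexx. Qed.

Lemma cond_prob_orthogonal t (E : set T) q Z C : measurable E ->
  cond_prob P (history X t) E q -> adapted t Z -> (forall w, `|Z w| <= C) ->
  \int[P]_w (Z w * (q w - \1_E w)) = 0.
Proof.
move=> mE [_ iq qE] aZ ZC.
have iE : P.-integrable setT (EFin \o \1_E).
  by apply: (@integrable_bounded _ _ _ _ _ 1) => // w; rewrite indicE; case: (_ \in _); rewrite ?normr1 ?normr0.
apply: (@integral_orthogonal _ _ _ P (history X t) _ _ C) => //.
- exact: (adapted_measurable X_vrjp aZ).
- exact: (history_measurable X_vrjp).
- by move=> c; rewrite (_ : [set w | _] = Z @^-1` `[c, +oo[); [exact: adaptedP|apply/seteqP; split=> w /=; rewrite in_itv/= andbT].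
- exact: (integrableB measurableT iq iE).
move=> A hA; have mA := history_measurable X_vrjp hA.
have iA f : P.-integrable setT (EFin \o f) -> P.-integrable A (EFin \o f).
  by move=> /integrableS; apply.
rewrite RintegralB//; [|exact: iA..].
rewrite /Rintegral qE// integral_indic// setIC subrr//.
Qed.

(** The rate condition tested against a bounded adapted [Z]: the version [q] of the conditional
    probability is exchanged for the indicator of the event by [cond_prob_orthogonal], since [Z]
    times the indicator of [X t = i] is adapted. *)
Lemma vrjp_rate_integral i j (K e : R) : i != j -> 0 < e ->
  exists2 delta : R, 0 < delta & forall t h, 0 <= t <= K -> 0 < h < delta ->
  forall Z C, adapted t Z -> (forall w, `|Z w| <= C) ->
  `|\int[P]_w (Z w * ((X t w == i)%:R * ((X (t + h) w == j)%:R - beta i j * L t w j * h)))| <= e * h * C.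
Proof.
move=> ij e0; have [delta d0 hd] := vrjp_rate X_vrjp ij K e0.
exists delta => // t h tK hh Z C aZ ZC.
have [q cq qb] := hd t h tK hh.
have /andP[t0 _] := tK; have /andP[h0 _] := hh.
have th0 : 0 <= t + h by rewrite addr_ge0 ?(ltW h0).
pose Z' w := Z w * (X t w == i)%:R.
have aZ' : adapted t Z'.
  by apply: (@measurable_funM _ (historyT X t)) => //; apply: adapted_state; rewrite t0 lexx.
have Z'C w : `|Z' w| <= C.
  by rewrite /Z'; case: (_ == _); rewrite ?mulr1// mulr0 normr0 (le_trans _ (ZC w)).
have C0 : 0 <= C by apply: le_trans (ZC point).
have mZ' := adapted_measurable X_vrjp aZ'.
have mE : measurable [set w | X (t + h) w = j] by exact: (vrjp_measurable X_vrjp).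
have o := cond_prob_orthogonal mE cq aZ' Z'C.
have [_ iq _] := cq.
have aL : adapted t (fun w => L t w j) by apply: (adapted_local_time X_vrjp); rewrite t0 lexx.
have iL : P.-integrable setT (EFin \o (fun w => beta i j * L t w j * h)).
  apply: (@integrable_bounded _ _ _ _ _ (beta i j * (1 + t) * h)).
    by apply: measurable_funM => //; apply: measurable_funM => //; exact: (adapted_measurable X_vrjp aL).
  move=> w; have l1 := local_time_ge1 X_vrjp w j t0; have l2 := local_time_bound X_vrjp w j t0.
  rewrite ger0_norm; first by rewrite ler_pM2r// ler_wpM2l.
  by rewrite mulr_ge0 ?(ltW h0)// mulr_ge0// (le_trans _ l1).
have iE : P.-integrable setT (EFin \o \1_[set w | X (t + h) w = j]).
  by apply: (@integrable_bounded _ _ _ _ _ 1) => // w; rewrite indicE; case: (_ \in _); rewrite ?normr1 ?normr0.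
have i1 : P.-integrable setT (EFin \o (fun w => Z' w * (q w - beta i j * L t w j * h))).
  by apply: (integrable_boundedM mZ' Z'C); exact: (integrableB measurableT iq iL).
have i2 : P.-integrable setT (EFin \o (fun w => Z' w * (q w - \1_[set w | X (t + h) w = j] w))).
  by apply: (integrable_boundedM mZ' Z'C); exact: (integrableB measurableT iq iE).
have -> : \int[P]_w (Z w * ((X t w == i)%:R * ((X (t + h) w == j)%:R - beta i j * L t w j * h))) =
   \int[P]_w (Z' w * (q w - beta i j * L t w j * h)).
  rewrite -[RHS]subr0 -o -RintegralB//; apply: eq_Rintegral => w _.
  by rewrite indic_state /Z'; ring.
apply: integral_le_ae => //; first by rewrite !mulr_ge0// ltW.
apply: filterS qb => w qw; rewrite /Z' -mulrA.
have [Xi|_] := eqVneq (X t w) i; last by rewrite mul0r mulr0 normr0 !mulr_ge0// ltW.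
by rewrite mul1r normrM mulrC ler_pM// qw.
Qed.

(** [1 + K] bounds the local times up to time [K]; the summand 1 is the error allowed in the rate
    condition, taken with [e = 1]. *)
Definition jump_rate (K : R) : R := \sum_i \sum_j (beta i j * (1 + K) + 1).

Lemma jump_rate_ge0 K : 0 <= K -> 0 <= jump_rate K.
Proof.
move=> K0; apply: sumr_ge0 => i _; apply: sumr_ge0 => j _.
by rewrite addr_ge0// mulr_ge0// addr_ge0.
Qed.

Lemma jump_prob (K : R) : exists2 delta : R, 0 < delta &
  forall t h, 0 <= t <= K -> 0 < h < delta ->
  \int[P]_w ((X (t + h) w != X t w)%:R : R) <= jump_rate K * h.
Proof.
pose Q (p : Lambda * Lambda) (h : R) := p.1 != p.2 -> forall t, 0 <= t <= K ->
  \int[P]_w (((X t w == p.1)%:R * (X (t + h) w == p.2)%:R : R)) <= (beta p.1 p.2 * (1 + K) + 1) * h.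
have [p|delta d0 hd] := @finite_small R _ Q.
  have [pp|pp] := eqVneq p.1 p.2.
    by exists 1 => // h _; rewrite /Q pp eqxx.
  have [delta d0 hd] := vrjp_rate_integral K pp ltr01.
  exists delta => // h hh _ t tK; have /andP[h0 _] := hh; have /andP[t0 tK'] := tK.
  have th0 : 0 <= t + h by rewrite addr_ge0 ?(ltW h0).
  have := hd t h tK hh (cst 1) 1; rewrite mulr1 mul1r.
  move=> /(_ (measurable_cst _)) /(_ (fun w => ltac:(by rewrite normr1))).
  have iXX : P.-integrable setT (EFin \o (fun w => (X t w == p.1)%:R * (X (t + h) w == p.2)%:R : R)).
    apply: (@integrable_bounded _ _ _ _ _ 1) => [|w].
      by apply: measurable_funM; exact: measurable_state.
    by rewrite -natrM normr_nat -[1]/(1%:R) ler_nat; case: (_ == _) (_ == _) => -[].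
  have aL : adapted t (fun w => L t w p.2) by apply: (adapted_local_time X_vrjp); rewrite t0 lexx.
  have bL w : 0 <= (X t w == p.1)%:R * (beta p.1 p.2 * L t w p.2) <= beta p.1 p.2 * (1 + K).
    have l1 := local_time_ge1 X_vrjp w p.2 t0; have l2 := local_time_bound X_vrjp w p.2 t0.
    have L0 : 0 <= L t w p.2 by rewrite (le_trans _ l1).
    have LK : beta p.1 p.2 * L t w p.2 <= beta p.1 p.2 * (1 + K).
      by rewrite ler_wpM2l// (le_trans l2)// lerD2l.
    case: (_ == _); rewrite ?mul1r ?mul0r ?lexx ?mulr_ge0//=.
    by rewrite addr_ge0// (le_trans t0).
  have mbL : measurable_fun setT (fun w => (X t w == p.1)%:R * (beta p.1 p.2 * L t w p.2)).
    apply: measurable_funM; first exact: measurable_state.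
    by apply: measurable_funM => //; exact: (adapted_measurable X_vrjp aL).
  have iL : P.-integrable setT (EFin \o (fun w => (X t w == p.1)%:R * (beta p.1 p.2 * L t w p.2))).
    by apply: (integrable_bounded P (C := beta p.1 p.2 * (1 + K)) mbL) => w; have /andP[b0 b1] := bL w; rewrite ger0_norm.
  have iLh : P.-integrable setT (EFin \o (fun w => h * ((X t w == p.1)%:R * (beta p.1 p.2 * L t w p.2)))).
    exact: (integrableZl measurableT _ iL).
  have -> : \int[P]_w (cst 1 w * ((X t w == p.1)%:R * ((X (t + h) w == p.2)%:R - beta p.1 p.2 * L t w p.2 * h))) =
    \int[P]_w ((X t w == p.1)%:R * (X (t + h) w == p.2)%:R) - h * \int[P]_w ((X t w == p.1)%:R * (beta p.1 p.2 * L t w p.2)).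
    by rewrite -RintegralZl// -RintegralB//; apply: eq_Rintegral => w _; rewrite /cst; ring.
  have IL : \int[P]_w ((X t w == p.1)%:R * (beta p.1 p.2 * L t w p.2)) <= beta p.1 p.2 * (1 + K).
    rewrite (le_trans (ler_norm _))// integral_le_bounded// => w.
    by have /andP[b0 b1] := bL w; rewrite ger0_norm// b1.
  rewrite ler_norml => /andP[_ ub].
  have := ler_wpM2l (ltW h0) IL; lra.
exists delta => // t h tK hh; have /andP[h0 _] := hh; have /andP[t0 tK'] := tK.
have th0 : 0 <= t + h by rewrite addr_ge0 ?(ltW h0).
have e w : (X (t + h) w != X t w)%:R =
    \sum_(p : Lambda * Lambda) (p.1 != p.2)%:R * ((X t w == p.1)%:R * (X (t + h) w == p.2)%:R) :> R.
  rewrite (bigD1 (X t w, X (t + h) w))//= !eqxx mulr1 mulr1 eq_sym big1 ?addr0// => -[i j]/=.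
  rewrite xpair_eqE negb_and (eq_sym i) (eq_sym j) => /orP[/negPf ->|/negPf ->]; first by rewrite mul0r mulr0.
  by rewrite !mulr0.
under eq_Rintegral do rewrite e.
have ip (p : Lambda * Lambda) : P.-integrable setT (EFin \o (fun w => (p.1 != p.2)%:R * ((X t w == p.1)%:R * (X (t + h) w == p.2)%:R : R))).
  apply: (@integrable_bounded _ _ _ _ _ 1) => [|w].
    by apply: measurable_funM => //; apply: measurable_funM; exact: measurable_state.
  by rewrite -!natrM normr_nat -[1]/(1%:R) ler_nat; by case: (p.1 != p.2); case: (X t w == _); case: (_ == _).
have [_ ->] := Rintegral_sum (index_enum _) ip.
rewrite /jump_rate pair_big/= mulr_suml; apply: ler_sum => p _.
have [pp|pp] := eqVneq p.1 p.2.
  rewrite (_ : \int[P]_w _ = 0); last by under eq_Rintegral do rewrite mul0r; rewrite Rintegral_cst// mul0r.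
  by rewrite mulr_ge0 ?(ltW h0)// addr_ge0// mulr_ge0// addr_ge0// (le_trans t0).
under eq_Rintegral do rewrite mul1r.
exact: (hd p h hh pp t tK).
Qed.

(** The time spent outside the state [X t] between [t] and [t + h]. *)
Definition away t h w : R := h - (L (t + h) w (X t w) - L t w (X t w)).

Lemma away_bounds t h w : 0 <= t -> 0 <= h -> 0 <= away t h w <= h.
Proof.
move=> t0 h0; rewrite /away.
have th : t <= t + h by rewrite lerDl.
have := local_time_lip X_vrjp w (X t w) t0 th.
have := local_time_le X_vrjp w (X t w) t0 th; lra.
Qed.

Lemma at_state t w (f : Lambda -> R) : f (X t w) = \sum_i (X t w == i)%:R * f i.
Proof.
rewrite (bigD1 (X t w))//= eqxx mul1r big1 ?addr0// => i /negPf.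
by rewrite eq_sym => ->; rewrite mul0r.
Qed.

Lemma measurable_at_state t (f : Lambda -> T -> R) : 0 <= t ->
  (forall i, measurable_fun setT (f i)) -> measurable_fun setT (fun w => f (X t w) w).
Proof.
move=> t0 mf; rewrite (_ : (fun w => _) = fun w => \sum_i (X t w == i)%:R * f i w).
  by apply: measurable_sum => i; apply: measurable_funM; [exact: measurable_state|].
by apply: funext => w; rewrite (at_state t w (f ^~ w)).
Qed.

Lemma measurable_local_time t i : 0 <= t -> measurable_fun setT (fun w => L t w i).
Proof.
by move=> t0; apply: (adapted_measurable X_vrjp (t := t)); apply: (adapted_local_time X_vrjp); rewrite t0 lexx.
Qed.

Lemma measurable_away t h : 0 <= t -> 0 <= h -> measurable_fun setT (away t h).
Proof.
move=> t0 h0; apply: (@measurable_at_state t (fun i w => h - (L (t + h) w i - L t w i))) => // i.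
by apply: measurable_funB => //; apply: measurable_funB; apply: measurable_local_time => //; exact: addr_ge0.
Qed.

(** The time away is the limit of mesh sums, each term of which is the indicator of being away at
    one mesh time. Every such event has probability of order [h] by [jump_prob], and the cells have
    total length [h]. *)
Lemma away_integral (K : R) : exists2 delta : R, 0 < delta &
  forall t h, 0 <= t <= K -> 0 < h < delta -> \int[P]_w away t h w <= jump_rate K * h ^+ 2.
Proof.
have [delta d0 hd] := jump_prob K; exists delta => // t h tK hh.
have /andP[t0 tK'] := tK; have /andP[h0 hdelta] := hh; have h0' := ltW h0.
have th : t <= t + h by rewrite lerDl.
have J0 : 0 <= jump_rate K by rewrite jump_rate_ge0// (le_trans t0).
pose S n w := h - visits (X^~ w) t (t + h) n (X t w).
have SE n w : S n w = \sum_(k < n.+1) (h / n.+1%:R) * (X (mesh t (t + h) n k.+1) w != X t w)%:R.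
  rewrite /S /visits [t + h - t]addrAC subrr add0r.
  have -> : h = \sum_(k < n.+1) h / n.+1%:R :> R by rewrite sumr_const card_ord -[RHS]mulr_natr divfK.
  rewrite sumr_const card_ord -[h / _ *+ _]mulr_natr divfK//.
  rewrite -{1}[h](@divfK _ n.+1%:R)// mulr_natr -[in X in _ *+ X](card_ord n.+1) -sumr_const -sumrB.
  by apply: eq_bigr => k _; case: (_ == _) => /=; rewrite ?mul1r ?mul0r ?mulr1 ?mulr0 ?subrr ?subr0.
have node_in n (k : 'I_n.+1) : exists2 r, mesh t (t + h) n k.+1 = t + r & 0 < r <= h.
  exists (k.+1%:R * (h / n.+1%:R)); first by rewrite /mesh [t + h - t]addrAC subrr add0r.
  rewrite mulr_gt0 ?divr_gt0//=; rewrite mulrCA ler_piMr// ler_pdivrMr// mul1r ler_nat ltn_ord//.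
have mX n (k : 'I_n.+1) : measurable_fun setT (fun w => (X (mesh t (t + h) n k.+1) w != X t w)%:R : R).
  have [r -> /andP[r0 _]] := node_in n k.
  rewrite (_ : (fun w => _) = fun w => 1 - \sum_i (X t w == i)%:R * (X (t + r) w == i)%:R); last first.
    apply: funext => w; rewrite -(at_state t w (fun i => (X (t + r) w == i)%:R)).
    by case: (_ == _); rewrite ?subrr ?subr0.
  apply: measurable_funB => //; apply: measurable_sum => i.
  by apply: measurable_funM; apply: measurable_state => //; rewrite addr_ge0// ltW.
have iX n (k : 'I_n.+1) : P.-integrable setT (EFin \o (fun w => (h / n.+1%:R) * (X (mesh t (t + h) n k.+1) w != X t w)%:R)).
  have iX : P.-integrable setT (EFin \o (fun w => (X (mesh t (t + h) n k.+1) w != X t w)%:R : R)).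
    apply: (integrable_bounded P (C := 1) (mX n k)) => w.
    by case: (_ == _); rewrite ?normr0 ?normr1.
  exact: (integrableZl measurableT _ iX).
have mS n : measurable_fun setT (S n).
  rewrite (funext (SE n)); apply: measurable_sum => k; apply: measurable_funM => //; exact: mX.
have Sle n : \int[P]_w S n w <= jump_rate K * h ^+ 2.
  rewrite (funext (SE n)) (Rintegral_sum (index_enum _) (iX n)).2.
  apply: (@le_trans _ _ (\sum_(k < n.+1) h / n.+1%:R * (jump_rate K * h))).
    apply: ler_sum => k _; rewrite RintegralZl//; last first.
      apply: (integrable_bounded P (C := 1) (mX n k)) => w.
      by case: (_ == _); rewrite ?normr0 ?normr1.
    rewrite ler_wpM2l ?divr_ge0//; have [r -> /andP[r0 rh]] := node_in n k.
    by rewrite (le_trans (hd t r tK _))// ?ler_wpM2l// r0 (le_lt_trans rh).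
  by rewrite -mulr_suml sumr_const card_ord -[X in X * _]mulr_natr divfK// mulrCA expr2.
have S01 n w : 0 <= S n w <= h.
  rewrite SE; apply/andP; split; first by apply: sumr_ge0 => k _; rewrite mulr_ge0// divr_ge0.
  apply: (@le_trans _ _ (\sum_(k < n.+1) h / n.+1%:R)).
    by apply: ler_sum => k _; rewrite ler_piMr ?divr_ge0//; case: (_ == _).
  by rewrite sumr_const card_ord -[X in X <= _]mulr_natr divfK.
have cS : \int[P]_w S n w @[n --> \oo] --> \int[P]_w away t h w.
  apply: (@cvg_Rintegral_bounded _ _ _ P setT S (away t h) h) => //.
  - exact: finite_measure_integrable_cst.
  - exact: measurable_away.
  - apply/aeW => w _; apply: cvgB; first exact: cvg_cst.
    by rewrite local_timeB; exact: (cvg_visits (path_right X_vrjp w)).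
  - by move=> n w _; have /andP[s0 s1] := S01 n w; rewrite ger0_norm.
by apply: (ler_cvg_to cS (cvg_cst _)); exact: nearW.
Qed.

End Rates.

(** * Lyapunov functions and one step of the walk *)

Section Lyapunov.
Variables (R : realType) (Lambda : finType) (beta : Lambda -> Lambda -> R).
Hypothesis beta_ge0 : forall i j, 0 <= beta i j.
Implicit Types (i j k : Lambda) (l : Lambda -> R) (h : R).

Definition shift l i h : Lambda -> R := fun k => l k + (k == i)%:R * h.

Definition box (M : R) l := forall k, 1 <= l k <= M.

Definition drift (f : Lambda -> (Lambda -> R) -> R) i l : R :=
  \sum_(j | j != i) beta i j * l j * (f j l - f i l).

(** A supermartingale condition free of derivatives: by [lyapunov_decr] the derivative of [f i] in
    [l i] plus the jump part [drift] of the generator is nonpositive, up to second order in the time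
    step. Being an inequality it covers the recurrence argument; imposed on both [f] and [- f] it
    gives identities. *)
Record lyapunov (M D : R) (f : Lambda -> (Lambda -> R) -> R) : Prop := Lyapunov {
  lyapunov_bound : forall i l, box M l -> `|f i l| <= D;
  lyapunov_lip : forall i l l', box M l -> box M l' -> `|f i l - f i l'| <= D * \sum_k `|l k - l' k|;
  lyapunov_decr : forall i l h, 0 <= h -> box M l -> box M (shift l i h) ->
    f i (shift l i h) <= f i l - h * drift f i l + D * h ^+ 2 }.

Definition drift_bound (M D : R) : R := \sum_i \sum_j beta i j * M * (2 * D).

Variables (M D : R) (f : Lambda -> (Lambda -> R) -> R).
Hypothesis f_lyap : lyapunov M D f.

Lemma drift_le i l : box M l -> `|drift f i l| <= drift_bound M D.
Proof.
move=> bl.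
have D0 : 0 <= D := le_trans (normr_ge0 _) (lyapunov_bound f_lyap i bl).
have M0 : 0 <= M by have /andP[l1 l2] := bl i; rewrite (le_trans _ (le_trans l1 l2)).
have pos i' j : 0 <= beta i' j * M * (2 * D) by rewrite !mulr_ge0.
rewrite /drift_bound (bigD1 i)//=; apply: ler_wpDr.
  by apply: sumr_ge0 => i' _; apply: sumr_ge0.
rewrite /drift big_mkcond/= (le_trans (ler_norm_sum _ _ _))//; apply: ler_sum => j _.
case: ifP => _; last by rewrite normr0.
have /andP[l1 l2] := bl j; have l0 : 0 <= l j by rewrite (le_trans _ l1).
rewrite normrM ler_pM//.
  by rewrite ger0_norm ?mulr_ge0// ler_wpM2l.
have := ler_normB (f j l) (f i l); have := lyapunov_bound f_lyap i bl.
have := lyapunov_bound f_lyap j bl; lra.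
Qed.

(** The real step is compared with the one in which the walk stays at [i] for the whole time [h].
    The first term corrects the local times for the time spent elsewhere; the third, present only
    after a jump, pays for evaluating the new state at unshifted local times. The last sum is what
    the jump rates make small in mean. *)
Lemma step_bound i i' l l' h : box M l -> box M l' -> box M (shift l i h) -> 0 <= h ->
  (forall k, l k <= l' k) -> \sum_k (l' k - l k) = h ->
  f i' l' - f i l <= 2 * D * (h - (l' i - l i)) + D * h ^+ 2 + (D + drift_bound M D) * h * (i' != i)%:R
    + \sum_(j | j != i) (f j l - f i l) * ((i' == j)%:R - beta i j * l j * h).
Proof.
move=> bl bl' bs h0 ll' sh.
have D0 : 0 <= D := le_trans (normr_ge0 _) (lyapunov_bound f_lyap i bl).
have -> : \sum_(j | j != i) (f j l - f i l) * ((i' == j)%:R - beta i j * l j * h) =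
    (f i' l - f i l) - h * drift f i l.
  under eq_bigr do rewrite mulrBr.
  rewrite sumrB; congr (_ - _); last by rewrite /drift mulr_sumr; apply: eq_bigr => j _; ring.
  have [->|ii'] := eqVneq i' i.
    by rewrite subrr big1// => j /negPf; rewrite eq_sym => ->; rewrite mulr0.
  rewrite (bigD1 i')//= eqxx mulr1 big1 ?addr0// => j /andP[_ /negPf].
  by rewrite eq_sym => ->; rewrite mulr0.
have l1 : f i' l' - f i' (shift l i h) <= 2 * D * (h - (l' i - l i)).
  rewrite (le_trans (ler_norm _))// (le_trans (lyapunov_lip f_lyap i' bl' bs))//.
  rewrite [2 * D]mulrC -mulrA ler_wpM2l//.
  have rest : \sum_(k | k != i) (l' k - l k) = h - (l' i - l i).
    by rewrite -sh [in RHS](bigD1 i)//=; ring.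
  have rest0 : 0 <= h - (l' i - l i).
    by rewrite -rest; apply: sumr_ge0 => k _; rewrite subr_ge0.
  rewrite (bigD1 i)//= /shift eqxx mul1r.
  rewrite (eq_bigr (fun k => l' k - l k)); last first.
    by move=> k /negPf ->; rewrite mul0r addr0 ger0_norm// subr_ge0.
  rewrite rest (_ : l' i - (l i + h) = - (h - (l' i - l i))); last by ring.
  by rewrite normrN ger0_norm//; lra.
have dr := drift_le i bl; have := ler_norm (drift f i l).
have [e|ii'] := eqVneq i' i.
  rewrite e in l1 *; have := lyapunov_decr f_lyap h0 bl bs; rewrite subrr mulr0; lra.
have l2 : f i' (shift l i h) - f i' l <= D * h.
  rewrite (le_trans (ler_norm _))// (le_trans (lyapunov_lip f_lyap i' bs bl))//.
  rewrite ler_wpM2l// (bigD1 i)//= big1 ?addr0 /shift ?eqxx ?mul1r; last first.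
    by move=> k /negPf ->; rewrite mul0r addr0 subrr normr0.
  by rewrite addrC addKr ger0_norm.
have Dh : 0 <= D * h ^+ 2 by rewrite mulr_ge0// sqr_ge0.
have := ler_wpM2l h0 dr; rewrite /= mulr1.
have := ler_wpM2l h0 (ler_norm (drift f i l)); lra.
Qed.
End Lyapunov.

Section OneStep.
Context {R : realType} {Lambda : finType} {d : measure_display} {T : measurableType d}.
Variables (P : probability T R) (X : R -> T -> Lambda).
Variables (beta : Lambda -> Lambda -> R) (a : Lambda).
Hypothesis beta_ge0 : forall i j, 0 <= beta i j.
Hypothesis X_vrjp : vrjp beta a (fun=> 1) P X.
Variables (K D : R) (f : Lambda -> (Lambda -> R) -> R).
Hypothesis f_lyap : lyapunov beta (1 + K) D f.
(** The measurable space is arbitrary because both the full sigma-algebra of [T] and the history at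
    a given time are needed. *)
Hypothesis f_meas : forall e (S : measurableType e) (l : S -> Lambda -> R),
  (forall k, measurable_fun setT (fun u => l u k)) -> forall i, measurable_fun setT (fun u => f i (l u)).
Implicit Types (s t r h : R) (i j : Lambda) (w : T) (A : set T).

Local Notation L := (local_time (fun=> 1) X).
Local Notation adapted := (adapted X).

Definition value t w : R := f (X t w) (L t w).

Lemma measurable_value t : 0 <= t -> measurable_fun setT (value t).
Proof.
move=> t0; apply: (measurable_at_state X_vrjp (f := fun i w => f i (L t w))) => // i.
by apply: f_meas => k; exact: (measurable_local_time X_vrjp).
Qed.

Lemma local_time_box t w : 0 <= t <= K -> box (1 + K) (L t w).
Proof.
move=> /andP[t0 tK] k; rewrite (local_time_ge1 X_vrjp)//=.
by rewrite (le_trans (local_time_bound X_vrjp _ _ t0))// lerD2l.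
Qed.

Lemma value_bound t w : 0 <= t <= K -> `|value t w| <= D.
Proof. by move=> tK; apply: (lyapunov_bound f_lyap); exact: local_time_box. Qed.

Lemma value_step t h w : 0 <= t -> 0 <= h -> t + h <= K ->
  value (t + h) w - value t w <= 2 * D * away X t h w + D * h ^+ 2
    + (D + drift_bound beta (1 + K) D) * h * (X (t + h) w != X t w)%:R
    + \sum_(p : Lambda * Lambda) (p.1 != p.2)%:R * ((f p.2 (L t w) - f p.1 (L t w)) *
        ((X t w == p.1)%:R * ((X (t + h) w == p.2)%:R - beta p.1 p.2 * L t w p.2 * h))).
Proof.
move=> t0 h0 thK; have th : t <= t + h by rewrite lerDl.
have tK : 0 <= t <= K by rewrite t0 (le_trans th).
have bl := local_time_box w tK.
have bl' : box (1 + K) (L (t + h) w) by apply: local_time_box; rewrite addr_ge0.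
have bs : box (1 + K) (shift (L t w) (X t w) h).
  move=> k; have /andP[l1 l2] := bl k; have lt := local_time_bound X_vrjp w k t0.
  rewrite /shift; case: (_ == _); rewrite ?mul1r ?mul0r ?addr0 ?l1//=; lra.
rewrite (le_trans (step_bound beta_ge0 f_lyap (X (t + h) w) bl bl' bs h0 _ _))//.
- by move=> k; exact: (local_time_le X_vrjp).
- by rewrite (local_time_sum X_vrjp)// addrAC subrr add0r.
rewrite lerD2l -(pair_bigA _ (fun i j => (i != j)%:R * ((f j (L t w) - f i (L t w)) *
  ((X t w == i)%:R * ((X (t + h) w == j)%:R - beta i j * L t w j * h)))))/=.
rewrite [leRHS](bigD1 (X t w))//= [X in _ <= _ + X]big1 ?addr0; last first.
  by move=> i /negPf; rewrite eq_sym => Xi; apply: big1 => j _; rewrite Xi mul0r !mulr0.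
rewrite big_mkcond/=; apply: ler_sum => j _; rewrite eqxx mul1r eq_sym.
by case: (_ == _); rewrite ?mul0r ?mul1r.
Qed.

Lemma one_step (e : R) : 0 < e -> exists2 delta : R, 0 < delta &
  forall t h, 0 <= t -> 0 < h < delta -> t + h <= K ->
  forall A, history X t A -> \int[P]_w (\1_A w * (value (t + h) w - value t w)) <= e * h.
Proof.
move=> e0.
have [K0|K0] := leP 0 K; last first.
  exists 1 => // t h t0 /andP[h0 _] thK.
  by have := lt_le_trans (addr_gt0 h0 (ltr01 : 0 < 1 :> R)) _; exfalso; lra.
have D0 : 0 <= D.
  by have := value_bound point (t := 0); rewrite lexx K0 => /(_ isT); exact: le_trans.
pose N : R := #|{: Lambda * Lambda}|%:R.
(* Half of [e] pays for the rate errors, one for each of the [N] pairs, tested against variables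
   bounded by [2 * D]; the other half pays for the terms [C' * h ^+ 2], through the choice of
   [d4]. *)
pose e1 := e / (2 * (2 * D * N + 1)).
have N0 : 0 <= N by [].
have DN1 : 0 < 2 * (2 * D * N + 1) by rewrite mulr_gt0// ltr_wpDl// !mulr_ge0.
have e10 : 0 < e1 by rewrite divr_gt0.
pose C := jump_rate beta K; have C0 : 0 <= C by exact: jump_rate_ge0.
pose B := drift_bound beta (1 + K) D.
have B0 : 0 <= B by apply: sumr_ge0 => i _; apply: sumr_ge0 => j _; rewrite !mulr_ge0// addr_ge0.
pose C' := 2 * D * C + D + (D + B) * C.
have C'0 : 0 <= C' by rewrite /C' !addr_ge0// !mulr_ge0// addr_ge0.
have [d1 d10 H1] := jump_prob beta_ge0 X_vrjp K.
have [d2 d20 H2] := away_integral beta_ge0 X_vrjp K.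
pose Q (p : Lambda * Lambda) (h : R) := p.1 != p.2 -> forall t, 0 <= t <= K ->
  forall Z C, adapted t Z -> (forall w, `|Z w| <= C) ->
  \int[P]_w (Z w * ((X t w == p.1)%:R * ((X (t + h) w == p.2)%:R - beta p.1 p.2 * L t w p.2 * h))) <= e1 * h * C.
have [p|d3 d30 H3] := @finite_small R _ Q.
  have [pp|pp] := eqVneq p.1 p.2; first by exists 1 => // h _; rewrite /Q pp eqxx.
  have [dp dp0 hp] := vrjp_rate_integral beta_ge0 X_vrjp K pp e10.
  exists dp => // h hh _ t tK Z Cz aZ ZC.
  exact: le_trans (ler_norm _) (hp t h tK hh Z Cz aZ ZC).
pose d4 := e / (2 * (C' + 1)).
have d40 : 0 < d4 by rewrite divr_gt0// mulr_gt0// ltr_wpDl.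
exists (Num.min (Num.min d1 d2) (Num.min d3 d4)).
  by rewrite !lt_min d10 d20 d30 d40.
move=> t h t0 /andP[h0]; rewrite !lt_min => /andP[/andP[h1 h2] /andP[h3 h4]] thK A hA.
have h0' := ltW h0; have th0 : 0 <= t + h by rewrite addr_ge0.
have tK : 0 <= t <= K by rewrite t0 (le_trans _ thK)// lerDl.
have mA := history_measurable X_vrjp hA.
have A01 w : 0 <= (\1_A w : R) <= 1 by rewrite indicE; case: (_ \in _); rewrite /= ?lexx ?ler01.
pose u1 w : R := 2 * D * away X t h w.
pose u2 w : R := D * h ^+ 2.
pose u3 w : R := (D + B) * h * (X (t + h) w != X t w)%:R.
pose Z (p : Lambda * Lambda) w : R := \1_A w * (p.1 != p.2)%:R * (f p.2 (L t w) - f p.1 (L t w)).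
pose u4 (p : Lambda * Lambda) w : R := Z p w * ((X t w == p.1)%:R * ((X (t + h) w == p.2)%:R - beta p.1 p.2 * L t w p.2 * h)).
have aZ p : adapted t (Z p).
  have af i : adapted t (fun w => f i (L t w)).
    by apply: (f_meas (S := historyT X t)) => k; apply: (adapted_local_time X_vrjp); rewrite t0 lexx.
  apply: (@measurable_funM _ (historyT X t)); last first.
    apply: (@measurable_funB _ (historyT X t)); exact: af.
  by apply: (@measurable_funM _ (historyT X t)) => //; exact: adapted_indic.
have ZD p w : `|Z p w| <= 2 * D.
  have /andP[a0 a1] := A01 w; have bl := local_time_box w tK.
  have f1 := lyapunov_bound f_lyap p.1 bl; have f2 := lyapunov_bound f_lyap p.2 bl.
  have fD : `|f p.2 (L t w) - f p.1 (L t w)| <= 2 * D.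
    by rewrite (le_trans (ler_normB _ _))//; lra.
  rewrite /Z -mulrA normrM (ger0_norm a0) (le_trans (ler_piMl _ a1))//.
  by case: (_ != _); rewrite ?mul1r// mul0r normr0 mulr_ge0.
have bZ p w : `|(X t w == p.1)%:R * ((X (t + h) w == p.2)%:R - beta p.1 p.2 * L t w p.2 * h)| <= 1 + beta p.1 p.2 * (1 + K) * h.
  have /andP[l1 l2] := local_time_box w tK p.2.
  have L0 : 0 <= L t w p.2 by rewrite (le_trans _ l1).
  have b1 : 0 <= beta p.1 p.2 * L t w p.2 * h by rewrite !mulr_ge0.
  have b2 : beta p.1 p.2 * L t w p.2 * h <= beta p.1 p.2 * (1 + K) * h by rewrite ler_wpM2r// ler_wpM2l.
  case: (X t w == _); case: (_ == p.2); rewrite ler_norml /= ?mul1r ?mul0r; lra.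
have mZ p : measurable_fun setT (Z p) := adapted_measurable X_vrjp (aZ p).
have mb p : measurable_fun setT (fun w => (X t w == p.1)%:R * ((X (t + h) w == p.2)%:R - beta p.1 p.2 * L t w p.2 * h)).
  apply: measurable_funM; first exact: (measurable_state X_vrjp).
  apply: measurable_funB; first exact: (measurable_state X_vrjp).
  by apply: measurable_funM => //; apply: measurable_funM => //; exact: (measurable_local_time X_vrjp).
have i4 p : P.-integrable setT (EFin \o u4 p).
  by apply: (integrable_boundedM (mZ p) (ZD p)); exact: (integrable_bounded P (mb p) (bZ p)).
have m1 : measurable_fun setT (away X t h) by exact: (measurable_away X_vrjp).
have ia : P.-integrable setT (EFin \o away X t h).
  by apply: (integrable_bounded P m1 (C := h)) => w; have /andP[s0 s1] := away_bounds X_vrjp w t0 h0'; rewrite ger0_norm.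
have i1 : P.-integrable setT (EFin \o u1) := integrableZl measurableT _ ia.
have i2 : P.-integrable setT (EFin \o u2) := finite_measure_integrable_cst P _ measurableT.
have mj : measurable_fun setT (fun w => (X (t + h) w != X t w)%:R : R).
  apply: (measurable_at_state X_vrjp (f := fun i w => (X (t + h) w != i)%:R)) => // i.
  rewrite (_ : (fun w => _) = fun w => 1 - (X (t + h) w == i)%:R).
    by apply: measurable_funB => //; exact: (measurable_state X_vrjp).
  by apply: funext => w; case: (_ == _); rewrite ?subrr ?subr0.
have ij : P.-integrable setT (EFin \o (fun w => (X (t + h) w != X t w)%:R : R)).
  by apply: (integrable_bounded P mj (C := 1)) => w; case: (_ == _); rewrite ?normr0 ?normr1.
have i3 : P.-integrable setT (EFin \o u3) := integrableZl measurableT _ ij.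
have [iS IS] := Rintegral_sum (index_enum _) i4.
have i12 := integrableD measurableT i1 i2.
have i123 := integrableD measurableT i12 i3.
have i1234 := integrableD measurableT i123 iS.
have mv : measurable_fun setT (fun w => \1_A w * (value (t + h) w - value t w)).
  by apply: measurable_funM => //; apply: measurable_funB; exact: measurable_value.
have iv : P.-integrable setT (EFin \o (fun w => \1_A w * (value (t + h) w - value t w))).
  apply: (integrable_bounded P mv (C := 2 * D)) => w.
  have /andP[a0 a1] := A01 w.
  have v1 := value_bound w tK; have v2 := @value_bound (t + h) w; rewrite th0 thK in v2.
  rewrite normrM (ger0_norm a0) (le_trans (ler_piMl _ a1))// (le_trans (ler_normB _ _))//.
  by have := v2 isT; lra.
apply: (@le_trans _ _ (\int[P]_w (u1 w + u2 w + u3 w + \sum_p u4 p w))).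
  apply: le_Rintegral => // w _; have /andP[a0 a1] := A01 w.
  have e4 : \sum_p u4 p w = \1_A w * (\sum_(p : Lambda * Lambda) (p.1 != p.2)%:R * ((f p.2 (L t w) - f p.1 (L t w)) *
        ((X t w == p.1)%:R * ((X (t + h) w == p.2)%:R - beta p.1 p.2 * L t w p.2 * h)))).
    by rewrite mulr_sumr; apply: eq_bigr => p _; rewrite /u4 /Z !mulrA.
  apply: (le_trans (ler_wpM2l a0 (value_step w t0 h0' thK))).
  rewrite e4 mulrDr lerD2r; apply: (ler_piMl _ a1).
  have /andP[s0 s1] := away_bounds X_vrjp w t0 h0'.
  by rewrite !addr_ge0// !mulr_ge0// ?sqr_ge0// addr_ge0.
have -> : \int[P]_w (u1 w + u2 w + u3 w + \sum_p u4 p w) =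
   \int[P]_w u1 w + \int[P]_w u2 w + \int[P]_w u3 w + \sum_p \int[P]_w u4 p w.
  by rewrite RintegralD// RintegralD// RintegralD// IS.
have I1 : \int[P]_w u1 w <= 2 * D * (C * h ^+ 2).
  rewrite RintegralZl// ler_wpM2l ?mulr_ge0//; apply: H2 => //; by rewrite h0 h2.
have I2 : \int[P]_w u2 w = D * h ^+ 2.
  exact: Rintegral_probability.
have I3 : \int[P]_w u3 w <= (D + B) * h * (C * h).
  rewrite RintegralZl// ler_wpM2l ?mulr_ge0// ?addr_ge0//; apply: H1 => //; by rewrite h0 h1.
have I4 : \sum_p \int[P]_w u4 p w <= \sum_(p : Lambda * Lambda) e1 * h * (2 * D).
  apply: ler_sum => p _; have [pp|pp] := eqVneq p.1 p.2.
    have e1h : 0 <= e1 * h * (2 * D) by exact: (mulr_ge0 (mulr_ge0 (ltW e10) h0') (mulr_ge0 (ler0n R 2) D0)).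
    rewrite (_ : \int[P]_w _ = 0) //.
    under eq_Rintegral do rewrite /u4 /Z pp eqxx/= mulr0 !mul0r.
    by rewrite Rintegral_cst// mul0r.
  by apply: (H3 p h _ pp t tK) => //; rewrite h0 h3.
have I5 : \sum_(p : Lambda * Lambda) e1 * h * (2 * D) <= e / 2 * h.
  rewrite sumr_const -[leLHS]mulr_natr -/N.
  have -> : e1 * h * (2 * D) * N = (e1 * (2 * D * N)) * h by ring.
  rewrite ler_wpM2r// /e1 mulrAC ler_pdivrMr//.
  have : 0 <= 2 * D * N by rewrite !mulr_ge0.
  have -> : e / 2 * (2 * (2 * D * N + 1)) = e * (2 * D * N + 1) by field.
  by rewrite ler_pM2l// lerDl.
have I6 : C' * h ^+ 2 <= e / 2 * h.
  rewrite expr2 mulrA ler_wpM2r//.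
  have : (C' + 1) * h <= (C' + 1) * d4 by rewrite ler_wpM2l ?(ltW h4)// addr_ge0.
  have -> : (C' + 1) * d4 = e / 2 by rewrite /d4; field; rewrite gt_eqF// ltr_wpDl.
  by rewrite mulrDl mul1r => /(le_trans _) -> //; rewrite lerDl.
have := le_trans I4 I5.
have e' : C' * h ^+ 2 = 2 * D * (C * h ^+ 2) + D * h ^+ 2 + (D + B) * h * (C * h) by rewrite /C'; ring.
rewrite e' in I6; rewrite I2.
have -> : e * h = e / 2 * h + e / 2 * h by field.
lra.
Qed.

End OneStep.

(** * Recurrence *)

Section RealEstimates.
Variable R : realType.
Implicit Types x y h : R.

Lemma expRN_le x : 0 <= x -> expR (- x) <= 1 - x + x ^+ 2.
Proof.
move=> x0; have h1 : 1 + x <= expR x := expR_ge1Dx x.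
have h2 : expR (- x) * expR x = 1 by rewrite -expRD addNr expR0.
have e0 := expR_ge0 (- x).
have h3 : expR (- x) * (1 + x) <= 1 by have := ler_wpM2l e0 h1; rewrite h2.
have x1 : 0 < 1 + x by rewrite ltr_wpDr.
rewrite -(ler_pM2r x1) (le_trans h3)//.
have -> : (1 - x + x ^+ 2) * (1 + x) = 1 + x ^+ 3 by ring.
by rewrite lerDl exprn_ge0.
Qed.

Lemma expRN_lip x y : 0 <= x -> 0 <= y -> `|expR (- x) - expR (- y)| <= `|x - y|.
Proof.
wlog xy : x y / x <= y => [hw x0 y0|x0 y0].
  by have [xy|/ltW xy] := leP x y; [exact: hw|rewrite distrC [leRHS]distrC; exact: hw].
rewrite ger0_norm ?subr_ge0 ?ler_expR ?lerN2// distrC ger0_norm ?subr_ge0//.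
have -> : - y = - x + - (y - x) by ring.
have h1 := expR_ge1Dx (- (y - x)).
have h2 : expR (- x) <= 1 by rewrite -expR0 ler_expR oppr_le0.
rewrite expRD -[X in X - _]mulr1 -mulrBr.
have h3 : 0 <= 1 - expR (- (y - x)) by rewrite subr_ge0 -expR0 ler_expR oppr_le0 subr_ge0.
rewrite (le_trans (ler_piMl h3 h2))//; lra.
Qed.

Lemma ln_shift x h : 1 <= x -> 0 <= h -> ln (x + h) <= ln x + h / x.
Proof.
move=> x1 h0; have x0 : 0 < x := lt_le_trans ltr01 x1.
have -> : x + h = x * (1 + h / x) by field; rewrite gt_eqF.
have hx : 0 <= h / x by rewrite divr_ge0// ltW.
rewrite lnM ?posrE ?ltr_wpDr// lerD2l le_ln1Dx//; exact: lt_le_trans hx.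
Qed.

Lemma ln_lip x y : 1 <= x -> 1 <= y -> `|ln x - ln y| <= `|x - y|.
Proof.
wlog xy : x y / x <= y => [hw x0 y0|x0 y0].
  by have [xy|/ltW xy] := leP x y; [exact: hw|rewrite distrC [leRHS]distrC; exact: hw].
have yx : 0 <= y - x by rewrite subr_ge0.
have := ln_shift x0 yx; rewrite addrC subrK => h.
have xp : 0 < x := lt_le_trans ltr01 x0.
rewrite distrC ger0_norm ?subr_ge0 ?ler_ln ?posrE ?(lt_le_trans ltr01 y0)// distrC ger0_norm//.
rewrite lerBlDl (le_trans h)// lerD2l ler_pdivrMr// ler_peMr//.
Qed.

Lemma inv_lip x y : 1 <= x -> 1 <= y -> `|x^-1 - y^-1| <= `|x - y|.
Proof.
move=> x1 y1; have x0 : 0 < x := lt_le_trans ltr01 x1; have y0 : 0 < y := lt_le_trans ltr01 y1.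
have -> : x^-1 - y^-1 = (y - x) / (x * y) by field; rewrite !gt_eqF.
rewrite normrM distrC ler_piMr// normfV gtr0_norm ?mulr_gt0// invf_le1 ?mulr_gt0//.
by rewrite (le_trans x1)// ler_peMr// ltW.
Qed.

End RealEstimates.

Section Recurrence.
Variables (R : realType) (Lambda : finType) (beta : Lambda -> Lambda -> R).
Hypothesis beta_ge0 : forall i j, 0 <= beta i j.
Hypothesis beta_sym : forall i j, beta i j = beta j i.
Hypothesis beta_connected : forall i j, connect (fun k l => 0 < beta k l) i j.
Variable B : {set Lambda}.
Implicit Types (i j k : Lambda) (l : Lambda -> R) (h : R).

Definition outer k : bool := (k \notin B) && [exists j in B, 0 < beta k j].
Definition outer_sum l : R := \sum_(k | outer k) l k.
Definition inner_sum l : R := \sum_(k in B) l k.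
(** The inverse of 0 is 0, so this is a sum over the edges. It is an upper bound for each single
    resistance, see [resist_beta]. *)
Definition resist : R := \sum_i \sum_j (beta i j)^-1.
Definition total_rate : R := \sum_i \sum_j beta i j.
(* On the outer boundary of [B], with total local time [S], the walk enters [B] at
   rate at least [1 / resist] and leaves it after a time of order [1 / S], so the
   local time in [B] should grow like [ln S]: [recf] blows up if it does not. *)
Definition recf i l : R :=
  expR (- (resist * total_rate * inner_sum l)) * (1 + ln (outer_sum l) + resist * (i \notin B)%:R / outer_sum l).

Lemma resist_ge0 : 0 <= resist.
Proof. by apply: sumr_ge0 => i _; apply: sumr_ge0 => j _; rewrite invr_ge0. Qed.

Lemma total_rate_ge0 : 0 <= total_rate.
Proof. by apply: sumr_ge0 => i _; apply: sumr_ge0. Qed.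

Lemma resist_beta i j : 0 < beta i j -> 1 <= resist * beta i j.
Proof.
move=> bij; rewrite -[X in X <= _](@mulVf _ (beta i j)) ?gt_eqF// ler_pM2r//.
rewrite /resist (bigD1 i)//= (bigD1 j)//= -addrA lerDl addr_ge0//.
  by apply: sumr_ge0 => k _; rewrite invr_ge0.
by apply: sumr_ge0 => k _; apply: sumr_ge0 => m _; rewrite invr_ge0.
Qed.

Lemma beta_total i j : beta i j <= total_rate.
Proof.
rewrite /total_rate (bigD1 i)//= (bigD1 j)//= -addrA lerDl addr_ge0//.
  by apply: sumr_ge0.
by apply: sumr_ge0 => k _; apply: sumr_ge0.
Qed.

Hypothesis B_proper : exists2 i, i \in B & exists j, j \notin B.

Lemma outer_exists : exists k, outer k.
Proof.
have [i iB [j jB]] := B_proper.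
have /connectP[p pp jp] := beta_connected i j.
elim: p i iB pp jp => [|k p IH] i iB /=; first by move=> _ ji; rewrite ji iB in jB.
move=> /andP[ik pp] jp; have [kB|kB] := boolP (k \in B); first exact: (IH k).
by exists k; rewrite /outer kB; apply/existsP; exists i; rewrite iB beta_sym.
Qed.

Lemma outer_sum_ge l k : (forall k, 1 <= l k) -> outer k -> l k <= outer_sum l.
Proof.
move=> l1 ok; rewrite /outer_sum (bigD1 k)//= lerDl; apply: sumr_ge0 => m _.
by rewrite (le_trans _ (l1 m)).
Qed.

Lemma outer_sum_ge1 l : (forall k, 1 <= l k) -> 1 <= outer_sum l.
Proof.
by move=> l1; have [k ok] := outer_exists; rewrite (le_trans (l1 k))// outer_sum_ge.
Qed.

Lemma inner_sum_ge0 l : (forall k, 1 <= l k) -> 0 <= inner_sum l.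
Proof. by move=> l1; apply: sumr_ge0 => k _; rewrite (le_trans _ (l1 k)). Qed.

Lemma recf_lower i l : (forall k, 1 <= l k) ->
  expR (- (resist * total_rate * inner_sum l)) * (1 + ln (outer_sum l)) <= recf i l.
Proof.
move=> l1; rewrite /recf ler_wpM2l ?expR_ge0// lerDl.
by rewrite !mulr_ge0 ?resist_ge0// invr_ge0 (le_trans ler01)// outer_sum_ge1.
Qed.

Lemma recf_ge0 i l : (forall k, 1 <= l k) -> 0 <= recf i l.
Proof.
move=> l1; apply: le_trans (recf_lower i l1).
by rewrite mulr_ge0 ?expR_ge0// addr_ge0// ln_ge0// outer_sum_ge1.
Qed.

Lemma recf_drift l i : (forall k, 1 <= l k) ->
  drift beta recf i l = expR (- (resist * total_rate * inner_sum l)) * (resist / outer_sum l) *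
    \sum_(j | j != i) beta i j * l j * ((j \notin B)%:R - (i \notin B)%:R).
Proof. by move=> l1; rewrite mulr_sumr; apply: eq_bigr => j _; rewrite /recf; ring. Qed.

Lemma outer_sum_shift l i h : outer_sum (shift l i h) = outer_sum l + (outer i)%:R * h.
Proof.
rewrite /outer_sum /shift big_split/=; congr (_ + _).
rewrite -mulr_suml; congr (_ * _); case: (boolP (outer i)) => oi.
  by rewrite (bigD1 i)//= eqxx big1 ?addr0// => k /andP[_ /negPf ->].
by rewrite big1// => k ok; case: eqP => // ki; rewrite -ki ok in oi.
Qed.

Lemma inner_sum_shift l i h : inner_sum (shift l i h) = inner_sum l + (i \in B)%:R * h.
Proof.
rewrite /inner_sum /shift big_split/=; congr (_ + _).
rewrite -mulr_suml; congr (_ * _); case: (boolP (i \in B)) => oi.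
  by rewrite (bigD1 i)//= eqxx big1 ?addr0// => k /andP[_ /negPf ->].
by rewrite big1// => k ok; case: eqP => // ki; rewrite -ki ok in oi.
Qed.

(** Inside [B] only the exponential varies. It decays at rate [resist * total_rate], which outweighs
    the gain from jumps out of [B]: their total rate is at most [total_rate] times the outer sum,
    and each gains [resist] divided by that sum. Outside [B] the logarithm grows only on the outer
    boundary, at rate one over the outer sum; there the walk enters [B] at rate at least
    [1 / resist], and the loss of the last summand compensates. *)
Lemma recf_decr i l h : 0 <= h -> (forall k, 1 <= l k) ->
  recf i (shift l i h) <= recf i l - h * drift beta recf i l +
    (resist * total_rate) ^+ 2 * (1 + outer_sum l) * h ^+ 2.
Proof.
move=> h0 l1; rewrite recf_drift//.
have S1 := outer_sum_ge1 l1; have S0 : 0 < outer_sum l := lt_le_trans ltr01 S1.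
have V0 := inner_sum_ge0 l1; have r0 := resist_ge0; have t0 := total_rate_ge0.
have lpos k : 0 <= l k by rewrite (le_trans _ (l1 k)).
set E := expR _; have E0 : 0 <= E by exact: expR_ge0.
have E1 : E <= 1 by rewrite -expR0 ler_expR oppr_le0 !mulr_ge0.
have lnS0 : 0 <= ln (outer_sum l) by rewrite ln_ge0.
have lnS : ln (outer_sum l) <= outer_sum l by rewrite ltW// ln_sublinear.
have [iB|iB] := boolP (i \in B).
  have oi : outer i = false by rewrite /outer iB.
  rewrite /recf outer_sum_shift inner_sum_shift oi iB /= mulr0 mul0r !addr0 mul1r mul0r addr0.
  rewrite [_ * (inner_sum l + h)]mulrDr opprD expRD -/E.
  set k := resist * total_rate; have k0 : 0 <= k by rewrite mulr_ge0.
  set Sg := \sum_(j | _) _.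
  have Sg1 : Sg <= total_rate * outer_sum l.
    rewrite /Sg /outer_sum mulr_sumr big_mkcond [leRHS]big_mkcond; apply: ler_sum => j _.
    case: ifP => ji; last by case: ifP => // _; rewrite mulr_ge0.
    rewrite subr0; have [jB|jB] := boolP (j \in B).
      by rewrite mulr0; case: ifP => // _; rewrite mulr_ge0.
    rewrite mulr1 /outer jB /=; case: existsP => [_|nx].
      by rewrite ler_wpM2r// beta_total.
    have [->|/eqP bn] := eqVneq (beta i j) 0; first by rewrite mul0r.
    by exfalso; apply: nx; exists i; rewrite iB beta_sym lt_neqAle eq_sym beta_ge0 andbT; apply/eqP.
  have d1 : E * (resist / outer_sum l) * Sg <= E * k.
    rewrite -mulrA ler_wpM2l// /k mulrAC ler_pdivrMr// -mulrA ler_wpM2l//.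
  have e1 := expRN_le (mulr_ge0 k0 h0).
  have EL0 : 0 <= E * (1 + ln (outer_sum l)) by rewrite mulr_ge0// addr_ge0.
  have e2 := ler_wpM2l EL0 e1.
  have e3 := ler_wpM2l h0 d1.
  have e4 : h * (E * k) <= E * (1 + ln (outer_sum l)) * (k * h).
    have -> : h * (E * k) = (h * E * k) * 1 by ring.
    have -> : E * (1 + ln (outer_sum l)) * (k * h) = h * E * k * (1 + ln (outer_sum l)) by ring.
    by rewrite ler_wpM2l ?lerDl// !mulr_ge0.
  have e5 : E * (1 + ln (outer_sum l)) * (k * h) ^+ 2 <= k ^+ 2 * (1 + outer_sum l) * h ^+ 2.
    have -> : E * (1 + ln (outer_sum l)) * (k * h) ^+ 2 = k ^+ 2 * (E * (1 + ln (outer_sum l))) * h ^+ 2 by ring.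
    rewrite ler_wpM2r ?sqr_ge0// ler_wpM2l ?sqr_ge0//.
    by rewrite (le_trans (ler_piMl _ E1)) ?addr_ge0// lerD2l.
  rewrite mul0r addr0.
  have -> : E * expR (- (k * h)) * (1 + ln (outer_sum l)) = E * (1 + ln (outer_sum l)) * expR (- (k * h)) by ring.
  lra.
rewrite /recf outer_sum_shift inner_sum_shift (negPf iB)/= mul0r addr0 -/E.
have Dh : 0 <= (resist * total_rate) ^+ 2 * (1 + outer_sum l) * h ^+ 2.
  by rewrite mulr_ge0 ?sqr_ge0// mulr_ge0 ?sqr_ge0// addr_ge0// ltW.
set Sg := \sum_(j | _) _.
have ch : 0 <= (outer i)%:R * h by rewrite mulr_ge0.
have SgE : Sg = - \sum_(j in B) beta i j * l j.
  rewrite /Sg -sumrN big_mkcond [RHS]big_mkcond; apply: eq_bigr => j _.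
  case: eqP => [->|_] /=; first by rewrite (negPf iB).
  by case: (j \in B) => /=; ring.
have P0 : 0 <= \sum_(j in B) beta i j * l j by apply: sumr_ge0 => j _; rewrite mulr_ge0.
have oi : (outer i)%:R <= resist * \sum_(j in B) beta i j * l j.
  case: (boolP (outer i)) => [|_]; last by rewrite mulr_ge0.
  move=> /andP[_ /existsP[j /andP[jB bij]]]; rewrite (le_trans (resist_beta bij))// ler_wpM2l//.
  rewrite (bigD1 j)//= ler_wpDr ?ler_peMr//.
  by apply: sumr_ge0 => k _; rewrite mulr_ge0.
have l2 := ln_shift S1 ch.
have l3 : resist * 1 / (outer_sum l + (outer i)%:R * h) <= resist * 1 / outer_sum l.
  by rewrite !mulr1 ler_wpM2l// lef_pV2 ?posrE ?lerDl// ltr_wpDr.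
have l4 : (outer i)%:R * h / outer_sum l <= h * (resist / outer_sum l * \sum_(j in B) beta i j * l j).
  have -> : h * (resist / outer_sum l * \sum_(j in B) beta i j * l j) =
    (resist * \sum_(j in B) beta i j * l j) * h / outer_sum l by ring.
  by rewrite ler_wpM2r ?invr_ge0 ?(ltW S0)// ler_wpM2r.
apply: ler_wpDr => //; rewrite SgE.
set PB := \sum_(j in B) _ in P0 oi l4 *.
have -> : E * (1 + ln (outer_sum l) + resist * 1 / outer_sum l) - h * (E * (resist / outer_sum l) * - PB) =
  E * (1 + ln (outer_sum l) + resist * 1 / outer_sum l + h * (resist / outer_sum l * PB)) by ring.
by rewrite ler_wpM2l//; lra.
Qed.

Definition recf_const (M : R) : R :=
  ((resist * total_rate) ^+ 2 + resist * total_rate + 1 + resist) * (1 + #|Lambda|%:R * M + resist).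

Lemma recf_lyapunov M : 1 <= M -> lyapunov beta M (recf_const M) recf.
Proof.
move=> M1; have M0 : 0 <= M by rewrite (le_trans _ M1).
have r0 := resist_ge0; have t0 := total_rate_ge0.
have rt0 : 0 <= resist * total_rate by rewrite mulr_ge0.
pose N : R := #|Lambda|%:R * M; have N0 : 0 <= N by rewrite mulr_ge0.
have bx l : box M l -> forall k, 1 <= l k by move=> bl k; have /andP[] := bl k.
have SN l : box M l -> outer_sum l <= N.
  move=> bl; rewrite /outer_sum big_mkcond/= (_ : N = \sum_(k : Lambda) M).
    by apply: ler_sum => k _; case: ifP => // _; have /andP[] := bl k.
  by rewrite sumr_const -mulr_natl.
pose G i l := 1 + ln (outer_sum l) + resist * (i \notin B)%:R / outer_sum l.
pose E l := expR (- (resist * total_rate * inner_sum l)).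
have E01 l : box M l -> 0 <= E l <= 1.
  move=> bl; rewrite expR_ge0/= -expR0 ler_expR oppr_le0 mulr_ge0//.
  exact: inner_sum_ge0 (bx l bl).
have GB i l : box M l -> 0 <= G i l <= 1 + N + resist.
  move=> bl; have S1 := outer_sum_ge1 (bx l bl); have S0 := lt_le_trans ltr01 S1.
  have ls : ln (outer_sum l) <= outer_sum l by rewrite ltW// ln_sublinear.
  have l0 := ln_ge0 S1; have sn := SN l bl.
  have a0 : 0 <= resist * (i \notin B)%:R / outer_sum l by rewrite !mulr_ge0// invr_ge0 ltW.
  have a1 : resist * (i \notin B)%:R / outer_sum l <= resist.
    rewrite -mulrA ler_piMr//; case: (i \notin B); rewrite ?mul0r ?mul1r//.
    by rewrite invf_le1.
  by rewrite /G; lra.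
have NR : 1 <= 1 + N + resist by rewrite -addrA lerDl addr_ge0.
have NR0 : 0 <= 1 + N + resist by rewrite (le_trans _ NR).
have k20 : 0 <= (resist * total_rate) ^+ 2 by rewrite sqr_ge0.
have sums (Q : pred Lambda) l l' : `|\sum_(k | Q k) l k - \sum_(k | Q k) l' k| <= \sum_k `|l k - l' k|.
  rewrite -sumrB (le_trans (ler_norm_sum _ _ _))// big_mkcond; apply: ler_sum => k _.
  by case: ifP.
split=> [i l bl|i l l' bl bl'|i l h h0 bl bs].
- have /andP[e0 e1] := E01 l bl; have /andP[g0 g1] := GB i l bl.
  rewrite /recf -/(E l) -/(G i l) ger0_norm ?mulr_ge0// (le_trans (ler_piMl g0 e1))//.
  rewrite (le_trans g1)// /recf_const ler_peMl//; lra.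
- have /andP[e0 e1] := E01 l bl; have /andP[g0 g1] := GB i l bl.
  have /andP[e0' e1'] := E01 l' bl'; have /andP[g0' g1'] := GB i l' bl'.
  have S1 := outer_sum_ge1 (bx l bl); have S1' := outer_sum_ge1 (bx l' bl').
  rewrite /recf -/(E l) -/(G i l) -/(E l') -/(G i l').
  set n := \sum_k _; have n0 : 0 <= n by apply: sumr_ge0.
  have dE : `|E l - E l'| <= resist * total_rate * n.
    rewrite (le_trans (expRN_lip _ _)) ?mulr_ge0 ?(inner_sum_ge0 (bx _ _))//.
    by rewrite -mulrBr normrM ger0_norm// ler_wpM2l// sums.
  have dG : `|G i l - G i l'| <= (1 + resist) * n.
    have -> : G i l - G i l' = (ln (outer_sum l) - ln (outer_sum l')) +
      resist * (i \notin B)%:R * ((outer_sum l)^-1 - (outer_sum l')^-1) by rewrite /G; ring.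
    rewrite (le_trans (ler_normD _ _))// mulrDl mul1r lerD//.
      by rewrite (le_trans (ln_lip _ _))// sums.
    rewrite normrM ler_pM//.
      by rewrite ger0_norm ?mulr_ge0// ler_piMr//; case: (_ \notin _).
    by rewrite (le_trans (inv_lip _ _))// sums.
  have -> : E l * G i l - E l' * G i l' = (E l - E l') * G i l + E l' * (G i l - G i l') by ring.
  rewrite (le_trans (ler_normD _ _))// !normrM (ger0_norm g0) (ger0_norm e0').
  have a1 : `|E l - E l'| * G i l <= resist * total_rate * n * (1 + N + resist) by rewrite ler_pM.
  have a2 : E l' * `|G i l - G i l'| <= (1 + resist) * n * (1 + N + resist).
    rewrite (le_trans (ler_piMl _ e1'))// (le_trans dG)// ler_peMr// mulr_ge0//; lra.
  rewrite (le_trans (lerD a1 a2))// /recf_const -/N -mulrDl -mulrDl mulrAC ler_wpM2r//.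
  by rewrite ler_wpM2r//; lra.
- rewrite (le_trans (recf_decr i h0 (bx l bl)))// lerD2l ler_wpM2r ?sqr_ge0//.
  rewrite /recf_const -/N ler_pM//.
  + by rewrite addr_ge0// (le_trans ler01)// outer_sum_ge1//; exact: bx.
  + by lra.
  + by have := SN l bl; lra.
Qed.

Lemma recf_measurable e (S : measurableType e) (l : S -> Lambda -> R) i :
  (forall k, measurable_fun setT (fun u => l u k)) -> measurable_fun setT (fun u => recf i (l u)).
Proof.
move=> ml.
have mQ (Q : pred Lambda) : measurable_fun setT (fun u => \sum_(k | Q k) l u k).
  rewrite (_ : (fun u => _) = fun u => \sum_k if Q k then l u k else 0).
    by apply: measurable_sum => k; case: (Q k).
  by apply: funext => u; rewrite big_mkcond.
have mS : measurable_fun setT (fun u => outer_sum (l u)) := mQ outer.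
have mI : measurable_fun setT (fun u => inner_sum (l u)) := mQ (fun k => k \in B).
apply: measurable_funM.
  by apply: measurableT_comp => //; apply: measurable_funN; apply: measurable_funM.
apply: measurable_funD.
  by apply: measurable_funD => //; apply: measurableT_comp.
apply: measurable_funM => //.
(* The inverse is rewritten through a power of the nonnegative number [x ^+ 2], whose measurability
   is known; at [x = 0] both sides are 0. *)
have eV (x : R) : x^-1 = x * (x ^+ 2) `^ (-1).
  rewrite powR_inv1 ?sqr_ge0//; have [->|x0] := eqVneq x 0; first by rewrite invr0 mul0r.
  by rewrite expr2 invfM mulrA divff// mul1r.
under eq_fun do rewrite eV.
apply: measurable_funM => //.
apply: (@measurableT_comp _ _ _ _ _ _ (fun y : R => y `^ (-1)) _ (fun u => outer_sum (l u) ^+ 2)).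
  exact: measurable_powR.
exact: measurable_funX.
Qed.

End Recurrence.

Section Transience.
Context {R : realType} {Lambda : finType} {d : measure_display} {T : measurableType d}.
Variables (P : probability T R) (X : R -> T -> Lambda).
Variables (beta : Lambda -> Lambda -> R) (a : Lambda).
Hypothesis beta_ge0 : forall i j, 0 <= beta i j.
Hypothesis X_vrjp : vrjp beta a (fun=> 1) P X.
Implicit Types (s t r h : R) (i j : Lambda) (w : T) (A : set T).

Local Notation L := (local_time (fun=> 1) X).

Lemma ae_start : {ae P, forall w, X 0 w = a}.
Proof.
have m0 : measurable [set w | X 0 w = a] by exact: (vrjp_measurable X_vrjp).
exists (~` [set w | X 0 w = a]); split; [exact: measurableC| |by move=> w].
by rewrite probability_setC// (vrjp_start X_vrjp) subee.
Qed.

Lemma integral_start (u : T -> R) (c : R) : measurable_fun setT u ->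
  (forall w, X 0 w = a -> u w = c) -> \int[P]_w u w = c.
Proof.
move=> mu uc.
have -> : \int[P]_w u w = \int[P]_(w in setT) c.
  congr fine; apply: ae_eq_integral => //; first exact/measurable_EFinP.
  by apply: filterS ae_start => w Xa _; rewrite /= uc.
exact: Rintegral_probability.
Qed.

Variables (K D : R) (f : Lambda -> (Lambda -> R) -> R).
Hypothesis K_ge0 : 0 <= K.
Hypothesis f_lyap : lyapunov beta (1 + K) D f.
Hypothesis f_meas : forall e (S : measurableType e) (l : S -> Lambda -> R),
  (forall k, measurable_fun setT (fun u => l u k)) -> forall i, measurable_fun setT (fun u => f i (l u)).

Local Notation value := (value X f).

(** The one-step errors [e * h] add up to [e] times the horizon. The indicators of events [A k]
    known at time [k h] leave room for stopping. *)
Lemma stopped_step (e : R) : 0 < e -> exists2 delta : R, 0 < delta &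
  forall h (m : nat), 0 < h < delta -> m%:R * h <= K ->
  forall A : nat -> set T, (forall k, (k < m)%N -> history X (k%:R * h) (A k)) ->
  \int[P]_w (\sum_(k < m) \1_(A k) w * (value (k.+1%:R * h) w - value (k%:R * h) w)) <= e * (m%:R * h).
Proof.
move=> e0; have [delta d0 hd] := one_step beta_ge0 X_vrjp f_lyap f_meas e0.
exists delta => // h m hh mK A hA; have /andP[h0 _] := hh; have h0' := ltW h0.
have kK (k : nat) : (k <= m)%N -> 0 <= k%:R * h <= K.
  by move=> km; rewrite mulr_ge0//= (le_trans _ mK)// ler_wpM2r// ler_nat.
have S (k : nat) : k.+1%:R * h = k%:R * h + h by rewrite -natr1 mulrDl mul1r.
have iv (k : 'I_m) : P.-integrable setT (EFin \o (fun w => \1_(A k) w * (value (k.+1%:R * h) w - value (k%:R * h) w))).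
  have mA := history_measurable X_vrjp (hA k (ltn_ord k)).
  have mv t : 0 <= t -> measurable_fun setT (value t) by exact: (measurable_value X_vrjp).
  apply: (@integrable_bounded _ _ _ _ _ (2 * D)).
    by apply: measurable_funM => //; apply: measurable_funB; apply: mv; rewrite mulr_ge0.
  move=> w; have A01 : 0 <= (\1_(A k) w : R) <= 1 by rewrite indicE; case: (_ \in _); rewrite /= ?lexx ?ler01.
  have /andP[a0 a1] := A01.
  have v1 := value_bound X_vrjp f_lyap w (kK k (ltnW (ltn_ord k))).
  have v2 := value_bound X_vrjp f_lyap w (kK k.+1 (ltn_ord k)).
  rewrite normrM (ger0_norm a0) (le_trans (ler_piMl _ a1))// (le_trans (ler_normB _ _))//; lra.
rewrite (Rintegral_sum (index_enum _) iv).2.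
have -> : e * (m%:R * h) = \sum_(k < m) e * h.
  by rewrite sumr_const card_ord -[RHS]mulr_natl mulrCA.
apply: ler_sum => k _; rewrite S.
have kk := kK k.+1 (ltn_ord k); rewrite S in kk; have /andP[_ kk'] := kk.
have /andP[k0 _] := kK k (ltnW (ltn_ord k)).
apply: hd => //; exact: hA.
Qed.

Lemma supermartingale : \int[P]_w value K w <= f a (fun=> 1).
Proof.
have [K0|K0] := eqVneq K 0.
  rewrite (@integral_start _ (f a (fun=> 1))) ?K0//; first exact: (measurable_value X_vrjp).
  by move=> w Xa; rewrite /value Xa; congr (f a _); apply: funext => i; rewrite (local_time0 X).
have Kp : 0 < K by rewrite lt_neqAle eq_sym K0.
have mv t : 0 <= t -> measurable_fun setT (value t) by exact: (measurable_value X_vrjp).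
apply/ler_addgt0Pr => e e0.
have [delta d0 hd] := stopped_step (divr_gt0 e0 Kp).
pose m := (Num.trunc (K / delta)).+1.
have mp : (0 : R) < m%:R by [].
have := hd (K / m%:R) m; rewrite divr_gt0//= ltr_pdivrMr// mulrC -ltr_pdivrMr//.
rewrite truncnS_gt// => /(_ isT); rewrite mulrC divfK ?gt_eqF// => /(_ (lexx _)) /(_ (fun=> setT)).
move=> /(_ (fun _ _ => @measurableT _ (historyT X _))).
have -> : (fun w => \sum_(k < m) \1_[set: T] w * (value (k.+1%:R * (K / m%:R)) w - value (k%:R * (K / m%:R)) w)) =
  (fun w => value K w - value 0 w).
  apply: funext => w; under eq_bigr do rewrite indicT mul1r.
  rewrite -(big_mkord xpredT (fun k => value (k.+1%:R * (K / m%:R)) w - value (k%:R * (K / m%:R)) w)).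
  by rewrite (telescope_sumr (fun k => value (k%:R * (K / m%:R)) w))// mul0r mulrC divfK ?gt_eqF.
rewrite RintegralB//; last 2 first.
- by apply: (integrable_bounded P (C := D) (mv _ K_ge0)) => w; apply: (value_bound X_vrjp f_lyap); rewrite K_ge0 lexx.
- by apply: (integrable_bounded P (C := D) (mv _ (lexx 0))) => w; apply: (value_bound X_vrjp f_lyap); rewrite K_ge0 lexx.
rewrite (@integral_start (value 0) (f a (fun=> 1))); last 2 first.
- exact: mv.
- by move=> w Xa; rewrite /value Xa; congr (f a _); apply: funext => i; rewrite (local_time0 X).
by rewrite divfK ?gt_eqF// lerBlDl.
Qed.

End Transience.

Section Unbounded.
Context {R : realType} {Lambda : finType} {d : measure_display} {T : measurableType d}.
Variables (P : probability T R) (X : R -> T -> Lambda).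
Variables (beta : Lambda -> Lambda -> R) (a : Lambda).
Hypothesis beta_ge0 : forall i j, 0 <= beta i j.
Hypothesis beta_sym : forall i j, beta i j = beta j i.
Hypothesis beta_connected : forall i j, connect (fun k l => 0 < beta k l) i j.
Hypothesis X_vrjp : vrjp beta a (fun=> 1) P X.
Implicit Types (s t r h : R) (i j : Lambda) (w : T) (A : set T) (B : {set Lambda}).

Local Notation L := (local_time (fun=> 1) X).

Definition trapped B w := (exists M : R, forall n : nat, inner_sum B (L n%:R w) <= M) /\
  (forall M : R, exists n : nat, M <= outer_sum beta B (L n%:R w)).

(** The expectations of [recf] along the walk stay below the initial value, so its lower limit is
    almost surely finite by Fatou. On a trapped path the exponential factor stays away from 0 while
    the logarithm tends to infinity. *)
Lemma ae_not_trapped B : (exists2 i, i \in B & exists j, j \notin B) ->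
  {ae P, forall w, ~ trapped B w}.
Proof.
move=> Bp.
pose G (n : nat) w := recf beta B (X n%:R w) (L n%:R w).
have l1 (n : nat) w k : 1 <= L n%:R w k by exact: (local_time_ge1 X_vrjp).
have G0 n w : 0 <= G n w.
  exact: (recf_ge0 beta_ge0 beta_sym beta_connected Bp).
have n1 (n : nat) : (1 : R) <= 1 + n%:R by rewrite lerDl.
have GE (n : nat) : \int[P]_w G n w <= recf beta B a (fun=> 1).
  have lyap := recf_lyapunov beta_ge0 beta_sym beta_connected Bp (n1 n).
  by apply: (supermartingale beta_ge0 X_vrjp (ler0n R n) lyap) => e S l ml i; exact: recf_measurable.
have mG n : measurable_fun setT (G n).
  apply: (measurable_at_state X_vrjp (f := fun i w => recf beta B i (L n%:R w))) => // i.
  by apply: recf_measurable => k; exact: (measurable_local_time X_vrjp).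
have iG n : P.-integrable setT (EFin \o G n).
  have lyap := recf_lyapunov beta_ge0 beta_sym beta_connected Bp (n1 n).
  apply: (integrable_bounded P (mG n)) => w; apply: (lyapunov_bound lyap).
  by apply: (local_time_box X_vrjp); rewrite lexx andbT.
have IG n : (\int[P]_w (G n w)%:E = (\int[P]_w G n w)%:E)%E.
  by rewrite fineK//; exact: (integrable_fin_num measurableT (iG n)).
pose c := recf beta B a (fun=> 1).
pose F w := limn_einf (fun n => (G n w)%:E).
have F0 w : (0 <= F w)%E.
  rewrite /F limn_einf_lim; apply: lime_ge; first exact: is_cvg_einfs.
  by apply: nearW => n; apply: le_ereal_inf_tmp => _ [m _ <-]; rewrite lee_fin.
have mF : measurable_fun setT F.
  rewrite /F /limn_einf; apply: measurableT_comp => //.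
  by apply: measurable_fun_limn_esup => n; apply: measurableT_comp => //; exact/measurable_EFinP.
have FB : (\int[P]_w F w <= c%:E)%E.
  apply: le_trans.
    apply: (@fatou _ _ _ P setT measurableT (fun n => EFin \o G n)) => [n|n w _].
      exact/measurable_EFinP.
    by rewrite lee_fin.
  rewrite limn_einf_lim; apply: lime_le; first exact: is_cvg_einfs.
  apply: nearW => n; apply: (@le_trans _ _ (\int[P]_w (G n w)%:E)%E).
    by apply: ereal_inf_lbound; exists n => /=.
  by rewrite IG lee_fin GE.
have iF : P.-integrable setT F.
  apply/integrableP; split => //.
  under eq_integral do rewrite gee0_abs//.
  exact: le_lt_trans FB (ltry _).
apply: filterS (integrable_ae measurableT iF) => w /(_ Logic.I) fF [[M HM] HS].
move: fF; rewrite /F (_ : limn_einf _ = +oo%E)//.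
apply: (cvg_limn_einf_sup _).1; apply/cvgeryP/cvgryPge => A.
pose k := resist beta * total_rate beta; have k0 : 0 <= k.
  by apply: mulr_ge0; [exact: resist_ge0|exact: total_rate_ge0].
have [N HN] := HS (expR (`|A| * expR (k * M))).
near=> n; have Nn : (N <= n)%N by near: n; exact: nbhs_infty_ge.
apply: le_trans (recf_lower beta_ge0 beta_sym beta_connected Bp _ (l1 n w)).
have mono : outer_sum beta B (L N%:R w) <= outer_sum beta B (L n%:R w).
  by apply: ler_sum => i _; apply: (local_time_le X_vrjp) => //; rewrite ler_nat.
have S1 := outer_sum_ge1 beta_sym beta_connected Bp (l1 n w).
have l2 : `|A| * expR (k * M) <= ln (outer_sum beta B (L n%:R w)).
  rewrite -[leLHS]expRK ler_ln ?posrE ?expR_gt0 ?(lt_le_trans ltr01)//.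
  exact: le_trans HN mono.
have l3 : expR (- (k * M)) <= expR (- (k * inner_sum B (L n%:R w))).
  by rewrite ler_expR lerN2 ler_wpM2l.
apply: (le_trans (ler_norm A)).
have -> : `|A| = expR (- (k * M)) * (`|A| * expR (k * M)).
  by rewrite mulrCA -expRD addNr expR0 mulr1.
apply: ler_pM => //.
by rewrite (le_trans l2)// lerDr.
Unshelve. all: end_near. Qed.

(** If the local time at [a] stayed bounded, let [B] be the set of sites with bounded local time. It
    contains [a], and it is not everything, as the total local time grows like [t]. The walk is then
    trapped for this [B]; the set [B] depends on the path, but there are finitely many
    candidates. *)
Lemma ae_unbounded : {ae P, forall w (M : R), exists n : nat, M <= L n%:R w a}.
Proof.
have h : {ae P, forall w B, (exists2 i, i \in B & exists j, j \notin B) -> ~ trapped B w}.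
  apply: filter_forall => B.
  have [Bp|nBp] := pselect (exists2 i, i \in B & exists j, j \notin B).
    by apply: filterS (ae_not_trapped Bp).
  by apply: nearW.
apply: filterS h => w hw M0; apply: contrapT => nM.
pose B := [set i | `[< exists M : R, forall n : nat, L n%:R w i <= M >]]%SET.
have aB : a \in B.
  rewrite inE; apply/asboolP; exists M0 => n; rewrite leNgt; apply/negP => h.
  by apply: nM; exists n; exact: ltW.
have /choice[M HM] : forall i, exists M : R, i \in B -> forall n : nat, L n%:R w i <= M.
  move=> i; have [|iB] := boolP (i \in B); last by exists 0.
  by rewrite inE => /asboolP[M HM]; exists M.
have nB i : i \notin B -> forall M' : R, exists n : nat, M' <= L n%:R w i.
  rewrite inE => /asboolPn iB M'; apply: contrapT => h; apply: iB; exists M' => n.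
  by rewrite leNgt; apply/negP => h'; apply: h; exists n; exact: ltW.
have [j jB] : exists j, j \notin B.
  apply: contrapT => nj.
  have allB i : i \in B by apply/negPn/negP => iB; apply: nj; exists i.
  pose n := (Num.trunc (\sum_i (M i - 1))).+1.
  have := local_time_sum X_vrjp w (lexx 0) (ler0n R n); rewrite subr0.
  have h1 : \sum_i (L n%:R w i - L 0 w i) <= \sum_i (M i - 1).
    by apply: ler_sum => i _; rewrite (local_time0 X) lerB// HM.
  by move=> h2; move: h1; rewrite h2 leNgt truncnS_gt.
have Bp : exists2 i, i \in B & exists j, j \notin B by exists a => //; exists j.
apply: (hw B Bp); split.
  by exists (\sum_(i in B) M i) => n; apply: ler_sum => i iB; exact: HM.
move=> M'; have [k ok] := outer_exists beta_sym beta_connected Bp.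
have [n Hn] := nB k (proj1 (andP ok)) M'.
exists n; apply: (le_trans Hn); apply: outer_sum_ge => // m.
exact: (local_time_ge1 X_vrjp).
Qed.

End Unbounded.

(** * Optional stopping at the hitting time *)

Section StopIndex.
Variable R : realType.

Lemma sum_bool_le (b : nat -> bool) (m : nat) : (\sum_(j < m) b j <= m)%N.
Proof.
elim: m => [|m IH]; first by rewrite big_ord0.
by rewrite big_ord_recr/= -addn1 leq_add//; case: (b m).
Qed.

Lemma decreasing_index (b : nat -> bool) (m k : nat) : (forall k, b k.+1 -> b k) ->
  (k < m)%N -> b k = (k < \sum_(j < m) b j)%N.
Proof.
move=> db; elim: m k => [//|m IH] k; rewrite ltnS big_ord_recr/=.
have [bm|bm] := boolP (b m).
  have bk n : (n <= m)%N -> b n.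
    move=> nm; rewrite -(subKn nm); elim: (m - n)%N => [|q IHq]; first by rewrite subn0.
    have [qm|qm] := ltnP q m; last by rewrite (eqP (leqW qm : _ - _ == 0)%N) -?(eqP (qm : m - q == 0)%N).
    by apply: db; rewrite -subSn// subSS.
  move=> km; rewrite bk//; rewrite (eq_bigr (fun=> 1%N)); last by move=> j _; rewrite bk// ltnW.
  by rewrite sum_nat_const card_ord muln1 addn1 ltnS km.
rewrite addn0 leq_eqVlt => /orP[/eqP ->|]; last exact: IH.
rewrite (negPf bm); apply/esym/negbTE; rewrite -leqNgt.
exact: sum_bool_le.
Qed.

(** The increments telescope until [b] fails for the first time, and that index is the number of
    times [b] holds. *)
Lemma stopped_sum (b : nat -> bool) (m : nat) (u : nat -> R) : (forall k, b k.+1 -> b k) ->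
  \sum_(k < m) (b k)%:R * (u k.+1 - u k) = u (\sum_(j < m) b j)%N - u 0.
Proof.
move=> db; elim: m => [|m IH]; first by rewrite !big_ord0 subrr.
rewrite !big_ord_recr/= IH; have [bm|bm] := boolP (b m); last by rewrite mul0r addr0 addn0.
have -> : (\sum_(j < m) b j)%N = m.
  apply/eqP; rewrite eqn_leq; apply/andP; split.
    exact: sum_bool_le.
  rewrite leqNgt; apply/negP => h.
  have := @decreasing_index b m.+1 m db (ltnSn m); rewrite bm big_ord_recr/= bm => /esym.
  by rewrite addn1 ltnS leqNgt h.
by rewrite addn1 mul1r; ring.
Qed.

End StopIndex.

Section Exit.
Context {R : realType} {Lambda : finType} {d : measure_display} {T : measurableType d}.
Variables (P : probability T R) (X : R -> T -> Lambda).
Variables (beta : Lambda -> Lambda -> R) (a : Lambda).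
Hypothesis beta_ge0 : forall i j, 0 <= beta i j.
Hypothesis X_vrjp : vrjp beta a (fun=> 1) P X.
Variable gamma : R.
Hypothesis gamma_ge1 : 1 <= gamma.
Implicit Types (s t r h : R) (i j : Lambda) (w : T) (A : set T) (k m n : nat).

Local Notation L := (local_time (fun=> 1) X).

(* The margin [2 * h] makes the stopped grid time fall strictly before the hitting
   time, where the walk sits at [a]. *)
Definition below h k w : bool := L (k%:R * h) w a < gamma - 2 * h.
Definition stop h m w : R := (\sum_(k < m) below h k w)%N%:R * h.

Local Notation tau := (hitting_time (fun=> 1) X a gamma).

Lemma belowS h k w : 0 <= h -> below h k.+1 w -> below h k w.
Proof.
move=> h0; apply: le_lt_trans; apply: (local_time_le X_vrjp); rewrite ?mulr_ge0//.
by rewrite ler_wpM2r// ler_nat.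
Qed.

Lemma stop_ge0 h m w : 0 <= h -> 0 <= stop h m w.
Proof. by move=> h0; rewrite mulr_ge0. Qed.

Lemma stop_bound h m w : 0 < h -> L (stop h m w) w a <= gamma.
Proof.
move=> h0; have h0' := ltW h0; rewrite /stop; case E : (\sum_(k < m) below h k w)%N => [|n].
  by rewrite mul0r (local_time0 X).
have nm : (n < m)%N by rewrite -E (sum_bool_le (fun k => below h k w)).
have : below h n w by rewrite (decreasing_index (fun k => @belowS h k w h0') nm) E.
have e : n.+1%:R * h = n%:R * h + h by rewrite -natr1 mulrDl mul1r.
have nn : n%:R * h <= n.+1%:R * h by rewrite e lerDl.
have n0 : 0 <= n%:R * h by rewrite mulr_ge0.
have := local_time_lip X_vrjp w a n0 nn; rewrite /below; lra.
Qed.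

Variable w : T.
Hypothesis w_exit : exists n : nat, gamma <= L n%:R w a.

Let exits := [set t | 0 <= t /\ gamma <= L t w a].

Lemma exits_nonempty : exits !=set0.
Proof. by have [n Hn] := w_exit; exists n%:R. Qed.

Lemma exits_lbound : lbound exits 0.
Proof. by move=> t []. Qed.

Lemma exits_inf : has_inf exits.
Proof. by split; [exact: exits_nonempty|exists 0; exact: exits_lbound]. Qed.

Lemma exit_ge0 : 0 <= tau w.
Proof. by apply: lb_le_inf; [exact: exits_nonempty|exact: exits_lbound]. Qed.

Lemma before_exit t : 0 <= t -> t < tau w -> L t w a < gamma.
Proof.
move=> t0 tt; rewrite ltNge; apply/negP => h.
by move: tt; rewrite ltNge => /negP; apply; apply: ge_inf; [exists 0; exact: exits_lbound|].
Qed.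

(** The local time at [a] is Lipschitz in time and starts at 1, which is at most [gamma]: it can
    neither jump over the level nor start above it. *)
Lemma local_time_exit : L (tau w) w a = gamma.
Proof.
have t0 := exit_ge0.
apply/eqP; rewrite eq_le; apply/andP; split.
  have [e|tn0] := eqVneq (tau w) 0; first by rewrite e (local_time0 X).
  have tp : 0 < tau w by rewrite lt_neqAle eq_sym tn0.
  apply/ler_addgt0Pr => e e0.
  pose s := Num.max 0 (tau w - e).
  have s0 : 0 <= s by rewrite le_max lexx.
  have st : s < tau w by rewrite gt_max tp/= ltrBlDr ltrDl.
  have := before_exit s0 st; have := local_time_lip X_vrjp w a s0 (ltW st).
  have : tau w - e <= s by rewrite le_max lexx orbT.
  lra.
apply/ler_addgt0Pr => e e0.
have [t [t0' gt] te] := inf_adherent e0 exits_inf.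
have tt : tau w <= t by apply: ge_inf; [exists 0; exact: exits_lbound|].
have := local_time_lip X_vrjp w a t0 tt; rewrite -/(tau w) in te.
move: te; rewrite /hitting_time -/exits => te; have := te; lra.
Qed.

Lemma below_exit h k : 0 < h -> below h k w -> k.+1%:R * h < tau w.
Proof.
move=> h0 b; have h0' := ltW h0; have k0 : 0 <= k%:R * h by rewrite mulr_ge0.
rewrite ltNge; apply/negP => tk.
have := local_time_le X_vrjp w a exit_ge0 tk; rewrite local_time_exit.
have e : k.+1%:R * h = k%:R * h + h by rewrite -natr1 mulrDl mul1r.
have kk : k%:R * h <= k.+1%:R * h by rewrite e lerDl.
have := local_time_lip X_vrjp w a k0 kk; move: b; rewrite /below; lra.
Qed.

Lemma stop_exit h m : 0 < h -> stop h m w = 0 \/ stop h m w < tau w.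
Proof.
move=> h0; rewrite /stop; case E : (\sum_(k < m) below h k w)%N => [|n]; first by left; rewrite mul0r.
right; apply: below_exit => //.
have nm : (n < m)%N by rewrite -E (sum_bool_le (fun k => below h k w)).
by rewrite (decreasing_index (fun k => @belowS h k w (ltW h0)) nm) E.
Qed.

Lemma stop_le_exit h m : 0 < h -> stop h m w <= tau w.
Proof. by move=> h0; case: (stop_exit m h0) => [->|/ltW]//; exact: exit_ge0. Qed.

Lemma stop_near h m : 0 < h -> tau w < m%:R * h -> gamma - 2 * h <= L (stop h m w) w a.
Proof.
move=> h0 tm; rewrite leNgt; apply/negP => b.
have sm := sum_bool_le (fun k => below h k w) m.
move: sm; rewrite leq_eqVlt => /orP[/eqP sm|sm].
  have := stop_le_exit m h0; rewrite /stop sm leNgt => /negP; exact.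
have := decreasing_index (fun k => @belowS h k w (ltW h0)) sm.
by rewrite ltnn; move: b; rewrite -/(below h _ w) => ->.
Qed.

(** The walk is constant on some interval before [tau]. Were it elsewhere than at [a], the local
    time at [a] would be constant there and would have reached [gamma] before [tau]. *)
Lemma state_before_exit : 0 < tau w ->
  exists2 e : R, 0 < e & forall r, 0 <= r -> tau w - e < r < tau w -> X r w = a.
Proof.
move=> tp; have [e e0 [i Xi]] := vrjp_left X_vrjp w tp.
exists e => // r r0 rt; rewrite Xi//.
have [//|ia] := eqVneq i a; exfalso.
pose s := Num.max 0 (tau w - e / 2).
have s0 : 0 <= s by rewrite le_max lexx.
have st : s < tau w by rewrite gt_max tp/= ltrBlDr ltrDl divr_gt0.
have se : tau w - e < s by rewrite lt_max; apply/orP; right; lra.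
have Ls := before_exit s0 st.
have : gamma <= L s w a.
  apply/ler_addgt0Pr => e1 e10.
  pose t := Num.max s (tau w - e1).
  have t1 : s <= t by rewrite le_max lexx.
  have t2 : t < tau w by rewrite gt_max st/= ltrBlDr ltrDl.
  have t3 : tau w - e1 <= t by rewrite le_max lexx orbT.
  have := local_time_idle X_vrjp (i := a) s0 t1.
  have idle : forall r, s < r <= t -> X r w != a.
    move=> q /andP[q1 q2]; rewrite Xi//; first by rewrite (le_trans s0)// ltW.
    by rewrite (lt_trans se q1) (le_lt_trans q2).
  move=> /(_ w idle) e2.
  have := local_time_lip X_vrjp w a (le_trans s0 t1) (ltW t2).
  rewrite local_time_exit; lra.
by rewrite leNgt Ls.
Qed.

Variables (h : nat -> R) (m : nat -> nat).
Hypothesis h_gt0 : forall n, 0 < h n.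
Hypothesis h_cvg0 : h n @[n --> \oo] --> (0 : R).
Hypothesis mh_large : forall n, n%:R <= (m n)%:R * h n.

Lemma stop_late (e : R) : 0 < e -> \forall n \near \oo, tau w - e < stop (h n) (m n) w.
Proof.
move=> e0; have [te|te] := ltP (tau w - e) 0.
  by apply: nearW => n; rewrite (lt_le_trans te)// stop_ge0// ltW.
have tt : tau w - e < tau w by rewrite ltrBlDr ltrDl.
have Lt := before_exit te tt.
have gL : 0 < (gamma - L (tau w - e) w a) / 2 by rewrite divr_gt0// subr_gt0.
near=> n; rewrite ltNge; apply/negP => s1.
have hn : h n < (gamma - L (tau w - e) w a) / 2 by near: n; exact: (cvgr_lt 0 h_cvg0).
have tn : tau w < (m n)%:R * h n.
  apply: lt_le_trans (mh_large n); near: n; exact: (nbhs_infty_gtr (tau w)).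
have := stop_near (h_gt0 n) tn.
have := local_time_le X_vrjp w a (stop_ge0 (m n) w (ltW (h_gt0 n))) s1; lra.
Unshelve. all: end_near. Qed.

Lemma cvg_stop_local_time i : L (stop (h n) (m n) w) w i @[n --> \oo] --> L (tau w) w i.
Proof.
apply/cvgrPdist_lt => e e0.
have := stop_late e0; apply: filterS => n sn.
have sle := stop_le_exit (m n) (h_gt0 n); have s0 := stop_ge0 (m n) w (ltW (h_gt0 n)).
have := local_time_le X_vrjp w i s0 sle; rewrite -subr_ge0 => l0.
have := local_time_lip X_vrjp w i s0 sle.
by rewrite ger0_norm//; lra.
Qed.

Hypothesis w_start : X 0 w = a.

Lemma stop_state : \forall n \near \oo, X (stop (h n) (m n) w) w = a.
Proof.
have [t0|tn0] := eqVneq (tau w) 0.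
  apply: nearW => n; case: (stop_exit (m n) (h_gt0 n)) => [->//|].
  by rewrite t0 ltNge stop_ge0// ltW.
have tp : 0 < tau w by rewrite lt_neqAle eq_sym tn0 exit_ge0.
have [e e0 Xe] := state_before_exit tp.
have := stop_late e0; apply: filterS => n sn.
have s0 := stop_ge0 (m n) w (ltW (h_gt0 n)).
apply: Xe => //; rewrite sn/=.
by case: (stop_exit (m n) (h_gt0 n)) => [->|].
Qed.

End Exit.

Section ExitExpectation.
Context {R : realType} {Lambda : finType} {d : measure_display} {T : measurableType d}.
Variables (P : probability T R) (X : R -> T -> Lambda).
Variables (beta : Lambda -> Lambda -> R) (a : Lambda).
Hypothesis beta_ge0 : forall i j, 0 <= beta i j.
Hypothesis beta_sym : forall i j, beta i j = beta j i.
Hypothesis beta_connected : forall i j, connect (fun k l => 0 < beta k l) i j.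
Hypothesis X_vrjp : vrjp beta a (fun=> 1) P X.
Variable gamma : R.
Hypothesis gamma_ge1 : 1 <= gamma.
Implicit Types (s t r h : R) (i j : Lambda) (w : T) (A : set T) (k m n : nat).

Local Notation L := (local_time (fun=> 1) X).
Local Notation tau := (hitting_time (fun=> 1) X a gamma).

Lemma measurable_below h k : 0 <= h -> history X (k%:R * h) [set w | below X a gamma h k w].
Proof.
move=> h0; have k0 : 0 <= k%:R * h by rewrite mulr_ge0.
rewrite (_ : [set w | _] = (fun w => L (k%:R * h) w a) @^-1` `]-oo, gamma - 2 * h[).
  by apply: adaptedP => //; apply: (adapted_local_time X_vrjp); rewrite k0 lexx.
by apply/seteqP; split=> w /=; rewrite in_itv.
Qed.

Lemma indic_below h k w : \1_[set w | below X a gamma h k w] w = (below X a gamma h k w)%:R :> R.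
Proof. by rewrite indicE; congr ((nat_of_bool _)%:R); apply/idP/idP => [|h']; rewrite ?inE. Qed.

Lemma stopped_sum_time (u : R -> T -> R) h m w : 0 <= h ->
  \sum_(k < m) \1_[set w | below X a gamma h k w] w * (u (k.+1%:R * h) w - u (k%:R * h) w) =
  u (stop X a gamma h m w) w - u 0 w.
Proof.
move=> h0; under eq_bigr do rewrite indic_below.
rewrite (stopped_sum m (fun k => u (k%:R * h) w) (fun k => @belowS _ _ _ _ _ _ _ _ X_vrjp gamma h k w h0)).
by rewrite mul0r.
Qed.

Lemma measurable_stopped (u : R -> T -> R) h m : 0 <= h ->
  (forall t, 0 <= t -> measurable_fun setT (u t)) ->
  measurable_fun setT (fun w => u (stop X a gamma h m w) w).
Proof.
move=> h0 mu.
rewrite (_ : (fun w => _) = fun w => u 0 w + \sum_(k < m) \1_[set w | below X a gamma h k w] w * (u (k.+1%:R * h) w - u (k%:R * h) w)).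
  apply: measurable_funD; first exact: mu.
  apply: measurable_sum => k; apply: measurable_funM.
    by apply: measurable_indic; apply: (history_measurable X_vrjp (t := k%:R * h)); exact: measurable_below.
  by apply: measurable_funB; apply: mu; rewrite mulr_ge0.
by apply: funext => w; rewrite stopped_sum_time// addrC subrK.
Qed.

Definition exit_local_time w i : R := L (tau w) w i.

(** The infimum of the empty set is 0, and at time 0 all local times are 1. *)
Lemma no_exit w : ~ (exists n : nat, gamma <= L n%:R w a) -> exit_local_time w = fun=> 1.
Proof.
move=> nw; apply: funext => i; rewrite /exit_local_time /hitting_time.
rewrite (_ : [set t | _] = set0) ?inf0 ?(local_time0 X)//.
apply/seteqP; split=> // t [t0 gt]; apply: nw; exists (Num.trunc t).+1.
apply: (le_trans gt); apply: (local_time_le X_vrjp) => //.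
by apply: ltW; exact: truncnS_gt.
Qed.

Lemma measurable_exit_local_time i : measurable_fun setT (fun w => exit_local_time w i).
Proof.
pose U := \bigcup_n [set w | gamma <= L n%:R w a].
have mU : measurable U.
  apply: bigcupT_measurable => n.
  rewrite (_ : [set w | _] = (fun w => L n%:R w a) @^-1` `[gamma, +oo[).
    have mL : measurable_fun setT (fun w => L n%:R w a) by exact: (measurable_local_time X_vrjp).
    by rewrite -[X in measurable X]setTI; exact: mL.
  by apply/seteqP; split=> w /=; rewrite in_itv/= andbT.
(* With step [1 / (n + 1)] and [n (n + 1)] steps, the grid reaches up to time [n]. *)
pose h (n : nat) : R := n.+1%:R^-1.
have h0 n : 0 < h n by rewrite invr_gt0.
pose m (n : nat) : nat := (n * n.+1)%N.
apply: (@measurable_fun_cvg _ _ _ _ (fun n w => \1_U w * L (stop X a gamma (h n) (m n) w) w i + \1_(~` U) w)) => [n|w _].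
  apply: measurable_funD; last exact: measurable_indic (measurableC mU).
  apply: measurable_funM; first exact: measurable_indic.
  apply: (measurable_stopped (u := fun t w => L t w i)); first exact: ltW.
  by move=> t t0; exact: (measurable_local_time X_vrjp).
have [wU|wU] := pselect (U w).
  rewrite (_ : (fun n => _) = fun n => L (stop X a gamma (h n) (m n) w) w i).
    apply: (cvg_stop_local_time X_vrjp gamma_ge1) => //.
    - by case: wU => n _ wn; exists n.
    - exact: cvg_harmonic.
    - by move=> n; rewrite /m /h natrM mulfK.
  by apply: funext => n; rewrite !indicE in_setC !mem_set// mul1r addr0.
rewrite (_ : (fun n => _) = fun=> 1).
  rewrite no_exit; first exact: cvg_cst.
  by move=> [n wn]; apply: wU; exists n.
by apply: funext => n; rewrite !indicE in_setC memNset// mul0r add0r.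
Qed.

Variables (D : R -> R) (C : R) (f : Lambda -> (Lambda -> R) -> R).
Hypothesis f_lyap : forall K, 0 <= K -> lyapunov beta (1 + K) (D K) f.
Hypothesis f_lyapN : forall K, 0 <= K -> lyapunov beta (1 + K) (D K) (fun i l => - f i l).
Hypothesis f_meas : forall e (S : measurableType e) (l : S -> Lambda -> R),
  (forall j, measurable_fun setT (fun u => l u j)) -> forall i, measurable_fun setT (fun u => f i (l u)).
Hypothesis f_cont : continuous (f a : {ptws Lambda -> R} -> R).
Hypothesis f_bound : forall i l, (forall j, 1 <= l j) -> l a <= gamma -> `|f i l| <= C.

(** [stopped_step] for [f] and for [- f], with the events that the stopping criterion has not yet
    been met; [stopped_sum] collapses the sum to the value at the stopped time. *)
Lemma exit_mesh n : exists hm : R * nat, [/\ 0 < hm.1, hm.1 <= n.+1%:R^-1, n%:R <= hm.2%:R * hm.1 &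
  `|\int[P]_w value X f (stop X a gamma hm.1 hm.2 w) w - f a (fun=> 1)| <= n.+1%:R^-1].
Proof.
pose K : R := n.+1%:R; have K0 : 0 < K by []. have K0' := ltW K0.
(* Over the horizon [K] a rate of error [1 / K ^ 2] accumulates to [1 / K]. *)
have e0 : 0 < (K ^+ 2)^-1 by rewrite invr_gt0 exprn_gt0.
have fN_meas e (S : measurableType e) (l : S -> Lambda -> R) :
  (forall j, measurable_fun setT (fun u => l u j)) -> forall i, measurable_fun setT (fun u => - f i (l u)).
  by move=> ml i; apply: measurable_funN; exact: f_meas.
have [d1 d10 H1] := stopped_step beta_ge0 X_vrjp (f_lyap K0') f_meas e0.
have [d2 d20 H2] := stopped_step beta_ge0 X_vrjp (f_lyapN K0') fN_meas e0.
pose del := Num.min (Num.min d1 d2) K^-1.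
have del0 : 0 < del by rewrite !lt_min d10 d20 invr_gt0.
pose m := (Num.trunc (K / del)).+1.
have mp : (0 : R) < m%:R by [].
pose h := K / m%:R.
have h0 : 0 < h by rewrite divr_gt0.
have mh : m%:R * h = K by rewrite /h mulrC divfK ?gt_eqF.
have hdel : h < del by rewrite /h ltr_pdivrMr// mulrC -ltr_pdivrMr// truncnS_gt.
move: (hdel); rewrite !lt_min => /andP[/andP[hd1 hd2] hK].
have hA k : (k < m)%N -> history X (k%:R * h) [set w | below X a gamma h k w].
  by move=> _; exact: measurable_below (ltW h0).
have := H1 h m; rewrite h0 hd1 mh => /(_ isT (lexx _) _ hA) I1.
have := H2 h m; rewrite h0 hd2 mh => /(_ isT (lexx _) _ hA) I2.
have eK : (K ^+ 2)^-1 * K = K^-1 by rewrite expr2 invfM mulfVK ?gt_eqF.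
rewrite eK in I1 I2.
have mv t : 0 <= t -> measurable_fun setT (value X f t) by exact: (measurable_value X_vrjp f_meas).
have ms : measurable_fun setT (fun w => value X f (stop X a gamma h m w) w).
  by apply: measurable_stopped => //; exact: ltW.
have bs w : `|value X f (stop X a gamma h m w) w| <= C.
  apply: f_bound; last exact: (stop_bound X_vrjp).
  by move=> k; apply: (local_time_ge1 X_vrjp); apply: stop_ge0; exact: ltW.
have iv := integrable_bounded P ms bs.
have i0 : P.-integrable setT (EFin \o value X f 0).
  apply: (integrable_bounded P (mv 0 (lexx 0)) (C := D K)) => w.
  by apply: (value_bound X_vrjp (f_lyap K0')); rewrite lexx.
have E0 : \int[P]_w value X f 0 w = f a (fun=> 1).
  apply: (integral_start X_vrjp); first exact: mv.
  by move=> w Xa; rewrite /value Xa; congr (f a _); apply: funext => i; rewrite (local_time0 X).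
exists (h, m); split => //=.
- by rewrite ltW.
- by rewrite mh ler_nat.
have eB : \int[P]_w (value X f (stop X a gamma h m w) w - value X f 0 w) =
    \int[P]_w value X f (stop X a gamma h m w) w - f a (fun=> 1).
  by rewrite (RintegralB measurableT iv i0) E0.
rewrite ler_norml -/K; apply/andP; split.
  move: I2; rewrite (_ : (fun w => _) = fun w => - (value X f (stop X a gamma h m w) w - value X f 0 w)).
    have iB := integrableB measurableT iv i0.
    rewrite (_ : \int[P]_w _ = - (\int[P]_w (value X f (stop X a gamma h m w) w - value X f 0 w))).
      by rewrite eB => I3; rewrite lerNl.
    rewrite -[RHS]mulN1r -RintegralZl//; apply: eq_Rintegral => w _; by rewrite mulN1r.
  apply: funext => w; have := @stopped_sum_time (value X (fun i l => - f i l)) h m w (ltW h0).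
  by rewrite /value => ->; rewrite opprB opprK addrC.
move: I1; rewrite (_ : (fun w => _) = fun w => value X f (stop X a gamma h m w) w - value X f 0 w).
  by rewrite eB.
by apply: funext => w; rewrite (stopped_sum_time _ _ _ (ltW h0)).
Qed.

(** The stopped times increase to no more than [tau] and converge to it, at almost every path, with
    the walk eventually at [a]; [f_bound] allows dominated convergence, because the local time at
    [a] never exceeds [gamma] when stopped. *)
Lemma exit_identity : \int[P]_w f a (exit_local_time w) = f a (fun=> 1).
Proof.
have [hm Hhm] := choice exit_mesh.
have h0 n : 0 < (hm n).1 by have [] := Hhm n.
have hc : (hm n).1 @[n --> \oo] --> (0 : R).
  apply: (squeeze_cvgr (f := fun=> 0) (h := @harmonic R)).
  - by near=> n; have [h1 h2 _ _] := Hhm n; rewrite (ltW h1).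
  - exact: cvg_cst.
  - exact: cvg_harmonic.
have mh n : n%:R <= (hm n).2%:R * (hm n).1 by have [] := Hhm n.
have c1 : \int[P]_w value X f (stop X a gamma (hm n).1 (hm n).2 w) w @[n --> \oo] --> f a (fun=> 1).
  apply/cvgrPdist_lt => e e0; near=> n; rewrite distrC.
  have [_ _ _ hn] := Hhm n; apply: (le_lt_trans hn).
  near: n; exact: (cvgr_lt 0 (@cvg_harmonic R)).
have mv t : 0 <= t -> measurable_fun setT (value X f t) by exact: (measurable_value X_vrjp f_meas).
have c2 : \int[P]_w value X f (stop X a gamma (hm n).1 (hm n).2 w) w @[n --> \oo] --> \int[P]_w f a (exit_local_time w).
  apply: (@cvg_Rintegral_bounded _ _ _ P setT (fun n w => value X f (stop X a gamma (hm n).1 (hm n).2 w) w) _ C) => //.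
  - exact: finite_measure_integrable_cst.
  - by move=> n; apply: measurable_stopped => //; exact: ltW.
  - by apply: f_meas => k; exact: measurable_exit_local_time.
  - have := ae_unbounded beta_ge0 beta_sym beta_connected X_vrjp.
    apply: filterS2 (ae_start X_vrjp) => w Xa wU _.
    have wx := wU gamma.
    apply: (@cvg_trans _ (f a (L (stop X a gamma (hm n).1 (hm n).2 w) w) @[n --> \oo])).
      apply: near_eq_cvg.
      have := stop_state X_vrjp gamma_ge1 wx h0 hc mh Xa.
      by apply: filterS => n Xn; rewrite /value Xn.
    apply: (@continuous_cvg _ _ _ _ _ (fun n => L (stop X a gamma (hm n).1 (hm n).2 w) w : {ptws Lambda -> R}) (f a) (exit_local_time w)).
      exact: f_cont.
    apply: cvg_ptws => i; exact: (cvg_stop_local_time X_vrjp gamma_ge1).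
  - move=> n w _; apply: f_bound; last exact: (stop_bound X_vrjp).
    by move=> k; apply: (local_time_ge1 X_vrjp); apply: stop_ge0; exact: ltW.
exact: (cvg_unique (@Rhausdorff R) c2 c1).
Unshelve. all: end_near. Qed.

End ExitExpectation.

(** * Lipschitz functions on boxes *)

Section LipschitzBox.
Variables (R : realType) (I : finType) (M : R).
Implicit Types (F G : (I -> R) -> R) (l : I -> R) (i : I).

Definition box_lipschitz F := exists D : R, [/\ 0 <= D, forall l, box M l -> `|F l| <= D &
  forall l l', box M l -> box M l' -> `|F l - F l'| <= D * \sum_k `|l k - l' k|].

Lemma box_lipschitz_cst (c : R) : box_lipschitz (fun=> c).
Proof.
exists `|c|; split=> // l l' _ _; rewrite subrr normr0 mulr_ge0//.
by apply: sumr_ge0.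
Qed.

Lemma box_lipschitz_coord i : box_lipschitz (fun l => l i).
Proof.
exists (1 + `|M|); split=> [|l bl|l l' _ _]; first by rewrite addr_ge0.
  have /andP[l1 l2] := bl i; rewrite ger0_norm ?(le_trans ler01)//.
  by rewrite (le_trans l2)// (le_trans (ler_norm M))// lerDr.
rewrite (le_trans _ (ler_peMl _ _)) ?lerDl ?sumr_ge0//.
by rewrite (bigD1 i)//= lerDl sumr_ge0.
Qed.

Lemma box_lipschitzD F G : box_lipschitz F -> box_lipschitz G -> box_lipschitz (fun l => F l + G l).
Proof.
move=> [D [D0 FD FL]] [D' [D0' GD GL]]; exists (D + D'); split=> [|l bl|l l' bl bl'].
- exact: addr_ge0.
- by rewrite (le_trans (ler_normD _ _))// lerD ?FD ?GD.
rewrite opprD addrACA (le_trans (ler_normD _ _))// mulrDl lerD ?FL ?GL//.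
Qed.

Lemma box_lipschitzM F G : box_lipschitz F -> box_lipschitz G -> box_lipschitz (fun l => F l * G l).
Proof.
move=> [D [D0 FD FL]] [D' [D0' GD GL]]; exists (D * D' + D * D'); split=> [|l bl|l l' bl bl'].
- by rewrite addr_ge0// mulr_ge0.
- by rewrite normrM (le_trans (ler_pM _ _ (FD _ bl) (GD _ bl)))// lerDl mulr_ge0.
have -> : F l * G l - F l' * G l' = (F l - F l') * G l + F l' * (G l - G l') by ring.
rewrite (le_trans (ler_normD _ _))// !normrM mulrDl lerD//.
  by rewrite mulrAC ler_pM// ?FL ?GD.
by rewrite -mulrA ler_pM// ?FD ?GL.
Qed.

Lemma box_lipschitz_exp F : box_lipschitz F -> box_lipschitz (fun l => expR (F l)).
Proof.
move=> [D [D0 FD FL]]; exists (expR D * (1 + D)); split=> [|l bl|l l' bl bl'].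
- by rewrite mulr_ge0 ?expR_ge0// addr_ge0.
- rewrite ger0_norm ?expR_ge0// -[leLHS]mulr1 ler_pM ?expR_ge0// ?lerDl//.
  by rewrite ler_expR (le_trans (ler_norm _))// FD.
suff h x y : x <= y -> `|x| <= D -> `|y| <= D -> `|expR x - expR y| <= expR D * `|x - y|.
  have e : `|expR (F l) - expR (F l')| <= expR D * `|F l - F l'|.
    have [xy|/ltW xy] := leP (F l) (F l'); first by apply: h; rewrite ?FD.
    by rewrite distrC [`|F l - _|]distrC; apply: h; rewrite ?FD.
  rewrite (le_trans e)// -mulrA ler_wpM2l ?expR_ge0// (le_trans (FL _ _ bl bl'))//.
  by rewrite ler_wpM2r ?lerDr// sumr_ge0.
move=> xy xD yD; have yx : 0 <= y - x by rewrite subr_ge0.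
rewrite [`|x - y|]distrC (ger0_norm yx) distrC ger0_norm ?subr_ge0 ?ler_expR//.
have -> : expR y - expR x = expR y * (1 - expR (- (y - x))).
  by rewrite mulrBr mulr1 -expRD; congr (_ - expR _); ring.
have h1 := expR_ge1Dx (- (y - x)).
have h2 : expR y <= expR D by rewrite ler_expR (le_trans (ler_norm _)).
apply: (@le_trans _ _ (expR y * (y - x))); last by rewrite ler_wpM2r.
by rewrite ler_wpM2l ?expR_ge0//; lra.
Qed.

Lemma box_lipschitz_sum (J : Type) (r : seq J) (Q : pred J) (F : J -> (I -> R) -> R) :
  (forall j, Q j -> box_lipschitz (F j)) -> box_lipschitz (fun l => \sum_(j <- r | Q j) F j l).
Proof.
move=> h; elim: r => [|j r IH].
  rewrite (_ : (fun l => _) = fun=> 0); first exact: box_lipschitz_cst.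
  by apply: funext => l; rewrite big_nil.
rewrite (_ : (fun l => _) = fun l => (if Q j then F j l else 0) + \sum_(j <- r | Q j) F j l).
  apply: box_lipschitzD => //; case E : (Q j); [exact: h|exact: box_lipschitz_cst].
by apply: funext => l; rewrite big_cons; case: ifP => // _; rewrite add0r.
Qed.

Lemma box_lipschitz_prod (J : Type) (r : seq J) (Q : pred J) (F : J -> (I -> R) -> R) :
  (forall j, Q j -> box_lipschitz (F j)) -> box_lipschitz (fun l => \prod_(j <- r | Q j) F j l).
Proof.
move=> h; elim: r => [|j r IH].
  rewrite (_ : (fun l => _) = fun=> 1); first exact: box_lipschitz_cst.
  by apply: funext => l; rewrite big_nil.
rewrite (_ : (fun l => _) = fun l => (if Q j then F j l else 1) * \prod_(j <- r | Q j) F j l).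
  apply: box_lipschitzM => //; case E : (Q j); [exact: h|exact: box_lipschitz_cst].
by apply: funext => l; rewrite big_cons; case: ifP => // _; rewrite mul1r.
Qed.

End LipschitzBox.

(** * Functions annihilated by the generator *)

Section Harmonic.
Variables (R : realType) (Lambda : finType) (beta : Lambda -> Lambda -> R) (a : Lambda).
Hypothesis beta_ge0 : forall i j, 0 <= beta i j.
Variables (H : Lambda -> Lambda -> R) (psi : Lambda -> R).
Hypothesis H_adm : admissible a beta H.
Hypothesis H_psi : forall i, \sum_j H i j * psi j = 0.
Implicit Types (i j k : Lambda) (l : Lambda -> R) (h M : R).

Definition harmonic_fun i l : R := psi i * (\prod_(j | j != i) l j) * expR (quad H l).

Lemma prod_shift i l h : \prod_(j | j != i) shift l i h j = \prod_(j | j != i) l j.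
Proof. by apply: eq_bigr => j /negPf ji; rewrite /shift ji mul0r addr0. Qed.

Lemma sum_delta i (F : Lambda -> R) : \sum_k (k == i)%:R * F k = F i.
Proof.
by rewrite (bigD1 i)//= eqxx mul1r big1 ?addr0// => k /negPf ->; rewrite mul0r.
Qed.

Lemma quad_shift i l h :
  quad H (shift l i h) = quad H l - h * (\sum_j H i j * l j) - 2^-1 * H i i * h ^+ 2.
Proof.
have [Hs _ _] := H_adm.
have e : \sum_k \sum_j H k j * (shift l i h k * shift l i h j) =
  \sum_k \sum_j H k j * (l k * l j) + h * (\sum_j H i j * l j) + h * (\sum_j H i j * l j) + H i i * h ^+ 2.
  transitivity (\sum_k (\sum_j H k j * (l k * l j) + (k == i)%:R * (h * \sum_j H k j * l j)
     + h * l k * \sum_j (j == i)%:R * H k j + (k == i)%:R * (h ^+ 2 * \sum_j (j == i)%:R * H k j))).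
    apply: eq_bigr => k _; rewrite !mulr_sumr -!big_split/=; apply: eq_bigr => j _; rewrite /shift; ring.
  rewrite !big_split/= !sum_delta; congr (_ + _ + _ + _); last by rewrite mulrC.
  by rewrite mulr_sumr; apply: eq_bigr => k _; rewrite sum_delta Hs; ring.
by rewrite /quad e; field.
Qed.

(** [l j * harmonic_fun j l] is [psi j] times a quantity that does not depend on [j], so the sum
    over jumps is linear in [psi] and is evaluated by [H psi = 0]. The result is minus the
    derivative of [harmonic_fun i] in [l i], which sees only the quadratic exponent. *)
Lemma harmonic_drift i l : drift beta harmonic_fun i l = (\sum_j H i j * l j) * harmonic_fun i l.
Proof.
have [_ _ Hb] := H_adm.
pose S := (\prod_j l j) * expR (quad H l).
have fE j : l j * harmonic_fun j l = psi j * S.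
  by rewrite /harmonic_fun /S [in RHS](bigD1 j)//=; ring.
rewrite /drift.
have e1 j : j != i -> beta i j * l j * (harmonic_fun j l - harmonic_fun i l) =
    H i j * l j * harmonic_fun i l - H i j * psi j * S.
  move=> ji; have bH : beta i j = - H i j by rewrite Hb 1?eq_sym// opprK.
  transitivity (H i j * l j * harmonic_fun i l - H i j * (l j * harmonic_fun j l)); first by rewrite bH; ring.
  by rewrite fE mulrA.
rewrite (eq_bigr _ e1) big_split/= sumrN -!mulr_suml.
have := H_psi i; rewrite (bigD1 i)//= => /eqP; rewrite addrC addr_eq0 => /eqP ->.
rewrite [in RHS](bigD1 i)//= mulrDl addrC; congr (_ + _).
by rewrite mulNr opprK -!mulrA fE.
Qed.

Lemma expR_taylor (u : R) : `|expR u - 1 - u| <= u ^+ 2 * expR `|u|.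
Proof.
have h1 := expR_ge1Dx u; have h2 := expR_ge1Dx (- u).
have p0 := expR_ge0 u; have p1 := expR_ge0 (- u).
have uu : expR u * expR (- u) = 1 by rewrite -expRD subrr expR0.
have e1 : 1 - u <= expR (- u) by [].
have e2 : expR u - 1 <= u * expR u.
  by have := ler_wpM2l p0 e1; rewrite uu; lra.
rewrite ger0_norm; last by lra.
have eu : expR u <= expR `|u| by rewrite ler_expR ler_norm.
have e3 : 1 <= expR `|u| by rewrite -expR0 ler_expR.
have [u0|u0] := leP 0 u.
  have := ler_wpM2l u0 e2; have := ler_wpM2l (sqr_ge0 u) eu; lra.
have u0' : 0 <= - u by lra.
have := ler_wpM2l u0' h1; have := ler_wpM2l (sqr_ge0 u) e3; nra.
Qed.

Lemma harmonic_box_lipschitz M i : box_lipschitz M (harmonic_fun i).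
Proof.
apply: box_lipschitzM.
  apply: box_lipschitzM; first exact: box_lipschitz_cst.
  by apply: box_lipschitz_prod => j _; exact: box_lipschitz_coord.
apply: box_lipschitz_exp.
rewrite (_ : quad H = fun l => - 2^-1 * \sum_i \sum_j H i j * (l i * l j)); last first.
  by apply: funext => l; rewrite mulNr.
apply: box_lipschitzM; first exact: box_lipschitz_cst.
apply: box_lipschitz_sum => k _; apply: box_lipschitz_sum => j _.
apply: box_lipschitzM; first exact: box_lipschitz_cst.
by apply: box_lipschitzM; exact: box_lipschitz_coord.
Qed.

(** Along the shift only the exponent changes, and its linear part cancels against the drift; the
    remainder is of second order by [expR_taylor]. *)
Lemma harmonic_step M : exists2 D : R, 0 <= D & forall i l h, 0 <= h -> box M l -> box M (shift l i h) ->
  `|harmonic_fun i (shift l i h) - harmonic_fun i l + h * drift beta harmonic_fun i l| <= D * h ^+ 2.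
Proof.
have /choice[D HD] : forall i, exists D : R, 0 <= D /\ forall l, box M l -> `|harmonic_fun i l| <= D.
  by move=> i; have [D [D0 DB _]] := harmonic_box_lipschitz M i; exists D.
pose N : R := \sum_i \sum_j `|H i j|.
have N0 : 0 <= N by apply: sumr_ge0 => i _; apply: sumr_ge0.
pose B : R := 2 * N * `|M|; have B0 : 0 <= B by rewrite !mulr_ge0.
pose DD : R := \sum_i D i; have DD0 : 0 <= DD by apply: sumr_ge0 => i _; have [] := HD i.
exists (DD * (B ^+ 2 * expR (B * `|M|) + N)).
  by rewrite mulr_ge0// addr_ge0// mulr_ge0 ?sqr_ge0 ?expR_ge0.
move=> i l h h0 bl bs.
have DiDD : D i <= DD.
  by rewrite /DD (bigD1 i)//= lerDl; apply: sumr_ge0 => j _; have [] := HD j.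
have Nrow : \sum_j `|H i j| <= N.
  by rewrite /N [leRHS](bigD1 i)//= lerDl; apply: sumr_ge0 => j _; apply: sumr_ge0.
have Nii : `|H i i| <= N.
  by rewrite (le_trans _ Nrow)// (bigD1 i)//= lerDl; apply: sumr_ge0.
have hM : h <= `|M|.
  have /andP[_ sM] := bs i; have /andP[l1 _] := bl i; move: sM; rewrite /shift eqxx mul1r => sM.
  by have := ler_norm M; lra.
set s := \sum_j H i j * l j.
have sB : `|s| <= N * `|M|.
  rewrite /s (le_trans (ler_norm_sum _ _ _))// (le_trans _ (ler_wpM2r (normr_ge0 M) Nrow))//.
  rewrite mulr_suml; apply: ler_sum => j _; rewrite normrM ler_wpM2l//.
  have /andP[l1 l2] := bl j; rewrite ger0_norm ?(le_trans ler01)//.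
  exact: le_trans l2 (ler_norm M).
pose u := - (h * s) - 2^-1 * H i i * h ^+ 2.
have uB : `|u| <= B * h.
  have eh : `|2^-1 * H i i * h ^+ 2| = 2^-1 * (`|H i i| * h ^+ 2).
    rewrite normrM (ger0_norm (sqr_ge0 h)) normrM [`|2^-1|]ger0_norm ?invr_ge0//; ring.
  rewrite /u (le_trans (ler_normB _ _))// normrN eh normrM (ger0_norm h0).
  have a1 : h * `|s| <= h * (N * `|M|) by rewrite ler_wpM2l.
  have a2 : `|H i i| * h ^+ 2 <= N * (`|M| * h).
    by rewrite ler_pM ?sqr_ge0// expr2 ler_wpM2r.
  have a3 : 0 <= N * (`|M| * h) by rewrite !mulr_ge0.
  by rewrite /B; lra.
have fs : harmonic_fun i (shift l i h) = harmonic_fun i l * expR u.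
  rewrite /harmonic_fun prod_shift quad_shift -[RHS]mulrA -expRD; congr (_ * expR _).
  by rewrite /u addrA.
rewrite harmonic_drift fs -/s.
have -> : harmonic_fun i l * expR u - harmonic_fun i l + h * (s * harmonic_fun i l) =
  harmonic_fun i l * ((expR u - 1 - u) - 2^-1 * H i i * h ^+ 2) by rewrite /u; ring.
have fD := le_trans ((HD i).2 l bl) DiDD.
rewrite normrM -[leRHS]mulrA; apply: ler_pM => //.
rewrite (le_trans (ler_normB _ _))// mulrDl lerD//.
  have u2 : u ^+ 2 <= B ^+ 2 * h ^+ 2.
    rewrite -exprMn -(@real_normK _ u) ?num_real//.
    by rewrite lerXn2r ?nnegrE// mulr_ge0.
  have eu : expR `|u| <= expR (B * `|M|) by rewrite ler_expR (le_trans uB)// ler_wpM2l.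
  have -> : B ^+ 2 * expR (B * `|M|) * h ^+ 2 = B ^+ 2 * h ^+ 2 * expR (B * `|M|) by ring.
  exact: le_trans (expR_taylor u) (ler_pM (sqr_ge0 u) (expR_ge0 _) u2 eu).
rewrite normrM (ger0_norm (sqr_ge0 h)) ler_wpM2r ?sqr_ge0// normrM.
rewrite ger0_norm ?invr_ge0//; have := normr_ge0 (H i i); lra.
Qed.

Lemma harmonic_lyapunov M : exists D : R,
  lyapunov beta M D harmonic_fun /\ lyapunov beta M D (fun i l => - harmonic_fun i l).
Proof.
have /choice[D HD] : forall i, exists D : R, [/\ 0 <= D, forall l, box M l -> `|harmonic_fun i l| <= D &
  forall l l', box M l -> box M l' -> `|harmonic_fun i l - harmonic_fun i l'| <= D * \sum_k `|l k - l' k|].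
  by move=> i; exact: harmonic_box_lipschitz.
have [D' D'0 HD'] := harmonic_step M.
pose DD : R := \sum_i D i + D'.
have DD0 : 0 <= \sum_i D i by apply: sumr_ge0 => i _; have [] := HD i.
have DiDD i : D i <= DD.
  by rewrite /DD (bigD1 i)//= -addrA lerDl addr_ge0//; apply: sumr_ge0 => j _; have [] := HD j.
have D'D : D' <= DD by rewrite lerDr.
have bd i l : box M l -> `|harmonic_fun i l| <= DD.
  by move=> bl; have [_ h _] := HD i; exact: le_trans (h l bl) (DiDD i).
have lip i l l' : box M l -> box M l' -> `|harmonic_fun i l - harmonic_fun i l'| <= DD * \sum_k `|l k - l' k|.
  move=> bl bl'; have [_ _ h] := HD i; rewrite (le_trans (h l l' bl bl'))// ler_wpM2r// sumr_ge0//.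
have st i l h : 0 <= h -> box M l -> box M (shift l i h) ->
  `|harmonic_fun i (shift l i h) - harmonic_fun i l + h * drift beta harmonic_fun i l| <= DD * h ^+ 2.
  by move=> h0 bl bs; rewrite (le_trans (HD' i l h h0 bl bs))// ler_wpM2r// sqr_ge0.
exists DD; split; split=> //.
- by move=> i l h h0 bl bs; have := st i l h h0 bl bs; rewrite ler_norml => /andP[_]; lra.
- by move=> i l bl; rewrite normrN; exact: bd.
- by move=> i l l' bl bl'; rewrite -opprD normrN; exact: lip.
- move=> i l h h0 bl bs; have := st i l h h0 bl bs; rewrite ler_norml => /andP[+ _].
  have -> : drift beta (fun i l => - harmonic_fun i l) i l = - drift beta harmonic_fun i l.
    by rewrite /drift -sumrN; apply: eq_bigr => j _; ring.
  by lra.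
Qed.

Lemma harmonic_Cn n i : Cn n (harmonic_fun i).
Proof.
apply: CnM; last by apply: Cn_exp; exact: Cn_quad.
by apply: CnZ; apply: Cn_prod => j _; exact: Cn_coord.
Qed.

(** By [quad_lower] every site other than [a] contributes at most [l e^(- l^2 / 2) <= 1], and at [a]
    the local time is bounded by [gamma]. The factor missing at [i] may be restored, as it is at
    least 1. *)
Lemma harmonic_bound (gamma : R) : 1 <= gamma -> exists C : R, forall i l, (forall j, 1 <= l j) -> l a <= gamma ->
  `|harmonic_fun i l| <= C.
Proof.
move=> g1; have [Hs Hd _] := H_adm.
pose N : R := \sum_i `|psi i|.
exists (N * (gamma * expR (2^-1 * deficit a H * gamma ^+ 2))) => i l l1 la.
have l0 j : 0 <= l j by rewrite (le_trans ler01).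
have P0 (Q : pred Lambda) : 0 <= \prod_(j | Q j) l j by apply: prodr_ge0.
rewrite /harmonic_fun normrM normrM (ger0_norm (expR_ge0 _)) (ger0_norm (P0 _)) -mulrA.
apply: ler_pM => //; first by rewrite mulr_ge0// expR_ge0.
  by rewrite /N (bigD1 i)//= lerDl sumr_ge0.
have p1 : \prod_(j | j != i) l j <= \prod_j l j.
  by rewrite [leRHS](bigD1 i)//= ler_peMl.
have g0 : 0 <= gamma by rewrite (le_trans ler01).
have ql := quad_lower Hs Hd l.
have dl : deficit a H * l a ^+ 2 <= deficit a H * gamma ^+ 2.
  by rewrite ler_wpM2l ?deficit_ge0// lerXn2r ?nnegrE.
have q1 : quad H l <= - (2^-1 * \sum_(j in ~: [set a]%SET) l j ^+ 2) + 2^-1 * deficit a H * gamma ^+ 2.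
  by rewrite /quad; lra.
apply: (@le_trans _ _ ((\prod_j l j) * expR (- (2^-1 * \sum_(j in ~: [set a]%SET) l j ^+ 2) + 2^-1 * deficit a H * gamma ^+ 2))).
  by rewrite ler_pM ?expR_ge0// ler_expR.
rewrite expRD mulrA ler_wpM2r ?expR_ge0//.
rewrite (bigD1 a)//= -mulrA -[leRHS]mulr1 ler_pM ?mulr_ge0 ?expR_ge0//.
rewrite mulr_sumr -sumrN expR_sum.
rewrite [X in _ * X](eq_bigl (fun j => j != a)); last by move=> j; rewrite !inE.
rewrite -big_split/=; apply: prodr_ile1 => j _.
rewrite mulr_ge0 ?expR_ge0//=.
have := ler_wpM2r (expR_ge0 (- (2^-1 * l j ^+ 2))) (_ : l j <= expR (2^-1 * l j ^+ 2)).
rewrite -expRD subrr expR0; apply.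
apply: le_trans (expR_ge1Dx _); have := sqr_ge0 (l j - 1); rewrite sqrrB; lra.
Qed.

End Harmonic.

(** * Expectations of the test functions at the hitting time *)

Section ExitMoments.
Context {R : realType} {Lambda : finType} {d : measure_display} {T : measurableType d}.
Variables (P : probability T R) (X : R -> T -> Lambda).
Variables (beta : Lambda -> Lambda -> R) (a : Lambda).
Hypothesis beta_ge0 : forall i j, 0 <= beta i j.
Hypothesis beta_sym : forall i j, beta i j = beta j i.
Hypothesis beta_connected : forall i j, connect (fun k l => 0 < beta k l) i j.
Hypothesis X_vrjp : vrjp beta a (fun=> 1) P X.
Variable s : R.

Local Notation Lexit := (exit_local_time X a (cosh s)).

Lemma cosh_ge1 (t : R) : 1 <= cosh t.
Proof.
rewrite /cosh ler_pdivlMr// mul1r expRN.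
have h := expR_gt0 t; have -> : expR t + (expR t)^-1 = 2 + (expR t - 1) ^+ 2 / expR t by field; rewrite gt_eqF.
by rewrite lerDl divr_ge0 ?sqr_ge0// ltW.
Qed.

Lemma exit_bounds w : Lexit w a <= cosh s /\ forall i, 1 <= Lexit w i.
Proof.
have [wx|wx] := pselect (exists n : nat, cosh s <= local_time (fun=> 1) X n%:R w a).
  split; first by rewrite /exit_local_time (local_time_exit X_vrjp (cosh_ge1 s) wx).
  by move=> i; apply: (local_time_ge1 X_vrjp); exact: exit_ge0 wx.
by rewrite (no_exit X_vrjp wx); split => //; exact: cosh_ge1.
Qed.

Lemma ae_exit : {ae P, forall w, Lexit w a = cosh s}.
Proof.
have := ae_unbounded beta_ge0 beta_sym beta_connected X_vrjp.
by apply: filterS => w wU; exact: (local_time_exit X_vrjp (cosh_ge1 s) (wU _)).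
Qed.

(** Adding [h] to the entry of [H] at [(a, a)] makes [psi] harmonic at [a] too and keeps [H]
    admissible, since nothing is asked of the row of [a] on the diagonal. The extra factor
    [e^(- h l_a^2 / 2)] is constant at the hitting time; against its initial value it gives
    [cosh^2 s - 1 = sinh^2 s] in the exponent. *)
Lemma exit_special (H : Lambda -> Lambda -> R) (psi : Lambda -> R) (h : R) :
  admissible a beta H -> psi a = 1 -> (forall i, i != a -> \sum_j H i j * psi j = 0) ->
  \sum_j H a j * psi j = - h ->
  \int[P]_w special a H (Lexit w) = expR (- (2^-1 * \sum_i \sum_j H i j) + 2^-1 * h * sinh s ^+ 2).
Proof.
move=> adm psia psi0 psih; have [Hs Hd Hb] := adm.
pose H' i j := H i j + (i == a)%:R * ((j == a)%:R * h).
have adm' : admissible a beta H'.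
  split=> [i j|i ia|i j ij]; rewrite /H'.
  - by rewrite Hs mulrCA.
  - rewrite (negPf ia) mul0r addr0 (eq_bigr (fun j => `|H i j|)) ?Hd// => j _.
    by rewrite mul0r addr0.
  - rewrite Hb//; case: (eqVneq i a) => [ia|]; last by rewrite mul0r addr0.
    by case: (eqVneq j a) => [ja|]; rewrite ?mul0r ?mulr0 ?addr0//; rewrite ia ja eqxx in ij.
have Hpsi i : \sum_j H' i j * psi j = 0.
  transitivity (\sum_j (H i j * psi j) + (i == a)%:R * h * \sum_j (j == a)%:R * psi j).
    by rewrite mulr_sumr -big_split/=; apply: eq_bigr => j _; rewrite /H'; ring.
  rewrite sum_delta psia mulr1; case: (eqVneq i a) => [->|ia]; first by rewrite psih mul1r addNr.
  by rewrite psi0// mul0r addr0.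
have quadE l : quad H' l = quad H l - 2^-1 * h * l a ^+ 2.
  have -> : quad H' l = - (2^-1 * (\sum_i \sum_j H i j * (l i * l j) + \sum_i (i == a)%:R * (l i * h * \sum_j (j == a)%:R * l j))).
    rewrite /quad -big_split/=; congr (- (_ * _)); apply: eq_bigr => i _; rewrite !mulr_sumr -big_split/=.
    by apply: eq_bigr => j _; rewrite /H'; ring.
  by rewrite !sum_delta /quad; field.
pose f := harmonic_fun H' psi.
have fa l : f a l = special a H l * expR (- (2^-1 * h * l a ^+ 2)).
  rewrite /f /harmonic_fun psia mul1r quadE expRD /special /quad_mul.
  rewrite (eq_bigl (fun j => j \in ~: [set a]%SET)); last by move=> j; rewrite !inE.
  by ring.
have [C HC] := harmonic_bound psi adm' (cosh_ge1 s).
have /choice[D HD] : forall K, exists D : R, lyapunov beta (1 + K) D f /\ lyapunov beta (1 + K) D (fun i l => - f i l).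
  by move=> K; exact: (harmonic_lyapunov adm' Hpsi).
have f_meas e (S : measurableType e) (l : S -> Lambda -> R) :
    (forall j, measurable_fun setT (fun u => l u j)) -> forall i, measurable_fun setT (fun u => f i (l u)).
  move=> ml i; apply: measurable_continuous_ptws => //.
  exact: (Cn_continuous (harmonic_Cn H' psi 0 i)).
have := exit_identity beta_ge0 beta_sym beta_connected X_vrjp (cosh_ge1 s)
  (fun K _ => (HD K).1) (fun K _ => (HD K).2) f_meas (Cn_continuous (harmonic_Cn H' psi 0 a)) HC.
have mL i : measurable_fun setT (fun w => Lexit w i) by exact: (measurable_exit_local_time X_vrjp (cosh_ge1 s)).
have Cs : Cn 0 (special a H).
  apply: CnM; first by apply: Cn_exp; exact: Cn_quad.
  by apply: Cn_prod => j _; exact: Cn_coord.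
have ms : measurable_fun setT (fun w => special a H (Lexit w)).
  by apply: measurable_continuous_ptws => //; exact: (Cn_continuous Cs).
have mf : measurable_fun setT (fun w => f a (Lexit w)) by exact: f_meas.
have -> : \int[P]_w special a H (Lexit w) = \int[P]_w (expR (2^-1 * h * cosh s ^+ 2) * f a (Lexit w)).
  congr fine; apply: ae_eq_integral => //.
  - exact/measurable_EFinP.
  - by apply/measurable_EFinP; exact: measurable_funM.
  - apply: filterS ae_exit => w La _; rewrite fa La mulrCA -expRD subrr expR0 mulr1 //.
move=> E1; rewrite RintegralZl//; last first.
  by apply: (integrable_bounded P mf (C := C)) => w; have [b1 b2] := exit_bounds w; exact: HC.
rewrite E1 fa /special /quad_mul big1// mulr1 -!expRD; congr expR.
have -> : quad H (fun=> 1) = - (2^-1 * \sum_i \sum_j H i j).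
  by rewrite /quad; congr (- (_ * _)); apply: eq_bigr => i _; apply: eq_bigr => j _; rewrite !mulr1.
have := cosh2_sinh2 s => cs; have -> : cosh s ^+ 2 = 1 + sinh s ^+ 2 by rewrite -cs subrK.
by rewrite expr1n; ring.
Qed.

End ExitMoments.

(** * Both sides on a dense family *)

Section Assembly.
Variables (R : realType) (Lambda : finType) (beta : Lambda -> Lambda -> R) (a : Lambda).
Hypothesis beta_ge0 : forall i j, 0 <= beta i j.
Hypothesis beta_sym : forall i j, beta i j = beta j i.
Local Notation I := (~: [set a])%SET.
Implicit Types (i j : Lambda) (l : Lambda -> R) (k : Lambda -> nat).

(** Away from [a] the diagonal has the least value that dominance permits, plus [2 (k i)], which
    produces the factor [e^(- k_i l_i^2)] in the test function. *)
Definition base_matrix k i j : R :=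
  if i == j then (if i == a then 0 else 1 + \sum_(m | m != i) beta i m + 2 * (k i)%:R) else - beta i j.

Lemma base_admissible k : admissible a beta (base_matrix k).
Proof.
split=> [i j|i ia|i j /negPf ij]; last by rewrite /base_matrix ij.
  rewrite /base_matrix eq_sym; case: eqP => [->//|_]; by rewrite beta_sym.
rewrite {2}/base_matrix eqxx (negPf ia) -addrA lerD2l ler_wpDr//.
by apply: ler_sum => j; rewrite /base_matrix eq_sym => /negPf ->; rewrite normrN ger0_norm.
Qed.

Lemma quad_base k l : quad (base_matrix k) l = quad (base_matrix (fun=> 0)) l - \sum_(i in I) (k i)%:R * l i ^+ 2.
Proof.
have e : \sum_i \sum_j base_matrix k i j * (l i * l j) =
  \sum_i \sum_j base_matrix (fun=> 0) i j * (l i * l j) + \sum_(i in I) 2 * ((k i)%:R * l i ^+ 2).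
  rewrite [X in _ + X]big_mkcond/= -big_split/=; apply: eq_bigr => i _.
  rewrite (bigD1 i)//= [X in _ = X + _](bigD1 i)//= addrAC; congr (_ + _).
    rewrite /base_matrix eqxx !inE; case: eqP => [_|_] /=; first by rewrite addr0.
    by rewrite mulr0n; ring.
  by apply: eq_bigr => j; rewrite /base_matrix eq_sym => /negPf ->.
by rewrite /quad e -mulr_sumr; field.
Qed.

Lemma special_base k l :
  quad_mul (base_matrix (fun=> 0)) (monomial (enum I) k) l = special a (base_matrix k) l.
Proof.
rewrite /special /quad_mul (quad_base k) expRD -mulrA; congr (_ * _).
rewrite /monomial big_enum/= big_split/= mulrC; congr (_ * _).
by rewrite -sumrN expR_sum.
Qed.

Lemma quad_mul_span (r : seq (R * (Lambda -> nat))) (F : (Lambda -> R) -> R) :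
  (forall l, F l = \sum_(u <- r) u.1 * monomial (enum I) u.2 l) ->
  quad_mul (base_matrix (fun=> 0)) F = fun l => \sum_(u <- r) u.1 * special a (base_matrix u.2) l.
Proof.
move=> hF; apply: funext => l; rewrite /quad_mul hF mulr_sumr; apply: eq_bigr => u _.
by rewrite mulrCA -/(quad_mul _ (monomial (enum I) u.2) l) special_base.
Qed.

(** [e^q] decays in every coordinate except that of [a], which is bounded, and so absorbs the
    polynomial weight of the approximation errors. *)
Lemma quad_weight_bound H (gamma : R) : admissible a beta H -> 1 <= gamma -> exists C : R, forall l,
  (forall j, 1 <= l j) -> l a <= gamma -> expR (quad H l) * weight a 2 l <= C.
Proof.
move=> [Hs Hd _] g1.
(* The 4 comes from [(1 + l)^2 <= 2 + 2 l^2 <= 4 (1 + l^2 / 2) <= 4 e^(l^2 / 2)] at each site. *)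
exists (expR (2^-1 * deficit a H * gamma ^+ 2) * 4 ^+ #|I|) => l l1 la.
have l0 j : 0 <= l j by rewrite (le_trans ler01).
have g0 : 0 <= gamma by rewrite (le_trans ler01).
have ql := quad_lower Hs Hd l.
have dl : deficit a H * l a ^+ 2 <= deficit a H * gamma ^+ 2.
  by rewrite ler_wpM2l ?deficit_ge0// lerXn2r ?nnegrE.
have q1 : quad H l <= 2^-1 * deficit a H * gamma ^+ 2 - (2^-1 * \sum_(j in I) l j ^+ 2).
  by rewrite /quad; lra.
apply: (@le_trans _ _ (expR (2^-1 * deficit a H * gamma ^+ 2 - (2^-1 * \sum_(j in I) l j ^+ 2)) * weight a 2 l)).
  apply: ler_wpM2r; last by rewrite ler_expR.
  by apply: prodr_ge0 => i _; rewrite exprn_ge0// addr_ge0.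
rewrite expRD -mulrA ler_wpM2l ?expR_ge0//.
rewrite mulr_sumr -sumrN expR_sum /weight -big_split/= -prodr_const.
apply: ler_prod => i _; rewrite mulr_ge0 ?expR_ge0 ?exprn_ge0 ?addr_ge0//=.
have e1 := expR_ge1Dx (2^-1 * l i ^+ 2).
rewrite -(ler_pM2l (expR_gt0 (2^-1 * l i ^+ 2))) mulrA -expRD subrr expR0 mul1r.
have := sqr_ge0 (l i - 1); rewrite sqrrB !expr2; rewrite !expr2 in e1; nra.
Qed.

Context {d : measure_display} {T : measurableType d}.
Variables (P : probability T R) (X : R -> T -> Lambda).
Hypothesis beta_connected : forall i j, connect (fun i' j' => 0 < beta i' j') i j.
Hypothesis X_vrjp : vrjp beta a (fun=> 1) P X.
Variable s : R.
Local Notation Lexit := (exit_local_time X a (cosh s)).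

Lemma measurable_exit (F : (Lambda -> R) -> R) : Cn 0 F -> measurable_fun setT (fun w => F (Lexit w)).
Proof.
move=> CF; apply: measurable_continuous_ptws; first exact: (Cn_continuous CF).
by move=> i; exact: (measurable_exit_local_time X_vrjp (cosh_ge1 s)).
Qed.

Lemma integrable_special H : admissible a beta H ->
  P.-integrable setT (EFin \o (fun w => special a H (Lexit w))).
Proof.
move=> adm.
have [C HC] := harmonic_bound (fun j => (j == a)%:R) adm (cosh_ge1 s).
have e l : harmonic_fun H (fun j => (j == a)%:R) a l = special a H l.
  rewrite /harmonic_fun eqxx mul1r mulrC; congr (_ * _).
  by apply: eq_bigl => j; rewrite !inE.
apply: (integrable_bounded P (C := C)) => [|w].
  apply: measurable_exit; apply: CnM; first by apply: Cn_exp; exact: Cn_quad.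
  by apply: Cn_prod => j _; exact: Cn_coord.
by have [b1 b2] := exit_bounds X_vrjp s w; rewrite -e; exact: HC.
Qed.

Lemma superexp_exit_span (r : seq (R * (Lambda -> nat))) :
  superexp_pinned beta a
    (form_apply (fun l => \sum_(u <- r) u.1 * special a (base_matrix u.2) l) (boost_z s)) =
  \int[P]_w (\sum_(u <- r) u.1 * special a (base_matrix u.2) (Lexit w)).
Proof.
have /choice[h Hh] : forall k, exists h : R, exists psi : Lambda -> R, [/\ psi a = 1,
    forall i, i != a -> \sum_j base_matrix k i j * psi j = 0 & \sum_j base_matrix k a j * psi j = - h].
  move=> k; have [Hs Hd _] := base_admissible k; have [psi [pa pi]] := exists_harmonic Hs Hd.
  by exists (- \sum_j base_matrix k a j * psi j), psi; split=> //; rewrite opprK.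
rewrite (@superexp_special _ _ _ _ s _ r (fun u => base_matrix u.2) (fun u => u.1) (fun u => h u.2)); last 2 first.
- by move=> u; exact: base_admissible.
- by move=> u; exact: Hh.
have iu (u : R * (Lambda -> nat)) : P.-integrable setT (EFin \o (fun w => u.1 * special a (base_matrix u.2) (Lexit w))).
  exact: (integrableZl measurableT _ (integrable_special (base_admissible u.2))).
rewrite (Rintegral_sum r iu).2; apply: eq_bigr => u _.
rewrite RintegralZl//; last exact: (integrable_special (base_admissible u.2)).
have [psi [pa pi ph]] := Hh u.2.
by rewrite (exit_special beta_ge0 beta_sym beta_connected X_vrjp s (base_admissible u.2) pa pi ph).
Qed.

(** [g] is written as [e^q F]. The interpolants of [F] give combinations of test functions, for
    which [superexp_exit_span] holds, and both sides pass to the limit: the spins by [superexp_cvg],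
    the VRJP by the uniform bound [quad_weight_bound]. *)
Theorem superexp_exit (g : (Lambda -> R) -> R) : smooth g -> compactly_supported g ->
  superexp_pinned beta a (form_apply g (boost_z s)) = \int[P]_w g (Lexit w).
Proof.
move=> sg cg.
pose H0 := base_matrix (fun=> 0).
have [Hs Hd Hb] : admissible a beta H0 := base_admissible _.
(* Division by [e^q] preserves smoothness and the support, so that [density] applies to [F]. *)
pose F l := g l * expR (- quad H0 l).
have CF n : Cn n F by apply: CnM; [exact: smooth_Cn|apply: Cn_exp; apply: CnN; exact: Cn_quad].
have gE : g = quad_mul H0 F.
  by apply: funext => l; rewrite /quad_mul /F mulrCA -expRD subrr expR0 mulr1.
have [M M1 vg] := compactly_supported_vanishes cg.
have vF : vanishes_beyond M F by move=> x j xj; rewrite /F (vg x j xj) mul0r.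
have [A [Fn [eps [[A0 FA] CFn Fe elim0 span]]]] := density a s (smooth_of_Cn CF) vF.
have e0 n : 0 <= eps n by have [] := Fe n.
have lhs := superexp_cvg Hs Hd Hb (CF _) CFn A0 FA (fun n => (Fe n).2) e0 elim0.
rewrite -gE in lhs.
have [r Hr] := choice span.
have En n := quad_mul_span (Hr n).
have [C HC] := quad_weight_bound (base_admissible (fun=> 0)) (cosh_ge1 s).
have [B HB] := vanishes_bounded (sg [::]).1 vg.
have mg : measurable_fun setT (fun w => g (Lexit w)) by apply: measurable_exit; exact: smooth_Cn.
have ig : P.-integrable setT (EFin \o (fun w => g (Lexit w))).
  by apply: (integrable_bounded P mg (C := B)) => w; exact: HB.
have iFn n : P.-integrable setT (EFin \o (fun w => quad_mul H0 (Fn n) (Lexit w))).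
  rewrite En; apply: (Rintegral_sum (r n) _).1 => u.
  exact: (integrableZl measurableT _ (integrable_special (base_admissible u.2))).
have C0 : 0 <= C.
  have [b1 b2] := exit_bounds X_vrjp s point; apply: le_trans (HC _ b2 b1).
  rewrite mulr_ge0 ?expR_ge0// prodr_ge0// => i _.
  by rewrite exprn_ge0// addr_ge0// (le_trans ler01).
have rhs : superexp_pinned beta a (form_apply (quad_mul H0 (Fn n)) (boost_z s)) @[n --> \oo] --> \int[P]_w g (Lexit w).
  have ec : eps n * C @[n --> \oo] --> (0 : R).
    by rewrite -[X in _ --> X](mul0r C); apply: cvgM => //; exact: cvg_cst.
  apply/cvgrPdist_lt => e e1; near=> n.
  have -> : superexp_pinned beta a (form_apply (quad_mul H0 (Fn n)) (boost_z s)) =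
    \int[P]_w quad_mul H0 (Fn n) (Lexit w) by rewrite En superexp_exit_span.
  rewrite -RintegralB//.
  apply: (@le_lt_trans _ _ (eps n * C)); last by near: n; exact: (cvgr_lt 0 ec).
  apply: integral_le_ae; first by rewrite mulr_ge0.
    exact: (integrableB measurableT ig (iFn n)).
  have := ae_exit beta_ge0 beta_sym beta_connected X_vrjp s.
  apply: filterS => w La; have [b1 b2] := exit_bounds X_vrjp s w.
  (* For the VRJP only the values of [F - Fn n] matter, that is the bound for the empty block; the
     derivatives were required for the spins. *)
  have := (Fe n).2 finset.set0 (finset.sub0set _) (Lexit w) La b2.
  have -> : sub_block (finset.set0 : {set Lambda}) = [::].
    by rewrite /sub_block -(filter_pred0 (enum Lambda)); apply: eq_filter => i; rewrite inE.
  rewrite /= => Fb.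
  rewrite {1}gE /quad_mul -mulrBr normrM (ger0_norm (expR_ge0 _)).
  apply: le_trans (ler_wpM2l (expR_ge0 _) Fb) _.
  by rewrite mulrCA ler_wpM2l// HC.
exact: (cvg_unique (@Rhausdorff R) lhs rhs).
Unshelve. all: end_near. Qed.

End Assembly.

Theorem theorem5p7 (R : realType) (Lambda : finType)
    (beta : Lambda -> Lambda -> R)
    (beta_sym : forall i j, beta i j = beta j i)
    (beta_ge0 : forall i j, 0 <= beta i j)
    (beta_connected : forall i j, connect (fun k l => 0 < beta k l) i j)
    (g : (Lambda -> R) -> R)
    (g_smooth : smooth g) (g_supp : compactly_supported g)
    (a : Lambda) (s : R)
    (d : measure_display) (T : measurableType d) (P : probability T R)
    (X : R -> T -> Lambda) (X_vrjp : vrjp beta a (fun=> 1) P X) :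
  ((superexp_pinned beta a (form_apply g (boost_z s)))%:E
   = 'E_P[fun w => g (local_time (fun=> 1%R) X
                        (hitting_time (fun=> 1%R) X a (cosh s) w) w)])%E.
Proof.
rewrite (superexp_exit beta_ge0 beta_sym beta_connected X_vrjp s g_smooth g_supp).
rewrite unlock fineK//; apply: (integrable_fin_num measurableT).
have [M _ vg] := compactly_supported_vanishes g_supp.
have [B HB] := vanishes_bounded (g_smooth [::]).1 vg.
apply: (integrable_bounded P (C := B)) => [|w]; last exact: HB.
by apply: (measurable_exit X_vrjp); exact: smooth_Cn.
Qed.
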